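(* Suppose that $F$ is an admissible nonlinearity (defined in the context). Let $\mathbf{u}_0\in H^1(\Gamma)$ satisfy the Kirchhoff condition and $|x|\mathbf{u}_0\in L^2(\Gamma)$. Then there exists a unique solution $\mathbf{u}=(u^1,\dots,u^N)$ of $$i\partial_t u^j=-\Delta u^j+F(|u^j|^2)u^j,\qquad u^j(0,x)=u_0^j(x),\qquad t\ge0,\ x\in[0,\infty),\ j=1,\dots,N,$$ on the star graph $\Gamma$ with the Kirchhoff condition at the vertex, satisfying, for some constants $C,c$ independent of $t$, $$\|\mathbf{u}(t)\|_{H^1(\Gamma)}\le C,\qquad \|\,|x|\mathbf{u}(t)\|_{L^2(\Gamma)}\le Ct+c .$$
   Context: **Graph.** $\Gamma$ is the star graph with one vertex and $N$ edges, each identified with $[0,\infty)$, the vertex being $0$. A function on $\Gamma$ is $\mathbf{u}=(u^1,\dots,u^N)$ with $u^j:[0,\infty)\to\mathbb{C}$. The Kirchhoff condition is: $u^i(0)=u^j(0)$ for all $i,j$, and $\sum_{j=1}^N \frac{d}{dx}u^j(0)=0$. $L^p(\Gamma)$ and $H^m(\Gamma)$ norms are the sums over edges of the corresponding norms on $[0,\infty)$; functions in $H^m(\Gamma)$ are required to be continuous at the vertex. $\Delta=\Delta_\Gamma$ acts as $\frac{d^2}{dx^2}$ on every edge with domain the functions in $H^2(\Gamma)$ satisfying the Kirchhoff condition. **Admissible nonlinearity.** $F$ is a smooth real function such that: (i) $F(\xi)\ge -C_1\xi^q$ for $\xi\ge 1$, with $C_1>0$, $q<2$; (ii) $4F(\xi)=C_2\xi^p(1+O(\xi))$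 near $\xi=0$, $p>0$, and, with $U(\varphi,\alpha)=-\frac18\alpha^2\varphi^2-\frac12\int_0^{\varphi^2}F(\xi)\,d\xi$, $U$ is negative for sufficiently small (nonzero) $\varphi$ when $\alpha\ne0$; (iii) for $\alpha$ in some interval $A\subset\mathbb{R}_+$, the function $\varphi\mapsto U(\varphi,\alpha)$ has a positive root, and $U_\varphi(\varphi_0,\alpha)\ne0$ where $\varphi_0=\varphi_0(\alpha)$ is the smallest positive root. *)

(* Defs.v *)
From HB Require Import structures.
From mathcomp Require Import all_boot all_order all_algebra.
From mathcomp Require Import all_classical all_reals all_analysis.
From mathcomp Require Export complex.

Set Implicit Arguments.
Unset Strict Implicit.
Unset Printing Implicit Defensive.

Import Order.TTheory GRing.Theory Num.Theory.
Import numFieldNormedType.Exports.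

Local Open Scope classical_set_scope.
Local Open Scope ring_scope.
Local Open Scope complex_scope.

Section Halfline.
Context {R : realType}.
Implicit Types (f g v w : R -> R[i]).

(* An edge is [0, +oo).  Functions on an edge are represented by total
   functions on R; no definition below depends on their values at x < 0. *)
Definition halfline : set R := `[0, +oo[.

(* R[i] carries no measurable structure in the library, so measurability and
   integrals are taken componentwise. *)
Definition cmeasurable (D : set R) f :=
  measurable_fun D (fun x => complex.Re (f x)) /\ measurable_fun D (fun x => complex.Im (f x)).

Definition cintegrable (D : set R) f :=
  (@lebesgue_measure R).-integrable D (fun x => (complex.Re (f x))%:E) /\
  (@lebesgue_measure R).-integrable D (fun x => (complex.Im (f x))%:E).

Definition cintegral (D : set R) f : R[i] :=
  (\int[@lebesgue_measure R]_(x in D) complex.Re (f x)) +i*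
  (\int[@lebesgue_measure R]_(x in D) complex.Im (f x)).

Definition L2norm f : \bar R :=
  'N[@lebesgue_measure R]_2%:E
    [EFin \o ((fun x => Normc.normc (f x)) \_ halfline)]%E.

Definition in_L2 f := cmeasurable halfline f /\ (L2norm f < +oo)%E.

(* [f] is the absolutely continuous representative of its class and [v] is
   (a representative of) its weak derivative. *)
Definition is_wderiv f v :=
  forall x, 0 <= x ->
    cintegrable `[0, x] v /\ f x = f 0 + cintegral `[0, x] v.

(* Weak derivatives agree almost everywhere on the half-line, so the choice is
   immaterial in the norm below. *)
Definition wderiv f : R -> R[i] := xget (fun=> 0) [set v | is_wderiv f v].

(* H^m([0, +oo)); for m >= 1 the function is its continuous representative. *)
Fixpoint in_H (m : nat) f : Prop :=
  if m is m'.+1 then in_L2 f /\ exists2 v, is_wderiv f v & in_H m' v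
  else in_L2 f.

Definition H1norm f : \bar R :=
  ((L2norm f ^+ 2 + L2norm (wderiv f) ^+ 2) `^ 2^-1)%E.

Definition is_rderiv0 f (d : R[i]) :=
  Normc.normc ((f h - f 0) / h%:C - d) @[h --> 0^'+] --> (0 : R).

End Halfline.

Section StarGraph.
Context {R : realType} {N : nat}.

Definition graph_fun := 'I_N -> R -> R[i].

Implicit Types u g : graph_fun.

Definition vertex_continuous u := forall i j, u i 0 = u j 0.

Definition kirchhoff u :=
  vertex_continuous u /\
  exists d : 'I_N -> R[i],
    (forall j, is_rderiv0 (u j) (d j)) /\ \sum_j d j = 0.

Definition graph_L2 u := forall j, in_L2 (u j).

Definition graph_L2norm u : \bar R := (\sum_j L2norm (u j))%E.

Definition graph_H (m : nat) u :=
  (forall j, in_H m (u j)) /\ vertex_continuous u.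

Definition graph_H1norm u : \bar R := (\sum_j H1norm (u j))%E.

(* The graph of the operator Delta: [u] is in its domain and [g] is (a
   representative of) Delta u. *)
Definition is_Laplacian u g :=
  [/\ graph_H 2 u, kirchhoff u &
      forall j, exists2 v, is_wderiv (u j) v & is_wderiv v (g j)].

Definition weighted u : graph_fun := fun j x => `|x|%:C * u j x.

Definition nonlinear (F : R -> R) u : graph_fun :=
  fun j x => (F (Normc.normc (u j x) ^+ 2))%:C * u j x.

Definition time_integral (u : R -> graph_fun) (t : R) : graph_fun :=
  fun j x => cintegral `[0, t] (fun s => u s j x).

(* H^1 solutions on [0, +oo) of
     i d/dt u^j = - Delta u^j + F(|u^j|^2) u^j,   u^j(0, x) = u0^j(x).
   For H^1 data, u(t) is in general not in the domain of Delta, and its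
   one-sided derivatives at the vertex need not exist; the equation and the
   Kirchhoff condition are therefore those of the (standard) mild solution:
   int_0^t u(s) ds belongs to the domain of Delta, Kirchhoff condition
   included, and the equation holds integrated over [0, t]. *)
Definition is_solution (F : R -> R) (u0 : graph_fun) (u : R -> graph_fun) :=
  [/\ forall t, 0 <= t -> graph_H 1 (u t),
      forall t, 0 <= t ->
        graph_H1norm (fun j x => u s j x - u t j x)
          @[s --> within halfline (nbhs t)] --> 0%E,
      forall j x, 0 <= x -> u 0 j x = u0 j x &
      forall t, 0 <= t -> exists2 g : graph_fun,
        is_Laplacian (time_integral u t) g &
        forall j x, 0 <= x ->
          (0 +i* 1) * (u t j x - u0 j x) =
            - g j x + time_integral (fun s => nonlinear F (u s)) t j x].

End StarGraph.

Arguments graph_fun : clear implicits.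

Section Nonlinearity.
Context {R : realType}.
Implicit Types F : R -> R.

Definition potential F (phi alpha : R) : R :=
  - 8^-1 * alpha ^+ 2 * phi ^+ 2
  - 2^-1 * \int[@lebesgue_measure R]_(xi in `[0, phi ^+ 2]) F xi.

Definition smallest_positive_root (f : R -> R) (x0 : R) :=
  [/\ 0 < x0, f x0 = 0 & forall x, 0 < x -> f x = 0 -> x0 <= x].

(* Only the values of F on [0, +oo) occur in the equation and in the
   conditions, hence the one-sided O at 0; the exponents p, q are real. *)
Definition admissible F :=
  [/\ forall n x, derivable (derive1n n F) x 1,
      exists C1 q : R, [/\ 0 < C1, q < 2 &
        forall xi, 1 <= xi -> F xi >= - C1 * xi `^ q],
      exists C2 p : R, 0 < p /\
        exists r : R -> R,
          (\forall xi \near 0^'+, 4 * F xi = C2 * xi `^ p * (1 + r xi)) /\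
          r =O_ (0^'+) (id : R -> R),
      forall alpha, alpha != 0 ->
        \forall phi \near 0^', potential F phi alpha < 0 &
      exists A : set R,
        [/\ is_interval A, A `<=` [set a | 0 <= a],
            exists a b, [/\ A a, A b & a < b] &
            forall alpha, A alpha ->
              exists phi0,
                smallest_positive_root (potential F ^~ alpha) phi0 /\
                derive1 (potential F ^~ alpha) phi0 != 0]].

End Nonlinearity.

(* Main.v *)
(* On the grid of spacing [2^-n] and length [2^n] on every edge, with Kirchhoff's
   law at the central node, the discrete Schroedinger flow is followed by explicit
   Euler steps, so short that mass and energy are conserved up to a vanishing
   error.  As [-F] grows slower than a square, a discrete Gagliardo-Nirenberg
   inequality turns energy into gradient bounds; these give Hoelder continuity in
   space and time, and linear growth of the norm weighted by [x].  A limit along an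
   ultrafilter is a mild solution whose energy does not exceed the initial
   one.
   Uniqueness: the difference of two solutions, averaged over [t, t + h] and cut off
   at [Y], obeys a Gronwall inequality; then h -> 0 and Y -> oo.  Complex conjugation
   with time reversal and uniqueness give the opposite energy inequality.  So the
   energy is conserved, the gradient norm is continuous in time, and the
   parallelogram identity yields continuity in H^1.
   The gradient norm enters as the supremum over m of the sums over k of
   [2^m |f((k+1)/2^m) - f(k/2^m)|^2], which passes to pointwise limits. *)

Require Import Defs.
From mathcomp Require Import all_boot all_order all_algebra.
From mathcomp Require Import all_classical all_reals all_analysis.
From mathcomp Require Import measurable_realfun.
From mathcomp Require Import ring lra zify.

Set Implicit Arguments.
Unset Strict Implicit.
Unset Printing Implicit Defensive.

Import Order.TTheory GRing.Theory Num.Theory.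
Import numFieldNormedType.Exports.

Local Open Scope classical_set_scope.
Local Open Scope ring_scope.

(** * Integrals over segments *)

(** Three losses shape the argument. Euler steps conserve nothing exactly, but the error of one step
    is quadratic in its length, with a constant attached to the grid; the step is chosen after the
    grid, as short as needed. Pointwise limits may lose gradient energy and leave an inequality
    only, while continuity in H^1 requires the gradient norm itself to be continuous. On an
    unbounded edge potential energy might escape to infinity: it is always cut at a length [Y], and
    the weighted norm bounds the rest by a multiple of 1 / Y^2.

    The integrated equation is kept in solved form, a Taylor formula in x with the source under the
    remainder integral and the slopes at the vertex as coefficients. This form contains no space
    derivative, passes to locally uniform limits, and shows the Kirchhoff law as a vanishing sum of
    slopes. The ultrafilter gives limits at all points at once; equicontinuity makes them locally
    uniform. Complex functions are pairs of real ones indexed by a boolean, so that multiplication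
    by -i is a swap with sign [sgb]. *)

Section SegmentIntegrals.
Context {R : realType}.
Implicit Types (a b c x y : R) (f g : R -> R).
Notation mu := (@lebesgue_measure R).

(** Unoriented: the value is 0 when [b < a], so the splitting lemmas carry order hypotheses. *)
Definition itg a b f : R := \int[mu]_(x in `[a, b]) f x.

Lemma integrable_cont a b f : continuous f ->
  mu.-integrable `[a, b] (EFin \o f).
Proof.
move=> cf; apply: continuous_compact_integrable; first exact: segment_compact.
exact: continuous_subspaceT.
Qed.

Lemma eq_itg a b f g : (forall x, a <= x <= b -> f x = g x) ->
  itg a b f = itg a b g.
Proof.
by move=> fg; apply: eq_Rintegral => x; rewrite inE /= in_itv /=; exact: fg.
Qed.

Lemma itgD a b f g : continuous f -> continuous g ->
  itg a b (fun x => f x + g x) = itg a b f + itg a b g.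
Proof. by move=> cf cg; rewrite /itg RintegralD //; exact: integrable_cont. Qed.

Lemma itgB a b f g : continuous f -> continuous g ->
  itg a b (fun x => f x - g x) = itg a b f - itg a b g.
Proof. by move=> cf cg; rewrite /itg RintegralB //; exact: integrable_cont. Qed.

Lemma itgZ a b k f : continuous f -> itg a b (fun x => k * f x) = k * itg a b f.
Proof. by move=> cf; rewrite /itg RintegralZl //; exact: integrable_cont. Qed.

Lemma itg0 a b : itg a b (fun=> 0) = 0.
Proof. by rewrite /itg Rintegral_cst //= mul0r. Qed.

Lemma continuous_sum (I : Type) (s : seq I) (f : I -> R -> R) :
  (forall i, continuous (f i)) -> continuous (fun x => \sum_(i <- s) f i x).
Proof.
move=> cf; elim: s => [|i s IH].
  have -> : (fun x => \sum_(i <- [::]) f i x) = (fun=> 0).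
    by apply/funext => x; rewrite big_nil.
  by move=> x; exact: cvg_cst.
have -> : (fun x => \sum_(i0 <- i :: s) f i0 x) =
          (fun x => f i x + \sum_(i <- s) f i x).
  by apply/funext => x; rewrite big_cons.
by move=> x; apply: cvgD; [exact: cf|exact: IH].
Qed.

Lemma itg_sum (I : Type) (s : seq I) (f : I -> R -> R) a b :
  (forall i, continuous (f i)) ->
  itg a b (fun x => \sum_(i <- s) f i x) = \sum_(i <- s) itg a b (f i).
Proof.
move=> cf; elim: s => [|i s IH].
  rewrite big_nil -[RHS](itg0 a b); by apply: eq_itg => x _; rewrite big_nil.
rewrite big_cons -IH -itgD //; first by apply: eq_itg => x _; rewrite big_cons.
exact: continuous_sum.
Qed.

Lemma le_itg a b f g : continuous f -> continuous g ->
  (forall x, a <= x <= b -> f x <= g x) -> itg a b f <= itg a b g.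
Proof.
move=> cf cg fg; apply: le_Rintegral; [by []|exact: integrable_cont|exact: integrable_cont|].
by move=> x /=; rewrite in_itv /=; exact: fg.
Qed.

Lemma itg_ge0 a b f : (forall x, a <= x <= b -> 0 <= f x) -> 0 <= itg a b f.
Proof.
by move=> f0; apply: Rintegral_ge0 => x /=; rewrite in_itv /=; exact: f0.
Qed.

Lemma itg_cst a b k : a <= b -> itg a b (fun=> k) = k * (b - a).
Proof.
rewrite /itg Rintegral_cst //= lebesgue_measure_itv /= lte_fin.
by rewrite le_eqVlt => /predU1P[->|->//]; rewrite ltxx subrr.
Qed.

Lemma contD f g : continuous f -> continuous g -> continuous (fun x => f x + g x).
Proof. by move=> cf cg x; apply: cvgD; [exact: cf|exact: cg]. Qed.

Lemma contB f g : continuous f -> continuous g -> continuous (fun x => f x - g x).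
Proof. by move=> cf cg x; apply: cvgB; [exact: cf|exact: cg]. Qed.

Lemma contM f g : continuous f -> continuous g -> continuous (fun x => f x * g x).
Proof. by move=> cf cg x; apply: cvgM; [exact: cf|exact: cg]. Qed.

Lemma contZ k f : continuous f -> continuous (fun x => k * f x).
Proof. by move=> cf; apply: contM => //; exact: cst_continuous. Qed.

Lemma continuous_norm f : continuous f -> continuous (fun x => `|f x|).
Proof. by move=> cf x; apply: cvg_norm; exact: cf. Qed.

Lemma continuous_sqr f : continuous f -> continuous (fun x => f x ^+ 2).
Proof. by move=> cf; exact: (contM cf cf). Qed.

Lemma ler_itg_norm a b f : continuous f ->
  `|itg a b f| <= itg a b (fun x => `|f x|).
Proof. by move=> cf; apply: le_normr_Rintegral => //; exact: integrable_cont. Qed.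

Lemma itg_bound a b f k : continuous f -> a <= b ->
  (forall x, a <= x <= b -> `|f x| <= k) -> `|itg a b f| <= k * (b - a).
Proof.
move=> cf ab fk; apply: le_trans (ler_itg_norm _ _ cf) _.
rewrite -itg_cst //; apply: le_itg => //; first exact: continuous_norm.
exact: cst_continuous.
Qed.

Lemma itgxx a f : itg a a f = 0.
Proof. by rewrite /itg set_itv1 Rintegral_set1. Qed.

Lemma itg_chasles_int a b c f : a <= b -> b <= c ->
  mu.-integrable `[a, c] (EFin \o f) ->
  itg a c f = itg a b f + itg b c f.
Proof.
move=> ab bc fi; apply/eqP; rewrite addrC -subr_eq; apply/eqP.
rewrite /itg Rintegral_itvB //.
rewrite Rintegral_itv_obnd_cbnd //; apply: integrableS fi => //.
by move=> x /=; rewrite !in_itv /= => /andP[bx ->]; rewrite (le_trans ab (ltW bx)).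
Qed.

Lemma itg_chasles b a c f : continuous f -> a <= b -> b <= c ->
  itg a c f = itg a b f + itg b c f.
Proof. by move=> cf ab bc; apply: itg_chasles_int => //; exact: integrable_cont. Qed.

Lemma is_derive_itg a x f : continuous f -> a < x ->
  is_derive x 1 (fun y => itg a y f) (f x).
Proof.
move=> cf ax.
have xx1 : x < x + 1 by rewrite ltrDl.
have := @continuous_FTC1_closed R f a x (x + 1) xx1 (integrable_cont _ _ cf) ax (cf x).
move=> [d e]; exact: (DeriveDef d (etrans (esym (derive1E _ _)) e)).
Qed.

Lemma itg_FTC2 a b F f : a <= b -> continuous f ->
  {within `[a, b], continuous F} ->
  (forall x, a < x < b -> is_derive x 1 F (f x)) ->
  itg a b f = F b - F a.
Proof.
rewrite le_eqVlt => /predU1P[<-|ab] cf cF dF; first by rewrite itgxx subrr.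
have H := @continuous_FTC2 R f F a b ab (continuous_subspaceT cf) _ _.
rewrite /itg /Rintegral H //.
  have /(continuous_within_itvP _ ab)[cF1 cF2 cF3] := cF.
  split => // x; rewrite in_itv /= => xab.
  by have [] := dF x xab.
by move=> x; rewrite in_itv /= => xab; have [? <-] := dF x xab; rewrite derive1E.
Qed.

(** Cauchy-Schwarz against the constant 1: the integral of [(f - c) ^+ 2] is nonnegative, [c] being
    the mean of [f]. *)
Lemma sqr_itg_int a b f : a <= b -> mu.-integrable `[a, b] (EFin \o f) ->
  mu.-integrable `[a, b] (EFin \o (fun x => f x ^+ 2)) ->
  itg a b f ^+ 2 <= (b - a) * itg a b (fun x => f x ^+ 2).
Proof.
rewrite le_eqVlt => /predU1P[<-|ab] fi f2; first by rewrite !itgxx subrr mul0r expr0n.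
have ba : 0 < b - a by rewrite subr_gt0.
pose c := itg a b f / (b - a).
have ci : mu.-integrable `[a, b] (EFin \o (fun _ : R => c ^+ 2)).
  by apply: integrable_cont; exact: cst_continuous.
have fci : mu.-integrable `[a, b] (EFin \o (fun x => 2 * c * f x)).
  have -> : EFin \o (fun x => 2 * c * f x) = (fun x => (2 * c)%:E * (f x)%:E)%E by [].
  exact: integrableZl.
have H : 0 <= itg a b (fun x => f x ^+ 2 - 2 * c * f x + c ^+ 2).
  apply: itg_ge0 => x _; have -> : f x ^+ 2 - 2 * c * f x + c ^+ 2 = (f x - c) ^+ 2 by ring.
  exact: sqr_ge0.
have fdi : mu.-integrable `[a, b] (EFin \o (fun x => f x ^+ 2 - 2 * c * f x)).
  have -> : EFin \o (fun x => f x ^+ 2 - 2 * c * f x) =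
    (fun x => (f x ^+ 2)%:E - (2 * c * f x)%:E)%E by apply/funext.
  exact: integrableB.
move: H; rewrite /itg RintegralD // RintegralB // RintegralZl // -!/(itg _ _ _).
rewrite itg_cst ?(ltW ab) //.
have -> : itg a b f = c * (b - a) by rewrite /c divfK // gt_eqF.
move=> H; rewrite -subr_ge0.
have -> : (b - a) * itg a b (fun x => f x ^+ 2) - (c * (b - a)) ^+ 2 =
  (b - a) * (itg a b (fun x => f x ^+ 2) - 2 * c * (c * (b - a)) + c ^+ 2 * (b - a)).
  by ring.
by rewrite mulr_ge0 // ltW.
Qed.

Lemma sqr_itg a b f : a <= b -> continuous f ->
  itg a b f ^+ 2 <= (b - a) * itg a b (fun x => f x ^+ 2).
Proof.
move=> ab cf; apply: sqr_itg_int => //; apply: integrable_cont => //.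
exact: continuous_sqr.
Qed.

(** Only [x] is confined to the segment. Since [y] may leave it, approximations of values in
    [[a, b]] can be compared without knowing that they stay in the segment. *)
Lemma heine a b f e : continuous f -> 0 < e -> exists2 d, 0 < d &
  forall x y, a <= x <= b -> `|x - y| < d -> `|f x - f y| <= e.
Proof.
move=> cf e0.
have /compact_near_coveringP/near_covering_withinP := @segment_compact R a b.
move=> /(_ R (0^'+) (fun d x => forall y, `|x - y| < d -> `|f x - f y| <= e)) H.
have : \forall d \near 0^'+, `[a, b] `<=` (fun x => forall y, `|x - y| < d -> `|f x - f y| <= e).
  apply: H => x _.
  have e2 : 0 < e / 2 by rewrite divr_gt0.
  have /cvgrPdist_le/(_ _ e2) := cf x.
  move=> /nbhs_ballP[d /= d0 Hd].
  exists (ball x (d / 2), [set t | 0 < t < d / 2]) => /=.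
    split; first by apply: nbhsx_ballx; rewrite divr_gt0.
    exists (d / 2) => /=; first by rewrite divr_gt0.
    by move=> t /=; rewrite sub0r normrN => td t0; rewrite t0 -(gtr0_norm t0).
  move=> [z t] /= [xz /andP[t0 td]] _ y zy.
  have fz : `|f x - f z| <= e / 2.
    by apply: Hd; apply: le_ball xz; rewrite ler_pdivrMr // ler_pMr // ler1n.
  have fy : `|f x - f y| <= e / 2.
    apply: Hd; rewrite /ball /=; move: xz; rewrite /ball /= => xz.
    have -> : x - y = (x - z) + (z - y) by ring.
    apply: le_lt_trans (ler_normD _ _) _; lra.
  have -> : f z - f y = (f x - f y) - (f x - f z) by ring.
  apply: le_trans (ler_normB _ _) _; lra.
move=> [d /= d0 Hd]; exists (d / 2); first by rewrite divr_gt0.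
move=> x y xab xy; apply: (Hd (d / 2)) => //=.
- by rewrite sub0r normrN gtr0_norm ?divr_gt0 // ltr_pdivrMr // ltr_pMr // ltr1n.
- by rewrite divr_gt0.
Qed.

Lemma cont_bounded a b f : continuous f ->
  exists2 M, 0 < M & forall x, a <= x <= b -> `|f x| <= M.
Proof.
move=> cf.
have [] := @compact_bounded R R (f @` `[a, b]).
  apply: continuous_compact; last exact: segment_compact.
  exact: continuous_subspaceT.
move=> M [Mr HM]; exists (Num.max 1 (M + 1)); first by rewrite lt_max ltr01.
move=> x xab; apply: (HM (Num.max 1 (M + 1))); first by rewrite lt_max ltrDl ltr01 orbT.
by exists x => //=; rewrite in_itv.
Qed.

(* The sample points [y] are left free in the cells, so that the statement
   covers both end-points, and the sampled values need only be approximate. *)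
Lemma riemann_sum_mod Y f e d (h : R) (n : nat) (z : nat -> R) :
  continuous f -> 0 <= Y -> 0 <= e ->
  (forall x y, 0 <= x <= Y -> `|x - y| < d -> `|f x - f y| <= e) ->
  0 < h < d -> n%:R * h <= Y ->
  (forall k, (k < n)%N -> exists2 y, k%:R * h <= y <= k.+1%:R * h & `|z k - f y| <= e) ->
  `|h * \sum_(k < n) z k - itg 0 (n%:R * h) f| <= 2 * e * Y.
Proof.
move=> cf Y0 e0 Hd /andP[h0 hd] nhY Hz.
suff H m : (m <= n)%N ->
    `|h * \sum_(k < m) z k - itg 0 (m%:R * h) f| <= 2 * e * (m%:R * h).
  by apply: le_trans (H n (leqnn _)) _; rewrite ler_wpM2l // mulr_ge0.
elim: m => [|m IH] mn; first by rewrite big_ord0 !mul0r itgxx !mulr0 subrr normr0.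
have m0 : 0 <= m%:R * h by rewrite mulr_ge0 // ltW.
have mm : m%:R * h <= m.+1%:R * h by rewrite ler_pM2r // ler_nat.
rewrite big_ord_recr /= (itg_chasles cf m0 mm).
have [y /andP[y1 y2] zy] := Hz m mn.
have mnY : m.+1%:R * h <= Y by apply: le_trans nhY; rewrite ler_pM2r // ler_nat.
have mh : m.+1%:R * h = m%:R * h + h by rewrite -natr1; ring.
have H1 : `|h * z m - itg (m%:R * h) (m.+1%:R * h) f| <= 2 * e * h.
  have -> : h * z m - itg (m%:R * h) (m.+1%:R * h) f =
      itg (m%:R * h) (m.+1%:R * h) (fun x => z m - f x).
    rewrite itgB //; last exact: cst_continuous.
    by rewrite itg_cst // mh; congr (_ - _); ring.
  have -> : 2 * e * h = 2 * e * (m.+1%:R * h - m%:R * h) by rewrite mh; ring.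
  apply: itg_bound => //.
    by move=> x; apply: cvgB; [exact: cvg_cst|exact: cf].
  move=> x /andP[x1 x2].
  have -> : z m - f x = (z m - f y) + (f y - f x) by ring.
  apply: le_trans (ler_normD _ _) _.
  have : `|f y - f x| <= e.
    apply: Hd; first by rewrite (le_trans m0 y1) (le_trans y2).
    apply: le_lt_trans hd; rewrite ler_norml; apply/andP; split; lra.
  lra.
have {}IH := IH (ltnW mn).
have -> : h * (\sum_(k < m) z k + z m) -
   (itg 0 (m%:R * h) f + itg (m%:R * h) (m.+1%:R * h) f) =
   (h * \sum_(k < m) z k - itg 0 (m%:R * h) f) +
   (h * z m - itg (m%:R * h) (m.+1%:R * h) f) by ring.
apply: le_trans (ler_normD _ _) _; rewrite {2}mh mulrDr.
exact: lerD.
Qed.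

(** The function exp(- al s) J(s) - be s is nonincreasing: the factor exp(- al s) is at most 1, so
    the linear term absorbs the contribution of [be]. *)
Lemma gronwall (T al be : R) (J dJ : R -> R) : 0 <= T -> 0 <= al -> 0 <= be ->
  {within `[0, T], continuous J} ->
  (forall t, 0 < t < T -> is_derive t 1 J (dJ t)) ->
  (forall t, 0 < t < T -> dJ t <= al * J t + be) ->
  forall t, 0 <= t <= T -> J t <= (J 0 + be * t) * expR (al * t).
Proof.
move=> T0 al0 be0 cJ dJE Hd t /andP[t0 tT].
pose K s := expR (- al * s) * J s - be * s.
have dK s : 0 < s < T -> is_derive s 1 K
    (expR (- al * s) * dJ s + J s * (expR (- al * s) * - al) - be).
  move=> sT; have dJs := dJE s sT.
  have de : is_derive s 1 (fun s => expR (- al * s)) (expR (- al * s) * - al).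
    have dl : is_derive s 1 (fun s : R => - al * s) (- al).
      by apply: is_derive_eq; rewrite ?scaler0 ?add0r /GRing.scale /= mulr1.
    have := @is_derive1_comp R expR (fun s => - al * s) s _ _ (is_derive_expR _) dl.
    by rewrite mulrC mulrC.
  apply: is_derive_eq.
  by rewrite /GRing.scale /= mulr1.
have cK : {within `[0, T], continuous K}.
  move=> x; apply: cvgB.
    apply: cvgM; last exact: cJ.
    apply: continuous_subspaceT => y.
    apply: (@continuous_comp _ _ _ (fun s => - al * s) expR).
      by apply: cvgM; [exact: cvg_cst|exact: cvg_id].
    exact: continuous_expR.
  apply: continuous_subspaceT => y.
  by apply: cvgM; [exact: cvg_cst|exact: cvg_id].
have KK : K t <= K 0.
  apply: (@ler0_derive1_nincr _ K 0 T) => //.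
  - by move=> x; rewrite in_itv /= => xT; have [] := dK x xT.
  - move=> x; rewrite in_itv /= => xT; have [_] := dK x xT; rewrite derive1E => ->.
    have := Hd x xT; set E := expR _ => HJ.
    have E0 : 0 < E by exact: expR_gt0.
    have E1 : E <= 1.
      by rewrite -expR0 ler_expR mulNr oppr_le0 mulr_ge0 // ltW //; case/andP: xT.
    have : E * dJ x <= E * (al * J x + be) by rewrite ler_pM2l.
    have : E * be <= be by rewrite ler_piMl.
    nra.
move: KK; rewrite /K mulr0 expR0 mul1r mulr0 subr0 => KK.
have E0 : 0 < expR (al * t) by exact: expR_gt0.
have E1 : expR (al * t) * expR (- al * t) = 1 by rewrite -expRD mulNr subrr expR0.
have : expR (al * t) * (expR (- al * t) * J t - be * t) <= expR (al * t) * J 0.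
  by rewrite ler_pM2l.
rewrite mulrBr mulrA E1 mul1r; lra.
Qed.

End SegmentIntegrals.

(** * Weak derivatives and dyadic energies *)

Section DyadicEnergy.
Context {R : realType}.
Implicit Types (x y : R) (f v : R -> R) (c : nat -> R) (m n k l : nat).
Notation mu := (@lebesgue_measure R).

Definition mesh n : R := (2 ^+ n)^-1.

Lemma mesh_gt0 n : 0 < mesh n.
Proof. by rewrite invr_gt0 exprn_gt0. Qed.

Lemma meshS n : mesh n = 2 * mesh n.+1.
Proof. by rewrite /mesh exprS invfM mulrA divff // mul1r. Qed.

Lemma mesh_exp n : 2 ^+ n * mesh n = 1.
Proof. by rewrite divff // expf_neq0. Qed.

Lemma meshD m n : mesh m = (2 ^ n)%N%:R * mesh (m + n).
Proof. by rewrite /mesh exprD invfM natrX mulrCA divff ?mulr1 // expf_neq0. Qed.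

Lemma mesh_le1 n : mesh n <= 1.
Proof. by rewrite invf_le1 ?exprn_gt0 // exprn_ege1 // ler1n. Qed.

Lemma natr4 n : (4 ^ n)%N%:R = 2 ^+ n * 2 ^+ n :> R.
Proof. by rewrite natrX -exprMn -natrM. Qed.

Lemma mesh4 n : (4 ^ n)%N%:R * mesh n = 2 ^+ n.
Proof. by rewrite natr4 -mulrA mesh_exp mulr1. Qed.

Lemma mesh_cvg : mesh n @[n --> \oo] --> 0.
Proof.
have -> : mesh = GRing.exp (2^-1 : R) by apply/funext => n; rewrite /mesh exprVn.
by apply: cvg_expr; rewrite ger0_norm ?invr_ge0 // invf_lt1 // ltr1n.
Qed.

Lemma mesh_small (e : R) : 0 < e -> exists n, forall m, (n <= m)%N -> mesh m < e.
Proof.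
move=> e0; have /cvgrPdist_lt/(_ _ e0)[n _ Hn] := mesh_cvg.
exists n => m nm; have := Hn m nm; rewrite /= sub0r normrN ger0_norm //.
exact/ltW/mesh_gt0.
Qed.

Definition tr n x : nat := Num.truncn (x * 2 ^+ n).

Lemma trP n x : 0 <= x -> (tr n x)%:R * mesh n <= x < (tr n x).+1%:R * mesh n.
Proof.
move=> x0; have p0 : 0 < 2 ^+ n :> R by rewrite exprn_gt0.
have := truncn_itv (mulr_ge0 x0 (ltW p0)); rewrite -/(tr n x) => /andP[H1 H2].
by rewrite /mesh ler_pdivrMr // ltr_pdivlMr // H1 H2.
Qed.

Lemma tr_def n x k : k%:R * mesh n <= x < k.+1%:R * mesh n -> tr n x = k.
Proof.
have p0 : 0 < 2 ^+ n :> R by rewrite exprn_gt0.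
rewrite /mesh ler_pdivrMr // ltr_pdivlMr // => H.
exact: truncn_def.
Qed.

Lemma trS n x : 0 <= x -> tr n x = (tr n.+1 x)./2.
Proof.
move=> x0; apply: tr_def; have := trP n.+1 x0; rewrite (meshS n).
have m0 := mesh_gt0 n.+1; set q := tr _ _; set h := mesh _ in m0 *.
have : (q./2)%:R * 2 <= q%:R :> R.
  by rewrite -natrM ler_nat muln2 -{2}(odd_double_half q) leq_addl.
have : q.+1%:R <= (q./2).+1%:R * 2 :> R.
  rewrite -natrM ler_nat muln2 -{1}(odd_double_half q) doubleS.
  by case: (odd q).
move=> H1 H2 /andP[H3 H4]; apply/andP; split.
  by apply: le_trans H3; rewrite mulrA ler_pM2r.
by apply: lt_le_trans H4 _; rewrite mulrA ler_pM2r.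
Qed.

(** The Dirichlet energy on [0, 2^n] of the piecewise linear interpolation of [f] at the multiples
    of 2^-n. The window has 4^n cells and grows with [n], so that the supremum over [n] sees the
    whole half-line. *)
Definition dyadic_energy f n : R :=
  2 ^+ n * \sum_(k < 4 ^ n) (f (k.+1%:R * mesh n) - f (k%:R * mesh n)) ^+ 2.

Definition slope f n k : R :=
  2 ^+ n * (f (k.+1%:R * mesh n) - f (k%:R * mesh n)).

Lemma dyadic_energyE f n :
  dyadic_energy f n = mesh n * \sum_(k < 4 ^ n) slope f n k ^+ 2.
Proof.
rewrite /dyadic_energy !mulr_sumr; apply: eq_bigr => k _.
rewrite /slope exprMn [RHS]mulrA.
have -> : mesh n * 2 ^+ n ^+ 2 = 2 ^+ n by rewrite expr2 mulrA [mesh n * _]mulrC mesh_exp mul1r.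
by [].
Qed.

Lemma dyadic_energy_ge0 f n : 0 <= dyadic_energy f n.
Proof.
by rewrite mulr_ge0 ?exprn_ge0 // sumr_ge0 // => k _; exact: sqr_ge0.
Qed.

Lemma sum_double (g : nat -> R) n :
  \sum_(l < n.*2) g l = \sum_(k < n) (g k.*2 + g k.*2.+1).
Proof.
elim: n => [|n IH]; first by rewrite !big_ord0.
by rewrite doubleS !big_ord_recr /= IH addrA.
Qed.

Lemma sum_quad (g : nat -> R) n : \sum_(l < 4 ^ n.+1) g l =
  \sum_(k < 4 ^ n) (g k.*2 + g k.*2.+1) +
  \sum_(l < (4 ^ n).*2) g (l + (4 ^ n).*2)%N.
Proof.
have -> : (4 ^ n.+1 = (4 ^ n).*2 + (4 ^ n).*2)%N by rewrite expnS; lia.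
rewrite big_split_ord /= sum_double; congr (_ + _).
by apply: eq_bigr => l _; rewrite addnC.
Qed.

Lemma slopeS f n k : slope f n.+1 k.*2 + slope f n.+1 k.*2.+1 = 2 * slope f n k.
Proof.
have E1 : k.*2.+2%:R * mesh n.+1 = k.+1%:R * mesh n.
  by rewrite (meshS n) mulrA -natrM muln2.
have E2 : k.*2%:R * mesh n.+1 = k%:R * mesh n by rewrite (meshS n) mulrA -natrM muln2.
by rewrite /slope E1 E2 exprS; ring.
Qed.

(* Values of a level-[m] step function on the cells of level [m + d]; the
   cells beyond [2 ^ m] get the value [0]. *)
Fixpoint refine c m d l : R :=
  if d is d'.+1 then if (l < (4 ^ (m + d')).*2)%N then refine c m d' l./2 else 0
  else c l.

(** Pythagoras: a coarse slope is the mean of the two finer ones in its cell, so the coarse step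
    function is the orthogonal projection of the fine one, with value 0 on the cells beyond the
    coarse window. Monotonicity in the level and the Cauchy property of the slopes both come from
    this identity. *)
Lemma refine_energy f m d :
  mesh (m + d) * \sum_(l < 4 ^ (m + d)) (slope f (m + d) l - refine (slope f m) m d l) ^+ 2
  = dyadic_energy f (m + d) - dyadic_energy f m.
Proof.
elim: d => [|d IH].
  rewrite addn0 subrr big1 ?mulr0 // => l _.
  by rewrite /= subrr expr0n.
set n := (m + d)%N in IH *; rewrite addnS -/n.
rewrite (sum_quad (fun l => (slope f n.+1 l - refine (slope f m) m d.+1 l) ^+ 2)).
rewrite -[dyadic_energy f n.+1](subrK (dyadic_energy f n)) -addrA -IH.
rewrite !dyadic_energyE (sum_quad (fun l => slope f n.+1 l ^+ 2)) /=.
have -> : \sum_(l < (4 ^ n).*2)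
   (slope f n.+1 (l + (4 ^ n).*2) -
    (if (l + (4 ^ n).*2 < (4 ^ n).*2)%N then
      refine (slope f m) m d (l + (4 ^ n).*2)./2 else 0)) ^+ 2 =
  \sum_(l < (4 ^ n).*2) slope f n.+1 (l + (4 ^ n).*2) ^+ 2.
  by apply: eq_bigr => l _; rewrite ltnNge leq_addl /= subr0.
have -> : \sum_(k < 4 ^ n) ((slope f n.+1 k.*2 -
    (if (k.*2 < (4 ^ n).*2)%N then refine (slope f m) m d (k.*2)./2 else 0)) ^+ 2 +
   (slope f n.+1 k.*2.+1 - (if (k.*2.+1 < (4 ^ n).*2)%N then
      refine (slope f m) m d (uphalf k.*2) else 0)) ^+ 2) =
  \sum_(k < 4 ^ n) (2 * (slope f n k - refine (slope f m) m d k) ^+ 2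
     - 2 * slope f n k ^+ 2 + (slope f n.+1 k.*2 ^+ 2 + slope f n.+1 k.*2.+1 ^+ 2)).
  apply: eq_bigr => k _; have kn := ltn_ord k.
  have -> : (k.*2 < (4 ^ n).*2)%N by rewrite ltn_double.
  have -> : (k.*2.+1 < (4 ^ n).*2)%N by rewrite -doubleS in kn *; lia.
  rewrite doubleK uphalf_double.
  have -> : slope f n k = (slope f n.+1 k.*2 + slope f n.+1 k.*2.+1) / 2.
    by rewrite slopeS mulrC mulKf.
  by field.
rewrite !big_split /= -!mulr_sumr sumrN -mulr_sumr (meshS n).
ring.
Qed.

Lemma dyadic_energy_nondec f : {homo dyadic_energy f : m n / (m <= n)%N >-> m <= n}.
Proof.
move=> m n mn; rewrite -(subnKC mn) -subr_ge0 -refine_energy.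
rewrite mulr_ge0 ?(ltW (mesh_gt0 _)) // sumr_ge0 // => k _; exact: sqr_ge0.
Qed.

Definition step n c x : R :=
  if (0 <= x) && (tr n x < 4 ^ n)%N then c (tr n x) else 0.

Lemma stepE n c x : step n c x =
  \sum_(k < 4 ^ n) c k * \1_(`[k%:R * mesh n, k.+1%:R * mesh n[ : set R) x.
Proof.
have H k : (\1_(`[k%:R * mesh n, k.+1%:R * mesh n[ : set R) x : R) =
   (if (0 <= x) && (tr n x == k) then 1 else 0).
  rewrite indicE; case: ifPn => [/andP[x0 /eqP <-]|H].
    by rewrite mem_set //= in_itv /= trP.
  rewrite memNset //= in_itv /= => H1; move: H.
  rewrite (tr_def H1) eqxx andbT => /negP; apply.
  case/andP: H1 => + _; apply: le_trans.
  by rewrite mulr_ge0 // ltW // mesh_gt0.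
rewrite /step; case: (boolP (0 <= x)) => x0 /=; last first.
  by rewrite big1 // => k _; rewrite H (negbTE x0) /= mulr0.
case: ifPn => [tn|]; last first.
  rewrite -leqNgt => tn; rewrite big1 // => k _; rewrite H.
  case: eqP => [E|_]; last by rewrite andbF mulr0.
  by have := ltn_ord k; rewrite -E ltnNge tn.
rewrite (bigD1 (Ordinal tn)) //= H x0 eqxx mulr1 big1 ?addr0 // => k kt.
rewrite H x0 /=; case: eqP => [E|_]; last by rewrite mulr0.
by case/eqP: kt; apply/val_inj.
Qed.

Lemma measurable_step n c (D : set R) : measurable_fun D (step n c).
Proof.
have -> : step n c = (fun x => \sum_(k < 4 ^ n) c k * \1_(`[k%:R * mesh n, k.+1%:R * mesh n[ : set R) x).
  by apply/funext => x; exact: stepE.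
apply: measurable_sum => k; apply: measurable_funM => //.
Qed.

Lemma step_sqr n c x : step n c x ^+ 2 = step n (fun k => c k ^+ 2) x.
Proof. by rewrite /step; case: ifP => //; rewrite expr0n. Qed.

Lemma stepB n c c' x : step n c x - step n c' x = step n (fun k => c k - c' k) x.
Proof. by rewrite /step; case: ifP => //; rewrite subrr. Qed.

Lemma step_refine m c d x : step m c x = step (m + d) (refine c m d) x.
Proof.
elim: d => [|d IH]; first by rewrite addn0.
rewrite IH /step addnS /=; case: (boolP (0 <= x)) => //= x0.
rewrite -trS //; set n := (m + d)%N.
rewrite (trS n x0); set t := tr _ _.
case: ifPn => H.
  have H1 : (t < (4 ^ n).*2)%N by lia.
  by rewrite H1 expnS; case: ifPn => //; lia.
have -> : (t < (4 ^ n).*2)%N = false by apply/negbTE; lia.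
by case: ifP.
Qed.

Lemma measurable_halfline : measurable (halfline : set R).
Proof. exact: measurable_itv. Qed.

Lemma integral_step n c : (forall k, 0 <= c k) ->
  (\int[mu]_(x in halfline) (step n c x)%:E = (mesh n * \sum_(k < 4 ^ n) c k)%:E)%E.
Proof.
move=> c0.
under eq_integral do rewrite stepE -sumEFin.
rewrite (ge0_integral_sum mu measurable_halfline) //=; last 2 first.
- move=> k; apply/measurable_EFinP; apply: measurable_funM => //.
- move=> k x _; rewrite lee_fin mulr_ge0 //.
rewrite mulr_sumr -sumEFin; apply: eq_bigr => k _.
under eq_integral do rewrite EFinM.
rewrite ge0_integralZl_EFin //=; [|exact: measurable_itv|exact/measurable_EFinP].
rewrite (@integral_indic _ _ _ mu halfline) //; last exact: measurable_itv.
rewrite setIidl; last first.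
  rewrite /halfline => x /=; rewrite !in_itv /= andbT => /andP[+ _].
  by apply: le_trans; rewrite mulr_ge0 // ltW // mesh_gt0.
have muk : mu (`[k%:R * mesh n, k.+1%:R * mesh n[ : set R) = (mesh n)%:E.
  rewrite lebesgue_measure_itv /= lte_fin ltr_pM2r ?mesh_gt0 // ltr_nat ltnSn.
  by rewrite -EFinD; congr _%:E; rewrite -natr1; ring.
apply: etrans (congr1 (fun z => (c k)%:E * z)%E muk) _.
by rewrite -EFinM mulrC.
Qed.

End DyadicEnergy.

(** * Dyadic energies and the square integral of the weak derivative *)

Section WeakDerivative.
Context {R : realType}.
Implicit Types (x y B : R) (f v : R -> R) (m n k l : nat).
Notation mu := (@lebesgue_measure R).
Notation mesh := (@mesh R).

Lemma natr_mesh_ge0 k n : 0 <= k%:R * mesh n :> R.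
Proof. by rewrite mulr_ge0 // ltW // mesh_gt0. Qed.

Lemma le_mesh k n : k%:R * mesh n <= k.+1%:R * mesh n.
Proof. by rewrite ler_pM2r ?mesh_gt0 // ler_nat. Qed.

Lemma succ_mesh k n : k.+1%:R * mesh n = k%:R * mesh n + mesh n.
Proof. by rewrite -natr1; ring. Qed.

Definition loc_integrable v := forall x, mu.-integrable `[0, x] (EFin \o v).

Definition primitive_of f v := forall x, 0 <= x -> f x = f 0 + itg 0 x v.

Lemma integrable_sub v a b : loc_integrable v -> 0 <= a ->
  mu.-integrable `[a, b] (EFin \o v).
Proof.
move=> vi a0; apply: integrableS (vi b) => //.
by move=> x /=; rewrite !in_itv /= => /andP[ax ->]; rewrite (le_trans a0 ax).
Qed.

Lemma primitive_incr f v a b : loc_integrable v -> primitive_of f v ->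
  0 <= a -> a <= b -> f b - f a = itg a b v.
Proof.
move=> vi fv a0 ab; rewrite (fv a) // (fv b) ?(le_trans a0) //.
rewrite (itg_chasles_int a0 ab (vi b)); ring.
Qed.

Lemma incr_sqr_le f v a b : loc_integrable v ->
  loc_integrable (fun x => v x ^+ 2) -> primitive_of f v ->
  0 <= a -> a <= b -> (f b - f a) ^+ 2 <= (b - a) * itg a b (fun x => v x ^+ 2).
Proof.
move=> vi v2 fv a0 ab; rewrite (primitive_incr vi fv a0 ab).
by apply: sqr_itg_int => //; exact: integrable_sub.
Qed.

Lemma dyadic_sum_le f v n j : loc_integrable v ->
  loc_integrable (fun x => v x ^+ 2) -> primitive_of f v ->
  2 ^+ n * \sum_(k < j) (f (k.+1%:R * mesh n) - f (k%:R * mesh n)) ^+ 2 <=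
  itg 0 (j%:R * mesh n) (fun x => v x ^+ 2).
Proof.
move=> vi v2 fv; elim: j => [|j IH]; first by rewrite big_ord0 mulr0 mul0r itgxx.
rewrite big_ord_recr /= mulrDr.
have j0 := natr_mesh_ge0 j n; have jj := le_mesh j n.
rewrite (itg_chasles_int j0 jj (v2 _)) lerD //.
rewrite -(ler_pM2l (mesh_gt0 n)) mulrA [mesh n * _]mulrC mesh_exp mul1r.
apply: le_trans (incr_sqr_le vi v2 fv j0 jj) _.
by rewrite {1}succ_mesh addrAC subrr add0r.
Qed.

Lemma dyadic_energy_le f v n : loc_integrable v ->
  loc_integrable (fun x => v x ^+ 2) -> primitive_of f v ->
  dyadic_energy f n <= itg 0 (2 ^+ n) (fun x => v x ^+ 2).
Proof.
by move=> vi v2 fv; have := @dyadic_sum_le f v n (4 ^ n)%N vi v2 fv; rewrite mesh4.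
Qed.

Lemma limn_einf_ub (u : (\bar R)^nat) (l : \bar R) :
  (forall n, (u n <= l)%E) -> (limn_einf u <= l)%E.
Proof.
move=> ul; rewrite limn_einf_lim; apply: lime_le; first exact: is_cvg_einfs.
apply: nearW => n; apply: le_trans (ul n).
by apply: ereal_inf_lbound; exists n => /=.
Qed.

Lemma limn_einf_ge0 (u : (\bar R)^nat) :
  (forall n, (0 <= u n)%E) -> (0 <= limn_einf u)%E.
Proof.
move=> u0; rewrite limn_einf_lim; apply: lime_ge; first exact: is_cvg_einfs.
by apply: nearW => n; apply: le_ereal_inf_tmp => y [k /= nk <-].
Qed.

Definition dyadic_cell x n : set R :=
  `[(Num.floor (x * 2 ^+ n))%:~R * mesh n, (Num.floor (x * 2 ^+ n) + 1)%:~R * mesh n].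

Lemma dyadic_cellP x n : dyadic_cell x n x.
Proof.
rewrite /dyadic_cell /= in_itv /= /mesh.
have p0 : 0 < 2 ^+ n :> R by rewrite exprn_gt0.
rewrite ler_pdivrMr // ler_pdivlMr //.
by rewrite floor_le ltW // floorD1_gt.
Qed.

Lemma dyadic_cell_measure x n : mu (dyadic_cell x n) = (mesh n)%:E.
Proof.
rewrite /dyadic_cell lebesgue_measure_itv /= lte_fin ltr_pM2r ?mesh_gt0 //.
by rewrite ltr_int ltrDl ltr01 -EFinD intrD; congr _%:E; ring.
Qed.

Lemma dyadic_cell_shrinking x : nicely_shrinking x (dyadic_cell x).
Proof.
split; first by move=> n; exact: measurable_itv.
have p n : 0 < 2 * mesh n by rewrite mulr_gt0 // mesh_gt0.
(* A dyadic cell that contains [x] lies in the ball of radius [2 * mesh n], whose measure is 4 times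
   that of the cell. *)
exists (4, fun n => PosNum (p n)); split => //=.
- rewrite -(mulr0 2); apply: cvgM; first exact: cvg_cst.
  exact: mesh_cvg.
- move=> n y /= yn; have := dyadic_cellP x n; move: yn.
  rewrite /dyadic_cell /= !in_itv /= intrD mulrDl mul1r /ball /=.
  have h0 := mesh_gt0 (R := R) n.
  set z := (Num.floor _)%:~R * mesh n => /andP[y1 y2] /andP[x1 x2]; rewrite ltr_norml; apply/andP; split; lra.
move=> n; rewrite dyadic_cell_measure lebesgue_measure_ball; last exact/ltW/p.
by rewrite -EFinM lee_fin /=; have := mesh_gt0 (R := R) n; lra.
Qed.

Lemma floor_tr x n : 0 <= x -> Num.floor (x * 2 ^+ n) = tr n x.
Proof.
move=> x0; rewrite /tr truncEfloor.
have : 0 <= Num.floor (x * 2 ^+ n) by rewrite floor_ge0 mulr_ge0 // exprn_ge0.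
by case: (Num.floor _).
Qed.

(** The slope over a cell is the mean of [v] over that cell, and the cells around [x] shrink nicely:
    this is Lebesgue differentiation. The restriction to [[0, X]] only serves to have a locally
    integrable function on the line. *)
Lemma slope_cvg f v X x : loc_integrable v -> primitive_of f v ->
  0 <= x < X -> lebesgue_pt (v \_ `[0, X]) x ->
  step n (slope f n) x @[n --> \oo] --> v x.
Proof.
move=> vi fv /andP[x0 xX] xl.
have := nice_lebesgue_differentiation dyadic_cell_shrinking
  (integrable_locally_restrict (measurable_itv _) (vi X)) xl.
rewrite patchE mem_set; last by rewrite /= in_itv /= x0 ltW.
move=> /fine_cvgP[_]; apply: cvg_trans; apply: near_eq_cvg.
have Xx : 0 < X - x by rewrite subr_gt0.
have [n1 Hn1] := mesh_small Xx.
have [n2 Hn2] : exists n2 : nat, forall n, (n2 <= n)%N -> x < 2 ^+ n.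
  have x1 : 0 < (x + 1)^-1 by rewrite invr_gt0; lra.
  have [n2 Hn2] := mesh_small x1; exists n2 => n nn.
  have := Hn2 n nn; rewrite /mesh ltf_pV2 ?posrE ?exprn_gt0 //; lra.
exists (maxn n1 n2) => // n /=; rewrite geq_max => /andP[nn1 nn2].
have {}Hn1 := Hn1 n nn1; have {}Hn2 := Hn2 n nn2.
have /andP[t1 t2] := trP n x0.
have trn : (tr n x < 4 ^ n)%N.
  rewrite -(ltr_nat R) -(ltr_pM2r (mesh_gt0 n)) mesh4; exact: le_lt_trans Hn2.
rewrite /step x0 trn /=.
have -> : (\int[mu]_(y in dyadic_cell x n) ((v \_ `[0, X]) y)%:E)%E =
   (\int[mu]_(y in `[((tr n x)%:R * mesh n)%R, ((tr n x).+1%:R * mesh n)%R]) (v y)%:E)%E.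
  rewrite /dyadic_cell floor_tr // -[(tr n x : int)%:~R]/((tr n x)%:R).
  have -> : ((tr n x : int) + 1)%:~R = (tr n x).+1%:R :> R by rewrite -natr1 intrD.
  apply: eq_integral => y; rewrite inE /= in_itv /= => /andP[y1 y2].
  rewrite patchE mem_set // /= in_itv /= (le_trans (natr_mesh_ge0 _ _) y1) /=.
  by apply: le_trans y2 _; rewrite succ_mesh; lra.
rewrite dyadic_cell_measure /slope.
rewrite (primitive_incr vi fv (natr_mesh_ge0 _ _) (le_mesh _ _)).
have -> : ((mesh n)%:E^-1)%E = (2 ^+ n)%:E.
  by rewrite inver gt_eqF ?mesh_gt0 // /mesh invrK.
rewrite fineM //=; apply: integrable_fin_num => //.
by apply: integrable_sub => //; exact: natr_mesh_ge0.
Qed.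

Lemma loc_integrable_measurable v : loc_integrable v -> measurable_fun halfline v.
Proof.
move=> vi.
have -> : halfline = \bigcup_n (`[0, n%:R]%classic : set R).
  apply/seteqP; split => x /=.
    rewrite /halfline /= in_itv /= andbT => x0.
    exists (Num.truncn x).+1 => //=; rewrite in_itv /= x0 /=.
    exact/ltW/truncnS_gt.
  by move=> [n _] /=; rewrite /halfline /= !in_itv /= andbT => /andP[].
apply/measurable_fun_bigcup; first by move=> i; exact: measurable_itv.
by move=> i; have /integrableP[/measurable_EFinP] := vi i%:R.
Qed.

Lemma integral_halfline_le (g : R -> \bar R) (M : \bar R) :
  measurable_fun halfline g -> (forall x, 0 <= x -> (0 <= g x)%E) ->
  (forall n, (\int[mu]_(x in `[0%R, n%:R[) g x <= M)%E) ->
  (\int[mu]_(x in halfline) g x <= M)%E.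
Proof.
move=> mg g0 gM.
have E : halfline = \bigcup_n (`[0, n%:R[%classic : set R).
  apply/seteqP; split => x /=.
    rewrite /halfline /= in_itv /= andbT => x0.
    exists (Num.truncn x).+1 => //=; rewrite in_itv /= x0 /=.
    exact/truncnS_gt.
  by move=> [n _] /=; rewrite /halfline /= !in_itv /= andbT => /andP[].
have sub n : (`[0, n%:R[%classic : set R) `<=` halfline.
  by move=> x; rewrite /halfline /= !in_itv /= => /andP[-> _].
suff H : (\int[mu]_(x in (`[0%R, i%:R[)) g x)%E @[i --> \oo] --> (\int[mu]_(x in halfline) g x)%E.
  rewrite -(cvg_lim _ H) //; apply: lime_le; first by apply/cvg_ex; exists (\int[mu]_(x in halfline) g x)%E.
  exact: nearW.
rewrite E.
apply: (@ge0_nondecreasing_set_cvg_integral _ (measurableTypeR R) R (fun n => `[0, n%:R[%classic) g mu).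
- move=> n m nm; apply/subsetPset => x; rewrite /= !in_itv /= => /andP[-> +] /=.
  by move=> /lt_le_trans; apply; rewrite ler_nat.
- by move=> i; exact: measurable_itv.
- by move=> i; apply: measurable_funS mg => //; exact: measurable_halfline.
- by move=> i x; rewrite /= in_itv /= => /andP[x0 _]; exact: g0.
Qed.

(** Fatou's lemma for the squared step functions of slopes, which converge almost everywhere to
    [v ^+ 2] and have the dyadic energies as integrals. *)
Lemma dyadic_energy_wderiv f v B : loc_integrable v -> primitive_of f v ->
  (forall n, dyadic_energy f n <= B) ->
  (\int[mu]_(x in halfline) (v x ^+ 2)%:E <= B%:E)%E.
Proof.
move=> vi fv fB.
have mv := loc_integrable_measurable vi.
have mv2 : measurable_fun halfline (fun x => (v x ^+ 2)%:E).
  exact/measurable_EFinP/measurable_funX.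
apply: integral_halfline_le => //; first by move=> x _; rewrite lee_fin sqr_ge0.
move=> N; set X : R := N%:R.
pose D : set R := `[0, X[%classic.
have mD : measurable D by exact: measurable_itv.
rewrite -/D.
have sub : D `<=` halfline.
  by move=> x; rewrite /D /halfline /= !in_itv /= => /andP[-> _].
pose g n x := ((step n (slope f n) x) ^+ 2)%:E.
have mg n : measurable_fun D (g n).
  by apply/measurable_EFinP/measurable_funX; exact: measurable_step.
have g0 n x : (0 <= g n x)%E by rewrite lee_fin sqr_ge0.
apply: (@le_trans _ _ (\int[mu]_(x in D) limn_einf (g^~ x))%E).
  apply: ae_ge0_le_integral => //.
  - by move=> x _; rewrite lee_fin sqr_ge0.
  - by apply: measurable_funS mv2 => //; exact: measurable_halfline.
  - by move=> x _; apply: limn_einf_ge0.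
  - rewrite /limn_einf; apply: measurableT_comp => //.
    apply: measurable_fun_limn_esup => n; rewrite /g.
    by apply/measurable_EFinP/measurable_funN/measurable_EFinP; exact: mg.
  have := lebesgue_differentiation
    (integrable_locally_restrict (measurable_itv _) (vi X)).
  apply: filterS; first exact: (ae_filter_ringOfSetsType mu).
  move=> x xl; rewrite /D /= in_itv /= => xX.
  have /cvg_limn_einf_sup[-> _] : g n x @[n --> \oo] --> (v x ^+ 2)%:E.
    apply: cvg_EFin; first exact: nearW.
    have H := slope_cvg vi fv xX xl.
    have -> : fine \o g^~ x = (fun n => step n (slope f n) x * step n (slope f n) x) by [].
    by rewrite expr2; apply: cvgM.
  by [].
apply: le_trans (fatou mu mD mg _) _ => //.
apply: limn_einf_ub => n.
apply: (@le_trans _ _ (\int[mu]_(x in halfline) g n x)%E).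
  apply: ge0_subset_integral => //; first exact: measurable_halfline.
  by apply/measurable_EFinP/measurable_funX; exact: measurable_step.
rewrite /g; under eq_integral do rewrite step_sqr.
rewrite integral_step; last by move=> k; exact: sqr_ge0.
by rewrite lee_fin -dyadic_energyE.
Qed.

End WeakDerivative.

(** * Bounded dyadic energies produce a weak derivative *)

Section WeakDerivativeExistence.
Context {R : realType}.
Variables (f : R -> R) (B : R).
Hypothesis fc : continuous f.
Hypothesis fB : forall n, dyadic_energy f n <= B.
Notation mu := (@lebesgue_measure R).
Notation mesh := (@mesh R).
Notation E := (dyadic_energy f).

Lemma geometric_half_le n : \sum_(0 <= i < n) (2^-1 : R) ^+ i <= 2.
Proof.
have := @geometric_le_lim R n 1 2^-1 ler01.
rewrite invr_gt0 ltr0n gtr0_norm ?invr_gt0 // invf_lt1 // ltr1n => /(_ isT isT).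
have E2 : 1 / (1 - 2^-1) = 2 :> R by field.
rewrite E2; apply: le_trans; rewrite /series /=.
by apply: ler_sum => i _; rewrite mul1r.
Qed.

Lemma step_integrable n c (X : R) : mu.-integrable `[0, X] (EFin \o step n c).
Proof.
pose M := \sum_(k < 4 ^ n) `|c k|.
have M0 : 0 <= M by apply: sumr_ge0.
apply: (@le_integrable _ _ _ mu _ _ _ (EFin \o (fun=> M))) => //.
- by apply/measurable_EFinP; exact: measurable_step.
- move=> x _ /=; rewrite lee_fin (ger0_norm M0) /step; case: ifPn => [/andP[_ tn]|_].
    by rewrite /M (bigD1 (Ordinal tn)) //= lerDl sumr_ge0.
  by rewrite normr0.
- by apply: integrable_cont; exact: cst_continuous.
Qed.

Lemma itg_step n c j : (j <= 4 ^ n)%N ->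
  itg 0 (j%:R * mesh n) (step n c) = mesh n * \sum_(k < j) c k.
Proof.
elim: j => [|j IH] jn; first by rewrite big_ord0 mulr0 mul0r itgxx.
have j0 := natr_mesh_ge0 (R := R) j n; have jj := le_mesh (R := R) j n.
rewrite (itg_chasles_int j0 jj); last exact: step_integrable.
rewrite IH 1?ltnW // big_ord_recr /= mulrDr; congr (_ + _).
rewrite /itg -Rintegral_itv_bndo_bndc; last first.
  apply: integrableS (step_integrable n c (j.+1%:R * mesh n)) => //.
  move=> x /=; rewrite !in_itv /= => /andP[jx /ltW ->].
  by rewrite (le_trans j0 jx).
rewrite (@eq_Rintegral _ _ _ _ _ (fun=> c j)); last first.
  move=> x; rewrite inE /= in_itv /= => jx.
  have x0 : 0 <= x by case/andP: jx => + _; exact: le_trans.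
  by rewrite /step x0 (tr_def jx) jn.
rewrite Rintegral_cst //= lebesgue_measure_itv /= lte_fin ltr_pM2r ?mesh_gt0 //.
by rewrite ltr_nat ltnSn /= succ_mesh; ring.
Qed.

Lemma itg_slope n j : (j <= 4 ^ n)%N ->
  itg 0 (j%:R * mesh n) (step n (slope f n)) = f (j%:R * mesh n) - f 0.
Proof.
move=> jn; rewrite itg_step //.
have -> : f (j%:R * mesh n) - f 0 =
    \sum_(k < j) (f (k.+1%:R * mesh n) - f (k%:R * mesh n)).
  elim: j {jn} => [|j IH]; first by rewrite big_ord0 mul0r subrr.
  by rewrite big_ord_recr /= -IH; ring.
rewrite mulr_sumr; apply: eq_bigr => k _.
by rewrite /slope mulrA [mesh n * _]mulrC mesh_exp mul1r.
Qed.

Lemma energy_cvg : cvgn E.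
Proof.
apply: nondecreasing_is_cvgn; first exact: dyadic_energy_nondec.
by exists B => _ [n _ <-].
Qed.

(** The energies converge, so levels can be picked after which less than 4^-k is left. This rate
    leaves 2^-k after multiplication by the weight 2^k used in the next lemma. *)
Lemma energy_tail : exists phi : nat -> nat, {homo phi : m n / (m <= n)%N} /\
  (forall k, (k <= phi k)%N) /\
  forall k n, (phi k <= n)%N -> E n - E (phi k) <= (2^-1) ^+ k * (2^-1) ^+ k.
Proof.
have H k : exists N, forall n, (N <= n)%N -> limn E - E n <= (2^-1) ^+ k * (2^-1) ^+ k.
  have e0 : 0 < (2^-1) ^+ k * (2^-1) ^+ k :> R by rewrite mulr_gt0 // exprn_gt0.
  have /cvgrPdist_le/(_ _ e0)[N _ HN] := energy_cvg.
  exists N => n Nn; apply: le_trans (HN n Nn); exact: ler_norm.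
have [N HN] := choice H.
(* Summing the thresholds makes [phi] increasing, at least [k], and beyond the threshold [N k]. *)
pose phi k := (\sum_(i < k.+1) (N i).+1)%N.
have phiS k : (phi k.+1 = phi k + (N k.+1).+1)%N by rewrite /phi big_ord_recr.
exists phi; split; [|split].
- apply: homo_leq => //; first exact: leq_trans.
  by move=> k; rewrite phiS leq_addr.
- elim=> // k IH; rewrite phiS; lia.
move=> k n kn; apply: le_trans (HN k (phi k) _); last first.
  by rewrite /phi big_ord_recr /=; lia.
rewrite lerB //; exact: (nondecreasing_cvgn_le (dyadic_energy_nondec f) energy_cvg).
Qed.

(** Along the chosen levels the step functions of slopes are Cauchy in L^2, by the Pythagoras
    identity. A weighted series of squared differences turns this into almost everywhere convergence
    together with an integrable majorant; dominated convergence then gives the primitive at dyadic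
    points, and continuity of [f] gives it everywhere. *)
Lemma ex_weak_derivative : exists v, loc_integrable v /\ primitive_of f v.
Proof.
have [phi [phi_homo [phi_ge Hphi]]] := energy_tail.
pose S k := step (phi k) (slope f (phi k)).
have mS k D : measurable_fun D (S k) by exact: measurable_step.
pose d k x := S k.+1 x - S k x.
have HS k : exists c, (forall l, 0 <= c l) /\ (forall x, d k x ^+ 2 = step (phi k.+1) c x) /\
    mesh (phi k.+1) * \sum_(l < 4 ^ phi k.+1) c l = E (phi k.+1) - E (phi k).
  have pk : (phi k <= phi k.+1)%N by exact: phi_homo.
  set e := (phi k.+1 - phi k)%N; have E1 : phi k.+1 = (phi k + e)%N by rewrite subnKC.
  exists (fun l => (slope f (phi k.+1) l - refine (slope f (phi k)) (phi k) e l) ^+ 2).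
  split; first by move=> l; exact: sqr_ge0.
  split; last by rewrite E1; exact: refine_energy.
  by move=> x; rewrite /d /S (step_refine (phi k) _ e) -E1 stepB step_sqr.
have wd0 k x : 0 <= 2 ^+ k * d k x ^+ 2 by apply: mulr_ge0; [exact: exprn_ge0|exact: sqr_ge0].
have mwd k D : measurable_fun D (fun x => (2 ^+ k * d k x ^+ 2)%:E).
  apply/measurable_EFinP/measurable_funM => //.
  by apply: measurable_funX; apply: measurable_funB; exact: mS.
(* The integral of [T] is at most the sum of the 2^-k, hence [T] is finite almost everywhere. Since
   2 |d_k| <= 2^k d_k^2 + 2^-k, finiteness of [T x] makes the differences absolutely summable at
   [x], with sum at most [T x + 1]. *)
pose T x := (\sum_(0 <= k <oo) (2 ^+ k * d k x ^+ 2)%:E)%E.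
have mT D : measurable D -> measurable_fun D T.
  by move=> mD; apply: ge0_emeasurable_sum => [k x _ _|k _]; [rewrite lee_fin; exact: wd0|exact: mwd].
have T0 x : (0 <= T x)%E.
  by apply: nneseries_ge0 => k _ _; rewrite lee_fin.
have IT : (\int[mu]_(x in halfline) T x <= 2%:E)%E.
  rewrite integral_nneseries; last 3 first.
  - exact: measurable_halfline.
  - by move=> k; exact: mwd.
  - by move=> k x _; rewrite lee_fin; exact: wd0.
  apply: (@le_trans _ _ (\sum_(0 <= k <oo) ((2^-1) ^+ k)%:E)%E).
    apply: lee_nneseries.
      move=> k _ _; apply: integral_ge0 => x _.
      by rewrite lee_fin.
    move=> k _; have [c [c0 [dc cE]]] := HS k.
    under eq_integral do rewrite EFinM dc.
    rewrite ge0_integralZl_EFin ?exprn_ge0 //; last 3 first.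
    - exact: measurable_halfline.
    - by move=> x _; rewrite lee_fin -dc sqr_ge0.
    - by apply/measurable_EFinP; exact: measurable_step.
    rewrite integral_step // cE -EFinM lee_fin.
    apply: (@le_trans _ _ (2 ^+ k * ((2^-1) ^+ k * (2^-1) ^+ k))).
      by rewrite ler_pM2l ?exprn_gt0 // Hphi // phi_homo.
    by rewrite mulrA -exprMn divff // expr1n mul1r.
  apply: lime_le; first by apply: is_cvg_nneseries => k _ _; rewrite lee_fin exprn_ge0.
  apply: nearW => n; rewrite sumEFin lee_fin.
  exact: geometric_half_le.
have bd k x t : T x = t%:E -> \sum_(0 <= i < k) `|d i x| <= t + 1.
  move=> Tx.
  apply: (@le_trans _ _ (\sum_(0 <= i < k) (2 ^+ i * d i x ^+ 2 + (2^-1) ^+ i) / 2)).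
    apply: ler_sum => i _.
    have p0 : 0 < 2 ^+ i :> R by rewrite exprn_gt0.
    rewrite exprVn -(real_normK (num_real (d i x))).
    set y := `|d i x|; set z := 2 ^+ i in p0 *.
    have -> : (z * y ^+ 2 + z^-1) / 2 = y + z^-1 * (z * y - 1) ^+ 2 / 2.
      by field; rewrite gt_eqF.
    by rewrite lerDl mulr_ge0 // mulr_ge0 ?sqr_ge0 // invr_ge0 ltW.
  rewrite -mulr_suml big_split /=.
  have H1 : \sum_(0 <= i < k) 2 ^+ i * d i x ^+ 2 <= t.
    rewrite -lee_fin -Tx -sumEFin; apply: nneseries_lim_ge => i _ _.
    by rewrite lee_fin.
  have H2 : \sum_(0 <= i < k) (2^-1) ^+ i <= 2 :> R.
    exact: geometric_half_le.
  have t0 : 0 <= t by rewrite -lee_fin -Tx.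
  lra.
have tele k x : S k x = S 0 x + \sum_(0 <= i < k) d i x.
  elim: k => [|k IH]; first by rewrite big_nil addr0.
  by rewrite big_nat_recr //= addrA -IH /d; ring.
(* An upper limit is measurable everywhere, even on the null set where the step functions do not
   converge. *)
pose v x := fine (limn_esup (fun k => (S k x)%:E)).
have vlim x : T x \is a fin_num -> S k x @[k --> \oo] --> v x.
  move=> Tx; have TE : T x = (fine (T x))%:E by rewrite fineK.
  have cv : cvgn (series (fun i => d i x)).
    apply: normed_cvg; apply: nondecreasing_is_cvgn.
      by apply: nondecreasing_series => i _ _; exact: normr_ge0.
    by exists (fine (T x) + 1) => _ [k _ <-]; exact: bd.
  have cS : S k x @[k --> \oo] --> S 0 x + limn (series (fun i => d i x)).
    have -> : (fun k => S k x) = (fun k => S 0 x + series (fun i => d i x) k).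
      by apply/funext => k; rewrite {1}tele.
    by apply: cvgD; [exact: cvg_cst|exact: cv].
  rewrite /v; have /cvg_limn_einf_sup[_ ->] :
     (S k x)%:E @[k --> \oo] --> (S 0 x + limn (series (fun i => d i x)))%:E.
    by apply: cvg_EFin; [exact: nearW|exact: cS].
  exact: cS.
have mv D : measurable_fun D v.
  move=> mD; apply: measurableT_comp => //; apply: measurable_fun_limn_esup => k.
  exact/measurable_EFinP.
pose G x := ((`|S 0 x| + 1)%:E + T x)%E.
have key X : mu.-integrable `[0, X] (EFin \o v) /\
   \int[mu]_(x in `[0, X]) S k x @[k --> \oo] --> itg 0 X v.
  have sub : (`[0, X]%classic : set R) `<=` halfline.
    by move=> x; rewrite /halfline /= !in_itv /= => /andP[-> _].
  have iT : mu.-integrable `[0, X] T.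
    apply/integrableP; split; first exact: mT.
    apply: (@le_lt_trans _ _ (\int[mu]_(x in halfline) T x)%E); last first.
      exact: le_lt_trans IT (ltry _).
    under eq_integral do rewrite gee0_abs //.
    apply: ge0_subset_integral => //; first exact: measurable_halfline.
    by apply: mT; exact: measurable_halfline.
  have iG : mu.-integrable `[0, X] G.
    apply: integrableD => //.
    have -> : (fun x => (`|S 0 x| + 1)%:E) = (fun x => (`|S 0 x|)%:E + (cst 1 x)%:E)%E by [].
    apply: integrableD => //; last by apply: integrable_cont; exact: cst_continuous.
    exact: (integrable_norm (step_integrable _ _ _)).
  have aeT : \forall x \ae mu, `[0, X]%classic x -> T x \is a fin_num.
    exact: integrable_ae.
  have [] := @dominated_convergence _ _ R mu `[0, X]%classic (measurable_itv _)
     (fun k x => (S k x)%:E) (EFin \o v) G.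
  - by move=> k; apply/measurable_EFinP; exact: mS.
  - by apply/measurable_EFinP; exact: mv.
  - apply: filterS aeT; first exact: (ae_filter_ringOfSetsType mu).
    move=> x H Dx; apply: cvg_EFin; first exact: nearW.
    exact: vlim (H Dx).
  - exact: iG.
  - apply: filterS aeT; first exact: (ae_filter_ringOfSetsType mu).
    move=> x H k Dx; have Tx := H Dx.
    have TE : T x = (fine (T x))%:E by rewrite fineK.
    rewrite /G TE /= -EFinD lee_fin tele.
    apply: le_trans (ler_normD _ _) _; rewrite -addrA lerD2l.
    apply: le_trans (ler_norm_sum _ _ _) _.
    by rewrite addrC; exact: bd.
  move=> iv _ cv; split => //.
  have : (fine \o (fun k => \int[mu]_(x in `[0%R, X]) (S k x)%:E)%E) k @[k --> \oo] -->
     fine (\int[mu]_(x in `[0%R, X]) (v x)%:E)%E.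
    apply: fine_cvg; rewrite fineK //.
    exact: integrable_fin_num.
  by [].
exists v; split; first by move=> X; have [] := key X.
(* At a fixed dyadic point the integrals of the step functions telescope and equal the increment of
   [f] exactly, as soon as the level is at least [m] and the window reaches the point. *)
have dya m j : f (j%:R * mesh m) = f 0 + itg 0 (j%:R * mesh m) v.
  have [_ cv] := key (j%:R * mesh m).
  suff cf : \int[mu]_(x in `[0, j%:R * mesh m]) S k x @[k --> \oo] -->
      f (j%:R * mesh m) - f 0.
    by rewrite -(cvg_unique _ cf cv) //; ring.
  apply: cvg_near_cst; exists (maxn m j) => // k /=; rewrite geq_max => /andP[mk jk].
  have mp : (m <= phi k)%N by apply: leq_trans mk _; exact: phi_ge.
  have jp : (j <= phi k)%N by apply: leq_trans jk _; exact: phi_ge.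
  set e := (phi k - m)%N; have E1 : phi k = (m + e)%N by rewrite subnKC.
  have E2 : j%:R * mesh m = (j * 2 ^ e)%N%:R * mesh (phi k).
    by rewrite E1 natrM -mulrA -meshD.
  rewrite -/(itg _ _ _) E2 itg_slope //.
  have -> : (4 ^ phi k = 2 ^ phi k * 2 ^ phi k)%N by rewrite -expnMn.
  apply: leq_mul; last by rewrite leq_exp2l // /e leq_subr.
  apply: leq_trans jp _; exact/ltnW/ltn_expl.
move=> x x0; have [->|xn0] := eqVneq x 0; first by rewrite itgxx addr0.
have {}x0 : 0 < x by rewrite lt_neqAle eq_sym xn0.
have xx1 : 0 < x + 1 by lra.
pose D y := f y - (f 0 + itg 0 y v).
have cD : {for x, continuous D}.
  have [iv _] := key (x + 1).
  have /(continuous_within_itvP _ xx1)[ci _ _] :=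
     parameterized_integral_continuous (ltW xx1) iv.
  apply: cvgB; first exact: fc.
  apply: cvgD; first exact: cvg_cst.
  by apply: ci; rewrite in_itv /= x0 ltrDl ltr01.
have cx : (tr n x)%:R * mesh n @[n --> \oo] --> x.
  apply/cvgrPdist_lt => e e0; have [n0 Hn] := mesh_small e0.
  exists n0 => // n /= n0n; have := trP n (ltW x0); rewrite succ_mesh => /andP[a b].
  rewrite ger0_norm ?subr_ge0 //; have := Hn n n0n; lra.
have : D ((tr n x)%:R * mesh n) @[n --> \oo] --> D x by apply: continuous_cvg.
have -> : (fun n => D ((tr n x)%:R * mesh n)) = (fun=> 0).
  by apply/funext => n; rewrite /D dya subrr.
move=> H; have D0 : D x = 0 by apply: (cvg_unique _ H) => //; exact: cvg_cst.
by apply/eqP; rewrite -subr_eq0; apply/eqP.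
Qed.

End WeakDerivativeExistence.

(** * Explicit Euler steps for a Schroedinger flow on a weighted graph *)

Section Lattice.
Context {R : realType} {V E : finType}.
Variables (m : V -> R) (c : E -> R) (src tgt : E -> V) (F G : R -> R).
Hypothesis m_gt0 : forall x, 0 < m x.
Hypothesis c_ge0 : forall e, 0 <= c e.
Hypothesis F_bounded : forall S, exists2 K, 0 <= K &
  forall s, 0 <= s <= S -> `|F s| <= K.
Hypothesis G_taylor : forall S, exists2 L, 0 <= L &
  forall s s', 0 <= s <= S -> 0 <= s' <= S ->
    `|G s' - G s - F s * (s' - s)| <= L * (s' - s) ^+ 2.

Implicit Types (f g phi psi : V -> R) (u w : bool -> V -> R) (b : bool).

Definition jump f e : R := f (tgt e) - f (src e).

Definition dform f g : R := \sum_e c e * (jump f e * jump g e).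

Definition lap f x : R :=
  (m x)^-1 * \sum_e c e * (jump f e * ((src e == x)%:R - (tgt e == x)%:R)).

Definition inner f g : R := \sum_x m x * (f x * g x).

Definition sgb b : R := if b then 1 else -1.

Definition sqnorm u x : R := u true x ^+ 2 + u false x ^+ 2.

(** The right-hand side of the flow i u' = - lap u + F(|u|^2) u solved for u', with real part at
    [true] and imaginary part at [false]: the factor -i exchanges the two components. *)
Definition field u b x : R :=
  sgb b * (- lap (u (~~ b)) x + F (sqnorm u x) * u (~~ b) x).

Definition euler_step (tau : R) u b x : R := u b x + tau * field u b x.

Definition euler tau u n := iter n (euler_step tau) u.

Definition wmass phi u : R := \sum_x m x * (phi x * sqnorm u x).

Definition mass u : R := \sum_x m x * sqnorm u x.

Definition dirichlet u : R := dform (u true) (u true) + dform (u false) (u false).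

(** Twice the usual Hamiltonian: [G] stands for the primitive of [F] in the variable |u|^2, and no
    factor 1/2 appears. *)
Definition energy u : R := dirichlet u + \sum_x m x * G (sqnorm u x).

Lemma pick_sum f x : \sum_y (x == y)%:R * f y = f x.
Proof.
rewrite (bigD1 x) //= eqxx mul1r big1 ?addr0 // => y yx.
by rewrite eq_sym (negbTE yx) mul0r.
Qed.

Lemma lap_ibp f g : inner (lap f) g = - dform f g.
Proof.
rewrite /inner /dform.
have -> : \sum_x m x * (lap f x * g x) =
    \sum_x \sum_e c e * (jump f e * ((src e == x)%:R * g x - (tgt e == x)%:R * g x)).
  apply: eq_bigr => x _; rewrite /lap mulrA mulrA divff ?gt_eqF // mul1r mulr_suml.
  by apply: eq_bigr => e _; ring.
rewrite exchange_big /= -sumrN; apply: eq_bigr => e _.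
by rewrite -!mulr_sumr sumrB !pick_sum /jump; ring.
Qed.

Lemma dform_ge0 f : 0 <= dform f f.
Proof. by apply: sumr_ge0 => e _; rewrite mulr_ge0 // -expr2 sqr_ge0. Qed.

Lemma dirichlet_ge0 u : 0 <= dirichlet u.
Proof. by rewrite addr_ge0 // dform_ge0. Qed.

Lemma sqnorm_ge0 u x : 0 <= sqnorm u x.
Proof. by rewrite addr_ge0 // sqr_ge0. Qed.

Lemma mass_ge0 u : 0 <= mass u.
Proof. by apply: sumr_ge0 => x _; rewrite mulr_ge0 ?sqnorm_ge0 // ltW. Qed.

(** The nonlinear terms cancel at each node because [F] is real. Summation by parts leaves the
    current through each edge, weighted by the jump of [phi]; the left side is half the rate of
    change of [wmass phi] along the flow. *)
Lemma wmass_rate phi u :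
  \sum_x m x * (phi x * (u true x * field u true x + u false x * field u false x)) =
  \sum_e c e * ((phi (tgt e) - phi (src e)) *
    (u true (src e) * u false (tgt e) - u false (src e) * u true (tgt e))).
Proof.
have -> : \sum_x m x * (phi x * (u true x * field u true x + u false x * field u false x)) =
  inner (lap (u true)) (fun x => phi x * u false x) -
  inner (lap (u false)) (fun x => phi x * u true x).
  rewrite /inner -sumrB; apply: eq_bigr => x _; rewrite /field /sgb /=; ring.
rewrite !lap_ibp /dform opprK addrC -sumrB; apply: eq_bigr => e _.
by rewrite /jump; ring.
Qed.

Lemma wmass_step tau phi u : wmass phi (euler_step tau u) = wmass phi u +
  2 * tau * (\sum_e c e * ((phi (tgt e) - phi (src e)) *
    (u true (src e) * u false (tgt e) - u false (src e) * u true (tgt e)))) +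
  tau ^+ 2 * wmass phi (field u).
Proof.
rewrite -wmass_rate /wmass !mulr_sumr -!big_split /=; apply: eq_bigr => x _.
by rewrite /sqnorm /euler_step; ring.
Qed.

Lemma massE u : mass u = wmass (fun=> 1) u.
Proof. by apply: eq_bigr => x _; rewrite mul1r. Qed.

Lemma mass_step tau u :
  mass (euler_step tau u) = mass u + tau ^+ 2 * mass (field u).
Proof.
rewrite !massE wmass_step big1 ?mulr0 ?addr0 // => e _.
by rewrite subrr mul0r mulr0.
Qed.

Lemma dformD f g (tau : R) : dform (fun x => f x + tau * g x) (fun x => f x + tau * g x) =
  dform f f + 2 * tau * dform f g + tau ^+ 2 * dform g g.
Proof.
rewrite /dform !mulr_sumr -!big_split /=; apply: eq_bigr => e _.
by rewrite /jump; ring.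
Qed.

(** The field is -i times the gradient of the Hamiltonian, hence orthogonal to that gradient: the
    terms of first order in the step vanish. *)
Lemma energy_rate u : dform (u true) (field u true) + dform (u false) (field u false) +
  \sum_x m x * (F (sqnorm u x) * (u true x * field u true x + u false x * field u false x)) = 0.
Proof.
have H b : dform (u b) (field u b) = - inner (lap (u b)) (field u b).
  by rewrite lap_ibp opprK.
rewrite !H /inner -opprD -big_split /= addrC -sumrB big1 // => x _.
by rewrite /field /sgb /=; ring.
Qed.

Lemma energy_step tau u :
  energy (euler_step tau u) = energy u + tau ^+ 2 * dirichlet (field u) +
   \sum_x m x * (G (sqnorm (euler_step tau u) x) - G (sqnorm u x) -
      F (sqnorm u x) * (sqnorm (euler_step tau u) x - sqnorm u x)) +
   tau ^+ 2 * \sum_x m x * (F (sqnorm u x) * sqnorm (field u) x).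
Proof.
have Z := energy_rate u.
have E1 : dirichlet (euler_step tau u) = dirichlet u +
   2 * tau * (dform (u true) (field u true) + dform (u false) (field u false)) +
   tau ^+ 2 * dirichlet (field u).
  rewrite /dirichlet !(dformD (u _) (field u _)); ring.
have {}Z : dform (u true) (field u true) + dform (u false) (field u false) =
  - \sum_x m x * (F (sqnorm u x) * (u true x * field u true x + u false x * field u false x)).
  by apply/eqP; rewrite -addr_eq0; apply/eqP.
have HS : \sum_x m x * G (sqnorm (euler_step tau u) x) = \sum_x m x * G (sqnorm u x) +
   \sum_x m x * (G (sqnorm (euler_step tau u) x) - G (sqnorm u x) -
      F (sqnorm u x) * (sqnorm (euler_step tau u) x - sqnorm u x)) +
   2 * tau * (\sum_x m x * (F (sqnorm u x) *
      (u true x * field u true x + u false x * field u false x))) +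
   tau ^+ 2 * \sum_x m x * (F (sqnorm u x) * sqnorm (field u) x).
  rewrite !mulr_sumr -!big_split /=; apply: eq_bigr => x _.
  by rewrite /sqnorm /euler_step; ring.
by rewrite /energy E1 Z HS; ring.
Qed.

Lemma sqnorm_le_mass : exists2 A, 0 <= A &
  forall u x, sqnorm u x <= A * mass u.
Proof.
exists (\sum_x (m x)^-1); first by apply: sumr_ge0 => x _; rewrite invr_ge0 ltW.
move=> u x.
have H1 : sqnorm u x <= (m x)^-1 * mass u.
  rewrite -(ler_pM2l (m_gt0 x)) mulrA divff ?gt_eqF // mul1r /mass (bigD1 x) //= lerDl.
  by apply: sumr_ge0 => y _; rewrite mulr_ge0 ?sqnorm_ge0 // ltW.
apply: le_trans H1 _; rewrite ler_wpM2r ?mass_ge0 // (bigD1 x) //= lerDl.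
by apply: sumr_ge0 => y _; rewrite invr_ge0 ltW.
Qed.

Lemma abs_le_sqnorm u x (S : R) b : sqnorm u x <= S -> `|u b x| <= 1 + S.
Proof.
move=> H; have H1 : u b x ^+ 2 <= S.
  by apply: le_trans H; case: b; rewrite ?lerDl ?lerDr sqr_ge0.
rewrite -(real_normK (num_real _)) in H1; have := sqr_ge0 (`|u b x| - 1); nra.
Qed.

Lemma field_bounded (M : R) : exists2 K, 0 <= K &
  forall u, mass u <= M -> forall b x, `|field u b x| <= K.
Proof.
have [A A0 HA] := sqnorm_le_mass.
have [KF KF0 HKF] := F_bounded (A * M).
pose a := 1 + A * M; pose Lm := \sum_x (m x)^-1 * \sum_e c e * (2 * 2).
have Lm0 : 0 <= Lm.
  apply: sumr_ge0 => x _; rewrite mulr_ge0 ?invr_ge0 ?(ltW (m_gt0 x)) //.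
  by apply: sumr_ge0 => e _; rewrite mulr_ge0 // mulr_ge0.
have [M0|Mn] := leP 0 M; last first.
  by exists 0 => // u uM; have := le_lt_trans uM Mn; rewrite ltNge mass_ge0.
have a0 : 0 <= a by rewrite /a; have := mulr_ge0 A0 M0; lra.
exists (Lm * a + KF * a); first by rewrite addr_ge0 // mulr_ge0.
move=> u uM b x.
have sM y : sqnorm u y <= A * M by apply: le_trans (HA u y) _; rewrite ler_wpM2l.
have ub b' y : `|u b' y| <= a by exact: abs_le_sqnorm.
have lapb b' : `|lap (u b') x| <= Lm * a.
  rewrite /lap normrM ger0_norm ?invr_ge0 ?(ltW (m_gt0 x)) //.
  rewrite /Lm (bigD1 x) //= mulrDl -mulrA.
  apply: (@le_trans _ _ ((m x)^-1 * ((\sum_e c e * (2 * 2)) * a))); last first.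
    rewrite lerDl mulr_ge0 //; apply: sumr_ge0 => y _.
    rewrite mulr_ge0 ?invr_ge0 ?(ltW (m_gt0 y)) //.
    by apply: sumr_ge0 => e _; rewrite mulr_ge0 // mulr_ge0.
  rewrite ler_wpM2l ?invr_ge0 ?(ltW (m_gt0 x)) // mulr_suml.
  apply: le_trans (ler_norm_sum _ _ _) _; apply: ler_sum => e _.
  rewrite normrM ger0_norm // -mulrA ler_wpM2l // normrM.
  have -> : 2 * 2 * a = 2 * a * 2 by ring.
  apply: ler_pM => //.
    rewrite /jump; apply: le_trans (ler_normB _ _) _.
    by have := ub b' (tgt e); have := ub b' (src e); lra.
  apply: le_trans (ler_normB _ _) _.
  by do 2 case: (_ == _); rewrite ?normr0 ?normr1; lra.
rewrite /field normrM.
have -> : `|sgb b| = 1 by case: b; rewrite /sgb ?normrN normr1.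
rewrite mul1r; apply: le_trans (ler_normD _ _) _; rewrite normrN [`|F _ * _|]normrM.
apply: lerD; first exact: lapb.
by apply: ler_pM => //; apply: HKF; rewrite sqnorm_ge0 sM.
Qed.

(** On a finite graph the mass controls every node value, hence the field and all second-order
    terms. The constant [K] may explode when the grid is refined; this is harmless, as it only
    serves to choose the time step of that grid. *)
Lemma step_bounds (M : R) psi : (forall x, 0 <= psi x) -> exists2 K, 0 <= K &
  forall tau u, 0 < tau <= 1 -> mass u <= M ->
    [/\ mass (euler_step tau u) <= mass u + tau ^+ 2 * K,
        energy (euler_step tau u) <= energy u + tau ^+ 2 * K &
        wmass psi (field u) <= K].
Proof.
move=> psi0; have [A A0 HA] := sqnorm_le_mass.
have [M0|Mn] := leP 0 M; last first.
  by exists 0 => // tau u _ uM; have := le_lt_trans uM Mn; rewrite ltNge mass_ge0.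
have [K K0 HK] := field_bounded M.
pose a := 1 + A * M; pose S := A * M.
have S0 : 0 <= S by exact: mulr_ge0.
have a0 : 0 <= a by rewrite /a -/S; lra.
have [KF KF0 HKF] := F_bounded S.
pose K3 := 4 * a * K + 2 * K ^+ 2.
have K30 : 0 <= K3 by rewrite addr_ge0 // ?mulr_ge0 // sqr_ge0.
have [L L0 HL] := G_taylor (S + K3).
pose m1 := \sum_x m x.
have m10 : 0 <= m1 by apply: sumr_ge0 => x _; exact: ltW.
pose C1 := m1 * (2 * K ^+ 2).
pose C2 := 2 * \sum_e c e * (2 * K * (2 * K)).
pose C3 := m1 * (L * K3 ^+ 2).
pose C4 := m1 * (KF * (2 * K ^+ 2)).
pose C5 := \sum_x m x * (psi x * (2 * K ^+ 2)).
have KK : 0 <= 2 * K ^+ 2 by rewrite mulr_ge0 // sqr_ge0.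
have C10 : 0 <= C1 by rewrite mulr_ge0.
have C20 : 0 <= C2.
  by rewrite mulr_ge0 // sumr_ge0 // => e _; rewrite mulr_ge0 // mulr_ge0 // mulr_ge0.
have C30 : 0 <= C3 by rewrite mulr_ge0 // mulr_ge0 // sqr_ge0.
have C40 : 0 <= C4 by rewrite mulr_ge0 // mulr_ge0.
have C50 : 0 <= C5.
  by apply: sumr_ge0 => x _; rewrite mulr_ge0 ?(ltW (m_gt0 x)) // mulr_ge0.
exists (C1 + C2 + C3 + C4 + C5); first by rewrite !addr_ge0.
move=> tau u /andP[tau0 tau1] uM.
have t20 : 0 <= tau ^+ 2 by exact: sqr_ge0.
have sM y : sqnorm u y <= S by apply: le_trans (HA u y) _; rewrite ler_wpM2l.
have ub b' y : `|u b' y| <= a by exact: abs_le_sqnorm.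
have fb b' y : `|field u b' y| <= K by exact: HK.
have f2 b' y : field u b' y ^+ 2 <= K ^+ 2.
  by rewrite -(real_normK (num_real (field u b' y))) ler_pXn2r ?nnegrE.
have sf y : sqnorm (field u) y <= 2 * K ^+ 2.
  by rewrite /sqnorm; have := f2 true y; have := f2 false y; lra.
have ds y : `|sqnorm (euler_step tau u) y - sqnorm u y| <= tau * K3.
  have -> : sqnorm (euler_step tau u) y - sqnorm u y =
    tau * (2 * (u true y * field u true y + u false y * field u false y) +
       tau * sqnorm (field u) y).
    by rewrite /sqnorm /euler_step; ring.
  rewrite normrM gtr0_norm // ler_wpM2l ?(ltW tau0) // /K3.
  apply: le_trans (ler_normD _ _) _; apply: lerD.
    rewrite normrM ger0_norm //.
    have -> : 4 * a * K = 2 * (a * K + a * K) by ring.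
    rewrite ler_wpM2l //; apply: le_trans (ler_normD _ _) _.
    by apply: lerD; rewrite normrM; apply: ler_pM.
  rewrite normrM gtr0_norm // ger0_norm ?sqnorm_ge0 //.
  by rewrite -[leRHS]mul1r; apply: ler_pM => //; [exact: ltW|exact: sqnorm_ge0].
have H1 : mass (field u) <= C1.
  rewrite /mass /C1 /m1 mulr_suml; apply: ler_sum => x _.
  by rewrite ler_wpM2l // ltW.
split.
- rewrite mass_step lerD2l ler_wpM2l //; lra.
- rewrite energy_step.
  have H2 : dirichlet (field u) <= C2.
    rewrite /dirichlet /C2 mulr2n mulrDl mul1r.
    have H b' : dform (field u b') (field u b') <= \sum_e c e * (2 * K * (2 * K)).
      apply: ler_sum => e _; rewrite ler_wpM2l // -!expr2 /jump.
      rewrite -(real_normK (num_real (_ - _))) ler_pXn2r ?nnegrE ?mulr_ge0 //.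
      apply: le_trans (ler_normB _ _) _.
      by have := fb b' (tgt e); have := fb b' (src e); lra.
    by apply: lerD.
  have H3 : \sum_x m x * (G (sqnorm (euler_step tau u) x) - G (sqnorm u x) -
      F (sqnorm u x) * (sqnorm (euler_step tau u) x - sqnorm u x)) <= tau ^+ 2 * C3.
    rewrite /C3 mulrCA /m1 mulr_suml; apply: ler_sum => x _.
    rewrite ler_wpM2l ?(ltW (m_gt0 x)) //.
    apply: le_trans (ler_norm _) _.
    apply: le_trans (HL _ _ _ _) _.
    + by rewrite sqnorm_ge0; have := sM x; lra.
    + rewrite sqnorm_ge0 /=; have := ds x; have := sM x.
      have : tau * K3 <= K3 by rewrite ler_piMl.
      by rewrite ler_norml => ? ? /andP[_ ?]; lra.
    have -> : tau ^+ 2 * (L * K3 ^+ 2) = L * (tau * K3) ^+ 2 by ring.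
    rewrite ler_wpM2l // -(real_normK (num_real (_ - _))).
    by rewrite ler_pXn2r ?nnegrE ?mulr_ge0 ?(ltW tau0).
  have H4 : \sum_x m x * (F (sqnorm u x) * sqnorm (field u) x) <= C4.
    rewrite /C4 /m1 mulr_suml; apply: ler_sum => x _.
    rewrite ler_wpM2l ?(ltW (m_gt0 x)) //.
    apply: (@le_trans _ _ (`|F (sqnorm u x)| * sqnorm (field u) x)).
      by rewrite ler_wpM2r ?sqnorm_ge0 // ler_norm.
    apply: ler_pM; rewrite ?sqnorm_ge0 //; apply: HKF.
    by rewrite sqnorm_ge0 sM.
  have := ler_wpM2l t20 H2; have := ler_wpM2l t20 H4.
  have := mulr_ge0 t20 C10; have := mulr_ge0 t20 C50; lra.
- apply: (@le_trans _ _ C5); last by lra.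
  apply: ler_sum => x _; rewrite ler_wpM2l ?(ltW (m_gt0 x)) // ler_wpM2l //.
Qed.

(** The discrete version of bounding the current of psi^2 |u|^2 by |u'| times psi |u|, with a free
    Young parameter [lam]. The second hypothesis says that [psi] has slope at most 1; it is asked
    only where [psi] is nonzero, which exempts the vertex of the star, where many edges meet. *)
Lemma virial_rate psi u (lam : R) : 0 < lam ->
  (forall x, psi x != 0 -> \sum_e c e * (jump psi e ^+ 2 *
     ((src e == x)%:R + (tgt e == x)%:R)) <= 2 * m x) ->
  \sum_e c e * ((psi (tgt e) ^+ 2 - psi (src e) ^+ 2) *
    (u true (src e) * u false (tgt e) - u false (src e) * u true (tgt e))) <=
  lam / 2 * dirichlet u + 2 / lam * wmass (fun x => psi x ^+ 2) u.
Proof.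
move=> lam0 W.
have H1 : \sum_e c e * ((psi (tgt e) ^+ 2 - psi (src e) ^+ 2) *
    (u true (src e) * u false (tgt e) - u false (src e) * u true (tgt e))) <=
  lam / 2 * dirichlet u + lam^-1 * \sum_e c e * (jump psi e ^+ 2 *
    (psi (src e) ^+ 2 * sqnorm u (src e) + psi (tgt e) ^+ 2 * sqnorm u (tgt e))).
  rewrite /dirichlet /dform -big_split /= !mulr_sumr -big_split /=.
  apply: ler_sum => e _; rewrite -mulrDr [lam / 2 * _]mulrCA [X in _ <= _ + X]mulrCA.
  rewrite -[X in _ <= X]mulrDr ler_wpM2l // /jump /sqnorm.
  set a := psi (src e); set a' := psi (tgt e).
  set p := u true (src e); set p' := u true (tgt e).
  set q := u false (src e); set q' := u false (tgt e).
  rewrite -subr_ge0.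
  (* Completing the square in each of the two jumps leaves a third square, so the gap is visibly
     nonnegative. *)
  have -> : lam / 2 * ((p' - p) * (p' - p) + (q' - q) * (q' - q)) +
     lam^-1 * ((a' - a) ^+ 2 * (a ^+ 2 * (p ^+ 2 + q ^+ 2) + a' ^+ 2 * (p' ^+ 2 + q' ^+ 2))) -
     (a' ^+ 2 - a ^+ 2) * (p * q' - q * p') =
    (lam / 2) * ((p' - p + lam^-1 * (a' - a) * (a * q + a' * q')) ^+ 2 +
                 (q' - q - lam^-1 * (a' - a) * (a * p + a' * p')) ^+ 2) +
    (lam^-1 / 2) * (a' - a) ^+ 2 * ((a * p - a' * p') ^+ 2 + (a * q - a' * q') ^+ 2).
    by field; rewrite gt_eqF.
  have l1 : 0 <= lam / 2 by rewrite divr_ge0 // ltW.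
  have l2 : 0 <= lam^-1 / 2 by rewrite divr_ge0 // invr_ge0 ltW.
  by rewrite addr_ge0 // mulr_ge0 ?addr_ge0 ?sqr_ge0 // mulr_ge0 ?sqr_ge0.
apply: le_trans H1 _; rewrite lerD2l [2 / lam]mulrC -mulrA ler_wpM2l ?invr_ge0 ?(ltW lam0) //.
have -> : \sum_e c e * (jump psi e ^+ 2 *
    (psi (src e) ^+ 2 * sqnorm u (src e) + psi (tgt e) ^+ 2 * sqnorm u (tgt e))) =
  \sum_x (psi x ^+ 2 * sqnorm u x) * \sum_e c e * (jump psi e ^+ 2 *
     ((src e == x)%:R + (tgt e == x)%:R)).
  under [RHS]eq_bigr do rewrite mulr_sumr.
  rewrite exchange_big /=; apply: eq_bigr => e _.
  have -> : \sum_x psi x ^+ 2 * sqnorm u x *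
      (c e * (jump psi e ^+ 2 * ((src e == x)%:R + (tgt e == x)%:R))) =
    c e * jump psi e ^+ 2 * (\sum_x (src e == x)%:R * (psi x ^+ 2 * sqnorm u x) +
       \sum_x (tgt e == x)%:R * (psi x ^+ 2 * sqnorm u x)).
    by rewrite -big_split mulr_sumr /=; apply: eq_bigr => x _; ring.
  by rewrite !(pick_sum (fun x => psi x ^+ 2 * sqnorm u x)) mulrA.
rewrite /wmass mulr_sumr; apply: ler_sum => x _.
have [->|px] := eqVneq (psi x) 0; first by rewrite expr0n /= !mul0r !mulr0.
have := W x px.
have : 0 <= psi x ^+ 2 * sqnorm u x by rewrite mulr_ge0 ?sqr_ge0 ?sqnorm_ge0.
set z := psi x ^+ 2 * _ => z0 Wx.
have -> : 2 * (m x * z) = z * (2 * m x) by ring.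
by rewrite ler_wpM2l.
Qed.

(** The three bounds are propagated together: mass and energy give the Dirichlet bound and the step
    constants, and the Dirichlet bound limits the growth of the weighted norm. In the rate
    [2 * B0 + 1] the part [2 * B0] belongs to the flow and the 1 pays for the Euler error. *)
Lemma euler_bounds u0 (T eta B0 A : R) psi : 0 <= T -> 0 < eta -> 0 < B0 -> 0 < A ->
  (forall x, 0 <= psi x) ->
  (forall x, psi x != 0 -> \sum_e c e * (jump psi e ^+ 2 *
     ((src e == x)%:R + (tgt e == x)%:R)) <= 2 * m x) ->
  wmass (fun x => psi x ^+ 2) u0 <= A ^+ 2 ->
  (forall u, mass u <= mass u0 + eta -> energy u <= energy u0 + eta ->
     dirichlet u <= B0 ^+ 2) ->
  exists2 tau0, 0 < tau0 & forall tau n, 0 < tau <= tau0 -> n%:R * tau <= T ->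
    [/\ mass (euler tau u0 n) <= mass u0 + eta,
        energy (euler tau u0 n) <= energy u0 + eta &
        wmass (fun x => psi x ^+ 2) (euler tau u0 n) <=
          (A + (2 * B0 + 1) * (n%:R * tau)) ^+ 2].
Proof.
move=> T0 eta0 B00 A0 psi0 W hA hD.
have psi2 x : 0 <= psi x ^+ 2 by exact: sqr_ge0.
have [K K0 HK] := step_bounds (mass u0 + eta) psi2.
have TK : 0 < T * K + 1 by have := mulr_ge0 T0 K0; lra.
have K1 : 0 < K + 1 by lra.
exists (Num.min 1 (Num.min (eta / (T * K + 1)) (2 * A / (K + 1)))).
  by rewrite !lt_min ltr01 !divr_gt0 // mulr_gt0.
move=> tau n /andP[tau0]; rewrite !le_min => /and3P[tau1 tau2 tau3] nT.
have tK : tau * (T * K + 1) <= eta by rewrite -ler_pdivlMr.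
have tA : tau * (K + 1) <= 2 * A by rewrite -ler_pdivlMr.
have tT j : (j <= n)%N -> j%:R * tau <= T.
  by move=> jn; apply: le_trans nT; rewrite ler_pM2r // ler_nat.
have jt0 j : 0 <= j%:R * tau by rewrite mulr_ge0 // ltW.
have small j : (j <= n)%N -> j%:R * tau * (tau * K) <= eta.
  move=> jn; apply: (@le_trans _ _ (T * (tau * K))).
    by rewrite ler_wpM2r ?tT // mulr_ge0 // ltW.
  by apply: le_trans tK; rewrite mulrDr mulr1 mulrCA lerDl ltW.
have t01 : 0 < tau <= 1 by rewrite tau0.
suff H j : (j <= n)%N ->
    [/\ mass (euler tau u0 j) <= mass u0 + j%:R * tau * (tau * K),
        energy (euler tau u0 j) <= energy u0 + j%:R * tau * (tau * K) &
        wmass (fun x => psi x ^+ 2) (euler tau u0 j) <=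
          (A + (2 * B0 + 1) * (j%:R * tau)) ^+ 2].
  have [H1 H2 H3] := H n (leqnn _); have Hs := small n (leqnn _).
  by split=> //; [apply: le_trans H1 _|apply: le_trans H2 _]; rewrite lerD2l.
elim: j => [_|j IH jn]; first by rewrite !mul0r mulr0 !addr0; split.
have [H1 H2 H3] := IH (ltnW jn); have Hs := small j (ltnW jn).
rewrite /euler iterS -/(euler _ _ _); set uj := euler tau u0 j in H1 H2 H3 *.
have Hm : mass uj <= mass u0 + eta by apply: le_trans H1 _; rewrite lerD2l.
have He : energy uj <= energy u0 + eta by apply: le_trans H2 _; rewrite lerD2l.
have HD := hD uj Hm He.
have [S1 S2 S3] := HK tau uj t01 Hm.
have jS : j.+1%:R * tau * (tau * K) = j%:R * tau * (tau * K) + tau ^+ 2 * K.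
  by rewrite -natr1; ring.
split.
- by apply: le_trans S1 _; rewrite jS addrA lerD2r.
- by apply: le_trans S2 _; rewrite jS addrA lerD2r.
rewrite wmass_step.
set S := A + (2 * B0 + 1) * (j%:R * tau) in H3.
have SA : A <= S by rewrite lerDl mulr_ge0 //; lra.
have S0 : 0 < S by exact: lt_le_trans SA.
(* [S] bounds the current weighted norm. This value of the Young parameter equalises the two terms
   of the virial bound, each becoming [S * B0]. *)
have lam0 : 0 < 2 * S / B0 by rewrite divr_gt0 // mulr_gt0.
have HV := virial_rate uj lam0 W.
have HV2 : 2 * S / B0 / 2 * dirichlet uj + 2 / (2 * S / B0) * wmass (fun x => psi x ^+ 2) uj
    <= 2 * S * B0.
  have -> : 2 * S * B0 = 2 * S / B0 / 2 * B0 ^+ 2 + 2 / (2 * S / B0) * S ^+ 2.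
    by field; rewrite !gt_eqF.
  apply: lerD; rewrite ler_wpM2l // divr_ge0 ?(ltW lam0) //.
have {}HV := le_trans HV HV2.
have -> : A + (2 * B0 + 1) * (j.+1%:R * tau) = S + (2 * B0 + 1) * tau.
  by rewrite /S -natr1; ring.
have X1 : 2 * tau * (\sum_e c e * ((psi (tgt e) ^+ 2 - psi (src e) ^+ 2) *
   (uj true (src e) * uj false (tgt e) - uj false (src e) * uj true (tgt e)))) <=
   2 * tau * (2 * S * B0) by rewrite ler_wpM2l // mulr_ge0 // ltW.
have X2 : tau ^+ 2 * wmass (fun x => psi x ^+ 2) (field uj) <= tau ^+ 2 * K.
  by rewrite ler_wpM2l // sqr_ge0.
have X3 : tau * (tau * K) <= tau * (2 * S).
  by rewrite ler_pM2l //; apply: le_trans (le_trans tA _); lra.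
have X4 : 0 <= ((2 * B0 + 1) * tau) ^+ 2 by exact: sqr_ge0.
rewrite sqrrD -mulr_natl; move: X1 X2 X3 X4 H3; rewrite !expr2; lra.
Qed.

Lemma euler_sum tau u0 n d b x : euler tau u0 (n + d) b x =
  euler tau u0 n b x + \sum_(i < d) tau * field (euler tau u0 (n + i)) b x.
Proof.
elim: d => [|d IH]; first by rewrite addn0 big_ord0 addr0.
by rewrite addnS big_ord_recr /= addrA -IH.
Qed.

Lemma lap_sum (I : Type) (s : seq I) (tau : R) (f : I -> V -> R) x :
  lap (fun y => \sum_(i <- s) tau * f i y) x = \sum_(i <- s) tau * lap (f i) x.
Proof.
elim: s => [|i s IH].
  rewrite big_nil /lap big1 ?mulr0 // => e _.
  by rewrite /jump !big_nil subrr mul0r mulr0.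
have key : \sum_e c e * (jump (fun y => \sum_(k <- i :: s) tau * f k y) e *
      ((src e == x)%:R - (tgt e == x)%:R)) =
    tau * (\sum_e c e * (jump (f i) e * ((src e == x)%:R - (tgt e == x)%:R))) +
    \sum_e c e * (jump (fun y => \sum_(k <- s) tau * f k y) e *
      ((src e == x)%:R - (tgt e == x)%:R)).
  rewrite mulr_sumr -big_split /=; apply: eq_bigr => e _.
  by rewrite /jump !big_cons; ring.
by rewrite big_cons -IH /lap key; ring.
Qed.

(** Summed over time, the scheme says that the Laplacian of the accumulated solution equals a source
    free of space derivatives. This is the form whose limit is the integrated equation. *)
Lemma euler_equation tau u0 n b x :
  lap (fun y => \sum_(i < n) tau * euler tau u0 i b y) x =
  \sum_(i < n) tau * (F (sqnorm (euler tau u0 i) x) * euler tau u0 i b x) +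
  sgb b * (euler tau u0 n (~~ b) x - u0 (~~ b) x).
Proof.
have := euler_sum tau u0 0 n (~~ b) x; rewrite add0n /= => ->.
rewrite lap_sum [u0 _ _ + _]addrC addrK mulr_sumr -big_split /=.
apply: eq_bigr => i _; rewrite add0n /field negbK.
by case: b; rewrite /sgb /=; ring.
Qed.

(** Tested against [w], the Laplacian costs only Dirichlet forms of [u] and [w]. The bound therefore
    stays uniform in the mesh, which a bound on the field itself would not. *)
Lemma inner_field_le u w (KF : R) : 0 <= KF -> (forall x, `|F (sqnorm u x)| <= KF) ->
  \sum_x m x * (field u true x * w true x + field u false x * w false x) <=
  (dirichlet u + dirichlet w) / 2 + KF * ((mass u + mass w) / 2).
Proof.
move=> KF0 HF.
have E1 : \sum_x m x * (field u true x * w true x + field u false x * w false x) =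
  dform (u false) (w true) - dform (u true) (w false) +
  \sum_x m x * (F (sqnorm u x) * (u false x * w true x - u true x * w false x)).
  have H b f : dform (u b) f = - inner (lap (u b)) f by rewrite lap_ibp opprK.
  rewrite !H opprK addrC /inner addrA -sumrN -!big_split /=.
  by apply: eq_bigr => x _; rewrite /field /sgb /=; ring.
rewrite E1; apply: lerD.
  rewrite /dirichlet /dform -sumrB -!big_split /= mulr_suml.
  apply: ler_sum => e _; rewrite -mulrBr -!mulrDr -mulrA ler_wpM2l //.
  set a := jump (u true) e; set b := jump (u false) e.
  set a' := jump (w true) e; set b' := jump (w false) e.
  rewrite -subr_ge0.
  have -> : (a * a + b * b + (a' * a' + b' * b')) / 2 - (b * a' - a * b') =
    ((b - a') ^+ 2 + (a + b') ^+ 2) / 2 by field.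
  by rewrite divr_ge0 // addr_ge0 ?sqr_ge0.
rewrite /mass -big_split /= mulr_suml mulr_sumr; apply: ler_sum => x _.
have -> : KF * ((m x * sqnorm u x + m x * sqnorm w x) / 2) =
   m x * (KF * ((sqnorm u x + sqnorm w x) / 2)) by ring.
rewrite ler_wpM2l ?(ltW (m_gt0 x)) //.
set p := u true x; set q := u false x; set p' := w true x; set q' := w false x.
have H : `|q * p' - p * q'| <= (sqnorm u x + sqnorm w x) / 2.
  rewrite /sqnorm -/p -/q -/p' -/q' ler_norml; apply/andP; split; rewrite -subr_ge0.
    have -> : q * p' - p * q' - - ((p ^+ 2 + q ^+ 2 + (p' ^+ 2 + q' ^+ 2)) / 2) =
      ((q + p') ^+ 2 + (p - q') ^+ 2) / 2 by field.
    by rewrite divr_ge0 // addr_ge0 ?sqr_ge0.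
  have -> : (p ^+ 2 + q ^+ 2 + (p' ^+ 2 + q' ^+ 2)) / 2 - (q * p' - p * q') =
      ((q - p') ^+ 2 + (p + q') ^+ 2) / 2 by field.
  by rewrite divr_ge0 // addr_ge0 ?sqr_ge0.
apply: le_trans (ler_norm _) _; rewrite normrM.
by apply: ler_pM.
Qed.

Lemma dirichletB u w : dirichlet (fun b x => u b x - w b x) <= 2 * (dirichlet u + dirichlet w).
Proof.
rewrite /dirichlet /dform -!big_split /= mulr_sumr; apply: ler_sum => e _.
rewrite -!mulrDr mulrCA ler_wpM2l // /jump -subr_ge0.
set a := u true _; set a' := u true _; set b := u false _; set b' := u false _.
set d := w true _; set d' := w true _; set k := w false _; set k' := w false _.
have := sqr_ge0 (a - a' + (d - d')); have := sqr_ge0 (b - b' + (k - k')).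
rewrite !expr2; lra.
Qed.

Lemma massB u w : mass (fun b x => u b x - w b x) <= 2 * (mass u + mass w).
Proof.
rewrite /mass -big_split /= mulr_sumr; apply: ler_sum => x _.
rewrite -mulrDr mulrCA ler_wpM2l ?(ltW (m_gt0 x)) // /sqnorm.
have := sqr_ge0 (u true x + w true x); have := sqr_ge0 (u false x + w false x); nra.
Qed.

(** The squared norm of the increment [w] is the sum over the steps of [tau] times the pairing of
    the field with [w], and each pairing is bounded in the energy space. Dirichlet form and mass of
    [w] are at most four times the bounds for the states, whence (1 + 4) / 2. *)
Lemma euler_holder tau u0 n d (D0 M KF : R) : 0 < tau -> 0 <= KF ->
  (forall i, (i <= n + d)%N -> [/\ dirichlet (euler tau u0 i) <= D0,
     mass (euler tau u0 i) <= M & forall x, `|F (sqnorm (euler tau u0 i) x)| <= KF]) ->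
  mass (fun b x => euler tau u0 (n + d) b x - euler tau u0 n b x) <=
    d%:R * tau * (5 / 2 * (D0 + KF * M)).
Proof.
move=> tau0 KF0 H; set w := fun b x => _.
have [D1 M1 _] := H (n + d)%N (leqnn _); have [D2 M2 _] := H n (leq_addr _ _).
have Dw : dirichlet w <= 4 * D0 by apply: le_trans (dirichletB _ _) _; lra.
have Mw : mass w <= 4 * M by apply: le_trans (massB _ _) _; lra.
have -> : mass w = \sum_(i < d) tau * \sum_x m x *
   (field (euler tau u0 (n + i)) true x * w true x +
    field (euler tau u0 (n + i)) false x * w false x).
  have wE b x : w b x = \sum_(i < d) tau * field (euler tau u0 (n + i)) b x.
    by rewrite /w euler_sum addrC addKr.
  under eq_bigr do rewrite mulr_sumr.
  rewrite exchange_big /=; apply: eq_bigr => x _.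
  have w2 b : w b x ^+ 2 = \sum_(i < d) tau * (field (euler tau u0 (n + i)) b x * w b x).
    by rewrite expr2 {1}wE mulr_suml; apply: eq_bigr => i _; ring.
  rewrite /sqnorm !w2 -big_split /= mulr_sumr.
  by apply: eq_bigr => i _; ring.
rewrite -mulrA mulr_natl -[d in X in _ <= X]card_ord -sumr_const.
apply: ler_sum => i _; rewrite ler_pM2l //.
have [D3 M3 F3] := H (n + i)%N (leq_add (leqnn _) (ltnW (ltn_ord i))).
apply: le_trans (inner_field_le _ KF0 F3) _.
have : KF * ((mass (euler tau u0 (n + i)) + mass w) / 2) <= KF * (5 / 2 * M).
  by rewrite ler_wpM2l //; lra.
lra.
Qed.

End Lattice.

(** * Grids on the star *)

Section StarGrid.
Context {R : realType} {N : nat}.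
Implicit Types (n i k l : nat) (j : 'I_N.+1) (b : bool).

(* The vertex is [None]; [Some (j, k)] is the point [(k + 1) 2^-n] of edge [j],
   which is also the far end of the [k]-th cell of that edge. *)
Definition gpoint n := option ('I_N.+1 * 'I_(4 ^ n)).
Definition gcell n := ('I_N.+1 * 'I_(4 ^ n))%type.

(** An index beyond [4 ^ n] yields the vertex as a default. *)
Definition node n j k : gpoint n :=
  if k is k'.+1 then omap (pair j) (insub k' : option 'I_(4 ^ n)) else None.

Arguments node : simpl never.

Definition gsrc n (e : gcell n) : gpoint n := node n e.1 e.2.
Definition gtgt n (e : gcell n) : gpoint n := Some e.
(** The vertex carries the mass of an ordinary node. As this mass vanishes with the mesh, the
    equation at the vertex turns into the Kirchhoff law in the limit. *)
Definition gmesh n (x : gpoint n) : R := mesh n.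
Definition gcond n (e : gcell n) : R := 2 ^+ n.

Lemma node_succ n j (k : 'I_(4 ^ n)) : node n j k.+1 = Some (j, k).
Proof. by rewrite /node (insubT (fun x => (x < 4 ^ n)%N) (ltn_ord k)) /=; congr (Some (_, _)); exact/val_inj. Qed.

Lemma nodeE n j k (kn : (k < 4 ^ n)%N) : node n j k.+1 = Some (j, Ordinal kn).
Proof. exact: (node_succ j (Ordinal kn)). Qed.

Lemma nodeP n (x : gpoint n) : exists j k, (k <= 4 ^ n)%N /\ x = node n j k.
Proof.
case: x => [[j k]|]; last by exists ord0, 0%N.
by exists j, k.+1; rewrite node_succ; split => //; exact: ltn_ord.
Qed.

Lemma sum_gpoint n (f : gpoint n -> R) :
  \sum_x f x = f None + \sum_j \sum_(k < 4 ^ n) f (node n j k.+1).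
Proof.
rewrite (bigD1 None) //=; congr (_ + _).
rewrite (reindex_omap Some id) /=; last by case.
rewrite pair_bigA; apply: eq_big => [e|e _] /=; first by rewrite eqxx.
by rewrite node_succ; case: e.
Qed.

Lemma sum_gcell n (f : gcell n -> R) :
  \sum_e f e = \sum_j \sum_(k < 4 ^ n) f (j, k).
Proof. by rewrite pair_bigA /=; apply: eq_bigr => -[]. Qed.

Lemma gsrc_eq n (e : gcell n) j (k : 'I_(4 ^ n)) :
  (gsrc e == Some (j, k)) = (e.1 == j) && (e.2 == k.+1 :> nat).
Proof.
case: e => j1 [[|k1] k1n]; rewrite /gsrc /=; first by rewrite andbF.
have k1n' : (k1 < 4 ^ n)%N by exact: ltnW.
rewrite (nodeE j1 k1n') eqSS.
by apply/eqP/andP => [[-> <-]|[/eqP-> /eqP kk]] //; congr (Some (_, _)); exact/val_inj.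
Qed.

Lemma sum_gsrc n j (k : 'I_(4 ^ n)) (f : gcell n -> R) :
  \sum_e (gsrc e == Some (j, k))%:R * f e = \sum_(l < 4 ^ n | l == k.+1 :> nat) f (j, l).
Proof.
rewrite sum_gcell (bigD1 j) //= [X in _ + X]big1 ?addr0; last first.
  by move=> j' j'j; apply: big1 => l _; rewrite gsrc_eq /= (negbTE j'j) mul0r.
rewrite [RHS]big_mkcond /=; apply: eq_bigr => l _; rewrite gsrc_eq /= eqxx /=.
by case: ifP => _; rewrite ?mul1r ?mul0r.
Qed.

(** The far end [k = 4 ^ n] is left out: it has a single neighbour, a reflecting end that recedes to
    infinity as the grids grow. *)
Lemma lap_interior n (f : gpoint n -> R) j k : (0 < k < 4 ^ n)%N ->
  lap (@gmesh n) (@gcond n) (@gsrc n) (@gtgt n) f (node n j k) =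
  2 ^+ n * 2 ^+ n * (f (node n j k.+1) - 2 * f (node n j k) + f (node n j k.-1)).
Proof.
case: k => // k /andP[_ k1n]; rewrite [k.+1.-1]/=; have kn : (k < 4 ^ n)%N by exact: ltnW.
rewrite (nodeE j kn) /lap /gmesh /mesh invrK -mulrA; congr (_ * _).
have -> : \sum_e gcond e * (jump (@gsrc n) (@gtgt n) f e *
     ((gsrc e == Some (j, Ordinal kn))%:R - (gtgt e == Some (j, Ordinal kn))%:R)) =
  2 ^+ n * (\sum_e (gsrc e == Some (j, Ordinal kn))%:R * jump (@gsrc n) (@gtgt n) f e -
   \sum_e ((j, Ordinal kn) == e)%:R * jump (@gsrc n) (@gtgt n) f e).
  rewrite -sumrB mulr_sumr; apply: eq_bigr => e _.
  have -> : (gtgt e == Some (j, Ordinal kn)) = ((j, Ordinal kn) == e) by rewrite /gtgt eq_sym.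
  by rewrite /gcond; ring.
rewrite pick_sum sum_gsrc (big_pred1 (Ordinal k1n)); last by move=> l; rewrite /= -val_eqE.
by rewrite /jump /gsrc /gtgt -!node_succ /= (nodeE j kn); ring.
Qed.

Lemma lap_vertex n (f : gpoint n -> R) :
  lap (@gmesh n) (@gcond n) (@gsrc n) (@gtgt n) f None =
  2 ^+ n * 2 ^+ n * \sum_j (f (node n j 1) - f None).
Proof.
rewrite /lap /gmesh /mesh invrK -mulrA; congr (_ * _).
rewrite sum_gcell mulr_sumr; apply: eq_bigr => j _.
have n0 : (0 < 4 ^ n)%N by rewrite expn_gt0.
rewrite (bigD1 (Ordinal n0)) //= big1 ?addr0.
  by rewrite /gcond /jump /gsrc /gtgt /= subr0 mulr1 -node_succ.
case=> -[|k] kn // _; rewrite /gcond /gsrc /gtgt /=.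
have kn' : (k < 4 ^ n)%N by exact: ltnW.
by rewrite (nodeE j kn') subr0 mulr0 mulr0.
Qed.

Lemma gdform n (f : gpoint n -> R) :
  dform (@gcond n) (@gsrc n) (@gtgt n) f f =
  2 ^+ n * \sum_j \sum_(k < 4 ^ n) (f (node n j k.+1) - f (node n j k)) ^+ 2.
Proof.
rewrite /dform sum_gcell mulr_sumr; apply: eq_bigr => j _.
rewrite mulr_sumr; apply: eq_bigr => k _.
by rewrite /gcond /jump /gsrc /gtgt /= -node_succ -expr2.
Qed.

Definition gdist n (x : gpoint n) : R := if x is Some e then e.2.+1%:R * mesh n else 0.

Lemma gdist_node n j k : (k <= 4 ^ n)%N -> gdist (node n j k) = k%:R * mesh n.
Proof.
case: k => [|k] kn; first by rewrite /= mul0r.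
by rewrite (nodeE j kn).
Qed.

Lemma gdist_jump n (e : gcell n) : jump (@gsrc n) (@gtgt n) (@gdist n) e = mesh n.
Proof.
case: e => j k; rewrite /jump /gtgt /gsrc -node_succ /= .
by rewrite !gdist_node ?(ltnW (ltn_ord k)) ?ltn_ord // -natr1; ring.
Qed.

Lemma gdist_ge0 n (x : gpoint n) : 0 <= gdist x.
Proof. by case: x => //= e; exact: natr_mesh_ge0. Qed.

(** This is the slope condition of the virial estimate for the distance to the vertex: away from the
    vertex a node has at most two cells, each contributing 2^n times the squared mesh. *)
Lemma gdist_weight n (x : gpoint n) : gdist x != 0 ->
  \sum_e gcond e * (jump (@gsrc n) (@gtgt n) (@gdist n) e ^+ 2 *
     ((gsrc e == x)%:R + (gtgt e == x)%:R)) <= 2 * gmesh x.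
Proof.
case: x => [[j k] _|]; last by rewrite eqxx.
have -> : \sum_e gcond e * (jump (@gsrc n) (@gtgt n) (@gdist n) e ^+ 2 *
     ((gsrc e == Some (j, k))%:R + (gtgt e == Some (j, k))%:R)) =
  mesh n * (\sum_e (gsrc e == Some (j, k))%:R * 1 + \sum_e ((j, k) == e)%:R * 1).
  rewrite -big_split mulr_sumr /=; apply: eq_bigr => e _.
  rewrite gdist_jump /gcond /gtgt [Some e == _]eq_sym -[Some _ == Some e]/(_ == e).
  by rewrite expr2 mulrA mulrA mesh_exp mul1r !mulr1.
rewrite pick_sum sum_gsrc mulrC /gmesh ler_wpM2r ?(ltW (mesh_gt0 n)) //.
rewrite -[2]/(1 + 1) lerD2r.
have := ltn_ord k; rewrite leq_eqVlt => /predU1P[kn|kn].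
  rewrite big_pred0 // => l; apply/negbTE; rewrite neq_ltn; apply/orP; left.
  by rewrite kn.
by rewrite (big_pred1 (Ordinal kn)) // => l; rewrite -val_eqE.
Qed.

Lemma telescope_norm_le (z : nat -> R) K k l : (k <= K)%N -> (l <= K)%N ->
  `|z l - z k| <= \sum_(i < K) `|z i.+1 - z i|.
Proof.
wlog kl : k l / (k <= l)%N.
  move=> H kK lK; have [kl|/ltnW lk] := leqP k l; first exact: H.
  by rewrite distrC; exact: H.
move=> kK lK; rewrite -telescope_sumr //.
apply: le_trans (ler_norm_sum _ _ _) _.
rewrite -(big_mkord xpredT (fun i => `|z i.+1 - z i|)).
rewrite [leRHS](big_cat_nat (n := k)) //= [X in _ <= _ + X](big_cat_nat (n := l)) //= addrCA lerDl.
by rewrite addr_ge0 // sumr_ge0.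
Qed.

Lemma sum_shift_le (a : nat -> R) K : (forall i, 0 <= a i) ->
  \sum_(i < K) a i <= a 0%N + \sum_(i < K) a i.+1.
Proof.
move=> a0; have -> : a 0%N + \sum_(i < K) a i.+1 = \sum_(i < K.+1) a i.
  by rewrite big_ord_recl.
by rewrite big_ord_recr /= lerDl.
Qed.

(** Squares at two nodes of one edge differ by a telescoping sum that Young's inequality splits
    between Dirichlet form and mass. Averaging over the nodes of the edge, whose length 2^n is at
    least 1, removes the reference value. *)
Lemma gagliardo n (f : gpoint n -> R) (lam : R) j k : (k <= 4 ^ n)%N -> 0 < lam ->
  f (node n j k) ^+ 2 <= (1 + 2 / lam) * (\sum_x mesh n * f x ^+ 2) +
    lam / 2 * dform (@gcond n) (@gsrc n) (@gtgt n) f f.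
Proof.
move=> kn lam0; set M1 := \sum_x _; set D1 := dform _ _ _ _ _.
have h0 := mesh_gt0 (R := R) n.
pose a i := f (node n j i).
have M1E : M1 = mesh n * f None ^+ 2 + \sum_j' mesh n * \sum_(i < 4 ^ n) f (node n j' i.+1) ^+ 2.
  by rewrite /M1 sum_gpoint; congr (_ + _); apply: eq_bigr => j' _; rewrite mulr_sumr.
have s0 j' : 0 <= mesh n * \sum_(i < 4 ^ n) f (node n j' i.+1) ^+ 2.
  by rewrite mulr_ge0 ?(ltW h0) // sumr_ge0 // => i _; exact: sqr_ge0.
have M1a : mesh n * f None ^+ 2 + mesh n * \sum_(i < 4 ^ n) a i.+1 ^+ 2 <= M1.
  rewrite M1E lerD2l (bigD1 j) //= lerDl; apply: sumr_ge0 => j' _; exact: s0.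
have v0 : 0 <= mesh n * f None ^+ 2 by rewrite mulr_ge0 ?sqr_ge0 // ltW.
have M1b : mesh n * \sum_(i < 4 ^ n) a i ^+ 2 <= M1.
  apply: le_trans M1a; rewrite -mulrDr ler_wpM2l ?(ltW h0) //.
  by apply: (sum_shift_le (a := fun i => a i ^+ 2)) => i; exact: sqr_ge0.
have D1a : 2 ^+ n * \sum_(i < 4 ^ n) (a i.+1 - a i) ^+ 2 <= D1.
  rewrite /D1 gdform ler_wpM2l ?exprn_ge0 // (bigD1 j) //= lerDl.
  by apply: sumr_ge0 => j' _; apply: sumr_ge0 => i _; exact: sqr_ge0.
pose C := lam / 2 * D1 + 2 / lam * M1.
have Cb l : (l <= 4 ^ n)%N -> `|a l ^+ 2 - a k ^+ 2| <= C.
  move=> ln; apply: le_trans (telescope_norm_le (fun i => a i ^+ 2) kn ln) _.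
  apply: (@le_trans _ _ (\sum_(i < 4 ^ n) (lam / 2 * (2 ^+ n * (a i.+1 - a i) ^+ 2) +
     lam^-1 * (mesh n * a i.+1 ^+ 2 + mesh n * a i ^+ 2)))).
    apply: ler_sum => i _; have p0 : 0 < 2 ^+ n :> R by rewrite exprn_gt0.
    rewrite /mesh; set p := 2 ^+ n in p0 *; set x := a _.+1; set y := a i.
    have q0 : 0 < lam * p / 2 by rewrite divr_gt0 // mulr_gt0.
    have r0 : 0 < lam * p by rewrite mulr_gt0.
    have -> : lam / 2 * (p * (x - y) ^+ 2) + lam^-1 * (p^-1 * x ^+ 2 + p^-1 * y ^+ 2) =
      (lam * p) / 2 * (x - y) ^+ 2 + (lam * p)^-1 * (x ^+ 2 + y ^+ 2).
      by field; rewrite !gt_eqF.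
    set r := lam * p in r0 q0 *.
    have H (s : R) : s ^+ 2 = 1 -> s * (x ^+ 2 - y ^+ 2) <=
        r / 2 * (x - y) ^+ 2 + r^-1 * (x ^+ 2 + y ^+ 2).
      move=> s2; rewrite -subr_ge0.
      have -> : r / 2 * (x - y) ^+ 2 + r^-1 * (x ^+ 2 + y ^+ 2) - s * (x ^+ 2 - y ^+ 2) =
        (r / 2) * (x - y - s * r^-1 * (x + y)) ^+ 2 + r^-1 / 2 * (x - y) ^+ 2 +
        (1 - s ^+ 2) * (r^-1 / 2 * (x + y) ^+ 2).
        by field; rewrite gt_eqF.
      rewrite s2 subrr mul0r addr0 addr_ge0 // mulr_ge0 ?sqr_ge0 ?(ltW q0) //.
      by rewrite divr_ge0 // invr_ge0 ltW.
    rewrite ler_norml; apply/andP; split.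
      rewrite lerNl -mulN1r; apply: H; by rewrite sqrrN expr1n.
    by rewrite -[_ - _]mul1r; apply: H; rewrite expr1n.
  rewrite big_split /= -!mulr_sumr big_split /= -!mulr_sumr /C.
  have l2 : 0 <= lam / 2 by rewrite divr_ge0 // ltW.
  have l3 : 0 <= lam^-1 by rewrite invr_ge0 ltW.
  apply: lerD; first by rewrite ler_wpM2l.
  rewrite [2 / lam]mulrC -mulrA ler_wpM2l // ; lra.
have C0 : 0 <= C by apply: le_trans (Cb k kn); exact: normr_ge0.
have M0 : 0 <= M1 by rewrite M1E addr_ge0 // sumr_ge0.
have HK : 1 <= (4 ^ n)%N%:R * mesh n :> R by rewrite mesh4 exprn_ege1 // ler1n.
have av : (4 ^ n)%N%:R * mesh n * a k ^+ 2 <= M1 + (4 ^ n)%N%:R * mesh n * C.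
  apply: (@le_trans _ _ (\sum_(i < 4 ^ n) (mesh n * a i.+1 ^+ 2 + mesh n * C))).
    rewrite -mulrA mulr_natl -[X in _ *+ X <= _]card_ord -sumr_const.
    apply: ler_sum => i _; rewrite -mulrDr ler_wpM2l ?(ltW h0) //.
    by have := Cb _ (ltn_ord i); rewrite ler_norml => /andP[? ?]; lra.
  rewrite big_split /= sumr_const card_ord -mulr_sumr -mulrA mulr_natl lerD2r.
  by apply: le_trans M1a; rewrite lerDr.
have -> : (1 + 2 / lam) * M1 + lam / 2 * D1 = M1 + C by rewrite /C; ring.
rewrite -/(a k); set T := (4 ^ n)%N%:R * mesh n in HK av.
rewrite -(ler_pM2l (lt_le_trans ltr01 HK)); apply: le_trans av _.
have -> : T * (M1 + C) = T * M1 + T * C by ring.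
by rewrite lerD2r ler_peMl.
Qed.

End StarGrid.

#[global] Arguments node : simpl never.

(** * A priori bounds for the scheme *)

(** The quantitative properties on which the existence part rests. The variable is s = |u|^2; in one
    dimension the supremum of s is of the order of the square root of the Dirichlet form when the
    mass is bounded, so the exponent [q < 2] in the lower bound on [G] keeps the focusing energy
    below the Dirichlet form. *)
Definition tame {R : realType} (F G : R -> R) : Prop :=
  [/\ forall S, exists2 K, 0 <= K & forall s, 0 <= s <= S -> `|F s| <= K,
      forall S, exists2 L, 0 <= L & forall s s', 0 <= s <= S -> 0 <= s' <= S ->
        `|G s' - G s - F s * (s' - s)| <= L * (s' - s) ^+ 2,
      exists CG q, [/\ 0 <= CG, 0 <= q < 2 &
        forall s, 0 <= s -> - (CG * s * (1 + s `^ q)) <= G s] &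
      G 0 = 0].

(** * Sampling the initial state on a grid *)

Section CellEstimates.
Context {R : realType}.
Variables (f v : R -> R).
Notation mesh := (@mesh R).
Hypothesis fc : continuous f.
Hypothesis vi : loc_integrable v.
Hypothesis v2i : loc_integrable (fun x => v x ^+ 2).
Hypothesis fv : primitive_of f v.

Lemma lt_mesh k n : k%:R * mesh n < k.+1%:R * mesh n.
Proof. by rewrite ltr_pM2r ?mesh_gt0 // ltr_nat. Qed.

(** A grid value is traded for a value inside the cell at the price of the gradient energy of the
    cell; integrated over [y], this bounds sampled norms uniformly in the mesh. *)
Lemma cell_sqr a b y : 0 <= a -> a <= y <= b ->
  f b ^+ 2 <= 2 * f y ^+ 2 + 2 * (b - a) * itg a b (fun x => v x ^+ 2).
Proof.
move=> a0 /andP[ay yb]; have ab := le_trans ay yb.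
have y0 := le_trans a0 ay.
have H := incr_sqr_le vi v2i fv y0 yb.
have I0 c d : 0 <= itg c d (fun x => v x ^+ 2) by apply: itg_ge0 => x _; exact: sqr_ge0.
have H2 : (b - y) * itg y b (fun x => v x ^+ 2) <= (b - a) * itg a b (fun x => v x ^+ 2).
  rewrite (itg_chasles_int ay yb (integrable_sub b v2i a0)).
  apply: ler_pM; rewrite ?subr_ge0 ?lerB //.
  by rewrite lerDr.
have := sqr_ge0 (f y - (f b - f y)); nra.
Qed.

Lemma cell_mass a b : 0 <= a -> a < b -> (b - a) * f b ^+ 2 <=
  2 * itg a b (fun x => f x ^+ 2) + 2 * (b - a) ^+ 2 * itg a b (fun x => v x ^+ 2).
Proof.
move=> a0 ab; have cf2 := continuous_sqr fc.
set I := itg a b (fun x => v x ^+ 2).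
have H : itg a b (fun=> f b ^+ 2) <= itg a b (fun x => 2 * f x ^+ 2 + 2 * (b - a) * I).
  apply: le_itg; [exact: cst_continuous|by apply: contD; [exact: contZ|exact: cst_continuous]|].
  by move=> x xab; exact: cell_sqr.
move: H; rewrite itgD; [|exact: contZ|exact: cst_continuous].
rewrite (itgZ _ _ 2 cf2) !itg_cst ?(ltW ab) // mulrC => H.
apply: le_trans H _; rewrite lerD2l le_eqVlt; apply/orP; left; apply/eqP; ring.
Qed.

(** The condition [b * (b - a) <= 1] holds on a grid of spacing 2^-n and length 2^n; it lets the
    weight [b ^+ 2] be absorbed by the squared length of the cell that multiplies the gradient
    term. *)
Lemma cell_weighted a b : 0 <= a -> a < b -> b * (b - a) <= 1 -> b - a <= 1 ->
  (b - a) * (b ^+ 2 * f b ^+ 2) <= 4 * itg a b (fun x => x ^+ 2 * f x ^+ 2) +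
    4 * itg a b (fun x => f x ^+ 2) + 2 * itg a b (fun x => v x ^+ 2).
Proof.
move=> a0 ab bab ba1; have cf2 := continuous_sqr fc.
have cx2 : continuous (fun x : R => x ^+ 2 * f x ^+ 2).
  by apply: contM => //; apply: continuous_sqr => x; exact: cvg_id.
set I := itg a b (fun x => v x ^+ 2).
have I0 : 0 <= I by apply: itg_ge0 => x _; exact: sqr_ge0.
have ba0 : 0 < b - a by rewrite subr_gt0.
have b0 : 0 < b by exact: le_lt_trans ab.
have H : itg a b (fun=> b ^+ 2 * f b ^+ 2) <=
  itg a b (fun x => 4 * (x ^+ 2 * f x ^+ 2) + 4 * f x ^+ 2 + 2 * b ^+ 2 * (b - a) * I).
  apply: le_itg; first exact: cst_continuous.
    by apply: contD; [apply: contD; exact: contZ|exact: cst_continuous].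
  move=> x xab; have C1 := cell_sqr a0 xab; case/andP: xab => ax xb.
  have C2 : b ^+ 2 * f b ^+ 2 <= b ^+ 2 * (2 * f x ^+ 2 + 2 * (b - a) * I).
    by rewrite ler_wpM2l ?sqr_ge0.
  have C3 : b ^+ 2 <= 2 * x ^+ 2 + 2.
    have : (b - x) ^+ 2 <= 1.
      by rewrite -(expr1n _ 2) ler_pXn2r ?nnegrE ?subr_ge0 //; lra.
    have := sqr_ge0 (2 * x - b); lra.
  have C4 : b ^+ 2 * f x ^+ 2 <= (2 * x ^+ 2 + 2) * f x ^+ 2.
    by rewrite ler_wpM2r ?sqr_ge0.
  lra.
move: H; rewrite itgD; [|by apply: contD; exact: contZ|exact: cst_continuous].
rewrite itgD; [|exact: contZ|exact: contZ].
rewrite (itgZ _ _ 4 cx2) (itgZ _ _ 4 cf2) !itg_cst ?(ltW ab) // mulrC => H.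
apply: le_trans H _; rewrite lerD2l.
have -> : 2 * b ^+ 2 * (b - a) * I * (b - a) = 2 * ((b * (b - a)) ^+ 2 * I) by ring.
rewrite ler_wpM2l // -[leRHS]mul1r ler_wpM2r //.
by rewrite -(expr1n _ 2) ler_pXn2r ?nnegrE // mulr_ge0 ?ltW.
Qed.

Lemma sum_itg_cells (phi : R -> R) n K : loc_integrable phi ->
  \sum_(k < K) itg (k%:R * mesh n) (k.+1%:R * mesh n) phi = itg 0 (K%:R * mesh n) phi.
Proof.
move=> pi; elim: K => [|K IH]; first by rewrite big_ord0 mul0r itgxx.
rewrite big_ord_recr /= IH -itg_chasles_int //; [exact: natr_mesh_ge0|exact: le_mesh].
Qed.

Lemma cont_loc_integrable (phi : R -> R) : continuous phi -> loc_integrable phi.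
Proof. by move=> cphi x; exact: integrable_cont. Qed.

Lemma sample_mass n (Mu Bv : R) :
  (forall X, itg 0 X (fun x => f x ^+ 2) <= Mu) ->
  (forall X, itg 0 X (fun x => v x ^+ 2) <= Bv) ->
  mesh n * \sum_(k < 4 ^ n) f (k.+1%:R * mesh n) ^+ 2 <= 2 * Mu + 2 * Bv.
Proof.
move=> HM HB; rewrite mulr_sumr.
have cf2 := continuous_sqr fc.
have I0 c d : 0 <= itg c d (fun x => v x ^+ 2) by apply: itg_ge0 => x _; exact: sqr_ge0.
apply: (@le_trans _ _ (2 * \sum_(k < 4 ^ n) itg (k%:R * mesh n) (k.+1%:R * mesh n) (fun x => f x ^+ 2) +
  2 * \sum_(k < 4 ^ n) itg (k%:R * mesh n) (k.+1%:R * mesh n) (fun x => v x ^+ 2))).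
  rewrite !mulr_sumr -big_split /=; apply: ler_sum => k _.
  have kk : k%:R * mesh n < k.+1%:R * mesh n by exact: lt_mesh.
  have := cell_mass (natr_mesh_ge0 k n) kk.
  have hh : k.+1%:R * mesh n - k%:R * mesh n = mesh n by rewrite succ_mesh; ring.
  rewrite hh => H.
  apply: le_trans H _; rewrite lerD2l -mulrA ler_wpM2l // -[leRHS]mul1r ler_wpM2r //.
  by rewrite -(expr1n _ 2) ler_pXn2r ?nnegrE ?mesh_le1 ?(ltW (mesh_gt0 n)).
rewrite !sum_itg_cells //; last exact: cont_loc_integrable.
by apply: lerD; rewrite ler_wpM2l.
Qed.

Lemma sample_weighted n (Mu Bv Xu : R) :
  (forall X, itg 0 X (fun x => f x ^+ 2) <= Mu) ->
  (forall X, itg 0 X (fun x => x ^+ 2 * f x ^+ 2) <= Xu) ->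
  (forall X, itg 0 X (fun x => v x ^+ 2) <= Bv) ->
  mesh n * \sum_(k < 4 ^ n) ((k.+1%:R * mesh n) ^+ 2 * f (k.+1%:R * mesh n) ^+ 2) <=
  4 * Xu + 4 * Mu + 2 * Bv.
Proof.
move=> HM HX HB; rewrite mulr_sumr.
have cf2 := continuous_sqr fc.
have cx2 : continuous (fun x : R => x ^+ 2 * f x ^+ 2).
  by apply: contM => //; apply: continuous_sqr => x; exact: cvg_id.
apply: (@le_trans _ _
 (4 * \sum_(k < 4 ^ n) itg (k%:R * mesh n) (k.+1%:R * mesh n) (fun x => x ^+ 2 * f x ^+ 2) +
  4 * \sum_(k < 4 ^ n) itg (k%:R * mesh n) (k.+1%:R * mesh n) (fun x => f x ^+ 2) +
  2 * \sum_(k < 4 ^ n) itg (k%:R * mesh n) (k.+1%:R * mesh n) (fun x => v x ^+ 2))).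
  rewrite !mulr_sumr -!big_split /=; apply: ler_sum => k _.
  have kk : k%:R * mesh n < k.+1%:R * mesh n by exact: lt_mesh.
  have hh : k.+1%:R * mesh n - k%:R * mesh n = mesh n by rewrite succ_mesh; ring.
  have := cell_weighted (natr_mesh_ge0 k n) kk; rewrite hh; apply; last exact: mesh_le1.
  rewrite -mulrA -expr2 /mesh exprVn -exprM mulnC exprM.
  have -> : (2 ^+ 2 : R) = 4%:R by rewrite -natrX.
  by rewrite -natrX ler_pdivrMr ?ltr0n ?expn_gt0 // mul1r ler_nat ltn_ord.
rewrite !sum_itg_cells //; try exact: cont_loc_integrable.
by apply: lerD; [apply: lerD|]; rewrite ler_wpM2l.
Qed.

End CellEstimates.

(** * Uniform bounds and existence of the discrete solutions *)

Section Scheme.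
Context {R : realType} {N : nat}.
Variables (F G : R -> R).
Hypothesis tFG : tame F G.
Implicit Types (n i k l : nat) (j : 'I_N.+1) (b : bool).

Notation gmass n u := (mass (@gmesh R N n) u).
Notation gdir n u := (dirichlet (@gcond R N n) (@gsrc N n) (@gtgt N n) u).
Notation gen n u := (energy (@gmesh R N n) (@gcond R N n) (@gsrc N n) (@gtgt N n) G u).
Notation gform n f := (dform (@gcond R N n) (@gsrc N n) (@gtgt N n) f f).

Lemma G_linear S : exists2 K, 0 <= K & forall s, 0 <= s <= S -> `|G s| <= K * s.
Proof.
have [_ HG _ G0] := tFG; have [L L0 HL] := HG S.
have [S0|Sn] := leP 0 S; last first.
  by exists 0 => // s /andP[s0 sS]; have := le_lt_trans (le_trans s0 sS) Sn; rewrite ltxx.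
exists (`|F 0| + L * S); first by rewrite addr_ge0 // mulr_ge0.
move=> s /andP[s0 sS].
have := HL 0 s; rewrite lexx S0 s0 sS G0 !subr0 => /(_ isT isT) H.
have -> : G s = (G s - F 0 * s) + F 0 * s by ring.
apply: le_trans (ler_normD _ _) _; rewrite mulrDl addrC; apply: lerD.
  by rewrite normrM (ger0_norm s0).
apply: le_trans H _; rewrite expr2 mulrA ler_wpM2r // ler_wpM2l //.
Qed.

Lemma powR_absorb (a q y : R) : 0 <= a -> 0 <= q < 2 -> 1 <= y ->
  y ^+ 2 <= a * y `^ q -> y <= (a + 1) `^ ((2 - q)^-1).
Proof.
move=> a0 /andP[q0 q2] y1 H; have y0 : 0 < y by exact: lt_le_trans y1.
have q20 : 0 < 2 - q by rewrite subr_gt0.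
have yq : 0 < y `^ q by exact: powR_gt0.
have H1 : y `^ (2 - q) <= a + 1.
  rewrite -(ler_pM2r yq) -powRD; last by rewrite (gt_eqF y0) implybT.
  rewrite subrK powR_mulrn ?(ltW y0) //; apply: le_trans H _.
  by rewrite ler_pM2r // lerDl.
have -> : y = (y `^ (2 - q)) `^ ((2 - q)^-1).
  by rewrite -powRrM divff ?gt_eqF // powRr1 // ltW.
by apply: ge0_ler_powR => //; rewrite ?nnegrE ?invr_ge0 ?(ltW q20) ?powR_ge0 // addr_ge0.
Qed.

Lemma massE2 n (u : bool -> gpoint n -> R) :
  gmass n u = \sum_x mesh n * u true x ^+ 2 + \sum_x mesh n * u false x ^+ 2.
Proof. by rewrite /mass -big_split; apply: eq_bigr => x _; rewrite /gmesh /sqnorm mulrDr. Qed.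

Lemma sqnorm_gagliardo n (u : bool -> gpoint n -> R) (lam : R) x : 0 < lam ->
  sqnorm u x <= (1 + 2 / lam) * gmass n u + lam / 2 * gdir n u.
Proof.
move=> lam0; have [j [k [kn ->]]] := nodeP x.
have H b := gagliardo (u b) j kn lam0.
rewrite massE2 /dirichlet /sqnorm !mulrDr addrACA.
by apply: lerD; exact: H.
Qed.

(* Discrete Gagliardo-Nirenberg: the hypothesis [q < 2] makes the focusing part
   of the potential energy of lower order than the Dirichlet form. *)
Lemma apriori (M E0 : R) : 0 <= M -> 0 <= E0 -> exists B0 S, [/\ 0 < B0, 0 <= S &
  forall n (u : bool -> gpoint n -> R), gmass n u <= M -> gen n u <= E0 ->
    gdir n u <= B0 ^+ 2 /\ forall x, sqnorm u x <= S].
Proof.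
move=> M0 E00; have [_ _ [CG [q [CG0 q02 HG]]] _] := tFG.
have [q0 q2] := andP q02.
pose c := 3 * M + 1; have c1 : 1 <= c by rewrite /c; lra.
pose a := 2 + 2 * E0 + 2 * (CG * M) + 2 * (CG * M) * c `^ q.
have CM : 0 <= CG * M by rewrite mulr_ge0.
have a0 : 0 <= a.
  by rewrite /a !addr_ge0 // ?mulr_ge0 // ?powR_ge0.
pose Y := (a + 1) `^ ((2 - q)^-1) + 1.
have Y0 : 0 < Y by rewrite ltr_wpDl // powR_ge0.
exists Y, (c * Y); split => //; first by rewrite mulr_ge0 ?(ltW Y0) //; lra.
move=> n u uM uE.
have D0 : 0 <= gdir n u by apply: dirichlet_ge0 => e; rewrite /gcond exprn_ge0.
(* Working with y = sqrt D + 1 rather than sqrt D makes [y] at least 1, so its inverse is a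
   legitimate Young parameter and lower powers of [y] are dominated by higher ones. *)
set D := gdir n u in D0 *; set y := Num.sqrt D + 1.
have sD : 0 <= Num.sqrt D by exact: sqrtr_ge0.
have y1 : 1 <= y by rewrite /y lerDr.
have y0 : 0 < y by exact: lt_le_trans y1.
have Dy : D <= y ^+ 2.
  by rewrite -{1}(sqr_sqrtr D0) ler_pXn2r ?nnegrE ?(ltW y0) // /y lerDl.
have m0 : 0 <= gmass n u by apply: mass_ge0 => x; exact: mesh_gt0.
(* With the Young parameter 1 / y the supremum bound reads (1 + 2 y) M + D / (2 y), which is at most
   (3 M + 1) y. *)
have sq x : sqnorm u x <= c * y.
  have yi : 0 < y^-1 by rewrite invr_gt0.
  apply: le_trans (sqnorm_gagliardo u x yi) _; rewrite -/D invrK.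
  have h1 : y^-1 / 2 * D <= y / 2.
    rewrite mulrAC ler_wpM2r // ler_pdivrMl // -expr2 //.
  have h2 : (1 + 2 * y) * gmass n u <= (1 + 2 * y) * M.
    by rewrite ler_wpM2l // addr_ge0 // mulr_ge0 // ltW.
  have : M <= M * y by rewrite ler_peMr.
  rewrite /c; lra.
have GD : D <= E0 + CG * M * (1 + (c * y) `^ q).
  have : - (CG * M * (1 + (c * y) `^ q)) <= \sum_x mesh n * G (sqnorm u x).
    apply: (@le_trans _ _ (\sum_x mesh n * (- (CG * (1 + (c * y) `^ q)) * sqnorm u x))).
      have -> : \sum_x mesh n * (- (CG * (1 + (c * y) `^ q)) * sqnorm u x) =
         - (CG * (1 + (c * y) `^ q)) * gmass n u.
        by rewrite /mass mulr_sumr; apply: eq_bigr => x _; rewrite /gmesh; ring.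
      have w0 : 0 <= CG * (1 + (c * y) `^ q) by rewrite mulr_ge0 // addr_ge0 // powR_ge0.
      have := ler_wpM2l w0 uM; lra.
    apply: ler_sum => x _; rewrite ler_wpM2l ?(ltW (mesh_gt0 n)) //.
    have s0 := sqnorm_ge0 u x.
    apply: le_trans (HG _ s0).
    rewrite mulNr lerN2 -mulrA [sqnorm u x * _]mulrC mulrA ler_wpM2r // ler_wpM2l // lerD2l.
    by apply: ge0_ler_powR => //; rewrite nnegrE // (le_trans s0 (sq x)).
  by move: uE; rewrite /energy -/D /gmesh; lra.
have yY : y <= Y.
  apply: le_trans (_ : (a + 1) `^ ((2 - q)^-1) <= _); last by rewrite /Y lerDl.
  apply: powR_absorb => //.
  have yq1 : 1 <= y `^ q by rewrite -(powRr0 y); exact: ler_powR.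
  have : (c * y) `^ q = c `^ q * y `^ q by rewrite powRM // ltW // ; lra.
  have : y ^+ 2 <= 2 * D + 2.
    rewrite /y -[in leRHS](sqr_sqrtr D0); have := sqr_ge0 (Num.sqrt D - 1); lra.
  move=> h1 h2; rewrite h2 in GD.
  apply: le_trans h1 _; rewrite /a.
  have : 2 + 2 * E0 + 2 * (CG * M) <= (2 + 2 * E0 + 2 * (CG * M)) * y `^ q.
    by rewrite ler_peMr // !addr_ge0 // mulr_ge0.
  lra.
split.
  by apply: le_trans Dy _; rewrite ler_pXn2r ?nnegrE ?(ltW y0) ?(ltW Y0).
by move=> x; apply: le_trans (sq x) _; rewrite ler_wpM2l //; lra.
Qed.

Definition edge_sum n (phi : 'I_N.+1 -> nat -> R) : R :=
  mesh n * \sum_j \sum_(k < 4 ^ n) phi j k.+1.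

Definition edge_sqr (U : 'I_N.+1 -> bool -> nat -> R) j k : R :=
  U j true k ^+ 2 + U j false k ^+ 2.

Definition edge_grad n (U : 'I_N.+1 -> bool -> nat -> R) : R :=
  2 ^+ n * \sum_j \sum_(k < 4 ^ n) ((U j true k.+1 - U j true k) ^+ 2 +
    (U j false k.+1 - U j false k) ^+ 2).

(* [U i j b k] is the value of component [b] at time [i * tau] and at the
   [k]-th node of edge [j]; the clauses only concern times up to [n]. *)
Record scheme (u0 : 'I_N.+1 -> bool -> R -> R) (M B S A kap C CE : R) n (tau : R)
    (U : nat -> 'I_N.+1 -> bool -> nat -> R) : Prop := {
  sch_tau : 0 < tau <= mesh n;
  sch_init : forall j b k, (k <= 4 ^ n)%N -> U 0%N j b k = u0 j b (k%:R * mesh n);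
  sch_vertex : forall i j j' b, U i j b 0%N = U i j' b 0%N;
  sch_mass : forall i, i%:R * tau <= n%:R -> edge_sum n (edge_sqr (U i)) <= M;
  sch_grad : forall i, i%:R * tau <= n%:R -> edge_grad n (U i) <= B;
  sch_weight : forall i, i%:R * tau <= n%:R ->
    edge_sum n (fun j k => (k%:R * mesh n) ^+ 2 * edge_sqr (U i) j k) <=
      (A + kap * (i%:R * tau)) ^+ 2;
  sch_sup : forall i j k, i%:R * tau <= n%:R -> (k <= 4 ^ n)%N -> edge_sqr (U i) j k <= S;
  sch_energy : forall i, i%:R * tau <= n%:R ->
    edge_grad n (U i) + edge_sum n (fun j k => G (edge_sqr (U i) j k)) <=
    edge_grad n (U 0%N) + edge_sum n (fun j k => G (edge_sqr (U 0%N) j k)) + CE * mesh n;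
  sch_holder : forall i d, (i + d)%:R * tau <= n%:R ->
    edge_sum n (edge_sqr (fun j b k => U (i + d)%N j b k - U i j b k)) <= C * (d%:R * tau);
  sch_holder_sup : forall i d (lam : R) j b k, (i + d)%:R * tau <= n%:R -> 0 < lam ->
    (k <= 4 ^ n)%N -> (U (i + d)%N j b k - U i j b k) ^+ 2 <=
      (1 + 2 / lam) * (C * (d%:R * tau)) + 2 * lam * B;
  sch_eq : forall i j b k, i%:R * tau <= n%:R -> (0 < k < 4 ^ n)%N ->
    \sum_(l < i) tau * U l j b k.+1 - 2 * (\sum_(l < i) tau * U l j b k) +
      \sum_(l < i) tau * U l j b k.-1 =
    mesh n ^+ 2 * (\sum_(l < i) tau * (F (edge_sqr (U l) j k) * U l j b k) +
      sgb b * (U i j (~~ b) k - U 0%N j (~~ b) k));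
  sch_eq_vertex : forall i b, i%:R * tau <= n%:R ->
    \sum_j (\sum_(l < i) tau * U l j b 1 - \sum_(l < i) tau * U l j b 0%N) =
    mesh n ^+ 2 * (\sum_(l < i) tau * (F (edge_sqr (U l) ord0 0%N) * U l ord0 b 0%N) +
      sgb b * (U i ord0 (~~ b) 0%N - U 0%N ord0 (~~ b) 0%N)) }.

Lemma edge_sum_le_mass n (u : bool -> gpoint n -> R) :
  edge_sum n (edge_sqr (fun j b k => u b (node n j k))) <= gmass n u.
Proof.
rewrite /mass (sum_gpoint (fun x => gmesh x * sqnorm u x)) /edge_sum mulr_sumr.
under eq_bigr do rewrite mulr_sumr.
by rewrite lerDr mulr_ge0 ?sqnorm_ge0 // ltW // mesh_gt0.
Qed.

Lemma edge_gradE n (u : bool -> gpoint n -> R) :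
  edge_grad n (fun j b k => u b (node n j k)) = gdir n u.
Proof.
rewrite /dirichlet !gdform /edge_grad -mulrDr -big_split; congr (_ * _).
by apply: eq_bigr => j _; rewrite -big_split.
Qed.

Lemma energy_absorb (a a' e e' g g' h k : R) : a + (g + e) <= a' + (g' + e') + h ->
  g' <= k -> - k <= g -> a + e <= a' + e' + (k * 2 + h).
Proof. lra. Qed.

Lemma mesh_sqr n : mesh n ^+ 2 * (2 ^+ n * 2 ^+ n) = 1 :> R.
Proof. by rewrite -expr2 -exprMn [mesh n * _]mulrC mesh_exp expr1n. Qed.

Section SchemeExists.
Variables (u0 v0 : 'I_N.+1 -> bool -> R -> R) (Mu Bv Xu : R).
Hypothesis u0c : forall j b, continuous (u0 j b).
Hypothesis v0i : forall j b, loc_integrable (v0 j b).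
Hypothesis v02i : forall j b, loc_integrable (fun x => v0 j b x ^+ 2).
Hypothesis uv : forall j b, primitive_of (u0 j b) (v0 j b).
Hypothesis u0v : forall j j' b, u0 j b 0 = u0 j' b 0.
Hypothesis HM : forall j b X, itg 0 X (fun x => u0 j b x ^+ 2) <= Mu.
Hypothesis HX : forall j b X, itg 0 X (fun x => x ^+ 2 * u0 j b x ^+ 2) <= Xu.
Hypothesis HB : forall j b X, itg 0 X (fun x => v0 j b x ^+ 2) <= Bv.

Definition sample n b (x : gpoint n) : R :=
  if x is Some (j, k) then u0 j b (k.+1%:R * mesh n) else u0 ord0 b 0.

Lemma sample_node n j b k : (k <= 4 ^ n)%N -> sample b (node n j k) = u0 j b (k%:R * mesh n).
Proof.
case: k => [_|k kn]; first by rewrite /= mul0r; exact: u0v.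
by rewrite (nodeE j kn).
Qed.

(** All constants are fixed before the grid: sampled data have uniformly bounded mass, energy and
    weight, and the a priori bound is taken with one unit of slack in mass and energy. On the grid
    of level [n] the time horizon is [n] and the tolerated drift is the mesh, so that both
    limitations disappear as [n] grows. *)
Lemma scheme_exists : exists M B S A kap C CE,
  [/\ [/\ 0 <= M, 0 <= B, 0 <= S & 0 <= A], [/\ 0 <= kap, 0 <= C & 0 <= CE] &
  forall n, exists tau U, scheme u0 M B S A kap C CE n tau U].
Proof.
have [FB GT _ _] := tFG.
have Mu0 : 0 <= Mu by apply: le_trans (HM ord0 true 0); apply: itg_ge0 => x _; exact: sqr_ge0.
have Bv0 : 0 <= Bv by apply: le_trans (HB ord0 true 0); apply: itg_ge0 => x _; exact: sqr_ge0.
have Xu0 : 0 <= Xu.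
  by apply: le_trans (HX ord0 true 0); apply: itg_ge0 => x _; rewrite mulr_ge0 ?sqr_ge0.
pose V0 := u0 ord0 true 0 ^+ 2 + u0 ord0 false 0 ^+ 2.
have V00 : 0 <= V0 by rewrite addr_ge0 ?sqr_ge0.
pose M0 := V0 + N.+1%:R * (2 * (2 * Mu + 2 * Bv)).
pose D0 := N.+1%:R * (2 * Bv).
pose X0 := N.+1%:R * (2 * (4 * Xu + 4 * Mu + 2 * Bv)).
have M00 : 0 <= M0 by rewrite /M0 addr_ge0 // mulr_ge0 // mulr_ge0 //; lra.
have D00 : 0 <= D0 by rewrite /D0 mulr_ge0 // mulr_ge0.
have X00 : 0 <= X0 by rewrite /X0 mulr_ge0 // mulr_ge0 //; lra.
have cs (z : R) : N.+1%:R * z = \sum_(j < N.+1) z.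
  by rewrite sumr_const card_ord mulr_natl.
have Hmass n : gmass n (@sample n) <= M0.
  rewrite /mass (sum_gpoint (fun x => gmesh x * sqnorm (@sample n) x)); apply: lerD.
    by rewrite /gmesh /sqnorm /= ler_piMl // mesh_le1.
  rewrite cs; apply: ler_sum => j _.
  apply: (@le_trans _ _ (mesh n * \sum_(k < 4 ^ n) u0 j true (k.+1%:R * mesh n) ^+ 2 +
     mesh n * \sum_(k < 4 ^ n) u0 j false (k.+1%:R * mesh n) ^+ 2)).
    rewrite -mulrDr -big_split mulr_sumr /=; apply: ler_sum => k _.
    by rewrite /sqnorm !sample_node.
  rewrite mulr_natl mulr2n.
  have H b := sample_mass (@u0c j b) (@v0i j b) (@v02i j b) (@uv j b) n (@HM j b) (@HB j b).
  by apply: lerD; exact: H.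
have Hdir n : gdir n (@sample n) <= D0.
  rewrite -edge_gradE /edge_grad mulr_sumr /D0 cs.
  apply: ler_sum => j _; rewrite big_split /= mulrDr mulr_natl mulr2n.
  have H b : 2 ^+ n * \sum_(k < 4 ^ n) (sample b (node n j k.+1) - sample b (node n j k)) ^+ 2 <= Bv.
    apply: le_trans (HB j b (2 ^+ n)); apply: le_trans (dyadic_energy_le n (@v0i j b) (@v02i j b) (@uv j b)).
    rewrite /dyadic_energy ler_wpM2l ?exprn_ge0 //; apply: ler_sum => k _.
    by rewrite !sample_node // ltnW.
  by apply: lerD; exact: H.
have Hw n : wmass (@gmesh R N n) (fun x => gdist x ^+ 2) (@sample n) <= X0.
  rewrite /wmass (sum_gpoint (fun x => gmesh x * (gdist x ^+ 2 * sqnorm (@sample n) x))).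
  rewrite /= expr0n /= mul0r mulr0 add0r.
  rewrite /X0 cs; apply: ler_sum => j _.
  apply: (@le_trans _ _ (mesh n * \sum_(k < 4 ^ n) ((k.+1%:R * mesh n) ^+ 2 * u0 j true (k.+1%:R * mesh n) ^+ 2) +
     mesh n * \sum_(k < 4 ^ n) ((k.+1%:R * mesh n) ^+ 2 * u0 j false (k.+1%:R * mesh n) ^+ 2))).
    rewrite -mulrDr -big_split mulr_sumr /=; apply: ler_sum => k _.
    by rewrite /sqnorm !sample_node // gdist_node // -mulrDr.
  rewrite mulr_natl mulr2n.
  have H b := sample_weighted (@u0c j b) (@v0i j b) (@v02i j b) (@uv j b) n (@HM j b) (@HX j b) (@HB j b).
  by apply: lerD; exact: H.
(* The supremum bound for the samples, from the Young parameter 1. *)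
pose S0 := 3 * M0 + D0 / 2.
have [KG KG0 HKG] := G_linear S0.
pose E0 := D0 + KG * M0.
have E00 : 0 <= E0 by rewrite addr_ge0 // mulr_ge0.
have HE n : gen n (@sample n) <= E0.
  rewrite /energy; apply: lerD => //.
  apply: (@le_trans _ _ (KG * gmass n (@sample n))); last by rewrite ler_wpM2l.
  rewrite /mass mulr_sumr; apply: ler_sum => x _.
  rewrite mulrCA ler_wpM2l ?(ltW (mesh_gt0 n)) //; apply: le_trans (ler_norm _) _.
  apply: HKG; rewrite sqnorm_ge0 /=.
  apply: le_trans (sqnorm_gagliardo _ x ltr01) _; rewrite /S0.
  have := Hmass n; have := Hdir n; lra.
have M10 : 0 <= M0 + 1 by lra.
have E10 : 0 <= E0 + 1 by lra.
have [B0 [S [B00 SS0 HBS]]] := apriori M10 E10.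
have [KF KF0 HKF] := FB S.
have [KG' KG'0 HKG'] := G_linear S.
pose C := 5 / 2 * (B0 ^+ 2 + KF * (M0 + 1)).
(* [edge_sum] omits the vertex: its potential energy at the initial and the current time costs
   [KG' * S] each, and the drift of the Euler steps costs 1, all multiplied by the mesh. *)
pose CE := 2 * (KG' * S) + 1.
have C0 : 0 <= C.
  by rewrite /C mulr_ge0 // addr_ge0 ?sqr_ge0 // mulr_ge0.
have CE0 : 0 <= CE by rewrite /CE; have := mulr_ge0 KG'0 SS0; lra.
exists (M0 + 1), (B0 ^+ 2), S, (X0 + 1), (2 * B0 + 1), C, CE.
split; first by split => //; [exact: sqr_ge0|lra].
  by split => //; lra.
move=> n; pose h : R := mesh n.
have h0 : 0 < h by exact: mesh_gt0.
have h1 : h <= 1 by exact: mesh_le1.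
have gm0 (x : @gpoint N n) : 0 < gmesh x :> R by exact: mesh_gt0.
have gc0 (e : @gcell N n) : 0 <= gcond e :> R by rewrite /gcond exprn_ge0.
have [tau0 tau00 Htau] : exists2 tau0, 0 < tau0 & forall tau i, 0 < tau <= tau0 -> i%:R * tau <= n%:R ->
    [/\ gmass n (euler (@gmesh R N n) (@gcond R N n) (@gsrc N n) (@gtgt N n) F tau (@sample n) i) <= gmass n (@sample n) + h,
        gen n (euler (@gmesh R N n) (@gcond R N n) (@gsrc N n) (@gtgt N n) F tau (@sample n) i) <= gen n (@sample n) + h &
        wmass (@gmesh R N n) (fun x => gdist x ^+ 2) (euler (@gmesh R N n) (@gcond R N n) (@gsrc N n) (@gtgt N n) F tau (@sample n) i) <=
          (X0 + 1 + (2 * B0 + 1) * (i%:R * tau)) ^+ 2].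
  apply: euler_bounds => //.
  - lra.
  - by move=> x; exact: gdist_ge0.
  - by move=> x; exact: gdist_weight.
  - by apply: le_trans (Hw n) _; rewrite -subr_ge0; have := sqr_ge0 X0; lra.
  - move=> u uM uE; apply: (proj1 (HBS n u _ _)).
      by apply: le_trans uM _; rewrite lerD.
    by apply: le_trans uE _; rewrite lerD.
(* Keeping the step below the mesh makes the time discretisation vanish along with the space
   discretisation. *)
pose tau := Num.min tau0 h.
have tau_gt0 : 0 < tau by rewrite lt_min tau00.
have tauh : tau <= h by rewrite ge_min lexx orbT.
have taut : 0 < tau <= tau0 by rewrite tau_gt0 ge_min lexx.
set e := euler _ _ _ _ _ in Htau.
exists tau, (fun i j b k => e tau (@sample n) i b (node n j k)).
have e0 : e tau (@sample n) 0%N = @sample n by [].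
have key i : i%:R * tau <= n%:R -> [/\ gmass n (e tau (@sample n) i) <= M0 + 1,
   gdir n (e tau (@sample n) i) <= B0 ^+ 2, forall x, sqnorm (e tau (@sample n) i) x <= S &
   gen n (e tau (@sample n) i) <= gen n (@sample n) + h].
  move=> iT; have [H1 H2 H3] := Htau tau i taut iT.
  have H1' : gmass n (e tau (@sample n) i) <= M0 + 1 by apply: le_trans H1 _; rewrite lerD.
  have H2' : gen n (e tau (@sample n) i) <= E0 + 1 by apply: le_trans H2 _; rewrite lerD.
  by have [? ?] := HBS n _ H1' H2'.
have hold i d : (i + d)%:R * tau <= n%:R ->
  gmass n (fun b x => e tau (@sample n) (i + d)%N b x - e tau (@sample n) i b x) <= C * (d%:R * tau).
  move=> iT; rewrite mulrC; apply: euler_holder => // l li.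
  have lT : l%:R * tau <= n%:R by apply: le_trans iT; rewrite ler_pM2r // ler_nat.
  have [K1 K2 K3 _] := key l lT; split => // x; apply: HKF.
  by rewrite sqnorm_ge0 K3.
split.
- by rewrite tau_gt0.
- by move=> j b k kn; rewrite e0 sample_node.
- by [].
- move=> i iT; have [K1 _ _ _] := key i iT.
  by apply: le_trans K1; exact: edge_sum_le_mass.
- by move=> i iT; have [_ K2 _ _] := key i iT; rewrite edge_gradE.
- move=> i iT; have [_ _ H3] := Htau tau i taut iT; apply: le_trans H3.
  rewrite /wmass (sum_gpoint (fun x => gmesh x * (gdist x ^+ 2 * sqnorm _ x))).
  rewrite /= expr0n /= mul0r mulr0 add0r /edge_sum mulr_sumr; apply: ler_sum => j _.
  by rewrite mulr_sumr; apply: ler_sum => k _; rewrite gdist_node.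
- by move=> i j k iT kn; have [_ _ K3 _] := key i iT; exact: K3.
- move=> i iT; have [_ _ K3 K4] := key i iT.
  have T0 : 0%:R * tau <= n%:R by rewrite mul0r.
  have [_ _ K30 _] := key 0%N T0.
  have sG (u : bool -> @gpoint N n -> R) : \sum_x gmesh x * G (sqnorm u x) = h * G (sqnorm u None) +
     edge_sum n (fun j k => G (edge_sqr (fun j b k => u b (node n j k)) j k)).
    rewrite (sum_gpoint (fun x => gmesh x * G (sqnorm u x))); congr (_ + _).
    by rewrite /edge_sum mulr_sumr; apply: eq_bigr => j _; rewrite mulr_sumr.
  move: K4; rewrite /energy !sG !edge_gradE e0.
  have Gb (u : bool -> @gpoint N n -> R) : (forall x, sqnorm u x <= S) -> `|G (sqnorm u None)| <= KG' * S.
    move=> uS; apply: le_trans (HKG' _ _) _; first by rewrite sqnorm_ge0 uS.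
    by rewrite ler_wpM2l.
  have := Gb _ K3; have := Gb _ K30; rewrite e0 !ler_norml => /andP[a1 a2] /andP[a3 a4].
  have b1 : h * G (sqnorm (@sample n) None) <= h * (KG' * S) by rewrite ler_pM2l.
  have b2 : h * - (KG' * S) <= h * G (sqnorm (e tau (@sample n) i) None) by rewrite ler_pM2l.
  have -> : CE * mesh n = h * (KG' * S) * 2 + h by rewrite /CE -/h; ring.
  move=> K4; apply: energy_absorb K4 b1 _; by rewrite -mulrN.
- by move=> i d iT; apply: le_trans (hold i d iT); exact: edge_sum_le_mass.
- move=> i d lam j b k iT lam0 kn.
  apply: le_trans (gagliardo (fun x => e tau (@sample n) (i + d)%N b x - e tau (@sample n) i b x) j kn lam0) _.
  have l20 : 0 <= 1 + 2 / lam by rewrite addr_ge0 // divr_ge0 // ltW.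
  apply: lerD.
    rewrite ler_wpM2l //; apply: le_trans (hold i d iT); rewrite massE2.
    by case: b; rewrite ?lerDl ?lerDr sumr_ge0 // => x _; rewrite mulr_ge0 ?sqr_ge0 // ltW.
  have iT' : i%:R * tau <= n%:R.
    by apply: le_trans iT; rewrite ler_pM2r // ler_nat leq_addr.
  have [_ D1 _ _] := key _ iT; have [_ D2 _ _] := key _ iT'.
  have D3 := dirichletB (@gsrc N n) (@gtgt N n) gc0 (e tau (@sample n) (i + d)%N) (e tau (@sample n) i).
  have D4 : gform n (fun x => e tau (@sample n) (i + d)%N b x - e tau (@sample n) i b x) <=
     gdir n (fun b x => e tau (@sample n) (i + d)%N b x - e tau (@sample n) i b x).
    by rewrite /dirichlet; case: b; rewrite ?lerDl ?lerDr; apply: dform_ge0.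
  have -> : 2 * lam * B0 ^+ 2 = lam / 2 * (4 * B0 ^+ 2) by field.
  by rewrite ler_wpM2l ?divr_ge0 ?(ltW lam0) //; lra.
- move=> i j b k iT kn.
  have := euler_equation (@gmesh R N n) (@gcond R N n) (@gsrc N n) (@gtgt N n) F tau (@sample n) i b (node n j k).
  rewrite (lap_interior _ j kn) -/e => <-.
  by rewrite [RHS]mulrA mesh_sqr mul1r.
- move=> i b iT.
  have := euler_equation (@gmesh R N n) (@gcond R N n) (@gsrc N n) (@gtgt N n) F tau (@sample n) i b None.
  rewrite lap_vertex -/e => <-.
  by rewrite [RHS]mulrA mesh_sqr mul1r.
Qed.

End SchemeExists.

End Scheme.

(** * Passage to the limit *)

Section UniformLimits.
Context {R : realType} {UF : set_system nat} {FF : ProperFilter UF}.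

(** The index type is arbitrary, so that limits of numbers (over [unit]), of functions of x and of
    functions of (t, x) share one calculus. *)
Definition ucv (I : Type) (D : set I) (z : nat -> I -> R) (f : I -> R) : Prop :=
  forall e, 0 < e -> UF [set n | forall i, D i -> `|z n i - f i| <= e].

Lemma near_fin (I : finType) (P : I -> nat -> Prop) :
  (forall i, UF (P i)) -> UF [set n | forall i, P i n].
Proof.
move=> H; suff K (s : seq I) : UF [set n | forall i, i \in s -> P i n].
  by apply: filterS (K (enum I)) => n Hn i; apply: Hn; rewrite mem_enum.
elim: s => [|i s IH]; first by apply: nearW => n.
apply: filterS2 (H i) IH => n Hi Hs k; rewrite inE => /predU1P[->//|]; exact: Hs.
Qed.

Variables (I : Type) (D : set I).
Implicit Types (z w : nat -> I -> R) (f g : I -> R).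

Lemma eq_ucv z w f g : (UF [set n | forall i, D i -> z n i = w n i]) ->
  (forall i, D i -> f i = g i) -> ucv D z f -> ucv D w g.
Proof.
move=> zw fg H e e0; apply: filterS2 zw (H e e0) => n Hn He i Di.
by rewrite -Hn // -fg //; exact: He.
Qed.

Lemma ucv_cst f : ucv D (fun _ => f) f.
Proof. by move=> e e0; apply: nearW => n i _; rewrite subrr normr0 ltW. Qed.

Lemma ucvD z w f g : ucv D z f -> ucv D w g ->
  ucv D (fun n i => z n i + w n i) (fun i => f i + g i).
Proof.
move=> H1 H2 e e0; have e2 : 0 < e / 2 by rewrite divr_gt0.
apply: filterS2 (H1 _ e2) (H2 _ e2) => n h1 h2 i Di.
have -> : z n i + w n i - (f i + g i) = (z n i - f i) + (w n i - g i) by ring.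
by apply: le_trans (ler_normD _ _) _; have := h1 i Di; have := h2 i Di; lra.
Qed.

Lemma ucvZ (k : R) z f : ucv D z f -> ucv D (fun n i => k * z n i) (fun i => k * f i).
Proof.
move=> H e e0; have k0 : 0 < `|k| + 1 by rewrite ltr_wpDl.
apply: filterS (H (e / (`|k| + 1)) (divr_gt0 e0 k0)) => n h i Di.
rewrite -mulrBr normrM; have := h i Di; rewrite ler_pdivlMr // => h'.
apply: le_trans h'; rewrite mulrC ler_wpM2l // lerDl //.
Qed.

Lemma ucvB z w f g : ucv D z f -> ucv D w g ->
  ucv D (fun n i => z n i - w n i) (fun i => f i - g i).
Proof.
move=> H1 H2; have := ucvD H1 (ucvZ (-1) H2).
by apply: eq_ucv => [|i _]; [apply: nearW => n i _|]; rewrite mulN1r.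
Qed.

Lemma ucv_comp (phi : R -> R) (K : R) z f : continuous phi ->
  (forall i, D i -> `|f i| <= K) -> ucv D z f ->
  ucv D (fun n i => phi (z n i)) (fun i => phi (f i)).
Proof.
move=> cphi fK H e e0; have [d d0 Hd] := heine (- K) K cphi e0.
have d2 : 0 < d / 2 by rewrite divr_gt0.
apply: filterS (H _ d2) => n h i Di; rewrite distrC; apply: Hd.
  by rewrite -ler_norml; exact: fK.
by rewrite distrC; apply: le_lt_trans (h i Di) _; rewrite ltr_pdivrMr // ltr_pMr // ltr1n.
Qed.

(** By polarisation a product is a difference of two squares, and squaring preserves uniform
    convergence to a bounded limit. *)
Lemma ucvM (K : R) z w f g : (forall i, D i -> `|f i| <= K) ->
  (forall i, D i -> `|g i| <= K) -> ucv D z f -> ucv D w g ->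
  ucv D (fun n i => z n i * w n i) (fun i => f i * g i).
Proof.
move=> fK gK H1 H2.
have sqc : continuous (fun x : R => x ^+ 2) by apply: continuous_sqr => x; exact: cvg_id.
have P1 := ucv_comp sqc _ (ucvD H1 H2).
have P2 := ucv_comp sqc _ (ucvB H1 H2).
have K1 i : D i -> `|f i + g i| <= K + K.
  by move=> Di; apply: le_trans (ler_normD _ _) _; rewrite lerD ?fK ?gK.
have K2 i : D i -> `|f i - g i| <= K + K.
  by move=> Di; apply: le_trans (ler_normB _ _) _; rewrite lerD ?fK ?gK.
have := ucvZ (4^-1) (ucvB (P1 _ K1) (P2 _ K2)).
by apply: eq_ucv => [|i _]; [apply: nearW => n i _|]; field.
Qed.

Lemma ucv_sum (J : finType) (z : J -> nat -> I -> R) (f : J -> I -> R) :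
  (forall j, ucv D (z j) (f j)) ->
  ucv D (fun n i => \sum_j z j n i) (fun i => \sum_j f j i).
Proof.
move=> H; suff K (s : seq J) : ucv D (fun n i => \sum_(j <- s) z j n i) (fun i => \sum_(j <- s) f j i).
  exact: K.
elim: s => [|j s IH].
  apply: eq_ucv (ucv_cst (fun=> 0)) => [|i _]; last by rewrite big_nil.
  by apply: nearW => n i _; rewrite big_nil.
apply: eq_ucv (ucvD (H j) IH) => [|i _]; last by rewrite big_cons.
by apply: nearW => n i _; rewrite big_cons.
Qed.

Lemma ucv_le z w f g i : D i -> ucv D z f -> ucv D w g ->
  UF [set n | z n i <= w n i] -> f i <= g i.
Proof.
move=> Di Hz Hw H; apply/ler_addgt0Pr => e e0.
have e2 : 0 < e / 2 by rewrite divr_gt0.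
have [n [/= h1 [h2 h3]]] := filter_ex (filterI H (filterI (Hz _ e2) (Hw _ e2))).
by move: (h2 i Di) (h3 i Di); rewrite !ler_norml => /andP[? ?] /andP[? ?]; lra.
Qed.

Lemma ucv_unique z f g : ucv D z f -> ucv D z g -> forall i, D i -> f i = g i.
Proof.
move=> H1 H2 i Di; apply/le_anti; apply/andP; split.
  by apply: (ucv_le Di H1 H2); apply: nearW => n /=; exact: lexx.
by apply: (ucv_le Di H2 H1); apply: nearW => n /=; exact: lexx.
Qed.

(** Riemann sums whose terms are themselves approximate, uniformly in a parameter. The piece beyond
    the last full cell is shorter than [delta n] and costs at most [K * delta n]. *)
Lemma ucv_riemann (Y K : R) (delta : nat -> R) (z : nat -> nat -> I -> R) (f : I -> R -> R) :
  0 <= Y -> (forall n, 0 < delta n) -> (forall e, 0 < e -> UF [set n | delta n < e]) ->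
  (forall i, D i -> continuous (f i)) ->
  (forall i y, D i -> 0 <= y <= Y -> `|f i y| <= K) ->
  (forall e, 0 < e -> exists2 d, 0 < d & forall i x y, D i -> 0 <= x <= Y ->
     `|x - y| < d -> `|f i x - f i y| <= e) ->
  (forall e, 0 < e -> UF [set n | forall i k, D i -> (k < Num.truncn (Y / delta n))%N ->
     exists2 y, k%:R * delta n <= y <= k.+1%:R * delta n & `|z n k i - f i y| <= e]) ->
  ucv D (fun n i => delta n * \sum_(k < Num.truncn (Y / delta n)) z n k i)
        (fun i => itg 0 Y (f i)).
Proof.
move=> Y0 dp d0 cf fK equi Hz e e0.
have K0 i : D i -> 0 <= K.
  by move=> Di; apply: le_trans (fK i 0 Di _); rewrite ?normr_ge0 // lexx.
have Y1 : 0 < 4 * Y + 2 by lra.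
have e1 : 0 < e / (4 * Y + 2) by rewrite divr_gt0.
set e' := e / _ in e1.
have [d dd Hd] := equi _ e1.
have K1 : 0 < `|K| + 1 by rewrite ltr_wpDl.
apply: filterS3 (d0 _ dd) (d0 _ (divr_gt0 e1 K1)) (Hz _ e1) => n nd nK nz i Di.
have dn := dp n; set h := delta n in dn nd nK nz *.
set m := Num.truncn (Y / h) in nz *.
have /andP[m1 m2] : m%:R * h <= Y < m.+1%:R * h.
  have := truncn_itv (divr_ge0 Y0 (ltW dn)); rewrite -/m => /andP[a b].
  by rewrite -ler_pdivlMr // a -ltr_pdivrMr.
have m0 : 0 <= m%:R * h by rewrite mulr_ge0 // ltW.
have H1 : `|h * \sum_(k < m) z n k i - itg 0 (m%:R * h) (f i)| <= 2 * e' * Y.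
  apply: (@riemann_sum_mod R Y (f i) e' d h m (fun k => z n k i)) => //.
  - exact: cf.
  - by apply: ltW.
  - by move=> x y xY; apply: Hd.
  - by rewrite dn.
  - by move=> k km; exact: nz.
have H2 : `|itg 0 (m%:R * h) (f i) - itg 0 Y (f i)| <= e'.
  rewrite (itg_chasles (cf i Di) m0 m1) opprD addrA subrr add0r normrN.
  apply: le_trans (itg_bound (k := K) (cf i Di) m1 _) _.
    by move=> x /andP[x1 x2]; apply: fK => //; rewrite (le_trans m0).
  have : K <= `|K| + 1 by rewrite (le_trans (ler_norm _)) // lerDl.
  have : (`|K| + 1) * h <= e' by rewrite mulrC -ler_pdivlMr // ltW.
  have := K0 i Di; move: m2; rewrite -natr1 mulrDl mul1r; nra.
have -> : h * \sum_(k < m) z n k i - itg 0 Y (f i) =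
  (h * \sum_(k < m) z n k i - itg 0 (m%:R * h) (f i)) +
  (itg 0 (m%:R * h) (f i) - itg 0 Y (f i)) by ring.
apply: le_trans (ler_normD _ _) _.
have -> : e = e' * (4 * Y + 2) by rewrite /e' divfK // gt_eqF.
nra.
Qed.

End UniformLimits.

(** Compactness gives a cluster point, and an ultrafilter converges to each of its cluster points. A
    single ultrafilter thus yields limits of all sample sequences, where subsequences would require
    a diagonal extraction. *)
Lemma ultra_limit {R : realType} (UF : set_system nat) (UU : UltraFilter UF)
    (z : nat -> R) (a : R) : UF [set n | `|z n| <= a] ->
  exists p, forall e, 0 < e -> UF [set n | `|z n - p| <= e].
Proof.
move=> za.
have [p [_ pc]] : `[- a, a]%classic `&` cluster (z @ UF) !=set0.
  apply: segment_compact.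
  change (UF (z @^-1` `[- a, a]%classic)).
  by apply: filterS za => n /=; rewrite in_itv /= ler_norml.
exists p => e e0.
have [//|H] := in_ultra_setVsetC [set n | `|z n - p| <= e] UU.
have nb : nbhs p (ball p e) by exact: nbhsx_ballx.
have [y [/= H1 H2]] := pc (z @` (~` [set n | `|z n - p| <= e])) (ball p e)
   (filterS (@preimage_image _ _ z _) H) nb.
case: H1 => n /= nn ny; exfalso; apply: nn; rewrite ny.
by rewrite distrC ltW.
Qed.

(** * Bounded uniformly continuous functions of time and space *)

Section BoundedUniformlyContinuous.
Context {R : realType}.
Implicit Types f g : R -> R -> R.

(** The condition is on the whole plane, not only on the quadrant: functions are extended constantly
    by [clip], and no continuity statement then has to deal with a boundary. *)
Definition buc f : Prop :=
  (exists K, forall t x, `|f t x| <= K) /\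
  forall e, 0 < e -> exists2 d, 0 < d &
    forall s t x y, `|t - s| < d -> `|x - y| < d -> `|f t x - f s y| <= e.

Lemma buc_cst k : buc (fun _ _ => k).
Proof.
split; first by exists `|k|.
by move=> e e0; exists 1 => // s t x y _ _; rewrite subrr normr0 ltW.
Qed.

Lemma bucD f g : buc f -> buc g -> buc (fun t x => f t x + g t x).
Proof.
move=> [[K fK] cf] [[L gL] cg]; split.
  by exists (K + L) => t x; apply: le_trans (ler_normD _ _) _; exact: lerD.
move=> e e0; have e2 : 0 < e / 2 by rewrite divr_gt0.
have [d d0 H1] := cf _ e2; have [d' d'0 H2] := cg _ e2.
exists (Num.min d d'); first by rewrite lt_min d0.
move=> s t x y; rewrite !lt_min => /andP[a b] /andP[p q].
have -> : f t x + g t x - (f s y + g s y) = (f t x - f s y) + (g t x - g s y) by ring.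
apply: le_trans (ler_normD _ _) _; have := H1 s t x y a p; have := H2 s t x y b q; lra.
Qed.

Lemma bucM f g : buc f -> buc g -> buc (fun t x => f t x * g t x).
Proof.
move=> [[K fK] cf] [[L gL] cg]; split.
  by exists (K * L) => t x; rewrite normrM ler_pM.
move=> e e0; have K0 : 0 <= K by apply: le_trans (fK 0 0).
have L0 : 0 <= L by apply: le_trans (gL 0 0).
have k0 : 0 < K + L + 1 by lra.
have e2 : 0 < e / (K + L + 1) by rewrite divr_gt0.
have [d d0 H1] := cf _ e2; have [d' d'0 H2] := cg _ e2.
exists (Num.min d d'); first by rewrite lt_min d0.
move=> s t x y; rewrite !lt_min => /andP[a b] /andP[p q].
have -> : f t x * g t x - f s y * g s y =
  f t x * (g t x - g s y) + (f t x - f s y) * g s y by ring.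
apply: le_trans (ler_normD _ _) _; rewrite !normrM.
have -> : e = K * (e / (K + L + 1)) + (e / (K + L + 1)) * L + e / (K + L + 1).
  by field; rewrite gt_eqF.
apply: ler_wpDr; first exact: ltW.
by apply: lerD; apply: ler_pM => //; [exact: H2|exact: H1].
Qed.

Lemma bucZ k f : buc f -> buc (fun t x => k * f t x).
Proof. by apply: bucM; exact: buc_cst. Qed.

Lemma bucB f g : buc f -> buc g -> buc (fun t x => f t x - g t x).
Proof.
move=> hf hg; have := bucD hf (bucZ (-1) hg).
by congr buc; apply/funext => t; apply/funext => x; rewrite mulN1r.
Qed.

Lemma buc_sqr f : buc f -> buc (fun t x => f t x ^+ 2).
Proof. by move=> hf; exact: bucM. Qed.

Lemma buc_comp (phi : R -> R) f : continuous phi -> buc f -> buc (fun t x => phi (f t x)).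
Proof.
move=> cphi [[K fK] cf].
have fK' t x : - K <= f t x <= K by rewrite -ler_norml.
split.
  have [M _ HM] := cont_bounded (- K) K cphi.
  by exists M => t x; exact: HM.
move=> e e0; have [d d0 Hd] := heine (- K) K cphi e0.
have [d' d'0 H] := cf (d / 2) (divr_gt0 d0 (ltr0n _ 2)).
exists d' => // s t x y h1 h2; apply: Hd => //.
apply: le_lt_trans (H s t x y h1 h2) _.
by rewrite ltr_pdivrMr // ltr_pMr // ltr1n.
Qed.

Lemma modulus_continuous (phi : R -> R) :
  (forall e, 0 < e -> exists2 d, 0 < d & forall x y, `|x - y| < d -> `|phi x - phi y| <= e) ->
  continuous phi.
Proof.
move=> H x; apply/cvgrPdist_le => /= e e0; have [d d0 Hd] := H e e0.
by exists d => //= y xy; exact: Hd.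
Qed.

Lemma buc_contx f t : buc f -> continuous (f t).
Proof.
move=> [_ cf]; apply: modulus_continuous => e e0; have [d d0 H] := cf e e0.
by exists d => // x y xy; apply: H => //; rewrite subrr normr0.
Qed.

Lemma buc_contt f x : buc f -> continuous (fun t => f t x).
Proof.
move=> [_ cf]; apply: modulus_continuous => e e0; have [d d0 H] := cf e e0.
by exists d => // t s ts; apply: H => //; rewrite subrr normr0.
Qed.

Lemma buc_itg_cont f a b : a <= b -> buc f -> continuous (fun x => itg a b (fun s => f s x)).
Proof.
move=> ab hf; have [_ cf] := hf; apply: modulus_continuous => e e0.
have ab1 : 0 < b - a + 1 by lra.
have [d d0 H] := cf (e / (b - a + 1)) (divr_gt0 e0 ab1).
exists d => // x y xy; rewrite -itgB; [|exact: buc_contt|exact: buc_contt].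
apply: le_trans (itg_bound (k := e / (b - a + 1)) _ ab _) _.
- by apply: contB; exact: buc_contt.
- by move=> s _; apply: H => //; rewrite subrr normr0.
- by rewrite mulrAC ler_pdivrMr // ler_wpM2l ?(ltW e0) //; lra.
Qed.

Definition clip (x : R) : R := Num.max x 0.

Lemma clip_ge0 x : 0 <= clip x. Proof. by rewrite /clip le_max lexx orbT. Qed.

Lemma clipE x : 0 <= x -> clip x = x. Proof. by move=> x0; rewrite /clip max_l. Qed.

Lemma clip_lip x y : `|clip x - clip y| <= `|x - y|.
Proof.
rewrite /clip; have [x0|x0] := leP x 0; have [y0|y0] := leP y 0 => //.
- by rewrite subrr normr0.
- by rewrite sub0r normrN gtr0_norm // ler_normr; apply/orP; right; lra.
- by rewrite subr0 gtr0_norm // ler_normr; apply/orP; left; lra.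
Qed.

End BoundedUniformlyContinuous.

Lemma ucv_reindex {R : realType} (UF : set_system nat) {FF : ProperFilter UF} (I J : Type)
    (D : set I) (D' : set J) (r : J -> I) (z : nat -> I -> R) f :
  (forall j, D' j -> D (r j)) -> ucv (UF := UF) D z f ->
  ucv (UF := UF) D' (fun n j => z n (r j)) (fun j => f (r j)).
Proof.
by move=> Dr H e e0; apply: filterS (H e e0) => n Hn j Dj; apply: Hn; exact: Dr.
Qed.

(** * Energies and the integrated equation on the edges *)

Section EdgeFunctionals.
Context {R : realType} {N : nat}.
Implicit Types f : 'I_N.+1 -> bool -> R -> R.

Definition edge_sq f j (x : R) : R := f j true x ^+ 2 + f j false x ^+ 2.

Definition grad_energy f m : R :=
  \sum_j (dyadic_energy (f j true) m + dyadic_energy (f j false) m).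

Definition pot_energy (G : R -> R) (Y : R) f : R :=
  \sum_j itg 0 Y (fun x => G (edge_sq f j x)).

(** The second space derivative of the time integral of [u], as read off the integrated equation:
    the integral of F(|u|^2) u minus i (u(t) - u(0)), component by component. *)
Definition mild_source (F : R -> R) (u : R -> 'I_N.+1 -> bool -> R -> R) t j b x : R :=
  itg 0 t (fun s => F (edge_sq (u s) j x) * u s j b x) +
  sgb b * (u t j (~~ b) x - u 0 j (~~ b) x).

(* The real form, with [b = true] for real and [b = false] for imaginary parts,
   of the equation integrated over [0, t]: the function U = int_0^t u solves
   U'' = mild_source on every edge with slopes d at the vertex. *)
Record mild (F : R -> R) (T : R) (u : R -> 'I_N.+1 -> bool -> R -> R) : Prop := {
  mild_buc : forall j b, buc (fun t x => u t j b x);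
  mild_grad : exists B, forall t m, 0 <= t <= T -> grad_energy (u t) m <= B;
  mild_vertex : forall t j j' b, 0 <= t <= T -> u t j b 0 = u t j' b 0;
  mild_eq : forall t b, 0 <= t <= T -> exists d : 'I_N.+1 -> R, \sum_j d j = 0 /\
    forall j x, 0 <= x -> itg 0 t (fun s => u s j b x) =
      itg 0 t (fun s => u s j b 0) + d j * x +
      itg 0 x (fun y => (x - y) * mild_source F u t j b y) }.

End EdgeFunctionals.

(** Taylor's formula with remainder for second differences. The sum includes [l = 0], where the
    recurrence is not assumed; the term [- c * g 0] in the slope compensates for it. *)
Lemma solve_recurrence {R : comNzRingType} (V g : nat -> R) (c : R) K :
  (forall k, (0 < k < K)%N -> V k.+1 - 2 * V k + V k.-1 = c * g k) ->
  forall k, (k <= K)%N ->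
    V k = V 0%N + k%:R * (V 1%N - V 0%N - c * g 0%N) + c * \sum_(l < k) (k%:R - l%:R) * g l.
Proof.
move=> H.
have dV k : (k < K)%N -> V k.+1 - V k = V 1%N - V 0%N - c * g 0%N + c * \sum_(l < k.+1) g l.
  elim: k => [_|k IH kK]; first by rewrite big_ord1; ring.
  have := H k.+1 kK; have := IH (ltnW kK).
  move=> E2 E1; rewrite big_ord_recr /= mulrDr -E1 addrA -E2 /=; ring.
elim=> [_|k IH kK]; first by rewrite big_ord0; ring.
have -> : V k.+1 = V k + (V k.+1 - V k) by ring.
rewrite (dV k kK) (IH (ltnW kK)).
have -> : \sum_(l < k.+1) (k.+1%:R - l%:R) * g l =
  \sum_(l < k) (k%:R - l%:R) * g l + \sum_(l < k.+1) g l.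
  rewrite !big_ord_recr /= [in RHS]addrA -big_split /=; congr (_ + _).
    by apply: eq_bigr => l _; rewrite -natr1; ring.
  by rewrite -natr1; ring.
by rewrite -natr1; ring.
Qed.

Lemma ucv_pt {R : realType} (UF : set_system nat) {FF : ProperFilter UF} (I : Type)
    (D : set I) (z : nat -> I -> R) f i : D i ->
  ucv (UF := UF) D z f -> ucv (UF := UF) [set: unit] (fun n _ => z n i) (fun _ => f i).
Proof. by move=> Di H e e0; apply: filterS (H e e0) => n Hn _ _; exact: Hn. Qed.

Lemma ucv_sqr {R : realType} (UF : set_system nat) {FF : ProperFilter UF} (I : Type)
    (D : set I) (K : R) (z : nat -> I -> R) f : (forall i, D i -> `|f i| <= K) ->
  ucv (UF := UF) D z f -> ucv (UF := UF) D (fun n i => z n i ^+ 2) (fun i => f i ^+ 2).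
Proof. by move=> fK H; exact: (ucvM fK fK H H). Qed.

(** * The limit of the discrete solutions *)

Section Limit.
Context {R : realType} {N : nat}.
Variables (F G : R -> R) (u0 : 'I_N.+1 -> bool -> R -> R) (M B S A kap C CE : R).
Variables (tau : nat -> R) (U : nat -> nat -> 'I_N.+1 -> bool -> nat -> R).
Hypothesis sch : forall n, scheme F G u0 M B S A kap C CE n (tau n) (U n).
Hypotheses (B0 : 0 <= B) (S0 : 0 <= S) (C0 : 0 <= C).
Notation mesh := (@mesh R).
Implicit Types (n k : nat) (j : 'I_N.+1) (b : bool) (t s x y e : R).

Definition it n t : nat := Num.truncn (t / tau n).
(** The minimum freezes the sampled functions at their last value beyond the far end of the grid. *)
Definition kx n x : nat := minn (tr n x) (4 ^ n).
Definition samp n j b (p : R * R) : R := U n (it n p.1) j b (kx n p.2).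

Lemma tau_gt0 n : 0 < tau n. Proof. by case/andP: (sch_tau (sch n)). Qed.

Lemma tau_le n : tau n <= mesh n. Proof. by case/andP: (sch_tau (sch n)). Qed.

Lemma itP n t : 0 <= t -> (it n t)%:R * tau n <= t < (it n t).+1%:R * tau n.
Proof.
move=> t0; have d0 := tau_gt0 n.
have := truncn_itv (divr_ge0 t0 (ltW d0)).
by rewrite -/(it n t) ler_pdivlMr // ltr_pdivrMr.
Qed.

Lemma it_le n t T : 0 <= t <= T -> (it n t)%:R * tau n <= T.
Proof. by case/andP=> t0 tT; apply: le_trans tT; case/andP: (itP n t0). Qed.

Lemma kx_le n x : (kx n x <= 4 ^ n)%N. Proof. exact: geq_minr. Qed.

Lemma kx_incr n x y : 0 <= x -> x <= y ->
  (kx n x <= kx n y)%N /\ (kx n y - kx n x)%N%:R * mesh n <= y - x + mesh n.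
Proof.
move=> x0 xy; have h0 := mesh_gt0 (R := R) n.
have ml : (kx n x <= kx n y)%N.
  rewrite /kx leq_min geq_minr andbT (leq_trans (geq_minl _ _)) //.
  by apply: le_truncn; rewrite ler_wpM2r ?exprn_ge0.
split=> //; have [kx4|kx4] := leqP (4 ^ n) (tr n x).
  have -> : kx n x = (4 ^ n)%N by exact/minn_idPr.
  have /eqP -> : (kx n y - 4 ^ n == 0)%N by rewrite subn_eq0 kx_le.
  by rewrite mul0r addr_ge0 ?subr_ge0 // ltW.
have /andP[a1 a2] := trP n x0; have /andP[b1 b2] := trP n (le_trans x0 xy).
have H : (kx n y)%:R * mesh n <= y.
  by apply: le_trans b1; rewrite ler_wpM2r ?ler_nat ?geq_minl // ltW.
have E : kx n x = tr n x by apply/minn_idPl/ltnW.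
rewrite natrB -?E // mulrBl E; move: a2; rewrite succ_mesh; lra.
Qed.

(** Hoelder continuity of exponent 1/2 in space, stated with a free Young parameter instead of a
    square root. *)
Lemma edge_diff n (V : 'I_N.+1 -> bool -> nat -> R) (lam : R) j b k d : 0 < lam ->
  (k + d <= 4 ^ n)%N ->
  `|V j b (k + d)%N - V j b k| <= lam * edge_grad n V + d%:R * mesh n / lam.
Proof.
move=> l0 kd.
have -> : V j b (k + d)%N - V j b k = \sum_(i < d) (V j b (k + i).+1 - V j b (k + i)%N).
  elim: d {kd} => [|d IH]; first by rewrite addn0 subrr big_ord0.
  by rewrite big_ord_recr /= -IH addnS; ring.
apply: le_trans (ler_norm_sum _ _ _) _.
have p0 : 0 < 2 ^+ n :> R by rewrite exprn_gt0.
apply: (@le_trans _ _ (\sum_(i < d) (lam * (2 ^+ n * (V j b (k + i).+1 - V j b (k + i)%N) ^+ 2) + mesh n / lam))).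
  apply: ler_sum => i _; set z := V j b _ - _.
  rewrite /mesh -invfM; set q := 2 ^+ n in p0 *.
  have lq : 0 < q * lam by rewrite mulr_gt0.
  have H : 2 * (q * lam) * `|z| <= (q * lam) ^+ 2 * `|z| ^+ 2 + 1.
    by have := sqr_ge0 (q * lam * `|z| - 1); rewrite sqrrB1 exprMn; lra.
  have zz := normr_ge0 z; rewrite -(real_normK (num_real z)).
  rewrite -(ler_pM2l lq) mulrDr mulfV ?gt_eqF //.
  have := mulr_ge0 (ltW lq) zz; move: H; rewrite expr2; lra.
rewrite big_split /= sumr_const card_ord -[_ *+ d]mulr_natl mulrA -!mulr_sumr.
apply: lerD => //; rewrite ler_pM2l // /edge_grad ler_pM2l //.
rewrite (bigD1 j) //=; apply: ler_wpDr.
  by apply: sumr_ge0 => j' _; apply: sumr_ge0 => i _; rewrite addr_ge0 ?sqr_ge0.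
pose g i := (V j b i.+1 - V j b i) ^+ 2.
apply: (@le_trans _ _ (\sum_(i < 4 ^ n) g i)).
  have g0 (m : nat) (h : nat -> nat) : 0 <= \sum_(i < m) g (h i) by apply: sumr_ge0 => i _; exact: sqr_ge0.
  rewrite -(subnKC kd) big_split_ord /=; apply: ler_wpDr; first exact: (g0 _ (addn (k + d)%N)).
  by rewrite big_split_ord /=; apply: ler_wpDl; first exact: (g0 _ id).
apply: ler_sum => i _; rewrite /g; case: (b) => //=; last by rewrite lerDr sqr_ge0.
by rewrite lerDl sqr_ge0.
Qed.

(** Equicontinuity can only hold from some level on, since the samples jump between time steps. The
    Young parameter makes the gradient term at most e^2 / 2, and the time shift then makes the mass
    term at most e^2 / 2. *)
Lemma samp_time e : 0 < e -> exists d n0, 0 < d /\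
  forall n t s j b k, (n0 <= n)%N -> 0 <= t <= n%:R -> 0 <= s <= n%:R -> `|t - s| < d ->
  (k <= 4 ^ n)%N -> `|U n (it n t) j b k - U n (it n s) j b k| <= e.
Proof.
move=> e0; pose lam := e ^+ 2 / (4 * (B + 1)).
have B1 : 0 < B + 1 by move: B0; lra.
have e2 : 0 < e ^+ 2 by rewrite exprn_gt0.
have l0 : 0 < lam by rewrite divr_gt0 // mulr_gt0.
pose K := (1 + 2 / lam) * C.
have K0 : 0 <= K by rewrite mulr_ge0 // addr_ge0 // divr_ge0 // ltW.
pose d := e ^+ 2 / (4 * (K + 1)).
have K1 : 0 < K + 1 by lra.
have d0 : 0 < d by rewrite divr_gt0 // mulr_gt0.
have [n0 Hn0] := mesh_small d0.
exists d, n0; split=> // n t s j b k nn tn sn ts k4.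
wlog st : t s tn sn ts / s <= t.
  move=> H; have [st|/ltW ts'] := leP s t; first exact: H.
  by rewrite distrC; apply: H => //; rewrite distrC.
have [t0 _] := andP tn; have [s0 _] := andP sn.
have /andP[a1 a2] := itP n t0; have /andP[b1 b2] := itP n s0.
have ml : (it n s <= it n t)%N.
  by apply: le_truncn; rewrite ler_wpM2r // invr_ge0 ltW // tau_gt0.
have {a1 a2 b1 b2}: (it n t - it n s)%N%:R * tau n <= 2 * d.
  rewrite natrB // mulrBl; move: ts b2; rewrite ger0_norm ?subr_ge0 // -natr1 mulrDl mul1r.
  by have := Hn0 n nn; have := tau_le n; lra.
have := @sch_holder_sup _ _ _ _ _ _ _ _ _ _ _ _ _ _ _ (sch n) (it n s) (it n t - it n s)%N lam j b k.
rewrite subnKC // => /(_ (it_le n tn) l0 k4) H D.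
rewrite -(ler_pXn2r (n := 2)) ?nnegrE ?(ltW e0) // real_normK ?num_real //.
apply: le_trans H _.
have E1 : 2 * lam * B <= e ^+ 2 / 2.
  rewrite /lam; have -> : 2 * (e ^+ 2 / (4 * (B + 1))) * B = e ^+ 2 / 2 * (B / (B + 1)) by field; lra.
  by rewrite ler_piMr ?divr_ge0 ?(ltW e2) // ler_pdivrMr // mul1r; lra.
have E2 : K * (2 * d) <= e ^+ 2 / 2.
  rewrite /d; have -> : K * (2 * (e ^+ 2 / (4 * (K + 1)))) = e ^+ 2 / 2 * (K / (K + 1)) by field; lra.
  by rewrite ler_piMr ?divr_ge0 ?(ltW e2) // ler_pdivrMr // mul1r; lra.
have := ler_wpM2l K0 D; have -> : (1 + 2 / lam) * (C * ((it n t - it n s)%:R * tau n)) =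
  K * ((it n t - it n s)%:R * tau n) by rewrite /K; ring.
lra.
Qed.

Lemma samp_space e : 0 < e -> exists d n0, 0 < d /\
  forall n i x y j b, (n0 <= n)%N -> i%:R * tau n <= n%:R -> 0 <= x -> 0 <= y -> `|x - y| < d ->
  `|U n i j b (kx n x) - U n i j b (kx n y)| <= e.
Proof.
move=> e0; have B1 : 0 < B + 1 by move: B0; lra.
pose lam := e / (2 * (B + 1)).
have l0 : 0 < lam by rewrite divr_gt0 // mulr_gt0.
pose d := lam * e / 4; have d0 : 0 < d by rewrite divr_gt0 // mulr_gt0.
have [n0 Hn0] := mesh_small d0.
exists d, n0; split=> // n i x y j b nn ii x0 y0 xy.
wlog yx : x y x0 y0 xy / y <= x.
  move=> H; have [st|/ltW ts'] := leP y x; first exact: H.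
  by rewrite distrC; apply: H => //; rewrite distrC.
have [H1 H2] := kx_incr n y0 yx.
have k4 : (kx n y + (kx n x - kx n y) <= 4 ^ n)%N by rewrite subnKC // kx_le.
have := edge_diff (U n i) j b l0 k4; rewrite subnKC // => H.
apply: le_trans H _.
have E1 : lam * edge_grad n (U n i) <= e / 2.
  apply: (@le_trans _ _ (lam * B)); first by rewrite ler_wpM2l ?(ltW l0) // (sch_grad (sch n)).
  rewrite /lam; have -> : e / (2 * (B + 1)) * B = e / 2 * (B / (B + 1)) by field; lra.
  by rewrite ler_piMr ?divr_ge0 ?(ltW e0) // ler_pdivrMr // mul1r; lra.
have E2 : (kx n x - kx n y)%N%:R * mesh n / lam <= e / 2.
  rewrite ler_pdivrMr //; apply: le_trans H2 _.
  by move: xy (Hn0 n nn); rewrite ger0_norm ?subr_ge0 // /d; lra.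
lra.
Qed.

Variable UF : set_system nat.
Context {UU : UltraFilter UF}.
Hypothesis Uoo : \oo `<=` UF.

Lemma UF_ge m : UF [set n | (m <= n)%N].
Proof. by apply: Uoo; exists m. Qed.

Lemma UF_real (T : R) : UF [set n | T <= n%:R].
Proof.
apply: filterS (UF_ge (Num.truncn T).+1) => n /= H.
by apply: le_trans (ltW (truncnS_gt T)) _; rewrite ler_nat.
Qed.

Lemma UF_mesh e : 0 < e -> UF [set n | mesh n < e].
Proof. by move=> e0; have [n0 H] := mesh_small e0; apply: filterS (UF_ge n0) => n; exact: H. Qed.

Lemma UF_tau e : 0 < e -> UF [set n | tau n < e].
Proof.
by move=> e0; apply: filterS (UF_mesh e0) => n; apply: le_lt_trans (tau_le n).
Qed.

Lemma samp_sqr n j t x : 0 <= t <= n%:R ->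
  samp n j true (t, x) ^+ 2 + samp n j false (t, x) ^+ 2 <= S.
Proof. by move=> tn; apply: (sch_sup (sch n)); [exact: it_le|exact: kx_le]. Qed.

Lemma samp_le n j b t x : 0 <= t <= n%:R -> `|samp n j b (t, x)| <= 1 + S.
Proof.
move=> /(samp_sqr j x) H.
have: `|samp n j b (t, x)| ^+ 2 <= S.
  rewrite real_normK ?num_real //; case: b; apply: le_trans H; first by rewrite lerDl sqr_ge0.
  by rewrite lerDr sqr_ge0.
by have := sqr_ge0 (`|samp n j b (t, x)| - 1); rewrite sqrrB1; move: S0; lra.
Qed.

(** The default value 0 does not occur: bounded samples have a limit along the ultrafilter. Through
    [clip] the limit is defined on the whole plane. *)
Definition ulim t j b x : R :=
  xget 0 [set p | forall e, 0 < e -> UF [set n | `|samp n j b (clip t, clip x) - p| <= e]].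

Lemma ulimP t j b x e : 0 < e ->
  UF [set n | `|samp n j b (clip t, clip x) - ulim t j b x| <= e].
Proof.
move=> e0; rewrite /ulim.
have [p Hp] : exists p, forall e, 0 < e -> UF [set n | `|samp n j b (clip t, clip x) - p| <= e].
  apply: (@ultra_limit _ _ UU _ (1 + S)); apply: filterS (UF_real (clip t)) => n /= H.
  by apply: samp_le; rewrite clip_ge0.
exact: (@xgetPex _ 0 [set p | forall e, 0 < e -> UF [set n | `|samp n j b (clip t, clip x) - p| <= e]]
  (ex_intro _ p Hp)) e e0.
Qed.

Lemma samp_equi e : 0 < e -> exists d n0, 0 < d /\
  forall n t s x y j b, (n0 <= n)%N -> 0 <= t <= n%:R -> 0 <= s <= n%:R -> 0 <= x -> 0 <= y ->
   `|t - s| < d -> `|x - y| < d -> `|samp n j b (t, x) - samp n j b (s, y)| <= e.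
Proof.
move=> e0; have e2 : 0 < e / 2 by rewrite divr_gt0.
have [d1 [n1 [d10 H1]]] := samp_time e2; have [d2 [n2 [d20 H2]]] := samp_space e2.
exists (Num.min d1 d2), (maxn n1 n2); split; first by rewrite lt_min d10.
move=> n t s x y j b; rewrite geq_max => /andP[a1 a2] tn sn x0 y0.
rewrite !lt_min => /andP[b1 _] /andP[_ b2].
have := H1 n t s j b (kx n x) a1 tn sn b1 (kx_le n x).
have := H2 n (it n s) x y j b a2 (it_le n sn) x0 y0 b2.
rewrite /samp /=; set p := U _ _ _ _ _; set q := U _ _ _ _ _; set r := U _ _ _ _ _ => G1 G2.
have -> : r - q = (r - p) + (p - q) by ring.
by apply: le_trans (ler_normD _ _) _; lra.
Qed.

Lemma ulim_equi e : 0 < e -> exists2 d, 0 < d &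
  forall t s x y j b, `|t - s| < d -> `|x - y| < d -> `|ulim t j b x - ulim s j b y| <= e.
Proof.
move=> e0; have e3 : 0 < e / 3 by rewrite divr_gt0.
have [d [n0 [d0 H]]] := samp_equi e3; exists d => // t s x y j b ts xy.
have [n [/= P1 [P2 [P3 [P4 P5]]]]] := filter_ex (filterI (ulimP t j b x e3)
  (filterI (ulimP s j b y e3) (filterI (UF_ge n0) (filterI (UF_real (clip t)) (UF_real (clip s)))))).
have := H n (clip t) (clip s) (clip x) (clip y) j b P3 _ _ (clip_ge0 _) (clip_ge0 _) _ _.
rewrite !clip_ge0 P4 P5 !(le_lt_trans (clip_lip _ _)) // => /(_ isT isT isT isT).
move: P1 P2; set p := samp _ _ _ _; set q := samp _ _ _ _; rewrite !ler_norml; lra.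
Qed.

Lemma ulim_le t j b x : `|ulim t j b x| <= 1 + S.
Proof.
apply/ler_addgt0Pr => e e0.
have [n [/= P1 P2]] := filter_ex (filterI (ulimP t j b x e0) (UF_real (clip t))).
have := @samp_le n j b (clip t) (clip x); rewrite clip_ge0 P2 => /(_ isT).
move: P1; set p := samp _ _ _ _; rewrite !ler_norml; lra.
Qed.

Lemma ulim_buc j b : buc (fun t x => ulim t j b x).
Proof.
split; first by exists (1 + S) => t x; exact: ulim_le.
by move=> e e0; have [d d0 H] := ulim_equi e0; exists d => // s t x y; exact: H.
Qed.

(** Convergence holds simultaneously on a finite net of the rectangle, and the equicontinuity of
    samples and limit spreads it to all points. *)
Lemma ulim_ucv T Y j b :
  ucv (UF := UF) [set p : R * R | 0 <= p.1 <= T /\ 0 <= p.2 <= Y]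
    (fun n p => samp n j b p) (fun p => ulim p.1 j b p.2).
Proof.
move=> e e0; have e3 : 0 < e / 3 by rewrite divr_gt0.
have [d1 [n0 [d10 H1]]] := samp_equi e3.
have [d2 d20 H2] := ulim_equi e3.
pose d := Num.min d1 d2 / 2.
have d0 : 0 < d by rewrite divr_gt0 // lt_min d10.
have [dd1 dd2] : d < d1 /\ d < d2.
  have : Num.min d1 d2 <= d1 by rewrite ge_min lexx.
  have : Num.min d1 d2 <= d2 by rewrite ge_min lexx orbT.
  by rewrite /d in d0 *; lra.
pose K z := (Num.truncn (z / d)).+1.
have net : UF [set n | forall ik : 'I_(K T) * 'I_(K Y),
    `|samp n j b (ik.1%:R * d, ik.2%:R * d) - ulim (ik.1%:R * d) j b (ik.2%:R * d)| <= e / 3].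
  apply: (near_fin (FF := _)) => ik.
  have := ulimP (ik.1%:R * d) j b (ik.2%:R * d) e3.
  by rewrite !clipE // mulr_ge0 // ltW.
apply: filterS (filterI net (filterI (UF_ge n0) (UF_real T))) => n [/= Hnet [nn nT]].
move=> [t x] [/= /andP[t0 tT] /andP[x0 xY]].
have grid z Z : 0 <= z -> z <= Z -> exists2 i : 'I_(K Z), i%:R * d <= z & `|z - i%:R * d| < d.
  move=> z0 zZ; have /andP[g1 g2] := truncn_itv (divr_ge0 z0 (ltW d0)).
  have iK : (Num.truncn (z / d) < K Z)%N.
    by rewrite ltnS le_truncn // ler_pM2r ?invr_gt0.
  exists (Ordinal iK) => /=; first by rewrite -ler_pdivlMr.
  move: g1 g2; rewrite ler_pdivlMr // ltr_pdivrMr // -natr1 mulrDl mul1r => g1 g2.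
  by rewrite ger0_norm; lra.
have [i i1 i2] := grid t T t0 tT; have [k k1 k2] := grid x Y x0 xY.
have Q1 := Hnet (i, k); rewrite /= in Q1.
have ip : 0 <= i%:R * d by rewrite mulr_ge0 // ltW.
have kp : 0 <= k%:R * d by rewrite mulr_ge0 // ltW.
have Q2 : `|samp n j b (t, x) - samp n j b (i%:R * d, k%:R * d)| <= e / 3.
  apply: H1 => //; rewrite ?t0 ?ip /=.
  - exact: le_trans tT nT.
  - exact: le_trans i1 (le_trans tT nT).
  - exact: lt_trans dd1.
  - exact: lt_trans dd1.
have Q3 : `|ulim t j b x - ulim (i%:R * d) j b (k%:R * d)| <= e / 3.
  by apply: H2; [exact: lt_trans dd2|exact: lt_trans dd2].
move: Q1 Q2 Q3; set p := samp _ _ _ _; set q := samp _ _ _ _.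
set p' := ulim _ _ _ _; set q' := ulim _ _ _ _; rewrite !ler_norml; lra.
Qed.

Lemma kx_tr n x : 0 <= x <= 2 ^+ n -> kx n x = tr n x.
Proof.
case/andP=> x0 xn; apply/minn_idPl.
have /andP[H _] := trP n x0.
have := le_trans H xn; rewrite -mesh4 ler_pM2r ?mesh_gt0 // ler_nat //.
Qed.

Lemma kx_near n x : 0 <= x <= 2 ^+ n ->
  (kx n x)%:R * mesh n <= x < (kx n x)%:R * mesh n + mesh n.
Proof.
by move=> H; rewrite kx_tr // -succ_mesh; apply: trP; case/andP: H.
Qed.

Lemma tr_grid n k : tr n (k%:R * mesh n) = k.
Proof. by apply: tr_def; rewrite lexx lt_mesh. Qed.

Lemma samp_grid n j b t k : (k <= 4 ^ n)%N -> samp n j b (t, k%:R * mesh n) = U n (it n t) j b k.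
Proof. by move=> k4; rewrite /samp /kx /= tr_grid (minn_idPl k4). Qed.

Lemma it_grid n l : it n (l%:R * tau n) = l.
Proof. by rewrite /it mulfK ?natrK // gt_eqF // tau_gt0. Qed.

Lemma UF_pow (T : R) : UF [set n | T <= 2 ^+ n].
Proof.
apply: filterS (UF_real T) => n /= H; apply: le_trans H _.
by rewrite -natrX ler_nat ltnW // ltn_expl.
Qed.

Lemma samp_ucv t Y j b : 0 <= t ->
  ucv (UF := UF) [set x | 0 <= x <= Y] (fun n x => samp n j b (t, x)) (ulim t j b).
Proof.
move=> t0; apply: (@ucv_reindex _ UF _ _ _ _ _ (fun x => (t, x)) _ _ _ (@ulim_ucv t Y j b)) => x /= xY.
by rewrite lexx t0.
Qed.

Lemma ulim_init j b x : continuous (u0 j b) -> 0 <= x -> ulim 0 j b x = u0 j b x.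
Proof.
move=> cu x0.
have Dx : [set y : R | 0 <= y <= x] x by rewrite /= x0 lexx.
pose proof (ucv_pt Dx (@samp_ucv 0 x j b (lexx 0))) as H1.
have H2 : ucv (UF := UF) [set: unit] (fun n _ => samp n j b (0, x)) (fun=> u0 j b x).
  move=> e e0; have [d d0 Hd] := heine x x cu e0.
  apply: filterS2 (UF_pow x) (UF_mesh d0) => n xn nd _ _.
  rewrite /samp /it /= mul0r truncn0 (sch_init (sch n)) ?kx_le // distrC; apply: Hd.
    by rewrite lexx.
  have := @kx_near n x; rewrite x0 xn => /(_ isT) /andP[a1 a2].
  by rewrite ger0_norm ?subr_ge0 //; move: nd a2 => /=; lra.
exact: (@ucv_unique _ _ _ _ _ _ _ _ H1 H2 tt).
Qed.

Lemma ulim_vertex t j j' b : 0 <= t -> ulim t j b 0 = ulim t j' b 0.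
Proof.
move=> t0; have D : [set x : R | 0 <= x <= 0] 0 by rewrite /= lexx.
have H1 := @samp_ucv t 0 j b t0; have H2 := @samp_ucv t 0 j' b t0.
apply: (ucv_unique _ H2 D); apply: eq_ucv H1 => //; apply: nearW => n x /= x0.
have -> : x = 0 by apply/le_anti; rewrite andbC.
by rewrite /samp /kx /tr mul0r truncn0 min0n (sch_vertex (sch n) _ j j').
Qed.

Lemma sq_ucv t Y j : 0 <= t ->
  ucv (UF := UF) [set x | 0 <= x <= Y]
    (fun n x => edge_sq (fun j b x => samp n j b (t, x)) j x) (edge_sq (ulim t) j).
Proof.
move=> t0; by apply: ucvD; apply: (ucv_sqr (K := 1 + S)); try exact: samp_ucv; move=> x _; exact: ulim_le.
Qed.

Lemma ulim_sqr t j x : 0 <= t -> 0 <= x -> edge_sq (ulim t) j x <= S.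
Proof.
move=> t0 x0; have D : [set y : R | 0 <= y <= x] x by rewrite /= x0 lexx.
apply: (ucv_le D (@sq_ucv t x j t0) (@ucv_cst _ _ _ _ _ (fun=> S))).
apply: filterS (UF_real t) => n /= tn; apply: samp_sqr; by rewrite t0.
Qed.

Lemma samp_energy n t :
  grad_energy (fun j b x => samp n j b (t, x)) n = edge_grad n (U n (it n t)).
Proof.
rewrite /edge_grad mulr_sumr; apply: eq_bigr => j _.
rewrite /dyadic_energy -mulrDr -big_split /=; congr (_ * _); apply: eq_bigr => k _.
by rewrite !samp_grid // ltnW.
Qed.

Lemma grad_energy_nondec (f : 'I_N.+1 -> bool -> R -> R) :
  {homo grad_energy f : m n / (m <= n)%N >-> m <= n}.
Proof. by move=> m n mn; apply: ler_sum => j _; rewrite lerD // dyadic_energy_nondec. Qed.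

Lemma grad_ucv t m : 0 <= t -> ucv (UF := UF) [set: unit]
  (fun n _ => grad_energy (fun j b x => samp n j b (t, x)) m) (fun _ => grad_energy (ulim t) m).
Proof.
move=> t0.
have P j b x : 0 <= x -> ucv (UF := UF) [set: unit] (fun n _ => samp n j b (t, x)) (fun=> ulim t j b x).
  move=> x0; have Dx : [set y : R | 0 <= y <= x] x by rewrite /= x0 lexx.
  exact: (ucv_pt Dx (@samp_ucv t x j b t0)).
have Q j b : ucv (UF := UF) [set: unit]
  (fun n _ => dyadic_energy (fun x => samp n j b (t, x)) m) (fun _ => dyadic_energy (ulim t j b) m).
  apply: ucvZ; apply: ucv_sum => k.
  pose proof (ucvB (P j b _ (natr_mesh_ge0 k.+1 m)) (P j b _ (natr_mesh_ge0 k m))) as D.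
  by apply: (ucv_sqr _ D) => _ _; exact: lexx.
by apply: ucv_sum => j; apply: ucvD.
Qed.

(** Lower semicontinuity: the energy at a fixed level [m] is a finite sum of point values, so it
    converges, and on the grid [n >= m] it is dominated by the full discrete energy. *)
Lemma ulim_grad t m : 0 <= t -> grad_energy (ulim t) m <= B.
Proof.
move=> t0; apply: (ucv_le (i := tt) (I : [set: unit] tt) (grad_ucv m t0) (@ucv_cst _ _ _ _ _ (fun=> B))).
apply: filterS2 (UF_ge m) (UF_real t) => n /= mn tn.
apply: le_trans (grad_energy_nondec _ mn) _; rewrite samp_energy (sch_grad (sch n)) //.
by rewrite it_le // t0.
Qed.

(** The boolean, read as 0 or 1, selects the left or the right end of the cells as sample points. *)
Lemma ucv_space (o : bool) Y (z : nat -> R -> R) (f : R -> R) : 0 <= Y -> continuous f ->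
  ucv (UF := UF) [set x | 0 <= x <= Y] z f ->
  ucv (UF := UF) [set: unit] (fun n _ => mesh n * \sum_(k < tr n Y) z n ((o + k)%:R * mesh n))
    (fun _ => itg 0 Y f).
Proof.
move=> Y0 cf H; have [K _ HK] := cont_bounded 0 Y cf.
have trE n : Num.truncn (Y / mesh n) = tr n Y by rewrite /mesh invrK.
have -> : (fun n (_ : unit) => mesh n * \sum_(k < tr n Y) z n ((o + k)%:R * mesh n)) =
  (fun n _ => mesh n * \sum_(k < Num.truncn (Y / mesh n)) z n ((o + k)%:R * mesh n)).
  by apply/funext => n; apply/funext => _; rewrite trE.
apply: (@ucv_riemann _ UF _ unit setT Y K mesh (fun n k _ => z n ((o + k)%:R * mesh n))
  (fun _ => f) Y0 (@mesh_gt0 R) (@UF_mesh) (fun _ _ => cf) (fun _ y _ => HK y)).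
- move=> e e0; have [d d0 Hd] := heine 0 Y cf e0; exists d => // _ x y _; exact: Hd.
- move=> e e0; apply: filterS (H e e0) => n Hn _ k _; rewrite trE => kY; exists ((o + k)%:R * mesh n).
    by rewrite !ler_pM2r ?mesh_gt0 // !ler_nat; case: o => /=; rewrite ?leqnn ?leqnSn.
  apply: Hn; rewrite /= natr_mesh_ge0 /=.
  have /andP[H1 _] := trP n Y0; apply: le_trans H1.
  by rewrite ler_pM2r ?mesh_gt0 // ler_nat; apply: leq_trans kY; case: o.
Qed.

Lemma ucv_time t X (z : nat -> R * R -> R) (f : R -> R -> R) : 0 <= t -> buc f ->
  ucv (UF := UF) [set p : R * R | 0 <= p.1 <= t /\ 0 <= p.2 <= X] z (fun p => f p.1 p.2) ->
  ucv (UF := UF) [set x | 0 <= x <= X]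
    (fun n x => tau n * \sum_(l < it n t) z n (l%:R * tau n, x)) (fun x => itg 0 t (fun s => f s x)).
Proof.
move=> t0 bf H; have [[K HK] uf] := bf.
apply: (@ucv_riemann _ UF _ R [set x | 0 <= x <= X] t K tau
  (fun n l x => z n (l%:R * tau n, x)) (fun x s => f s x) t0 tau_gt0 UF_tau).
- by move=> x _; exact: buc_contt.
- by move=> x s _ _; exact: HK.
- move=> e e0; have [d d0 Hd] := uf e e0; exists d => // x s s' _ _ ss.
  by apply: Hd => //; rewrite subrr normr0.
- move=> e e0; apply: filterS (H e e0) => n Hn x l xX lt; exists (l%:R * tau n).
    by rewrite lexx ler_pM2r ?tau_gt0 // ler_nat leqnSn.
  apply: Hn; split=> //=; rewrite mulr_ge0 ?(ltW (tau_gt0 n)) //=.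
  have /andP[H1 _] := itP n t0; apply: le_trans H1.
  by rewrite ler_pM2r ?tau_gt0 // ler_nat ltnW.
Qed.

Lemma edge_sum_split n (phi : 'I_N.+1 -> nat -> R) K : (K <= 4 ^ n)%N ->
  edge_sum n phi = mesh n * \sum_(k < K) \sum_j phi j k.+1 +
    mesh n * \sum_(k < 4 ^ n - K) \sum_j phi j (K + k)%N.+1.
Proof.
move=> K4; rewrite /edge_sum exchange_big -mulrDr; congr (_ * _).
rewrite -(big_mkord xpredT (fun k => \sum_j phi j k.+1)) -(big_mkord xpredT (fun k => \sum_j phi j (K + k)%N.+1)).
rewrite (big_cat_nat (leq0n K) K4) big_mkord; congr (_ + _).
by rewrite -{1}[K]add0n big_addn; apply: eq_bigr => k _; rewrite addnC.
Qed.

Lemma edge_sum_part n (phi : 'I_N.+1 -> nat -> R) K : (forall j k, 0 <= phi j k) ->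
  (K <= 4 ^ n)%N -> mesh n * \sum_(k < K) \sum_j phi j k.+1 <= edge_sum n phi.
Proof.
move=> p0 K4; rewrite (edge_sum_split _ K4) lerDl mulr_ge0 ?(ltW (mesh_gt0 n)) //.
by apply: sumr_ge0 => k _; apply: sumr_ge0 => j _.
Qed.

Lemma edge_sq_ge0 (f : 'I_N.+1 -> bool -> R -> R) j x : 0 <= edge_sq f j x.
Proof. by rewrite addr_ge0 ?sqr_ge0. Qed.

Lemma ulim_cont t j b : continuous (ulim t j b).
Proof. exact: buc_contx (ulim_buc j b). Qed.

Lemma cont_edge_sq (f : 'I_N.+1 -> bool -> R -> R) j : (forall b, continuous (f j b)) ->
  continuous (edge_sq f j).
Proof. by move=> cf; apply: contD; apply: continuous_sqr; exact: cf. Qed.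

Lemma tr_le n (Y : R) : Y <= 2 ^+ n -> (tr n Y <= 4 ^ n)%N.
Proof.
move=> H; have [Y0|Y0] := leP 0 Y; first by rewrite -kx_tr ?Y0 // kx_le.
by rewrite /tr truncn_floor leNgt pmulr_llt0 ?exprn_gt0 // Y0.
Qed.

Lemma ulim_mass t Y : 0 <= t -> 0 <= Y ->
  itg 0 Y (fun x => \sum_j edge_sq (ulim t) j x) <= M.
Proof.
move=> t0 Y0.
pose proof (ucv_sum (fun j => @sq_ucv t Y j t0)) as H.
have cf : continuous (fun x => \sum_j edge_sq (ulim t) j x).
  by apply: continuous_sum => j; apply: cont_edge_sq => b; exact: ulim_cont.
pose proof (ucv_space true Y0 cf H) as H2.
apply: (ucv_le (i := tt) I H2 (@ucv_cst _ _ _ _ _ (fun=> M))).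
apply: filterS2 (UF_real t) (UF_pow Y) => n /= tn Yn.
apply: le_trans (sch_mass (sch n) (i := it n t) _); last by rewrite it_le // t0.
apply: le_trans (edge_sum_part _ (tr_le Yn)); last by move=> j k; rewrite addr_ge0 ?sqr_ge0.
rewrite ler_pM2l ?mesh_gt0 //; apply: ler_sum => k _; apply: ler_sum => j _.
by rewrite /edge_sq !samp_grid // (leq_trans (ltn_ord k)) // tr_le.
Qed.

Lemma ulim_weight t Y : 0 <= A -> 0 <= kap -> 0 <= t -> 0 <= Y ->
  itg 0 Y (fun x => x ^+ 2 * \sum_j edge_sq (ulim t) j x) <= (A + kap * t) ^+ 2.
Proof.
move=> A0 k0 t0 Y0.
have S1 x : [set x | 0 <= x <= Y] x -> `|\sum_j edge_sq (ulim t) j x| <= \sum_(j < N.+1) S.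
  case/andP=> x0 _; rewrite ger0_norm; first by apply: ler_sum => j _; exact: ulim_sqr.
  by apply: sumr_ge0 => j _; exact: edge_sq_ge0.
have Y1 x : [set x | 0 <= x <= Y] x -> `|x ^+ 2| <= Y ^+ 2.
  by case/andP=> x0 xY; rewrite ger0_norm ?sqr_ge0 // ler_pXn2r ?nnegrE.
have H : ucv (UF := UF) [set x | 0 <= x <= Y] (fun n x => x ^+ 2 * \sum_j
    edge_sq (fun j b x => samp n j b (t, x)) j x) (fun x => x ^+ 2 * \sum_j edge_sq (ulim t) j x).
  apply: (@ucvM _ _ _ _ _ (Num.max (Y ^+ 2) (\sum_(j < N.+1) S))).
  - by move=> x Dx; rewrite le_max Y1.
  - by move=> x Dx; rewrite le_max S1 // orbT.
  - exact: ucv_cst.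
  - by apply: ucv_sum => j; exact: sq_ucv.
have cf : continuous (fun x => x ^+ 2 * \sum_j edge_sq (ulim t) j x).
  apply: contM; first by apply: continuous_sqr => x; exact: cvg_id.
  by apply: continuous_sum => j; apply: cont_edge_sq => b; exact: ulim_cont.
pose proof (ucv_space true Y0 cf H) as H2.
apply: (ucv_le (i := tt) I H2 (@ucv_cst _ _ _ _ _ (fun=> (A + kap * t) ^+ 2))).
apply: filterS2 (UF_real t) (UF_pow Y) => n /= tn Yn.
have iT : (it n t)%:R * tau n <= n%:R by rewrite it_le // t0.
apply: le_trans (le_trans (sch_weight (sch n) iT) _).
  apply: le_trans (edge_sum_part _ (tr_le Yn)).
    rewrite ler_pM2l ?mesh_gt0 //; apply: ler_sum => k _; rewrite mulr_sumr; apply: ler_sum => j _.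
    by rewrite /edge_sq !samp_grid // (leq_trans (ltn_ord k)) // tr_le.
  by move=> j k; rewrite mulr_ge0 ?sqr_ge0 // addr_ge0 ?sqr_ge0.
have H3 : A + kap * ((it n t)%:R * tau n) <= A + kap * t.
  by rewrite lerD2l ler_wpM2l // it_le // t0 lexx.
rewrite ler_pXn2r ?nnegrE // addr_ge0 // mulr_ge0 // mulr_ge0 //.
exact/ltW/tau_gt0.
Qed.

Lemma ulim_holder t s Y : 0 <= s <= t -> 0 <= Y ->
  itg 0 Y (fun x => \sum_j edge_sq (fun j b x => ulim t j b x - ulim s j b x) j x) <= C * (t - s).
Proof.
case/andP=> s0 st Y0; have t0 := le_trans s0 st.
pose f := fun x => \sum_j edge_sq (fun j b x => ulim t j b x - ulim s j b x) j x.
have cf : continuous f.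
  by apply: continuous_sum => j; apply: cont_edge_sq => b; apply: contB; exact: ulim_cont.
have H : ucv (UF := UF) [set x | 0 <= x <= Y] (fun n x => \sum_j
    edge_sq (fun j b x => samp n j b (t, x) - samp n j b (s, x)) j x) f.
  apply: ucv_sum => j; pose proof (fun b => ucvB (@samp_ucv t Y j b t0) (@samp_ucv s Y j b s0)) as P.
  have Q b x : [set x | 0 <= x <= Y] x -> `|ulim t j b x - ulim s j b x| <= 1 + S + (1 + S).
    by move=> _; apply: le_trans (ler_normB _ _) _; rewrite lerD ?ulim_le.
  by apply: ucvD; apply: (ucv_sqr _ (P _)); exact: Q.
pose proof (ucv_space true Y0 cf H) as H2.
apply/ler_addgt0Pr => e e0; have C1 : 0 < C + 1 by move: C0; lra.
apply: (ucv_le (i := tt) I H2 (@ucv_cst _ _ _ _ _ (fun=> C * (t - s) + e))).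
apply: filterS3 (UF_real t) (UF_pow Y) (UF_tau (divr_gt0 e0 C1)) => n /= tn Yn te.
have ml : (it n s <= it n t)%N.
  by apply: le_truncn; rewrite ler_wpM2r // invr_ge0 ltW // tau_gt0.
have := @sch_holder _ _ _ _ _ _ _ _ _ _ _ _ _ _ _ (sch n) (it n s) (it n t - it n s)%N.
rewrite subnKC // it_le ?t0 // => /(_ isT) H3.
have /andP[a1 a2] := itP n t0; have /andP[b1 b2] := itP n s0.
have D : (it n t - it n s)%N%:R * tau n <= t - s + tau n.
  by rewrite natrB // mulrBl; move: b2; rewrite -natr1 mulrDl mul1r; lra.
have {}D : C * ((it n t - it n s)%N%:R * tau n) <= C * (t - s) + e.
  apply: le_trans (ler_wpM2l C0 D) _; rewrite mulrDr lerD2l.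
  have : (C + 1) * tau n < e by rewrite mulrC -ltr_pdivlMr.
  by have := tau_gt0 n; rewrite mulrDl mul1r; lra.
apply: le_trans (le_trans H3 D).
apply: le_trans (edge_sum_part _ (tr_le Yn)).
  rewrite ler_pM2l ?mesh_gt0 //; apply: ler_sum => k _; apply: ler_sum => j _.
  by rewrite /edge_sq !samp_grid // (leq_trans (ltn_ord k)) // tr_le.
by move=> j k; rewrite addr_ge0 ?sqr_ge0.
Qed.

Hypothesis cG : continuous G.

(** The gradient part may lose energy in the limit, which gives an inequality. The potential part
    converges on [[0, Y]] only; what lies beyond is estimated by the weight at time [t] and at time
    0, whence the factor 2. *)
Lemma ulim_energy (KG Bz t Y : R) m :
  (forall s, 0 <= s <= S -> `|G s| <= KG * s) -> 0 <= KG -> 0 <= A -> 0 <= kap ->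
  (forall n, grad_energy u0 n <= Bz) -> 0 <= t -> 0 < Y ->
  grad_energy (ulim t) m + pot_energy G Y (ulim t) <=
  Bz + pot_energy G Y (ulim 0) + 2 * KG * (A + kap * t) ^+ 2 / Y ^+ 2.
Proof.
move=> HG KG0 A0 k0 HB t0 Y0; have Y0' := ltW Y0.
have E s : 0 <= s -> ucv (UF := UF) [set: unit] (fun n _ => mesh n * \sum_(k < tr n Y)
    \sum_j G (edge_sqr (U n (it n s)) j k.+1)) (fun=> pot_energy G Y (ulim s)).
  move=> s0.
  have cf j : continuous (fun x => G (edge_sq (ulim s) j x)).
    have cq : continuous (edge_sq (ulim s) j) by apply: cont_edge_sq => b; exact: ulim_cont.
    by move=> x; apply: continuous_comp; [exact: cq|exact: cG].
  have H : ucv (UF := UF) [set x | 0 <= x <= Y]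
     (fun n x => \sum_j G (edge_sq (fun j b x => samp n j b (s, x)) j x))
     (fun x => \sum_j G (edge_sq (ulim s) j x)).
    apply: ucv_sum => j; apply: (ucv_comp (K := S) cG); last exact: sq_ucv.
    by move=> x /andP[x0 _]; rewrite ger0_norm ?edge_sq_ge0 // ulim_sqr.
  pose proof (ucv_space true Y0' (continuous_sum (s := index_enum 'I_N.+1) cf) H) as H2; move: H2.
  apply: eq_ucv => [|_ _]; last by rewrite /pot_energy itg_sum.
  apply: filterS (UF_pow Y) => n Yn _ _; congr (_ * _); apply: eq_bigr => k _.
  apply: eq_bigr => j _; rewrite /edge_sq !samp_grid // (leq_trans (ltn_ord k)) //; exact: tr_le.
pose W := KG * (A + kap * t) ^+ 2 / Y ^+ 2.
have W0 : 0 <= W by exact: (divr_ge0 (mulr_ge0 KG0 (sqr_ge0 _)) (sqr_ge0 _)).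
(* Beyond [Y] one has |G(s)| <= KG s <= KG (x / Y)^2 s, which is summable by the weighted bound. *)
have tail n s : t <= n%:R -> Y <= 2 ^+ n -> 0 <= s <= t ->
  `|edge_sum n (fun j k => G (edge_sqr (U n (it n s)) j k)) -
    mesh n * \sum_(k < tr n Y) \sum_j G (edge_sqr (U n (it n s)) j k.+1)| <= W.
  move=> tn Yn /andP[s0 st].
  have iT : (it n s)%:R * tau n <= n%:R by rewrite it_le // s0 (le_trans st).
  have K4 := tr_le Yn; rewrite (edge_sum_split _ K4) addrAC subrr add0r normrM.
  rewrite (ger0_norm (ltW (mesh_gt0 n))).
  apply: (@le_trans _ _ (KG / Y ^+ 2 * edge_sum n (fun j k => (k%:R * mesh n) ^+ 2 * edge_sqr (U n (it n s)) j k))).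
    rewrite (edge_sum_split _ K4) mulrDr; apply: ler_wpDl.
      rewrite mulr_ge0 ?divr_ge0 ?sqr_ge0 // mulr_ge0 ?(ltW (mesh_gt0 n)) //.
      by apply: sumr_ge0 => k _; apply: sumr_ge0 => j _; rewrite mulr_ge0 ?sqr_ge0 // addr_ge0 ?sqr_ge0.
    rewrite mulrCA ler_pM2l ?mesh_gt0 //; apply: le_trans (ler_norm_sum _ _ _) _.
    rewrite mulr_sumr; apply: ler_sum => k _; apply: le_trans (ler_norm_sum _ _ _) _.
    rewrite mulr_sumr; apply: ler_sum => j _.
    have k4 : ((tr n Y + k).+1 <= 4 ^ n)%N by rewrite -addnS -[leqRHS](subnKC K4) leq_add2l.
    have q0 : 0 <= edge_sqr (U n (it n s)) j (tr n Y + k).+1 by rewrite addr_ge0 ?sqr_ge0.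
    have qS := sch_sup (sch n) j iT k4.
    apply: le_trans (HG _ _) _; first by rewrite q0.
    rewrite [leRHS](_ : _ = KG * ((((tr n Y + k).+1%:R * mesh n) ^+ 2 / Y ^+ 2) *
      edge_sqr (U n (it n s)) j (tr n Y + k).+1)); last by ring.
    rewrite ler_wpM2l // ler_peMl // ler_pdivlMr ?exprn_gt0 // mul1r.
    rewrite ler_pXn2r ?nnegrE ?natr_mesh_ge0 //.
    have /andP[_ H] := trP n Y0'; apply: le_trans (ltW H) _.
    by rewrite ler_pM2r ?mesh_gt0 // ler_nat ltnS leq_addr.
  have -> : W = KG / Y ^+ 2 * (A + kap * t) ^+ 2 by rewrite /W mulrAC.
  rewrite ler_wpM2l ?divr_ge0 ?sqr_ge0 //.
  apply: le_trans (sch_weight (sch n) iT) _.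
  have H3 : A + kap * ((it n s)%:R * tau n) <= A + kap * t.
    by rewrite lerD2l ler_wpM2l // it_le // s0.
  rewrite ler_pXn2r ?nnegrE // addr_ge0 // mulr_ge0 // mulr_ge0 //.
  exact/ltW/tau_gt0.
have -> : 2 * KG * (A + kap * t) ^+ 2 / Y ^+ 2 = 2 * W by rewrite /W; ring.
apply/ler_addgt0Pr => e e0.
have CE1 : 0 < `|CE| + 1 by rewrite ltr_wpDl.
rewrite -[leRHS]addrA.
pose proof (ucvD (grad_ucv m t0) (E t t0)) as P1.
pose proof (ucvD (ucvD (@ucv_cst _ UF _ _ setT (fun=> Bz)) (E 0 (lexx 0)))
  (@ucv_cst _ UF _ _ setT (fun=> 2 * W + e))) as P2.
apply: (ucv_le (i := tt) I P1 P2).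
apply: filterS2 (filterI (UF_ge m) (UF_mesh (divr_gt0 e0 CE1))) (filterI (UF_real t) (UF_pow Y)).
move=> n [/= mn me] [/= tn Yn].
have iT : (it n t)%:R * tau n <= n%:R by rewrite it_le // t0.
have H1 := sch_energy (sch n) iT.
have H2 := grad_energy_nondec (fun j b x => samp n j b (t, x)) mn; rewrite samp_energy in H2.
have H3 : edge_grad n (U n 0%N) <= Bz.
  apply: le_trans (HB n); rewrite /edge_grad mulr_sumr; apply: ler_sum => j _.
  rewrite /dyadic_energy -mulrDr -big_split /= ler_pM2l ?exprn_gt0 //; apply: ler_sum => k _.
  by rewrite !(sch_init (sch n)) // ltnW.
have T1 := tail n t tn Yn _; rewrite t0 lexx in T1; have {}T1 := T1 isT.
have T2 := tail n 0 tn Yn _; rewrite lexx t0 in T2; have {}T2 := T2 isT.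
have i0 : it n 0 = 0%N by rewrite /it mul0r truncn0.
have H4 : CE * mesh n <= e.
  apply: (@le_trans _ _ ((`|CE| + 1) * mesh n)).
    by rewrite ler_pM2r ?mesh_gt0 // (le_trans (ler_norm _)) // lerDl.
  by rewrite mulrC -ler_pdivlMr // ltW.
rewrite i0 in T2 *; move: T1 T2; rewrite !ler_norml; lra.
Qed.

Notation source := (mild_source F ulim).

Hypothesis cF : continuous F.

Lemma nonlin_buc j b : buc (fun s x => F (edge_sq (ulim s) j x) * ulim s j b x).
Proof.
apply: bucM; last exact: ulim_buc.
by apply: buc_comp => //; apply: bucD; apply: buc_sqr; exact: ulim_buc.
Qed.

Lemma source_cont t j b : 0 <= t -> continuous (source t j b).
Proof.
move=> t0; apply: contD; first exact: (buc_itg_cont t0 (nonlin_buc j b)).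
by apply: contZ; apply: contB; exact: ulim_cont.
Qed.

Definition dsource n t j b x : R :=
  tau n * (\sum_(l < it n t) F (edge_sq (fun j b x => samp n j b (l%:R * tau n, x)) j x) *
     samp n j b (l%:R * tau n, x)) +
  sgb b * (samp n j (~~ b) (t, x) - samp n j (~~ b) (0, x)).

Lemma dsource_ucv t X j b : 0 <= t ->
  ucv (UF := UF) [set x | 0 <= x <= X] (fun n x => dsource n t j b x) (source t j b).
Proof.
move=> t0; apply: ucvD; last first.
  apply: ucvZ; apply: ucvB; exact: samp_ucv.
pose D := [set p : R * R | 0 <= p.1 <= t /\ 0 <= p.2 <= X].
pose z n (p : R * R) := F (samp n j true p ^+ 2 + samp n j false p ^+ 2) * samp n j b p.
apply: (@ucv_time t X z (fun s x => F (edge_sq (ulim s) j x) * ulim s j b x) t0 (nonlin_buc j b)).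
have U1 b' : ucv (UF := UF) D (fun n p => samp n j b' p) (fun p => ulim p.1 j b' p.2).
  exact: ulim_ucv.
have [[K1 HK1] _] : buc (fun s x => F (edge_sq (ulim s) j x)).
  by apply: buc_comp => //; apply: bucD; apply: buc_sqr; exact: ulim_buc.
apply: (@ucvM _ _ _ _ _ (Num.max K1 (1 + S))).
- by move=> p _; rewrite le_max HK1.
- by move=> p _; rewrite le_max ulim_le orbT.
- apply: (@ucv_comp _ _ _ _ _ F S) => //.
    by move=> p [/andP[p1 _] /andP[p2 _]]; rewrite ger0_norm ?ulim_sqr // addr_ge0 ?sqr_ge0.
  apply: ucvD; apply: (ucv_sqr (K := 1 + S)) => //.
  + by move=> p _; exact: ulim_le.
  + by move=> p _; exact: ulim_le.
- exact: U1.
Qed.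

Definition tsamp n t j b x : R := tau n * \sum_(l < it n t) samp n j b (l%:R * tau n, x).

Lemma tsamp_ucv t X j b : 0 <= t ->
  ucv (UF := UF) [set x | 0 <= x <= X] (fun n x => tsamp n t j b x)
    (fun x => itg 0 t (fun s => ulim s j b x)).
Proof.
move=> t0; apply: (@ucv_time t X (fun n p => samp n j b p) (fun s x => ulim s j b x) t0 (ulim_buc j b)).
exact: ulim_ucv.
Qed.

Definition remainder n t j b x : R :=
  mesh n * \sum_(l < tr n x) ((kx n x)%:R * mesh n - l%:R * mesh n) * dsource n t j b (l%:R * mesh n).

Lemma remainder_ucv t j b x : 0 <= t -> 0 <= x ->
  ucv (UF := UF) [set: unit] (fun n _ => remainder n t j b x)
    (fun=> itg 0 x (fun y => (x - y) * source t j b y)).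
Proof.
move=> t0 x0.
have cs := @source_cont t j b t0.
have cxy : continuous (fun y : R => x - y).
  by apply: contB; [exact: cst_continuous|move=> y; exact: cvg_id].
have [K _ HK] := cont_bounded 0 x cs.
apply: (ucv_space false x0 (z := fun n y => ((kx n x)%:R * mesh n - y) * dsource n t j b y)).
  exact: contM.
apply: (@ucvM _ _ _ _ _ (Num.max x K)).
- by move=> y /andP[y0 yx]; rewrite le_max ger0_norm ?subr_ge0 // lerBlDr lerDl y0.
- by move=> y Dy; rewrite le_max HK // orbT.
- move=> e e0; apply: filterS2 (UF_pow x) (UF_mesh e0) => n xn /= hn y _.
  have := @kx_near n x; rewrite x0 xn => /(_ isT) /andP[a1 a2].
  have -> : (kx n x)%:R * mesh n - y - (x - y) = - (x - (kx n x)%:R * mesh n) by ring.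
  by rewrite normrN ger0_norm ?subr_ge0 //; lra.
- exact: dsource_ucv.
Qed.

(** The coefficient of the linear term in [solve_recurrence], in units of the mesh: the first
    difference quotient at the vertex, corrected by the source there. *)
Definition dslope n t j b : R :=
  (tsamp n t j b (mesh n) - tsamp n t j b 0) / mesh n - mesh n * dsource n t j b 0.

Lemma mesh_grid n (k : nat) : (k < 2)%N -> (k <= 4 ^ n)%N.
Proof. by move=> k2; apply: (@leq_trans 1%N) => //; rewrite expn_gt0. Qed.

Lemma tsamp_grid n t j b k : (k <= 4 ^ n)%N ->
  tsamp n t j b (k%:R * mesh n) = \sum_(l < it n t) tau n * U n l j b k.
Proof.
move=> k4; rewrite /tsamp mulr_sumr; apply: eq_bigr => l _.
by rewrite samp_grid // it_grid.
Qed.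

Lemma dsource_grid n t j b k : (k <= 4 ^ n)%N ->
  dsource n t j b (k%:R * mesh n) =
  \sum_(l < it n t) tau n * (F (edge_sqr (U n l) j k) * U n l j b k) +
      sgb b * (U n (it n t) j (~~ b) k - U n 0%N j (~~ b) k).
Proof.
move=> k4; rewrite /dsource mulr_sumr !samp_grid // [it n 0]/it mul0r truncn0; congr (_ + _).
by apply: eq_bigr => l _; rewrite /edge_sq !samp_grid // it_grid.
Qed.

Lemma tsamp_solved n t j b x : 0 <= t <= n%:R -> 0 <= x <= 2 ^+ n ->
  tsamp n t j b x = tsamp n t j b 0 + ((kx n x)%:R * mesh n) * dslope n t j b + remainder n t j b x.
Proof.
move=> tn xn; have k4 := kx_le n x.
have iT : (it n t)%:R * tau n <= n%:R by exact: it_le.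
have H := @solve_recurrence R (fun k => tsamp n t j b (k%:R * mesh n))
  (fun k => dsource n t j b (k%:R * mesh n)) (mesh n ^+ 2) (4 ^ n)%N _ (kx n x) k4.
have xE : tsamp n t j b x = tsamp n t j b ((kx n x)%:R * mesh n).
  by rewrite tsamp_grid // /tsamp mulr_sumr; apply: eq_bigr => l _; rewrite /samp /= it_grid.
rewrite xE H /= => [|k kK]; last first.
  have [k0 k1] := andP kK.
  rewrite (@tsamp_grid n t j b k.+1 k1) (@tsamp_grid n t j b k (ltnW k1)).
  rewrite (@tsamp_grid n t j b k.-1 (leq_trans (leq_pred k) (ltnW k1))).
  by rewrite (sch_eq (sch n)) // dsource_grid // ltnW.
rewrite mul0r mul1r /dslope /remainder -(kx_tr xn).
have h0 : mesh n != 0 by rewrite gt_eqF // mesh_gt0.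
congr (_ + _ + _); first by field.
rewrite !mulr_sumr; apply: eq_bigr => l _; ring.
Qed.

(** Uniform convergence says nothing about difference quotients at the vertex. The solved recurrence
    at x = 1, however, expresses the slope by two values and a remainder, all of which converge. *)
Lemma dslope_ucv t j b : 0 <= t -> ucv (UF := UF) [set: unit] (fun n _ => dslope n t j b)
  (fun=> itg 0 t (fun s => ulim s j b 1) - itg 0 t (fun s => ulim s j b 0) -
     itg 0 1 (fun y => (1 - y) * source t j b y)).
Proof.
move=> t0.
have D1 : [set x : R | 0 <= x <= 1] 1 by rewrite /= ler01 lexx.
have D0 : [set x : R | 0 <= x <= 1] 0 by rewrite /= ler01 lexx.
pose proof (ucvB (ucvB (ucv_pt D1 (@tsamp_ucv t 1 j b t0)) (ucv_pt D0 (@tsamp_ucv t 1 j b t0)))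
  (@remainder_ucv t j b 1 t0 ler01)) as H.
apply: eq_ucv H => //; apply: filterS2 (UF_real t) (UF_pow 1) => n /= tn n1 _ _.
rewrite (@tsamp_solved n t j b 1) ?t0 ?ler01 //.
have -> : (kx n 1)%:R * mesh n = 1.
  rewrite kx_tr ?ler01 //; have -> : tr n (1 : R) = (2 ^ n)%N; last by rewrite natrX mesh_exp.
  by rewrite /tr mul1r -natrX natrK.
ring.
Qed.

(** The equation at the vertex contains a single source term, while each slope subtracts its own.
    The mismatch carries a factor [mesh n] and vanishes in the limit: this is the origin of the
    Kirchhoff law for the limit. *)
Lemma dslope_sum n t b : 0 <= t <= n%:R -> \sum_j dslope n t j b =
  mesh n * (dsource n t ord0 b 0 - \sum_j dsource n t j b 0).
Proof.
move=> tn; have iT : (it n t)%:R * tau n <= n%:R by exact: it_le.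
have h0 : mesh n != 0 by rewrite gt_eqF // mesh_gt0.
have g0 : 0 = 0%:R * mesh n by rewrite mul0r.
have := sch_eq_vertex (sch n) b iT.
have -> : \sum_j (\sum_(l < it n t) tau n * U n l j b 1 - \sum_(l < it n t) tau n * U n l j b 0%N) =
  \sum_j (tsamp n t j b (mesh n) - tsamp n t j b 0).
  apply: eq_bigr => j _.
  rewrite -(@tsamp_grid n t j b 1%N (@mesh_grid n 1 isT)) -(@tsamp_grid n t j b 0%N isT).
  by rewrite mul0r mul1r.
rewrite -(@dsource_grid n t ord0 b 0%N) // -g0 => H.
rewrite /dslope big_split /= -mulr_suml H sumrN -mulr_sumr; field; exact: h0.
Qed.

Lemma ulim_eq t b : 0 <= t -> exists d : 'I_N.+1 -> R, \sum_j d j = 0 /\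
  forall j x, 0 <= x -> itg 0 t (fun s => ulim s j b x) =
    itg 0 t (fun s => ulim s j b 0) + d j * x + itg 0 x (fun y => (x - y) * source t j b y).
Proof.
move=> t0; pose d j := itg 0 t (fun s => ulim s j b 1) - itg 0 t (fun s => ulim s j b 0) -
     itg 0 1 (fun y => (1 - y) * source t j b y).
have dH j : ucv (UF := UF) [set: unit] (fun n _ => dslope n t j b) (fun=> d j).
  exact: dslope_ucv.
have ts : ucv (UF := UF) [set: unit] (fun n _ => mesh n) (fun=> 0).
  by move=> e e0; apply: filterS (UF_mesh e0) => n /= hn _ _; rewrite subr0 ger0_norm ?ltW // mesh_gt0.
exists d; split.
  have D0 : [set x : R | 0 <= x <= 0] 0 by rewrite /= lexx.
  pose c := source t ord0 b 0 - \sum_j source t j b 0.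
  have P : ucv (UF := UF) [set: unit] (fun n _ => mesh n * (dsource n t ord0 b 0 - \sum_j dsource n t j b 0)) (fun=> 0 * c).
    apply: (@ucvM _ _ _ _ _ `|c|) => //; first by move=> _ _; rewrite normr0.
    by apply: ucvB; [|apply: ucv_sum => j]; apply: (ucv_pt D0 (@dsource_ucv t 0 _ b t0)).
  have Q : ucv (UF := UF) [set: unit] (fun n _ => \sum_j dslope n t j b) (fun=> \sum_j d j).
    by apply: ucv_sum => j; exact: dH.
  have P' : ucv (UF := UF) [set: unit] (fun n _ => \sum_j dslope n t j b) (fun=> 0 * c).
    by apply: eq_ucv P => //; apply: filterS (UF_real t) => n /= tn _ _; rewrite dslope_sum ?t0.
  by rewrite (@ucv_unique _ _ _ _ _ _ _ _ Q P' tt I) mul0r.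
move=> j x x0.
have Dx : [set y : R | 0 <= y <= x] x by rewrite /= x0 lexx.
have D0 : [set y : R | 0 <= y <= x] 0 by rewrite /= x0 lexx.
have kxu : ucv (UF := UF) [set: unit] (fun n _ => (kx n x)%:R * mesh n) (fun=> x).
  move=> e e0; apply: filterS2 (UF_pow x) (UF_mesh e0) => n xn /= hn _ _.
  have := @kx_near n x; rewrite x0 xn => /(_ isT) /andP[a1 a2].
  by rewrite distrC ger0_norm ?subr_ge0 //; lra.
have R1 : ucv (UF := UF) [set: unit] (fun n _ => tsamp n t j b 0 +
    ((kx n x)%:R * mesh n) * dslope n t j b + remainder n t j b x)
  (fun=> itg 0 t (fun s => ulim s j b 0) + x * d j + itg 0 x (fun y => (x - y) * source t j b y)).
  apply: ucvD; [apply: ucvD|exact: remainder_ucv].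
    exact: (ucv_pt D0 (@tsamp_ucv t x j b t0)).
  apply: (@ucvM _ _ _ _ _ (Num.max `|x| `|d j|)) => //.
    by move=> _ _; rewrite le_max lexx.
  by move=> _ _; rewrite le_max lexx orbT.
pose proof (ucv_pt Dx (@tsamp_ucv t x j b t0)) as R2.
have R3 : ucv (UF := UF) [set: unit] (fun n _ => tsamp n t j b x)
  (fun=> itg 0 t (fun s => ulim s j b 0) + d j * x + itg 0 x (fun y => (x - y) * source t j b y)).
  apply: eq_ucv R1 => [|_ _]; last by rewrite mulrC.
  apply: filterS2 (UF_real t) (UF_pow x) => n /= tn xn _ _.
  by rewrite -tsamp_solved ?t0 ?x0.
exact: (@ucv_unique _ _ _ _ _ _ _ _ R2 R3 tt I).
Qed.

End Limit.

(** * Uniqueness *)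

Section CalculusLemmas.
Context {R : realType}.
Notation mu := (@lebesgue_measure R).

Lemma is_derive_near_pos (f g : R -> R) (x df : R) : 0 < x -> (forall y, 0 < y -> f y = g y) ->
  is_derive x 1 g df -> is_derive x 1 f df.
Proof.
move=> x0 fg; apply: near_eq_is_derive; near=> y; apply/esym/fg.
near: y; exact: lt_nbhsr.
Unshelve. all: end_near. Qed.

Lemma itg_sqr_wderiv (f v : R -> R) (B Y : R) : continuous v -> primitive_of f v ->
  (forall n, dyadic_energy f n <= B) -> itg 0 Y (fun x => v x ^+ 2) <= B.
Proof.
move=> cv fv HB; have cv2 := continuous_sqr cv.
have H := dyadic_energy_wderiv (cont_loc_integrable cv) fv HB.
have I2 := integrable_cont 0 Y cv2.
rewrite -lee_fin /itg /Rintegral fineK; last exact: integrable_fin_num.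
apply: le_trans H; apply: ge0_subset_integral => //=.
- exact: measurable_halfline.
- apply/measurable_EFinP; apply: (measurable_funS (E := setT)) => //.
  exact: continuous_measurable_fun.
- by move=> x _; rewrite lee_fin sqr_ge0.
- by move=> x /=; rewrite /halfline /= !in_itv /= andbT => /andP[].
Qed.

Lemma itg_eq0 (f : R -> R) Y x : continuous f -> (forall y, 0 <= f y) ->
  itg 0 Y f <= 0 -> 0 < x < Y -> f x = 0.
Proof.
move=> cf f0 H /andP[x0 xY]; apply/eqP; rewrite eq_le f0 andbT leNgt; apply/negP => fx.
have fx2 : 0 < f x / 2 by rewrite divr_gt0.
have [d d0 Hd] := heine x x cf fx2.
pose e := Num.min (d / 2) (Y - x).
have e0 : 0 < e by rewrite lt_min divr_gt0 // subr_gt0.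
have [e1 e2] : e <= d / 2 /\ e <= Y - x by rewrite /e !ge_min !lexx orbT.
have xe : x <= x + e by lra.
have xeY : x + e <= Y by lra.
have I1 : itg x (x + e) (fun=> f x / 2) <= itg x (x + e) f.
  apply: le_itg => //; first exact: cst_continuous.
  move=> y /andP[y1 y2]; have := Hd x y; rewrite lexx => /(_ isT).
  by rewrite ler0_norm; [|lra] => /(_ _); rewrite ler_norml; lra.
have I2 : itg 0 Y f = itg 0 x f + (itg x (x + e) f + itg (x + e) Y f).
  by rewrite -(itg_chasles cf xe xeY) -(itg_chasles cf (ltW x0) (ltW xY)).
have P a b : 0 <= itg a b f by apply: itg_ge0 => y _; exact: f0.
move: I1; rewrite itg_cst // addrAC subrr add0r => I1.
have := mulr_gt0 fx2 e0; have := P 0 x; have := P (x + e) Y; lra.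
Qed.

(** The mean value theorem replaces the difference quotient by [p] at an intermediate time that
    depends on [x]; this is why the modulus of [p] in time must be uniform in [x]. *)
Lemma is_derive_itg_param (Y t d0 : R) (q p : R -> R -> R) : 0 <= Y -> 0 < d0 ->
  (forall s x, `|s - t| < d0 -> 0 <= x <= Y -> is_derive s 1 (fun s => q s x) (p s x)) ->
  (forall s, continuous (q s)) -> (forall s, continuous (p s)) ->
  (forall e, 0 < e -> exists2 d, 0 < d & forall s x, `|s - t| < d -> 0 <= x <= Y ->
     `|p s x - p t x| <= e) ->
  is_derive t 1 (fun s => itg 0 Y (q s)) (itg 0 Y (p t)).
Proof.
move=> Y0 dd0 dq cq cp up.
have H : (fun h : R => h^-1 *: (itg 0 Y (q (h *: 1 + t)) - itg 0 Y (q t))) @ 0^' --> itg 0 Y (p t).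
  apply/cvgrPdist_le => /= e e0; have Y1 : 0 < Y + 1 by lra.
  have [d d0' Hd] := up (e / (Y + 1)) (divr_gt0 e0 Y1).
  near=> h.
  have h0 : h != 0 by near: h; exact: nbhs_dnbhs_neq.
  have hd : `|h| < Num.min d d0.
    by near: h; apply: dnbhs0_lt; rewrite lt_min d0'.
  have [hd1 hd2] : `|h| < d /\ `|h| < d0 by move: hd; rewrite lt_min => /andP.
  rewrite /GRing.scale /= mulr1 -itgB // -(itgZ _ _ _ (contB (cq _) (cq _))) -itgB //; last first.
    by apply: contZ; exact: contB.
  apply: (@le_trans _ _ (e / (Y + 1) * (Y - 0))); last first.
    by rewrite subr0 mulrAC ler_pdivrMr // ler_wpM2l ?(ltW e0) // lerDl.
  apply: itg_bound => //; first by apply: contB => //; apply: contZ; exact: contB.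
  move=> x xY.
  have [c cd cE] : exists2 c, `|c - t| < d & q (h + t) x - q t x = p c x * h.
    have [hp|hn] := ltP 0 h.
      have tt : t <= h + t by lra.
      have Dq s : s \in `]t, h + t[ -> is_derive s 1 (fun s => q s x) (p s x).
        rewrite in_itv /= => /andP[s1 s2]; apply: dq => //.
        by move: hd2; rewrite gtr0_norm // ger0_norm; lra.
      have Cq : {within `[t, h + t]%classic, continuous (fun s => q s x)}.
        apply: derivable_within_continuous => s; rewrite in_itv /= => /andP[s1 s2].
        suff [] : is_derive s 1 (fun s => q s x) (p s x) by [].
        by apply: dq => //; move: hd2; rewrite gtr0_norm // ger0_norm; lra.
      have [c] := MVT_segment tt Dq Cq.
      rewrite in_itv /= => /andP[c1 c2] E; exists c; last by rewrite E; ring.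
      by move: hd1; rewrite gtr0_norm // ger0_norm; lra.
    have tt : h + t <= t by lra.
    have Dq s : s \in `]h + t, t[ -> is_derive s 1 (fun s => q s x) (p s x).
      rewrite in_itv /= => /andP[s1 s2]; apply: dq => //.
      by move: hd2; rewrite ler0_norm // ler0_norm; lra.
    have Cq : {within `[h + t, t]%classic, continuous (fun s => q s x)}.
      apply: derivable_within_continuous => s; rewrite in_itv /= => /andP[s1 s2].
      suff [] : is_derive s 1 (fun s => q s x) (p s x) by [].
      by apply: dq => //; move: hd2; rewrite ler0_norm // ler0_norm; lra.
    have [c] := MVT_segment tt Dq Cq.
    rewrite in_itv /= => /andP[c1 c2] E; exists c.
      by move: hd1; rewrite ler0_norm // ler0_norm; lra.
    by rewrite -opprB E; ring.
  by rewrite cE mulrCA mulVf // mulr1 distrC; exact: Hd.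
have D : derivable (fun s => itg 0 Y (q s)) t 1 by apply/cvg_ex; exists (itg 0 Y (p t)).
by apply: DeriveDef => //; exact: cvg_lim.
Unshelve. all: end_near. Qed.

Lemma sqr_le_close (p q om : R) : (p - q) ^+ 2 <= om ->
  p ^+ 2 <= 4 * (2^-1 * q ^+ 2) + 2 * om.
Proof.
have -> : 4 * (2^-1 * q ^+ 2) = 2 * q ^+ 2 by field.
have : 0 <= p ^+ 2 - 4 * (p * q) + 4 * q ^+ 2.
  have -> : p ^+ 2 - 4 * (p * q) + 4 * q ^+ 2 = (p - 2 * q) ^+ 2 by ring.
  exact: sqr_ge0.
have -> : (p - q) ^+ 2 = p ^+ 2 - 2 * (p * q) + q ^+ 2 by ring.
lra.
Qed.

Lemma fin_modulus (I : finType) (P : I -> R -> Prop) :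
  (forall i d d', 0 < d' -> d' <= d -> P i d -> P i d') ->
  (forall i, exists2 d, 0 < d & P i d) -> exists2 d, 0 < d & forall i, P i d.
Proof.
move=> mono H; suff K (s : seq I) : exists2 d, 0 < d & forall i, i \in s -> P i d.
  by have [d d0 Hd] := K (enum I); exists d => // i; apply: Hd; rewrite mem_enum.
elim: s => [|i s [d d0 Hd]]; first by exists 1.
have [d' d'0 Hd'] := H i; exists (Num.min d d'); first by rewrite lt_min d0.
have m0 : 0 < Num.min d d' by rewrite lt_min d0.
move=> k; rewrite inE => /predU1P[->|ks].
  by apply: (mono _ d') => //; rewrite ge_min lexx orbT.
by apply: (mono _ d); rewrite ?ge_min ?lexx //; exact: Hd.
Qed.

Lemma buc_fin (I : finType) (f : I -> R -> R -> R) : (forall i, buc (f i)) ->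
  (exists2 K, 0 < K & forall i t x, `|f i t x| <= K) /\
  forall e, 0 < e -> exists2 d, 0 < d & forall i s t x y,
    `|t - s| < d -> `|x - y| < d -> `|f i t x - f i s y| <= e.
Proof.
move=> H; split; last first.
  move=> e e0; apply: fin_modulus => [i d d' d'0 dd Hd s t x y h1 h2|i].
    by apply: Hd; exact: lt_le_trans dd.
  by have [_ /(_ e e0)] := H i.
have Hb i : exists K, forall t x, `|f i t x| <= K by have [] := H i.
have [K HK] := choice Hb; have K0 i : 0 <= K i by apply: le_trans (HK i 0 0).
exists (\sum_i K i + 1).
  by rewrite ltr_wpDl // sumr_ge0.
move=> i t x; apply: le_trans (HK i t x) _; rewrite (bigD1 i) //= -addrA lerDl.
by rewrite addr_ge0 // sumr_ge0.
Qed.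

Lemma itg_clip_lip (g : R -> R) (K p q : R) : continuous g -> (forall s, `|g s| <= K) ->
  `|itg 0 (clip p) g - itg 0 (clip q) g| <= K * `|p - q|.
Proof.
move=> cg gK; have K0 : 0 <= K by apply: le_trans (gK 0).
wlog pq : p q / q <= p.
  by move=> H; have [qp|/ltW pq] := leP q p; [exact: H|rewrite distrC [`|p - q|]distrC; exact: H].
have cc : clip q <= clip p by rewrite /clip ge_max !le_max pq lexx !orbT.
rewrite (itg_chasles cg (clip_ge0 q) cc) addrAC subrr add0r.
apply: le_trans (itg_bound (k := K) cg cc _) _ => //.
by rewrite ler_wpM2l // (le_trans _ (clip_lip p q)) //; exact: ler_norm.
Qed.

Lemma dyadic_energyZ (c : R) (f : R -> R) m :
  dyadic_energy (fun x => c * f x) m = c ^+ 2 * dyadic_energy f m.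
Proof.
rewrite /dyadic_energy mulrCA [in RHS]mulr_sumr; congr (_ * _).
by apply: eq_bigr => k _; rewrite -mulrBr exprMn.
Qed.

(** Cauchy-Schwarz in time for each increment: averaging in time does not increase the dyadic
    energy. *)
Lemma dyadic_energy_itg (f : R -> R -> R) (a b B : R) m : a <= b -> buc f ->
  (forall s, a <= s <= b -> dyadic_energy (f s) m <= B) ->
  dyadic_energy (fun x => itg a b (fun s => f s x)) m <= (b - a) ^+ 2 * B.
Proof.
move=> ab bf HB; have ba : 0 <= b - a by rewrite subr_ge0.
have ct x : continuous (fun s => f s x) by exact: buc_contt bf.
have cd k : continuous (fun s => f s (k.+1%:R * mesh m) - f s (k%:R * mesh m)) by exact: contB.
apply: (@le_trans _ _ ((b - a) * itg a b (fun s => dyadic_energy (f s) m))).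
  rewrite /dyadic_energy itgZ; last by apply: continuous_sum => k; exact: continuous_sqr.
  rewrite mulrCA ler_pM2l ?exprn_gt0 // itg_sum; last by move=> k; exact: continuous_sqr.
  rewrite mulr_sumr; apply: ler_sum => k _; rewrite -itgB //; exact: sqr_itg.
rewrite expr2 -mulrA ler_wpM2l // mulrC -itg_cst //; apply: le_itg => //.
- by apply: contZ; apply: continuous_sum => k; exact: continuous_sqr.
- exact: cst_continuous.
Qed.

Lemma clip_primitive_cont (g : R -> R) d : continuous g ->
  continuous (fun x => d + itg 0 (clip x) g).
Proof.
move=> cg x; apply: cvgD; first exact: cvg_cst.
apply/cvgrPdist_le => /= e e0.
have [M M0 HM] := cont_bounded 0 (clip x + 1) cg.
have m0 : 0 < Num.min 1 (e / M) by rewrite lt_min ltr01 divr_gt0.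
exists (Num.min 1 (e / M)) => //= y /=; rewrite lt_min => /andP[y1 y2].
have cl := clip_lip x y; have x0 := clip_ge0 x; have y0 := clip_ge0 y.
have My : M * `|clip x - clip y| <= e.
  by rewrite mulrC -ler_pdivlMr // (le_trans cl) // ltW.
apply: le_trans My; have {y1}yb : clip y <= clip x + 1.
  by have := le_trans cl (ltW y1); rewrite ler_norml; lra.
have [xy|/ltW yx] := leP (clip x) (clip y).
  rewrite (itg_chasles cg x0 xy) opprD addrA subrr add0r normrN distrC (ger0_norm (x := _ - _)) ?subr_ge0 //.
  by apply: itg_bound => // z /andP[z1 z2]; apply: HM; rewrite (le_trans x0) //=; lra.
rewrite (itg_chasles cg y0 yx) addrAC subrr add0r [X in _ <= _ * X]ger0_norm ?subr_ge0 //.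
by apply: itg_bound => // z /andP[z1 z2]; apply: HM; rewrite (le_trans y0) //=; lra.
Qed.

Lemma is_derive_clip_primitive (g : R -> R) d (x : R) : continuous g -> 0 < x ->
  is_derive x 1 (fun y => d + itg 0 (clip y) g) (g x).
Proof.
move=> cg x0; apply: (@is_derive_near_pos _ (fun y => d + itg 0 y g)) => //.
  by move=> y y0; rewrite clipE // ltW.
have d1 := is_derive_itg cg x0.
have := is_deriveD (is_derive_cst d x (1 : R)) d1; rewrite add0r; exact.
Qed.

(** Splitting (x - y) g(y) into x g(y) - y g(y) takes the variable out of the integrand, so that the
    product rule and the fundamental theorem suffice. *)
Lemma is_derive_double (f g : R -> R) c d (x : R) : continuous g ->
  (forall x, 0 <= x -> f x = c + d * x + itg 0 x (fun y => (x - y) * g y)) -> 0 < x ->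
  is_derive x 1 f (d + itg 0 (clip x) g).
Proof.
move=> cg fE x0; rewrite clipE; last exact: ltW.
have cyg : continuous (fun y : R => y * g y) by apply: contM => // y; exact: cvg_id.
apply: (@is_derive_near_pos _ (fun x => c + (d * x + (x * itg 0 x g - itg 0 x (fun y => y * g y))))) => //.
  move=> y y0; rewrite fE ?ltW // -addrA; congr (_ + (_ + _)).
  have cy : continuous (fun z => y * g z) by apply: contZ.
  by rewrite -itgZ // -itgB //; apply: eq_itg => z _; ring.
have d1 := is_derive_itg cg x0; have d2 := is_derive_itg cyg x0.
have d0 := is_derive_id x (1 : R).
have := is_deriveD (is_derive_cst c x (1 : R)) (is_deriveD (is_deriveZ d d0)
  (is_deriveB (is_deriveM d0 d1) d2)).
have -> : 0 + (d *: 1 + ((id x *: g x + itg 0 x g *: 1) - x * g x)) = d + itg 0 x g.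
  by rewrite /GRing.scale /= add0r !mulr1; ring.
exact.
Qed.

End CalculusLemmas.

(** * Gronwall estimate for the averaged difference of two solutions *)

Section Uniqueness.
Context {R : realType} {N : nat}.
Variables (F : R -> R) (T : R) (u v : R -> 'I_N.+1 -> bool -> R -> R).
Hypothesis cF : continuous F.
Hypothesis Flip : forall S, exists2 L, 0 <= L & forall s s', 0 <= s <= S -> 0 <= s' <= S ->
  `|F s - F s'| <= L * `|s - s'|.
Hypotheses (mu_ : mild F T u) (mv_ : mild F T v).
Hypothesis uv0 : forall j b x, 0 <= x -> u 0 j b x = v 0 j b x.

Let w t j b x : R := u t j b x - v t j b x.

Lemma w_buc j b : buc (fun t x => w t j b x).
Proof. by apply: bucB; [exact: (mild_buc mu_)|exact: (mild_buc mv_)]. Qed.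

Let rhs (z : R -> 'I_N.+1 -> bool -> R -> R) s j b x : R := F (edge_sq (z s) j x) * z s j b x.

Lemma rhs_buc z j b : (forall b, buc (fun t x => z t j b x)) -> buc (fun t x => rhs z t j b x).
Proof.
move=> bz; apply: bucM; last exact: bz.
by apply: buc_comp => //; apply: bucD; apply: buc_sqr; exact: bz.
Qed.

Let nl s j b x : R := rhs u s j b x - rhs v s j b x.

Lemma nl_buc j b : buc (fun t x => nl t j b x).
Proof. by apply: bucB; apply: rhs_buc => b'; [exact: (mild_buc mu_)|exact: (mild_buc mv_)]. Qed.

Lemma nl_lip : exists2 L, 0 < L & forall s j b x,
  `|nl s j b x| <= L * (`|w s j true x| + `|w s j false x|).
Proof.
have [[K K0 HK] _] := buc_fin (fun i : 'I_N.+1 * bool => mild_buc mu_ i.1 i.2).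
have [[K' K'0 HK'] _] := buc_fin (fun i : 'I_N.+1 * bool => mild_buc mv_ i.1 i.2).
pose k := K + K'.
have uk s j b x : `|u s j b x| <= k by apply: le_trans (HK (j, b) s x) _; rewrite lerDl ltW.
have vk s j b x : `|v s j b x| <= k by apply: le_trans (HK' (j, b) s x) _; rewrite lerDr ltW.
have k0 : 0 < k by rewrite addr_gt0.
pose S := 2 * k ^+ 2.
have sqS (z : R -> 'I_N.+1 -> bool -> R -> R) s j x : (forall b, `|z s j b x| <= k) ->
    0 <= edge_sq (z s) j x <= S.
  move=> zk; rewrite edge_sq_ge0 /= /edge_sq /S mulrDl !mul1r.
  by apply: lerD; rewrite -real_normK ?num_real // ler_pXn2r ?nnegrE // ltW.
have [L0 L00 HL] := Flip S.
have [KF KF0 HKF] := cont_bounded 0 S cF.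
exists (KF + L0 * (2 * k) * k + 1).
  by rewrite ltr_wpDl // addr_ge0 ?(ltW KF0) // !mulr_ge0 // ltW.
move=> s j b x; rewrite /nl /rhs.
set su := edge_sq (u s) j x; set sv := edge_sq (v s) j x.
have Su : 0 <= su <= S by exact: sqS.
have Sv : 0 <= sv <= S by exact: sqS.
set W := `|w s j true x| + _.
have W0 : 0 <= W by rewrite addr_ge0.
have ww b' : `|w s j b' x| <= W by rewrite /W; case: b'; rewrite ?lerDl ?lerDr.
have dS : `|su - sv| <= (2 * k) * W.
  have -> : su - sv = (u s j true x + v s j true x) * w s j true x +
     (u s j false x + v s j false x) * w s j false x by rewrite /su /sv /edge_sq /w; ring.
  apply: le_trans (ler_normD _ _) _; rewrite !normrM /W mulrDr.
  have P b' : `|u s j b' x + v s j b' x| <= 2 * k.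
    by apply: le_trans (ler_normD _ _) _; rewrite mulrDl !mul1r lerD.
  by apply: lerD; rewrite ler_wpM2r.
have -> : F su * u s j b x - F sv * v s j b x =
  F su * w s j b x + (F su - F sv) * v s j b x by rewrite /w; ring.
apply: le_trans (ler_normD _ _) _; rewrite !normrM.
have A1 : `|F su| * `|w s j b x| <= KF * W by apply: ler_pM => //; exact: HKF.
have A2 : `|F su - F sv| * `|v s j b x| <= L0 * (2 * k) * k * W.
  have -> : L0 * (2 * k) * k * W = L0 * ((2 * k) * W) * k by ring.
  apply: ler_pM => //; apply: le_trans (HL _ _ Su Sv) _; exact: ler_wpM2l.
by rewrite !mulrDl mul1r; have := lerD A1 A2; lra.
Qed.

Lemma w_grad : exists2 B, 0 <= B & forall t m j b, 0 <= t <= T -> dyadic_energy (w t j b) m <= B.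
Proof.
have [B1 H1] := mild_grad mu_; have [B2 H2] := mild_grad mv_.
exists (2 * (`|B1| + `|B2|)); first by rewrite mulr_ge0 ?addr_ge0.
move=> t m j b tT.
have cp (z : R -> 'I_N.+1 -> bool -> R -> R) B : grad_energy (z t) m <= B -> dyadic_energy (z t j b) m <= `|B|.
  move=> zB; apply: le_trans (le_trans zB (ler_norm _)).
  rewrite /grad_energy (bigD1 j) //=; apply: ler_wpDr.
    by apply: sumr_ge0 => i _; rewrite addr_ge0 ?dyadic_energy_ge0.
  by case: (b); rewrite ?lerDl ?lerDr dyadic_energy_ge0.
have {}H1 := cp u B1 (H1 t m tT); have {}H2 := cp v B2 (H2 t m tT).
apply: (@le_trans _ _ (2 * (dyadic_energy (u t j b) m + dyadic_energy (v t j b) m))); last first.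
  by rewrite ler_pM2l // lerD.
rewrite /dyadic_energy -mulrDr mulrCA ler_pM2l ?exprn_gt0 // -big_split /= mulr_sumr.
apply: ler_sum => k _; rewrite /w; set p := u _ _ _ _; set q := v _ _ _ _.
set p' := u _ _ _ _; set q' := v _ _ _ _.
by have := sqr_ge0 ((p - p') + (q - q')); nra.
Qed.

Variable h : R.
Hypothesis h0 : 0 < h.

(* Averaging over [t, t + h] turns the integrated equation into one that may be
   differentiated in time and twice in space. *)
Let W t j b x : R := itg 0 (clip t) (fun s => w s j b x).
Let a t j b x : R := h^-1 * (W (t + h) j b x - W t j b x).
Let da t j b x : R := h^-1 * (w (t + h) j b x - w t j b x).
Let r t j b x : R := h^-1 * itg t (t + h) (fun s => nl s j b x).
(** The second space derivative of the average [a]: averaged nonlinear difference plus the rotated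
    time derivative. *)
Let gam t j b x : R := r t j b x + sgb b * da t j (~~ b) x.

Lemma avgE t j b x : 0 <= t -> a t j b x = h^-1 * itg t (t + h) (fun s => w s j b x).
Proof.
move=> t0; have th : t <= t + h by rewrite lerDl ltW.
rewrite /a /W !clipE //; last exact: le_trans th.
congr (_ * _); rewrite (itg_chasles (buc_contt (x := x) (w_buc j b)) t0 th); ring.
Qed.

Lemma avg_dt (t : R) j b x : 0 < t -> is_derive t 1 (fun s => a s j b x) (da t j b x).
Proof.
move=> t0; have cw := buc_contt (x := x) (w_buc j b).
pose g y := itg 0 y (fun s => w s j b x).
apply: (@is_derive_near_pos _ _ (fun s => h^-1 * (g (s + h) - g s))) => //.
  by move=> y y0; rewrite /a /W !clipE ?ltW // addr_gt0.
have d1 : is_derive t 1 g (w t j b x) by exact: (is_derive_itg cw).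
have d2 : is_derive t 1 (fun s => g (s + h)) (w (t + h) j b x).
  have e1 : is_derive (t + h) 1 g (w (t + h) j b x).
    by apply: (is_derive_itg cw); rewrite addr_gt0.
  have e2 : is_derive t 1 (fun s : R => s + h) 1 by apply: is_derive_eq; rewrite addr0.
  by have := @is_derive1_comp R g (fun s => s + h) t _ _ e1 e2; rewrite mulr1.
exact: (is_deriveZ h^-1 (is_deriveB d2 d1)).
Qed.

Lemma avg_lip (K : R) t s j b x : (forall s, `|w s j b x| <= K) ->
  `|a t j b x - a s j b x| <= h^-1 * (2 * K) * `|t - s|.
Proof.
move=> wK; have cw := buc_contt (x := x) (w_buc j b).
have K0 : 0 <= K by apply: le_trans (wK 0).
have WL p q : `|W p j b x - W q j b x| <= K * `|p - q| by exact: itg_clip_lip.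
rewrite /a -mulrBr normrM (ger0_norm (ltW _)) ?invr_gt0 // -mulrA ler_wpM2l ?invr_ge0 ?(ltW h0) //.
have -> : W (t + h) j b x - W t j b x - (W (s + h) j b x - W s j b x) =
  (W (t + h) j b x - W (s + h) j b x) - (W t j b x - W s j b x) by ring.
apply: le_trans (ler_normB _ _) _; have := WL (t + h) (s + h); have := WL t s.
have -> : t + h - (s + h) = t - s by ring.
lra.
Qed.

Lemma avg_cont t j b : continuous (a t j b).
Proof.
by apply: contZ; apply: contB; apply: (buc_itg_cont (clip_ge0 _) (w_buc j b)).
Qed.

Lemma da_cont t j b : continuous (da t j b).
Proof. by apply: contZ; apply: contB; apply: buc_contx (w_buc j b). Qed.

Lemma r_cont t j b : continuous (r t j b).
Proof. by apply: contZ; apply: (buc_itg_cont _ (nl_buc j b)); rewrite lerDl ltW. Qed.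

Lemma gam_cont t j b : continuous (gam t j b).
Proof. by apply: contD; [exact: r_cont|apply: contZ; exact: da_cont]. Qed.

Lemma avg_close (om : R) t j b x s : 0 <= t ->
  (forall s', t <= s' <= t + h -> `|w s j b x - w s' j b x| <= om) ->
  `|w s j b x - a t j b x| <= om.
Proof.
move=> t0 H; have th : t <= t + h by rewrite lerDl ltW.
have cw := buc_contt (x := x) (w_buc j b).
have E : w s j b x = h^-1 * itg t (t + h) (fun=> w s j b x).
  by rewrite itg_cst // addrAC subrr add0r mulrCA mulVf ?mulr1 // gt_eqF.
rewrite {1}E avgE // -mulrBr -itgB //; last exact: cst_continuous.
rewrite normrM (ger0_norm (ltW _)) ?invr_gt0 // mulrC ler_pdivrMr //.
have -> : om * h = om * (t + h - t) by ring.
by apply: itg_bound => //; apply: contB => //; exact: cst_continuous.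
Qed.

(** [r] averages the nonlinear difference and is not a function of the average [a]. Replacing [w] by
    [a] costs [om], the oscillation of [w] over a window of length [h]. *)
Lemma r_bound (L om : R) t j b x : 0 <= L -> 0 <= t ->
  (forall s b, `|nl s j b x| <= L * (`|w s j true x| + `|w s j false x|)) ->
  (forall b s s', t <= s <= t + h -> t <= s' <= t + h -> `|w s j b x - w s' j b x| <= om) ->
  `|r t j b x| <= L * (`|a t j true x| + `|a t j false x| + 2 * om).
Proof.
move=> L0 t0 HL Hom; have th : t <= t + h by rewrite lerDl ltW.
rewrite /r normrM (ger0_norm (ltW _)) ?invr_gt0 // mulrC ler_pdivrMr //.
set Z := L * _; have -> : Z * h = Z * (t + h - t) by ring.
apply: itg_bound => //; first exact: buc_contt (nl_buc j b).
move=> s st; apply: le_trans (HL s b) _; rewrite ler_wpM2l //.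
have P b' : `|w s j b' x| <= `|a t j b' x| + om.
  have := avg_close (s := s) t0 (fun s' Hs' => Hom b' s s' st Hs').
  set p := w _ _ _ _; set q := a _ _ _ _ => H.
  have -> : p = q + (p - q) by ring.
  by apply: le_trans (ler_normD _ _) _; rewrite lerD2l.
by have := P true; have := P false; lra.
Qed.

Lemma avg_grad (B : R) t m j b : 0 <= t -> t + h <= T ->
  (forall s, 0 <= s <= T -> dyadic_energy (w s j b) m <= B) -> dyadic_energy (a t j b) m <= B.
Proof.
move=> t0 tT HB; have th : t <= t + h by rewrite lerDl ltW.
have -> : a t j b = (fun x => h^-1 * itg t (t + h) (fun s => w s j b x)).
  by apply/funext => x; exact: avgE.
have H s : t <= s <= t + h -> dyadic_energy (w s j b) m <= B.
  by move=> /andP[s1 s2]; apply: HB; rewrite (le_trans t0 s1) (le_trans s2 tT).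
have H2 := dyadic_energy_itg th (w_buc j b) H.
rewrite dyadic_energyZ exprVn mulrC ler_pdivrMr ?exprn_gt0 //.
by rewrite mulrC; move: H2; have -> : t + h - t = h by ring.
Qed.

(** Subtracting the solved equations at [t] from those at [t + h] removes the initial states; the
    slopes are combined linearly and keep the sum 0. *)
Lemma avg_eq t b : 0 <= t -> t + h <= T -> exists d : 'I_N.+1 -> R, \sum_j d j = 0 /\
  forall j x, 0 <= x -> a t j b x = a t j b 0 + d j * x + itg 0 x (fun y => (x - y) * gam t j b y).
Proof.
move=> t0 tT; have th : t <= t + h by rewrite lerDl ltW.
have th0 : 0 <= t + h by exact: le_trans th.
have I1 : 0 <= t <= T by rewrite t0 (le_trans th).
have I2 : 0 <= t + h <= T by rewrite th0.
have [du [du0 Eu]] := mild_eq mu_ b I1; have [du' [du'0 Eu']] := mild_eq mu_ b I2.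
have [dv [dv0 Ev]] := mild_eq mv_ b I1; have [dv' [dv'0 Ev']] := mild_eq mv_ b I2.
exists (fun j => h^-1 * ((du' j - dv' j) - (du j - dv j))); split.
  by rewrite -mulr_sumr !sumrB du0 du'0 dv0 dv'0 !subrr mulr0.
move=> j x x0.
have bu := mild_buc mu_ j; have bv := mild_buc mv_ j; have bub := bu b; have bvb := bv b.
have cs (z : R -> 'I_N.+1 -> bool -> R -> R) s : 0 <= s -> (forall b, buc (fun t x => z t j b x)) ->
    continuous (mild_source F z s j b).
  move=> s0 bz; apply: contD; first exact: (buc_itg_cont s0 (rhs_buc b bz)).
  by apply: contZ; apply: contB; apply: buc_contx (bz _).
have WE s y : 0 <= s -> W s j b y = itg 0 s (fun s => u s j b y) - itg 0 s (fun s => v s j b y).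
  by move=> s0; rewrite /W clipE // -itgB //; [exact: buc_contt bub|exact: buc_contt bvb].
have cxy (g : R -> R) : continuous g -> continuous (fun y => (x - y) * g y).
  move=> cg; apply: contM => //; apply: contB; first exact: cst_continuous.
  by move=> y; exact: cvg_id.
have G : itg 0 x (fun y => (x - y) * gam t j b y) = h^-1 *
  ((itg 0 x (fun y => (x - y) * mild_source F u (t + h) j b y) -
    itg 0 x (fun y => (x - y) * mild_source F v (t + h) j b y)) -
   (itg 0 x (fun y => (x - y) * mild_source F u t j b y) -
    itg 0 x (fun y => (x - y) * mild_source F v t j b y))).
  have c1 := cxy _ (cs u _ th0 bu); have c2 := cxy _ (cs v _ th0 bv).
  have c3 := cxy _ (cs u _ t0 bu); have c4 := cxy _ (cs v _ t0 bv).
  rewrite -(itgB _ _ c1 c2) -(itgB _ _ c3 c4) -(itgB _ _ (contB c1 c2) (contB c3 c4)).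
  rewrite -(itgZ _ _ _ (contB (contB c1 c2) (contB c3 c4))).
  apply: eq_itg => y /andP[y0 _]; rewrite /gam /r /nl itgB; last 2 first.
  - exact: (buc_contt (x := y) (rhs_buc b bu)).
  - exact: (buc_contt (x := y) (rhs_buc b bv)).
  rewrite /mild_source /da /w /rhs (uv0 j (~~ b) y0).
  rewrite (itg_chasles (buc_contt (x := y) (rhs_buc b bu)) t0 th).
  rewrite (itg_chasles (buc_contt (x := y) (rhs_buc b bv)) t0 th) /rhs; ring.
rewrite G /a !WE // Eu // Eu' // Ev // Ev' //; ring.
Qed.

Variables (K L B om : R).
Hypotheses (L0 : 0 <= L) (B0 : 0 <= B) (om0 : 0 <= om).
Hypothesis wK : forall t j b x, `|w t j b x| <= K.
Hypothesis wB : forall t m j b, 0 <= t <= T -> dyadic_energy (w t j b) m <= B.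
Hypothesis wL : forall s j b x, `|nl s j b x| <= L * (`|w s j true x| + `|w s j false x|).
Hypothesis wom : forall j b x t s, `|t - s| <= h -> `|w t j b x - w s j b x| <= om.

Lemma avg_le t j b x : 0 <= t -> `|a t j b x| <= K.
Proof.
move=> t0; have th : t <= t + h by rewrite lerDl ltW.
rewrite avgE // normrM (ger0_norm (ltW _)) ?invr_gt0 // mulrC ler_pdivrMr //.
have -> : K * h = K * (t + h - t) by ring.
by apply: itg_bound => //; exact: buc_contt (w_buc j b).
Qed.

Lemma w_osc t j b x s s' : t <= s <= t + h -> t <= s' <= t + h -> `|w s j b x - w s' j b x| <= om.
Proof. by move=> /andP[a1 a2] /andP[b1 b2]; apply: wom; rewrite ler_norml; lra. Qed.

Lemma avg_vertex t j j' b : 0 <= t -> t + h <= T -> a t j b 0 = a t j' b 0.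
Proof.
move=> t0 tT; rewrite !avgE //; congr (_ * _); apply: eq_itg => s /andP[s1 s2].
have sT : 0 <= s <= T by rewrite (le_trans t0) // (le_trans s2).
by rewrite /w (mild_vertex mu_ j j' b sT) (mild_vertex mv_ j j' b sT).
Qed.

Variable Z : R.
Hypothesis Z0 : 0 < Z.
(** The cut-off flux is the integral over [[0, Y]] of |a| |a'|, divided by [Y]. With |a| <= K and a'
    bounded in L^2 it decays like the inverse square root of [Y]; taking a square for [Y] and the
    Young weights 1 / Z and Z avoids the root. *)
Let Y := Z ^+ 2.
Let cut x : R := 1 - x / Y.

Let Y_gt0 : 0 < Y. Proof. by rewrite exprn_gt0. Qed.

Lemma cut01 x : 0 <= x <= Y -> 0 <= cut x <= 1.
Proof.
case/andP=> x0 xY; rewrite /cut subr_ge0 ler_pdivrMr // mul1r xY gerBl.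
by rewrite divr_ge0 // ltW.
Qed.

Lemma cut_cont : continuous cut.
Proof.
apply: contB; first exact: cst_continuous.
by move=> x; apply: cvgM; [exact: cvg_id|exact: cvg_cst].
Qed.

(* The vertex contributions cancel by the Kirchhoff condition; the cut-off
   contributes a flux of size 1 / Y times the L2 norm of the gradient. *)
Lemma avg_flux t : 0 <= t -> t + h <= T ->
  `|\sum_j itg 0 Y (fun x => cut x * (a t j false x * gam t j true x - a t j true x * gam t j false x))|
  <= N.+1%:R * ((K ^+ 2 + B) / Z).
Proof.
move=> t0 tT; have Yn := ltW Y_gt0.
have [dt [dt0 Et]] := avg_eq true t0 tT; have [df [df0 Ef]] := avg_eq false t0 tT.
pose d b := if b then dt else df.
have Ed b j x : 0 <= x -> a t j b x = a t j b 0 + d b j * x + itg 0 x (fun y => (x - y) * gam t j b y).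
  by case: b; [exact: Et|exact: Ef].
pose P b j x := d b j + itg 0 (clip x) (gam t j b).
have cg := @gam_cont t; have ca := @avg_cont t.
have cP b j : continuous (P b j) by exact: clip_primitive_cont (cg j b).
have dP b j (x : R) : 0 < x -> is_derive x 1 (P b j) (gam t j b x).
  by move=> x0; exact: is_derive_clip_primitive (cg j b) x0.
have dA b j (x : R) : 0 < x -> is_derive x 1 (a t j b) (P b j x).
  by move=> x0; exact: is_derive_double (cg j b) (Ed b j) x0.
(* [P] is the space derivative of the average, whose dyadic energies inherit the bound [B]. *)
have P2 b j : itg 0 Y (fun x => P b j x ^+ 2) <= B.
  apply: (@itg_sqr_wderiv _ (a t j b)) => //.
    move=> x x0; have -> : itg 0 x (P b j) = a t j b x - a t j b 0; last by ring.
    apply: itg_FTC2 => //; first exact: continuous_subspaceT (ca j b).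
    by move=> y /andP[y0 _]; exact: dA.
  by move=> m; apply: avg_grad => // s sT; exact: wB.
pose q j := a t j false; pose p j := a t j true.
pose f j x := cut x * (q j x * gam t j true x - p j x * gam t j false x).
(* The current. In its derivative the products of two first derivatives cancel, so [cut * g] has
   derivative [f j x - Y^-1 * g j x]. *)
pose g j x := q j x * P true j x - p j x * P false j x.
have cf j : continuous (f j).
  by apply: contM; [exact: cut_cont|apply: contB; apply: contM => //; exact: ca].
have cgj j : continuous (g j) by apply: contB; apply: contM => //; exact: ca.
have ibp j : itg 0 Y (f j) = - (q j 0 * dt j - p j 0 * df j) + Y^-1 * itg 0 Y (g j).
  have H : itg 0 Y (fun x => f j x - Y^-1 * g j x) = cut Y * g j Y - cut 0 * g j 0.
    apply: (@itg_FTC2 _ 0 Y (fun x => cut x * g j x) _ Yn).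
    - by apply: contB; [exact: cf|apply: contZ; exact: cgj].
    - by apply: continuous_subspaceT; apply: contM => //; exact: cut_cont.
    - move=> x /andP[x0 _].
      have dc : is_derive x 1 cut (- Y^-1).
        have := is_deriveB (is_derive_cst (1 : R) x (1 : R)) (is_deriveZ Y^-1 (is_derive_id x (1 : R))).
        rewrite sub0r /GRing.scale /= mulr1; have -> // : (cst 1 - Y^-1 \*: id) = cut.
        by apply/funext => y; rewrite /cut /= mulrC.
      have dg := is_deriveB (is_deriveM (dA false j x x0) (dP true j x x0))
        (is_deriveM (dA true j x x0) (dP false j x x0)).
      have := is_deriveM dc dg.
      set D := (X in is_derive _ _ _ X).
      have -> : D = f j x - Y^-1 * g j x.
        rewrite /D /f /g /p /q /GRing.scale /=.
        rewrite -[(a t j false * P true j - a t j true * P false j) x]/(a t j false x * P true j x - a t j true x * P false j x).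
        by ring.
      exact.
  move: H; rewrite itgB // ?itgZ //; last exact: contZ.
  rewrite /cut divff ?gt_eqF // subrr mul0r sub0r mul0r subr0 mul1r => /eqP.
  rewrite subr_eq => /eqP ->; congr (- _ + _).
  by rewrite /g /P clipE // !itgxx !addr0.
have -> : \sum_j itg 0 Y (fun x => cut x * (a t j false x * gam t j true x - a t j true x * gam t j false x)) =
   \sum_j Y^-1 * itg 0 Y (g j).
  rewrite (eq_bigr (fun j => - (q ord0 0 * dt j - p ord0 0 * df j) + Y^-1 * itg 0 Y (g j))).
    by rewrite big_split /= sumrN sumrB -!mulr_sumr dt0 df0 !mulr0 subrr oppr0 add0r.
  move=> j _; rewrite -[LHS]/(itg 0 Y (f j)) ibp /q /p.
  by rewrite (@avg_vertex t j ord0 true) // (@avg_vertex t j ord0 false).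
apply: le_trans (ler_norm_sum _ _ _) _.
have -> : N.+1%:R * ((K ^+ 2 + B) / Z) = \sum_(j < N.+1) ((K ^+ 2 + B) / Z).
  by rewrite sumr_const card_ord mulr_natl.
apply: ler_sum => j _; rewrite normrM (ger0_norm (ltW _)) ?invr_gt0 // mulrC ler_pdivrMr //.
apply: le_trans (ler_itg_norm _ _ (cgj j)) _.
have K0 : 0 <= K by apply: le_trans (wK 0 ord0 true 0).
apply: (@le_trans _ _ (itg 0 Y (fun x => K ^+ 2 / Z + Z / 2 * (P true j x ^+ 2 + P false j x ^+ 2)))).
  apply: le_itg.
  - exact: continuous_norm.
  - apply: contD; first exact: cst_continuous.
    by apply: contZ; apply: contD; apply: continuous_sqr.
  move=> x _; apply: le_trans (ler_normB _ _) _; rewrite (normrM (q j x)) (normrM (p j x)).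
  have am (al be : R) : 0 <= al -> 0 <= be -> al <= K -> al * be <= K ^+ 2 / Z / 2 + Z / 2 * be ^+ 2.
    move=> al0 be0 alK; apply: (@le_trans _ _ (K * be)); first by rewrite ler_wpM2r.
    rewrite -(ler_pM2l (mulr_gt0 (ltr0n R 2) Z0)).
    have -> : 2 * Z * (K ^+ 2 / Z / 2 + Z / 2 * be ^+ 2) = K ^+ 2 + (Z * be) ^+ 2.
      by field; rewrite gt_eqF.
    by have := sqr_ge0 (K - Z * be); rewrite sqrrB; lra.
  have A1 := am _ _ (normr_ge0 (q j x)) (normr_ge0 (P true j x)) (avg_le j false x t0).
  have A2 := am _ _ (normr_ge0 (p j x)) (normr_ge0 (P false j x)) (avg_le j true x t0).
  rewrite !real_normK ?num_real // in A1 A2; lra.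
have cPP : continuous (fun x => P true j x ^+ 2 + P false j x ^+ 2).
  by apply: contD; apply: continuous_sqr.
rewrite itgD; [|exact: cst_continuous|exact: contZ].
rewrite itg_cst // itgZ // itgD; [|exact: continuous_sqr|exact: continuous_sqr].
have E1 : K ^+ 2 / Z * (Y - 0) = K ^+ 2 * Z by rewrite /Y subr0; field; rewrite gt_eqF.
have E2 : (K ^+ 2 + B) / Z * Y = K ^+ 2 * Z + Z / 2 * (B + B) by rewrite /Y; field; rewrite gt_eqF.
rewrite E1 E2 lerD2l ler_wpM2l ?divr_ge0 ?(ltW Z0) //.
exact: lerD (P2 true j) (P2 false j).
Qed.

Let J t : R := \sum_j itg 0 Y (fun x => cut x * edge_sq (a t) j x).
Let dJ t : R := \sum_j itg 0 Y (fun x => cut x * (2 * (a t j true x * da t j true x + a t j false x * da t j false x))).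

(** Solving the definition of [gam] for [da] turns [dJ] into twice the flux of [avg_flux] plus a
    term in [r]. The latter is at most quadratic in [a] up to an error proportional to [om],
    integrated over a length [Y] on each edge. *)
Lemma mass_rate t : 0 <= t -> t + h <= T ->
  dJ t <= 4 * L * J t + (2 * (N.+1%:R * ((K ^+ 2 + B) / Z)) + N.+1%:R * (8 * K * L * om * Y)).
Proof.
move=> t0 tT; have fl := avg_flux t0 tT.
have K0 : 0 <= K by apply: le_trans (wK 0 ord0 true 0).
pose f j x := cut x * (a t j false x * gam t j true x - a t j true x * gam t j false x).
pose g j x := cut x * (a t j true x * r t j false x - a t j false x * r t j true x).
have ca := @avg_cont t; have cg := @gam_cont t; have cr := @r_cont t.
have cf j : continuous (f j).
  by apply: contM; [exact: cut_cont|apply: contB; apply: contM => //; exact: ca].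
have cgj j : continuous (g j).
  by apply: contM; [exact: cut_cont|apply: contB; apply: contM => //; exact: ca].
have cq j : continuous (fun x => cut x * edge_sq (a t) j x).
  by apply: contM; [exact: cut_cont|apply: cont_edge_sq => b; exact: ca].
have -> : dJ t = 2 * (\sum_j itg 0 Y (f j)) + 2 * \sum_j itg 0 Y (g j).
  rewrite !mulr_sumr -big_split /=; apply: eq_bigr => j _.
  rewrite -!itgZ // -itgD; [|exact: contZ|exact: contZ].
  by apply: eq_itg => x _; rewrite /f /g /gam /sgb /=; ring.
have G j : itg 0 Y (g j) <= 2 * L * itg 0 Y (fun x => cut x * edge_sq (a t) j x) + 4 * K * L * om * Y.
  rewrite -itgZ //; have -> : 4 * K * L * om * Y = itg 0 Y (fun=> 4 * K * L * om).
    by rewrite itg_cst ?subr0 // ltW.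
  rewrite -itgD; [|exact: contZ|exact: cst_continuous].
  apply: le_itg => //; first by apply: contD; [exact: contZ|exact: cst_continuous].
  move=> x /cut01 /andP[c0 c1].
  have rb b := @r_bound L om t j b x L0 t0 (fun s b => wL s j b x) (fun b s s' => @w_osc t j b x s s').
  set al := `|a t j true x|; set be := `|a t j false x|.
  have [al0 be0] : 0 <= al /\ 0 <= be by rewrite !normr_ge0.
  have [alK beK] : al <= K /\ be <= K by split; exact: avg_le.
  have sqE : edge_sq (a t) j x = al ^+ 2 + be ^+ 2.
    by rewrite /edge_sq /al /be !real_normK ?num_real.
  have H1 : a t j true x * r t j false x - a t j false x * r t j true x <=
     (al + be) * (L * (al + be + 2 * om)).
    apply: le_trans (ler_norm _) _; apply: le_trans (ler_normB _ _) _.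
    rewrite (normrM (a t j true x)) (normrM (a t j false x)) mulrDl.
    by apply: lerD; apply: (ler_wpM2l (normr_ge0 _)); exact: rb.
  have H2 : (al + be) * (L * (al + be + 2 * om)) <= 2 * L * edge_sq (a t) j x + 4 * K * L * om.
    have -> : (al + be) * (L * (al + be + 2 * om)) = L * (al + be) ^+ 2 + 2 * (L * om) * (al + be) by ring.
    have S1 : L * (al + be) ^+ 2 <= L * (2 * (al ^+ 2 + be ^+ 2)).
      by rewrite ler_wpM2l //; have := sqr_ge0 (al - be); rewrite sqrrB sqrrD; lra.
    have S2 : 2 * (L * om) * (al + be) <= 2 * (L * om) * (2 * K).
      by rewrite ler_wpM2l ?mulr_ge0 //; lra.
    by rewrite sqE; lra.
  apply: (@le_trans _ _ (cut x * (2 * L * edge_sq (a t) j x + 4 * K * L * om))).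
    by rewrite /g ler_wpM2l // (le_trans H1).
  rewrite mulrDr; apply: lerD; first by rewrite le_eqVlt; apply/orP; left; apply/eqP; ring.
  by rewrite ler_piMl // !mulr_ge0.
have SG : \sum_j itg 0 Y (g j) <= 2 * L * J t + N.+1%:R * (4 * K * L * om * Y).
  apply: le_trans (ler_sum _ (fun j _ => G j)) _.
  by rewrite big_split /= sumr_const card_ord -[_ *+ N.+1]mulr_natl -mulr_sumr lexx.
move: fl; rewrite ler_norml => /andP[_ fl].
have -> : N.+1%:R * (8 * K * L * om * Y) = 2 * (N.+1%:R * (4 * K * L * om * Y)) by ring.
by have := lerD fl SG; rewrite /f; set s1 := \sum_j _; set s2 := \sum_j _; lra.
Qed.

Lemma avg_lipschitz t s j b x : `|a t j b x - a s j b x| <= h^-1 * (2 * K) * `|t - s|.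
Proof. by apply: avg_lip => s'; exact: wK. Qed.

Lemma mass_derive (t : R) : 0 < t -> is_derive t 1 J (dJ t).
Proof.
move=> t0.
have -> : J = \sum_(j < N.+1) (fun t => itg 0 Y (fun x => cut x * edge_sq (a t) j x)).
  by apply/funext => s; rewrite fct_sumE.
apply: is_derive_sum => j.
have K0 : 0 <= K by apply: le_trans (wK 0 ord0 true 0).
pose p s x := cut x * (2 * (a s j true x * da s j true x + a s j false x * da s j false x)).
apply: (@is_derive_itg_param _ Y t t (fun s x => cut x * edge_sq (a s) j x) p (ltW Y_gt0) t0).
- move=> s x st _.
  have s0 : 0 < s by move: st; rewrite ltr_norml; lra.
  have d1 b := @avg_dt s j b x s0.
  have := is_deriveZ (cut x) (is_deriveD (is_deriveM (d1 true) (d1 true)) (is_deriveM (d1 false) (d1 false))).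
  set D := (X in is_derive _ _ _ X).
  have -> // : D = p s x by rewrite /D /p /GRing.scale /=; ring.
- by move=> s; apply: contM; [exact: cut_cont|apply: cont_edge_sq => b; exact: avg_cont].
- move=> s; apply: contM; first exact: cut_cont.
  apply: contZ; apply: contD; (apply: contM; [exact: avg_cont|exact: da_cont]).
move=> e e0.
have [_ ub] := buc_fin (fun b => w_buc j b).
pose k := 16 * h^-1 * (K + 1).
have hi : 0 < h^-1 by rewrite invr_gt0.
have k0 : 0 < k by rewrite !mulr_gt0 //; lra.
have [d d0 Hd] := ub (e / k) (divr_gt0 e0 k0).
pose C := h^-1 * (2 * K).
have C0 : 0 <= C by rewrite !mulr_ge0 // ltW.
pose e' := e / (8 * (C + 1)).
have C1 : 0 < 8 * (C + 1) by lra.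
have e'0 : 0 < e' by rewrite divr_gt0.
exists (Num.min (Num.min d t) (e' / (C + 1))).
  by rewrite !lt_min d0 t0 divr_gt0 //; lra.
move=> s x; rewrite !lt_min => /andP[/andP[st1 st2] st3] /cut01 /andP[c0 c1].
have s0 : 0 < s by move: st2; rewrite ltr_norml; lra.
have da1 b : `|da s j b x - da t j b x| <= h^-1 * (2 * (e / k)).
  rewrite /da -mulrBr normrM (ger0_norm (ltW hi)) ler_wpM2l ?(ltW hi) //.
  have -> : w (s + h) j b x - w s j b x - (w (t + h) j b x - w t j b x) =
    (w (s + h) j b x - w (t + h) j b x) - (w s j b x - w t j b x) by ring.
  apply: le_trans (ler_normB _ _) _.
  have xx : `|x - x| < d by rewrite subrr normr0.
  have st : `|s + h - (t + h)| < d by have -> : s + h - (t + h) = s - t by ring.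
  have A1 := Hd b (t + h) (s + h) x x st xx; have A2 := Hd b t s x x st1 xx.
  by rewrite mulrDl mul1r; exact: lerD A1 A2.
have da2 b : `|da t j b x| <= C.
  rewrite /da normrM (ger0_norm (ltW hi)) /C ler_wpM2l ?(ltW hi) //.
  by apply: le_trans (ler_normB _ _) _; rewrite mulrDl mul1r lerD ?wK.
have a1 b : `|a s j b x - a t j b x| <= e'.
  apply: le_trans (avg_lipschitz s t j b x) _; rewrite -/C.
  apply: (@le_trans _ _ (C * (e' / (C + 1)))); first by rewrite ler_wpM2l // ltW.
  by rewrite mulrCA ler_piMr ?(ltW e'0) // ler_pdivrMr ?mul1r; lra.
have a2 b : `|a s j b x| <= K by apply: avg_le; exact: ltW.
have prod b : `|a s j b x * da s j b x - a t j b x * da t j b x| <= e / 4.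
  have -> : a s j b x * da s j b x - a t j b x * da t j b x =
    a s j b x * (da s j b x - da t j b x) + (a s j b x - a t j b x) * da t j b x by ring.
  apply: le_trans (ler_normD _ _) _.
  rewrite (normrM (a s j b x)) (normrM (a s j b x - _)).
  have P1 : `|a s j b x| * `|da s j b x - da t j b x| <= e / 8.
    apply: (@le_trans _ _ (K * (h^-1 * (2 * (e / k))))); first exact: ler_pM.
    rewrite /k; have -> : K * (h^-1 * (2 * (e / (16 * h^-1 * (K + 1))))) = e / 8 * (K / (K + 1)).
      by field; rewrite !gt_eqF //; lra.
    by rewrite ler_piMr ?divr_ge0 ?(ltW e0) // ler_pdivrMr ?mul1r; lra.
  have P2 : `|a s j b x - a t j b x| * `|da t j b x| <= e / 8.
    apply: (@le_trans _ _ (e' * C)); first exact: ler_pM.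
    rewrite /e'; have -> : e / (8 * (C + 1)) * C = e / 8 * (C / (C + 1)) by field; lra.
    by rewrite ler_piMr ?divr_ge0 ?(ltW e0) // ler_pdivrMr ?mul1r; lra.
  lra.
rewrite /p -mulrBr normrM (ger0_norm c0); apply: (@le_trans _ _ (1 * e)); last by rewrite mul1r.
apply: ler_pM => //.
have -> : 2 * (a s j true x * da s j true x + a s j false x * da s j false x) -
  2 * (a t j true x * da t j true x + a t j false x * da t j false x) =
  2 * ((a s j true x * da s j true x - a t j true x * da t j true x) +
       (a s j false x * da s j false x - a t j false x * da t j false x)) by ring.
rewrite normrM ger0_norm //; have := ler_normD (a s j true x * da s j true x - a t j true x * da t j true x)
  (a s j false x * da s j false x - a t j false x * da t j false x).
by have := prod true; have := prod false; lra.
Qed.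

(** Gronwall's inequality needs continuity up to t = 0, where no derivative is available; [clip]
    provides a version continuous on the line. *)
Lemma mass_cont : continuous (fun t => J (clip t)).
Proof.
have K0 : 0 <= K by apply: le_trans (wK 0 ord0 true 0).
have hi : 0 < h^-1 by rewrite invr_gt0.
apply: continuous_sum => j.
pose C := h^-1 * (2 * K); have C0 : 0 <= C by rewrite !mulr_ge0 // ltW.
pose k := 4 * K * C * Y + 1.
have k0 : 0 < k by rewrite ltr_wpDl // !mulr_ge0 // ltW.
apply: modulus_continuous => e e0; exists (e / k); first by rewrite divr_gt0.
move=> t s ts.
have cq t' : continuous (fun x => cut x * edge_sq (a t') j x).
  by apply: contM; [exact: cut_cont|apply: cont_edge_sq => b; exact: avg_cont].
rewrite -itgB //; apply: (@le_trans _ _ (4 * K * C * `|t - s| * (Y - 0))).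
  apply: itg_bound; [exact: contB|exact: ltW|].
  move=> x /cut01 /andP[c0 c1]; rewrite -mulrBr normrM (ger0_norm c0).
  set D := edge_sq _ _ _ - _; suff : `|D| <= 4 * K * C * `|t - s|.
    by move=> H; apply: le_trans H; rewrite ler_piMl.
  have S b : `|a (clip t) j b x ^+ 2 - a (clip s) j b x ^+ 2| <= C * `|t - s| * (K + K).
    rewrite subr_sqr normrM; apply: ler_pM => //.
      apply: le_trans (avg_lipschitz _ _ _ _ _) _; rewrite ler_wpM2l //; exact: clip_lip.
    by apply: le_trans (ler_normD _ _) _; rewrite lerD ?avg_le ?clip_ge0.
  have -> : D = (a (clip t) j true x ^+ 2 - a (clip s) j true x ^+ 2) +
     (a (clip t) j false x ^+ 2 - a (clip s) j false x ^+ 2) by rewrite /D /edge_sq; ring.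
  by apply: le_trans (ler_normD _ _) _; have := S true; have := S false; lra.
rewrite subr0; apply: (@le_trans _ _ (4 * K * C * Y * (e / k))).
  have -> : 4 * K * C * `|t - s| * Y = 4 * K * C * Y * `|t - s| by ring.
  by rewrite ler_wpM2l ?(ltW ts) // !mulr_ge0 // ltW.
by rewrite mulrCA ler_piMr ?(ltW e0) // ler_pdivrMr // mul1r /k; lra.
Qed.

(** The initial value of [J] is not 0, because [a] at time 0 averages [w] over [[0, h]], but it is
    of order om^2. The condition [X + X <= Y] makes the cut-off at least 1/2 on [[0, X]], and
    returning from the average to [w] costs another om^2 per unit length. *)
Lemma avg_gronwall t X j b : 0 <= t -> t + h <= T -> 0 <= X -> X + X <= Y ->
  itg 0 X (fun x => w t j b x ^+ 2) <=
   4 * (N.+1%:R * (2 * om ^+ 2 * Y) +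
     (2 * (N.+1%:R * ((K ^+ 2 + B) / Z)) + N.+1%:R * (8 * K * L * om * Y)) * t) * expR (4 * L * t)
   + 2 * om ^+ 2 * X.
Proof.
move=> t0 tT X0 XY; have K0 : 0 <= K by apply: le_trans (wK 0 ord0 true 0).
set be := 2 * (N.+1%:R * _) + _.
have be0 : 0 <= be.
  apply: addr_ge0; first by rewrite !mulr_ge0 // ?invr_ge0 ?addr_ge0 ?sqr_ge0 // ltW.
  by rewrite !mulr_ge0 // ltW.
have Th : 0 <= T - h by lra.
have tTh : 0 <= t <= T - h by rewrite t0; lra.
have G := @gronwall R (T - h) (4 * L) be (fun t => J (clip t)) dJ Th _ be0
  (continuous_subspaceT mass_cont) _ _ t tTh.
have {G} : J t <= (J 0 + be * t) * expR (4 * L * t).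
  have := G; rewrite !clipE //; apply.
  - by rewrite mulr_ge0.
  - move=> s /andP[s0 _]; have Jc y : 0 < y -> J (clip y) = J y by move=> y0; rewrite clipE // ltW.
    exact: (@is_derive_near_pos R (fun t => J (clip t)) J s (dJ s) s0 Jc (mass_derive s0)).
  - move=> s /andP[s0 sT]; have -> : clip s = s by rewrite clipE // ltW.
    have sT' : s + h <= T by rewrite -lerBrDr ltW.
    exact: (mass_rate (ltW s0) sT').
have cq t' j' : continuous (fun x => cut x * edge_sq (a t') j' x).
  by apply: contM; [exact: cut_cont|apply: cont_edge_sq => b'; exact: avg_cont].
have J0 : J 0 <= N.+1%:R * (2 * om ^+ 2 * Y).
  have -> : N.+1%:R * (2 * om ^+ 2 * Y) = \sum_(j < N.+1) (2 * om ^+ 2 * Y).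
    by rewrite sumr_const card_ord mulr_natl.
  apply: ler_sum => j' _; rewrite -[X in _ * X]subr0 -itg_cst ?(ltW Y_gt0) //.
  apply: le_itg => //; first exact: cst_continuous.
  move=> x xY; have [x0 _] := andP xY; have [c0 c1] := andP (cut01 xY).
  have A b' : a 0 j' b' x ^+ 2 <= om ^+ 2.
    rewrite -real_normK ?num_real // ler_pXn2r ?nnegrE //.
    have w00 : w 0 j' b' x = 0 by rewrite /w uv0 // subrr.
    have I0 : (0 : R) <= 0 <= (0 : R) + h by apply/andP; split; [exact: lexx|rewrite add0r; exact: ltW].
    have := @avg_close om 0 j' b' x 0 (lexx 0) (fun s' => @w_osc 0 j' b' x 0 s' I0).
    by rewrite w00 sub0r normrN.
  apply: (@le_trans _ _ (edge_sq (a 0) j' x)); first by rewrite ler_piMl // edge_sq_ge0.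
  by rewrite /edge_sq; have := A true; have := A false; lra.
have XY' : X <= Y by lra.
have Jt : itg 0 X (fun x => 2^-1 * a t j b x ^+ 2) <= J t.
  rewrite /J (bigD1 j) //=; apply: ler_wpDr.
    apply: sumr_ge0 => j' _; apply: itg_ge0 => x /cut01 /andP[c0 _].
    by rewrite mulr_ge0 // edge_sq_ge0.
  rewrite (itg_chasles (cq t j) X0 XY'); apply: ler_wpDr.
    apply: itg_ge0 => x /andP[x1 x2]; rewrite mulr_ge0 ?edge_sq_ge0 //.
    have xY : 0 <= x <= Y by rewrite (le_trans X0 x1) x2.
    by have /andP[] := cut01 xY.
  apply: le_itg => //; first by apply: contZ; apply: continuous_sqr; exact: avg_cont.
  move=> x /andP[x1 x2].
  have c2 : 2^-1 <= cut x.
    rewrite /cut lerBrDr -lerBrDl ler_pdivrMr //; have -> : 1 - 2^-1 = 2^-1 :> R by field.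
    lra.
  have i2 : 0 <= 2^-1 :> R by rewrite invr_ge0 ler0n.
  apply: (ler_pM i2 (sqr_ge0 _) c2).
  by rewrite /edge_sq; case: (b); rewrite ?lerDl ?lerDr sqr_ge0.
have W1 : itg 0 X (fun x => w t j b x ^+ 2) <= 4 * itg 0 X (fun x => 2^-1 * a t j b x ^+ 2) + 2 * om ^+ 2 * X.
  have c1 : continuous (fun x => 2^-1 * a t j b x ^+ 2).
    by apply: contZ; apply: continuous_sqr; exact: avg_cont.
  rewrite -itgZ // -[X in _ + _ * X]subr0 -itg_cst // -itgD; [|exact: contZ|exact: cst_continuous].
  apply: le_itg.
  - by apply: continuous_sqr; apply: buc_contx (w_buc j b).
  - by apply: contD; [exact: contZ|exact: cst_continuous].
  move=> x _; have Tt : t <= t <= t + h by rewrite lexx lerDl ltW.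
  have := avg_close (s := t) t0 (fun s' Hs' => @w_osc t j b x t s' Tt Hs').
  set p := w _ _ _ _; set q := a _ _ _ _ => H.
  have : (p - q) ^+ 2 <= om ^+ 2.
    by rewrite -real_normK ?num_real // ler_pXn2r ?nnegrE.
  by move=> /sqr_le_close.
move=> G; apply: le_trans W1 _; rewrite lerD2r -mulrA ler_pM2l //.
apply: le_trans (le_trans Jt G) _; rewrite ler_pM2r ?expR_gt0 // lerD2r.
exact: J0.
Qed.

End Uniqueness.

(** The order of choice matters: [Z] first, to make the flux term small, then [om0], since the other
    terms grow with [Z ^+ 2]. *)
Lemma small_quantity {R : realType} (a1 a2 a3 X e : R) : 0 <= a1 -> 0 <= a2 -> 0 <= a3 -> 0 <= X ->
  0 < e -> exists2 Z, 0 < Z /\ X + X <= Z ^+ 2 & exists2 om0, 0 < om0 &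
    forall om, 0 <= om <= om0 -> 4 * (a1 * (2 * om ^+ 2 * Z ^+ 2) + (a2 / Z + a3 * om * Z ^+ 2)) +
      2 * om ^+ 2 * X <= e.
Proof.
move=> a10 a20 a30 X0 e0.
pose Z := X + X + 1 + 8 * a2 / e.
have q0 : 0 <= 8 * a2 / e by rewrite divr_ge0 ?mulr_ge0 // ltW.
have Z1 : 1 <= Z by rewrite /Z; lra.
have Z0 : 0 < Z by lra.
exists Z.
  split=> //; rewrite expr2; apply: (@le_trans _ _ (1 * Z)); first by rewrite mul1r /Z; lra.
  by rewrite ler_pM2r.
have H2 : 4 * (a2 / Z) <= e / 2.
  rewrite mulrA ler_pdivrMr // /Z mulrDr; apply: ler_wpDl.
    by rewrite mulr_ge0 ?divr_ge0 ?(ltW e0) //; lra.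
  by have -> : e / 2 * (8 * a2 / e) = 4 * a2 by field; rewrite gt_eqF.
pose k := 8 * a1 * Z ^+ 2 + 4 * a3 * Z ^+ 2 + 2 * X + 1.
have Z2 : 0 <= Z ^+ 2 by exact: sqr_ge0.
have c1 : 0 <= 8 * a1 * Z ^+ 2 := mulr_ge0 (mulr_ge0 (ler0n _ 8) a10) Z2.
have c3 : 0 <= 4 * a3 * Z ^+ 2 := mulr_ge0 (mulr_ge0 (ler0n _ 4) a30) Z2.
have cX : 0 <= 2 * X := mulr_ge0 (ler0n _ 2) X0.
have k0 : 0 < k by rewrite /k; lra.
exists (Num.min 1 (e / 2 / k)); first by rewrite lt_min ltr01 !divr_gt0.
move=> om /andP[om0]; rewrite le_min => /andP[om1 omk].
have om2 : om ^+ 2 <= om by rewrite expr2 ler_piMl.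
have H3 : 8 * a1 * Z ^+ 2 * om ^+ 2 <= 8 * a1 * Z ^+ 2 * om by exact: ler_wpM2l c1 _ _ om2.
have H4 : 2 * X * om ^+ 2 <= 2 * X * om by exact: ler_wpM2l cX _ _ om2.
have H5 : om * k <= e / 2 by rewrite -ler_pdivlMr.
have H6 : 0 <= om by [].
move: H5; rewrite /k !mulrDr; lra.
Qed.

(** Uniform continuity gives an averaging window [h] on which the oscillation is as small as wanted.
    The window must fit before [T], whence the strict [t < T]. The vertex x = 0 is reached by
    continuity. *)
Lemma mild_unique {R : realType} {N : nat} (F : R -> R) (T : R)
    (u v : R -> 'I_N.+1 -> bool -> R -> R) : continuous F ->
  (forall S, exists2 L, 0 <= L & forall s s', 0 <= s <= S -> 0 <= s' <= S ->
    `|F s - F s'| <= L * `|s - s'|) ->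
  mild F T u -> mild F T v -> (forall j b x, 0 <= x -> u 0 j b x = v 0 j b x) ->
  forall t j b x, 0 <= t < T -> 0 <= x -> u t j b x = v t j b x.
Proof.
move=> cF Flip mu_ mv_ uv0 t j b x /andP[t0 tT] x0.
have wbuc (i : 'I_N.+1 * bool) : buc (fun t x => u t i.1 i.2 x - v t i.1 i.2 x) := w_buc mu_ mv_ i.1 i.2.
have [[K K0 HK] HM] := buc_fin wbuc.
have wK t' j' b' x' : `|u t' j' b' x' - v t' j' b' x'| <= K by exact: (HK (j', b') t' x').
have [L L0 HL] := nl_lip cF Flip mu_ mv_.
have [B B0 HB] := w_grad mu_ mv_.
have cw : continuous (fun x => u t j b x - v t j b x) := buc_contx (wbuc (j, b)).
suff H y : 0 < y -> u t j b y - v t j b y = 0.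
  have : u t j b x - v t j b x = 0; last by move/eqP; rewrite subr_eq0 => /eqP.
  apply/eqP; rewrite -normr_le0; apply/ler_addgt0Pr => e e0.
  have [d d0 Hd] := heine x x cw e0.
  have d2 : 0 < d / 2 by rewrite divr_gt0.
  have := Hd x (x + d / 2); rewrite lexx (H _ (ltr_wpDl x0 d2)) subr0 add0r; apply => //.
  rewrite opprD addrA subrr sub0r normrN gtr0_norm //; lra.
move=> y0; have [y1 yy] : y < y + 1 /\ 0 <= y + 1 by split; lra.
apply/eqP; rewrite -sqrf_eq0; apply/eqP.
apply: (@itg_eq0 _ (fun x => (u t j b x - v t j b x) ^+ 2) (y + 1)); last by rewrite y0.
- exact: continuous_sqr.
- by move=> z; exact: sqr_ge0.
apply/ler_addgt0Pr => e e0; rewrite add0r.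
pose E := expR (4 * L * t); have E0 : 0 <= E by rewrite ltW ?expR_gt0.
have nn0 : 0 <= N.+1%:R :> R by [].
have [Z [Z0 XZ] [om0 om00 Hom]] := @small_quantity R (N.+1%:R * E)
  (2 * (N.+1%:R * (K ^+ 2 + B)) * t * E) (N.+1%:R * (8 * K * L) * t * E) (y + 1) e
  (mulr_ge0 nn0 E0) (mulr_ge0 (mulr_ge0 (mulr_ge0 (ler0n _ 2) (mulr_ge0 nn0 (addr_ge0 (sqr_ge0 K) B0))) t0) E0)
  (mulr_ge0 (mulr_ge0 (mulr_ge0 nn0 (mulr_ge0 (mulr_ge0 (ler0n _ 8) (ltW K0)) (ltW L0))) t0) E0)
  yy e0.
have [d d0 Hd] := HM om0 om00.
pose h := Num.min (d / 2) (T - t).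
have h0 : 0 < h by rewrite lt_min divr_gt0 // subr_gt0.
have [h1 h2] : h <= d / 2 /\ h <= T - t by rewrite /h !ge_min !lexx orbT.
have hT : t + h <= T by lra.
have wom j' b' x' t' s' : `|t' - s'| <= h ->
    `|(u t' j' b' x' - v t' j' b' x') - (u s' j' b' x' - v s' j' b' x')| <= om0.
  move=> ts; apply: (Hd (j', b') s' t' x' x'); last by rewrite subrr normr0.
  by apply: le_lt_trans ts _; lra.
have := avg_gronwall cF mu_ mv_ uv0 h0 (ltW L0) B0 (ltW om00) wK HB HL wom Z0 j b t0 hT yy XZ.
move=> H; apply: le_trans H _; apply: le_trans (Hom om0 _); last by rewrite lexx ltW.
rewrite lerD2r -mulrA ler_pM2l // -/E le_eqVlt; apply/orP; left; apply/eqP; ring.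
Qed.

(** * Conservation of energy *)

Section Datum.
Context {R : realType} {N : nat}.
Notation mu := (@lebesgue_measure R).

Lemma itg_lt0 (X : R) (f : R -> R) : X < 0 -> itg 0 X f = 0.
Proof. by move=> X0; rewrite /itg set_itv_ge ?Rintegral_set0 // bnd_simp -ltNge. Qed.

Lemma wderiv_sqr (v : R -> R) (B : R) : loc_integrable v ->
  (\int[mu]_(x in halfline) (v x ^+ 2)%:E <= B%:E)%E ->
  loc_integrable (fun x => v x ^+ 2) /\ forall X, itg 0 X (fun x => v x ^+ 2) <= B.
Proof.
move=> vi vB; have mv := loc_integrable_measurable vi.
have mv2 : measurable_fun halfline (fun x => v x ^+ 2) by exact: measurable_funX.
have vi2 : mu.-integrable halfline (EFin \o (fun x => v x ^+ 2)).
  apply/integrableP; split; first by apply/measurable_EFinP.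
  apply: (@le_lt_trans _ _ B%:E); last exact: ltry.
  apply: le_trans vB; apply: ge0_le_integral => //=.
  - exact: measurable_halfline.
  - by apply/measurable_EFinP; apply: measurableT_comp.
  - exact/measurable_EFinP.
  - by move=> x _; rewrite lee_fin ger0_norm // sqr_ge0.
have sub X : `[0, X] `<=` (halfline : set R).
  by move=> x /=; rewrite /halfline /= !in_itv /= andbT => /andP[].
have vX X : mu.-integrable `[0, X] (EFin \o (fun x => v x ^+ 2)).
  by apply: integrableS vi2 => //; exact: measurable_halfline.
split=> // X; rewrite -lee_fin /itg /Rintegral fineK; last exact: integrable_fin_num.
apply: le_trans vB; apply: ge0_subset_integral => //=.
- exact: measurable_halfline.
- exact/measurable_EFinP.
- by move=> x _; rewrite lee_fin sqr_ge0.
Qed.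

Record datum (u0 : 'I_N.+1 -> bool -> R -> R) : Prop := {
  dat_cont : forall j b, continuous (u0 j b);
  dat_vertex : forall j j' b, u0 j b 0 = u0 j' b 0;
  dat_grad : exists B, forall m, grad_energy u0 m <= B;
  dat_mass : exists M, forall Y, 0 <= Y -> itg 0 Y (fun x => \sum_j edge_sq u0 j x) <= M;
  dat_weight : exists W, forall Y, 0 <= Y ->
    itg 0 Y (fun x => x ^+ 2 * \sum_j edge_sq u0 j x) <= W }.

Variables (F G : R -> R).
Hypothesis tFG : tame F G.
Hypotheses (cF : continuous F) (cG : continuous G).

(** All that the limit inherits from the discrete solutions, with the constants displayed because
    the reversed evolution has others. [Bz] is any bound on the initial dyadic energies, so that
    their supremum can be inserted. *)
Record evolution (u0 : 'I_N.+1 -> bool -> R -> R) (M B S A kap C KG : R)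
    (u : R -> 'I_N.+1 -> bool -> R -> R) : Prop := {
  evo_mild : forall T, mild F T u;
  evo_init : forall j b x, 0 <= x -> u 0 j b x = u0 j b x;
  evo_pos : [/\ 0 <= A, 0 <= kap, 0 <= C & 0 <= KG];
  evo_sup : forall t j x, 0 <= t -> 0 <= x -> edge_sq (u t) j x <= S;
  evo_lin : forall s, 0 <= s <= S -> `|G s| <= KG * s;
  evo_grad : forall t m, 0 <= t -> grad_energy (u t) m <= B;
  evo_mass : forall t Y, 0 <= t -> 0 <= Y -> itg 0 Y (fun x => \sum_j edge_sq (u t) j x) <= M;
  evo_weight : forall t Y, 0 <= t -> 0 <= Y ->
    itg 0 Y (fun x => x ^+ 2 * \sum_j edge_sq (u t) j x) <= (A + kap * t) ^+ 2;
  evo_holder : forall t s Y, 0 <= s <= t -> 0 <= Y ->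
    itg 0 Y (fun x => \sum_j edge_sq (fun j b x => u t j b x - u s j b x) j x) <= C * (t - s);
  evo_energy : forall Bz t Y m, (forall n, grad_energy u0 n <= Bz) -> 0 <= t -> 0 < Y ->
    grad_energy (u t) m + pot_energy G Y (u t) <=
    Bz + pot_energy G Y u0 + 2 * KG * (A + kap * t) ^+ 2 / Y ^+ 2 }.

Lemma dyadic_le_grad (f : 'I_N.+1 -> bool -> R -> R) j b m :
  dyadic_energy (f j b) m <= grad_energy f m.
Proof.
rewrite /grad_energy (bigD1 j) //=; apply: ler_wpDr.
  by apply: sumr_ge0 => i _; rewrite addr_ge0 ?dyadic_energy_ge0.
by case: b; rewrite ?lerDl ?lerDr dyadic_energy_ge0.
Qed.

Lemma sq_le_edge (f : 'I_N.+1 -> bool -> R -> R) j b x : f j b x ^+ 2 <= \sum_j edge_sq f j x.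
Proof.
rewrite (bigD1 j) //=; apply: ler_wpDr; first by apply: sumr_ge0 => i _; exact: edge_sq_ge0.
by rewrite /edge_sq; case: b; rewrite ?lerDl ?lerDr sqr_ge0.
Qed.

Lemma evolution_exists u0 : datum u0 ->
  exists M B S A kap C KG u, evolution u0 M B S A kap C KG u.
Proof.
case=> u0c u0v [B0 HB0] [M0 HM0] [W0 HW0].
have db j b n : dyadic_energy (u0 j b) n <= B0 by apply: le_trans (dyadic_le_grad _ _ _ _) _.
have Hv (i : 'I_N.+1 * bool) : exists v, loc_integrable v /\ primitive_of (u0 i.1 i.2) v.
  exact: ex_weak_derivative (u0c _ _) (db i.1 i.2).
have [v Hv'] := choice Hv; pose v0 j b := v (j, b).
have v0i j b : loc_integrable (v0 j b) by have [] := Hv' (j, b).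
have v0p j b : primitive_of (u0 j b) (v0 j b) by have [] := Hv' (j, b).
have v02 j b := wderiv_sqr (v0i j b) (dyadic_energy_wderiv (v0i j b) (v0p j b) (db j b)).
have cq : continuous (fun x => \sum_j edge_sq u0 j x).
  by apply: continuous_sum => j; apply: cont_edge_sq => b.
have cx2 : continuous (fun x : R => x ^+ 2) by apply: continuous_sqr => x; exact: cvg_id.
have HM j b X : itg 0 X (fun x => u0 j b x ^+ 2) <= `|M0|.
  have [X0|X0] := ltP X 0; first by rewrite itg_lt0.
  apply: le_trans (le_trans (HM0 X X0) (ler_norm _)).
  apply: le_itg => //; first by apply: continuous_sqr; exact: u0c.
  by move=> x _; exact: sq_le_edge.
have HX j b X : itg 0 X (fun x => x ^+ 2 * u0 j b x ^+ 2) <= `|W0|.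
  have [X0|X0] := ltP X 0; first by rewrite itg_lt0.
  apply: le_trans (le_trans (HW0 X X0) (ler_norm _)).
  apply: le_itg => //; first by apply: contM => //; apply: continuous_sqr; exact: u0c.
    exact: contM.
  by move=> x _; rewrite ler_wpM2l ?sqr_ge0 // sq_le_edge.
have [M [B [S [A [kap [C [CE [[M1 B1 S1 A1] [k1 C1 CE1] Hs]]]]]]]] :=
  scheme_exists tFG u0c v0i (fun j b => (v02 j b).1) v0p u0v HM HX (fun j b => (v02 j b).2).
have [tau Htau] := choice Hs; have [U HU] := choice Htau.
have [KG KG0 HKG] := G_linear tFG S.
(* An ultrafilter finer than convergence of the level to infinity. *)
have [UF [UU Uoo]] := ultraFilterLemma (_ : ProperFilter (\oo : set_system nat)).
pose u := ulim tau U UF.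
have i0 j b x : 0 <= x -> u 0 j b x = u0 j b x by move=> x0; exact: (ulim_init HU B1 S1 C1 Uoo).
exists M, B, S, A, kap, C, KG, u; split=> //.
- move=> T; split.
  + by move=> j b; exact: (ulim_buc HU B1 S1 C1 Uoo).
  + by exists B => t m /andP[t0 _]; exact: (ulim_grad HU B1 S1 C1 Uoo).
  + by move=> t j j' b /andP[t0 _]; exact: (ulim_vertex HU B1 S1 C1 Uoo).
  + by move=> t b /andP[t0 _]; exact: (ulim_eq HU B1 S1 C1 Uoo cF).
- by move=> t j x; exact: (ulim_sqr HU B1 S1 C1 Uoo).
- by move=> t m; exact: (ulim_grad HU B1 S1 C1 Uoo).
- by move=> t Y; exact: (ulim_mass HU B1 S1 C1 Uoo).
- by move=> t Y; exact: (ulim_weight HU B1 S1 C1 Uoo).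
- by move=> t s Y; exact: (ulim_holder HU B1 S1 C1 Uoo).
- move=> Bz t Y m HBz t0 Y0.
  have -> : pot_energy G Y u0 = pot_energy G Y (u 0).
    apply: eq_bigr => j _; apply: eq_itg => x /andP[x0 _].
    by rewrite /edge_sq !i0.
  exact: (ulim_energy HU B1 S1 C1 Uoo cG m HKG KG0 A1 k1 HBz t0 Y0).
Qed.

Hypothesis Flip : forall S, exists2 L, 0 <= L & forall s s', 0 <= s <= S -> 0 <= s' <= S ->
  `|F s - F s'| <= L * `|s - s'|.

(* Time reversal: the complex conjugate of u at time T - t. *)
Definition reverse (T : R) (u : R -> 'I_N.+1 -> bool -> R -> R) t j b x : R :=
  sgb b * u (T - t) j b x.

Lemma sgb_sqr b : sgb b ^+ 2 = 1 :> R.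
Proof. by case: b; rewrite /sgb ?sqrrN expr1n. Qed.

Lemma reverse_sq T u t j x : edge_sq (reverse T u t) j x = edge_sq (u (T - t)) j x.
Proof. by rewrite /edge_sq /reverse !exprMn !sgb_sqr !mul1r. Qed.

Lemma reverse_grad T u t m : grad_energy (reverse T u t) m = grad_energy (u (T - t)) m.
Proof.
rewrite /grad_energy; apply: eq_bigr => j _.
by rewrite !dyadic_energyZ !sgb_sqr !mul1r.
Qed.

Lemma cont_reverse (T : R) (f : R -> R) : continuous f -> continuous (fun s => f (T - s)).
Proof.
move=> cf s; apply: (@continuous_comp _ _ _ (fun s => T - s) f s); last exact: cf.
by apply: cvgB; [exact: cvg_cst|exact: cvg_id].
Qed.

Lemma itg_reverse (T t : R) (f : R -> R) : 0 <= t <= T -> continuous f ->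
  itg 0 t (fun s => f (T - s)) = itg 0 T f - itg 0 (T - t) f.
Proof.
case/andP=> t0 tT cf; pose al := - 1 : R.
have al0 : al <= 0 by rewrite /al; lra.
pose P s := - itg al (T - s) f.
have dP s : s <= t -> is_derive s 1 P (f (T - s)).
  move=> st; have d1 : is_derive (T - s) 1 (fun y => itg al y f) (f (T - s)).
    by apply: is_derive_itg => //; rewrite /al; lra.
  have d2 : is_derive s 1 (fun s : R => T - s) (- 1).
    by have := is_deriveB (is_derive_cst T s (1 : R)) (is_derive_id s (1 : R)); rewrite sub0r.
  have := is_deriveN (@is_derive1_comp R (fun y => itg al y f) (fun s => T - s) s _ _ d1 d2).
  by rewrite mulrN1 opprK.
have -> : itg 0 t (fun s => f (T - s)) = P t - P 0; last first.
  have T0 := le_trans t0 tT; have Tt : 0 <= T - t by rewrite subr_ge0.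
  rewrite /P subr0 opprK (itg_chasles cf al0 T0) (itg_chasles cf al0 Tt); ring.
apply: itg_FTC2 => //.
- exact: cont_reverse.
- apply: derivable_within_continuous => s; rewrite in_itv /= => /andP[_ st].
  by have [] := dP s st.
- by move=> s /andP[_ /ltW]; exact: dP.
Qed.

(** The reversed equation at [t] is the difference of the original ones at [T] and [T - t].
    Conjugation changes the sign of i, which compensates for the change of direction of time. *)
Lemma reverse_mild T u : mild F T u -> mild F T (reverse T u).
Proof.
move=> mu_; have bu := mild_buc mu_.
have rT t : 0 <= t <= T -> 0 <= T - t <= T by move=> /andP[? ?]; apply/andP; split; lra.
split.
- move=> j b; apply: bucZ; have [[K HK] H] := bu j b; split; first by exists K.
  move=> e e0; have [d d0 Hd] := H e e0; exists d => // s t x y ts xy; apply: Hd => //.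
  have -> : T - t - (T - s) = - (t - s) by ring.
  by rewrite normrN.
- have [B HB] := mild_grad mu_; exists B => t m tT; rewrite reverse_grad.
  by apply: HB; exact: rT.
- by move=> t j j' b tT; rewrite /reverse (mild_vertex mu_ j j' b (rT t tT)).
- move=> t b tT; have [t0 t1] := andP tT.
  have T0 := le_trans t0 t1; have TT : 0 <= T <= T by rewrite T0 lexx.
  have [d1 [d10 E1]] := mild_eq mu_ b TT; have [d2 [d20 E2]] := mild_eq mu_ b (rT t tT).
  exists (fun j => sgb b * (d1 j - d2 j)); split.
    by rewrite -mulr_sumr sumrB d10 d20 subrr mulr0.
  move=> j x x0.
  have IU y : itg 0 t (fun s => reverse T u s j b y) =
      sgb b * (itg 0 T (fun s => u s j b y) - itg 0 (T - t) (fun s => u s j b y)).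
    have cu : continuous (fun s => u s j b y) by exact: buc_contt (bu j b).
    by rewrite -itg_reverse // -itgZ //; exact: cont_reverse cu.
  have bn : buc (fun s y => F (edge_sq (u s) j y) * u s j b y) := rhs_buc cF b (bu j).
  have cs s : 0 <= s -> continuous (mild_source F u s j b).
    move=> s0; apply: contD; first exact: (buc_itg_cont s0 bn).
    by apply: contZ; apply: contB; apply: buc_contx (bu _ _).
  have SE y : mild_source F (reverse T u) t j b y =
      sgb b * (mild_source F u T j b y - mild_source F u (T - t) j b y).
    rewrite /mild_source.
    have -> : itg 0 t (fun s => F (edge_sq (reverse T u s) j y) * reverse T u s j b y) =
      sgb b * (itg 0 T (fun s => F (edge_sq (u s) j y) * u s j b y) -
               itg 0 (T - t) (fun s => F (edge_sq (u s) j y) * u s j b y)).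
      have cn : continuous (fun s => F (edge_sq (u s) j y) * u s j b y) by exact: buc_contt bn.
      rewrite -itg_reverse // -itgZ; last exact: cont_reverse cn.
      by apply: eq_itg => s _; rewrite reverse_sq /reverse; ring.
    by rewrite /reverse subr0; case: b {cs IU bn E1 E2} => /=; rewrite /sgb /=; ring.
  have cxy s : 0 <= s -> continuous (fun y => (x - y) * mild_source F u s j b y).
    move=> s0; apply: contM; last exact: cs.
    by apply: contB; [exact: cst_continuous|move=> y; exact: cvg_id].
  have Tt0 : 0 <= T - t by rewrite subr_ge0.
  have -> : itg 0 x (fun y => (x - y) * mild_source F (reverse T u) t j b y) =
     sgb b * (itg 0 x (fun y => (x - y) * mild_source F u T j b y) -
              itg 0 x (fun y => (x - y) * mild_source F u (T - t) j b y)).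
    rewrite -itgB; [|exact: cxy|exact: cxy].
    rewrite -itgZ; last by apply: contB; exact: cxy.
    by apply: eq_itg => y _; rewrite SE; ring.
  by rewrite !IU (E1 j x x0) (E2 j x x0); ring.
Qed.

Definition grad_sup (f : 'I_N.+1 -> bool -> R -> R) : R := sup (range (grad_energy f)).

Lemma grad_le_sup f B m : (forall n, grad_energy f n <= B) -> grad_energy f m <= grad_sup f.
Proof. by move=> HB; apply: ub_le_sup; [exists B => _ [n _ <-]|exists m]. Qed.

Lemma grad_sup_le f B : (forall n, grad_energy f n <= B) -> grad_sup f <= B.
Proof. by move=> HB; apply: ge_sup; [exists (grad_energy f 0%N); exists 0%N|move=> _ [n _ <-]]. Qed.

(** * Conservation of energy and strong continuity of the gradient *)

Section Conservation.
Variables (u0 : 'I_N.+1 -> bool -> R -> R) (M B S A kap C KG : R).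
Variable u : R -> 'I_N.+1 -> bool -> R -> R.
Hypothesis evo : evolution u0 M B S A kap C KG u.

Let bu j b : buc (fun t x => u t j b x). Proof. exact: (mild_buc (evo_mild evo 0)). Qed.

Lemma evo_cont t j b : continuous (u t j b).
Proof. exact: buc_contx (bu j b). Qed.

Lemma pot_buc j : buc (fun t x => G (edge_sq (u t) j x)).
Proof. by apply: buc_comp => //; apply: bucD; apply: buc_sqr; exact: bu. Qed.

(** Between [Y] and [Y'] the potential density is dominated by KG (x / Y)^2 |u|^2, whose integral
    the weighted norm controls independently of [Y']. *)
Lemma pot_tail t Y Y' : 0 <= t -> 0 < Y -> Y <= Y' ->
  `|pot_energy G Y' (u t) - pot_energy G Y (u t)| <= KG * (A + kap * t) ^+ 2 / Y ^+ 2.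
Proof.
move=> t0 Y0 YY; have Yn := ltW Y0; have Y'0 := le_trans Yn YY.
have [A0 k0 C0 KG0] := evo_pos evo.
have cg j : continuous (fun x => G (edge_sq (u t) j x)) by exact: buc_contx (pot_buc j).
have cq j : continuous (edge_sq (u t) j) by apply: cont_edge_sq => b; exact: evo_cont.
have cx2 : continuous (fun x : R => x ^+ 2) by apply: continuous_sqr => x; exact: cvg_id.
have cs : continuous (fun x => \sum_j edge_sq (u t) j x) by apply: continuous_sum => j.
rewrite /pot_energy -sumrB.
have -> : \sum_j (itg 0 Y' (fun x => G (edge_sq (u t) j x)) - itg 0 Y (fun x => G (edge_sq (u t) j x))) =
  \sum_j itg Y Y' (fun x => G (edge_sq (u t) j x)).
  by apply: eq_bigr => j _; rewrite (itg_chasles (cg j) Yn YY); ring.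
apply: le_trans (ler_norm_sum _ _ _) _.
have Y2 : 0 < Y ^+ 2 by rewrite exprn_gt0.
have c0 : 0 <= KG / Y ^+ 2 by rewrite divr_ge0 // ltW.
apply: (@le_trans _ _ (\sum_j KG / Y ^+ 2 * itg Y Y' (fun x => x ^+ 2 * edge_sq (u t) j x))).
  apply: ler_sum => j _; apply: le_trans (ler_itg_norm _ _ (cg j)) _.
  have cxq : continuous (fun x : R => x ^+ 2 * edge_sq (u t) j x) by apply: contM.
  rewrite -itgZ //; apply: le_itg; [exact: continuous_norm|exact: contZ|].
  move=> x /andP[x1 x2]; have x0 := le_trans Yn x1.
  have q0 := edge_sq_ge0 (u t) j x; have qS := evo_sup evo j t0 x0.
  apply: le_trans (evo_lin evo _) _; first by rewrite q0.
  have -> : KG / Y ^+ 2 * (x ^+ 2 * edge_sq (u t) j x) = KG * (x ^+ 2 / Y ^+ 2 * edge_sq (u t) j x) by ring.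
  rewrite ler_wpM2l // ler_peMl // ler_pdivlMr // mul1r ler_pXn2r ?nnegrE //.
rewrite -mulr_sumr.
have -> : KG * (A + kap * t) ^+ 2 / Y ^+ 2 = KG / Y ^+ 2 * (A + kap * t) ^+ 2 by ring.
rewrite ler_wpM2l //; apply: le_trans (evo_weight evo t0 Y'0).
rewrite -itg_sum; last by move=> j; exact: contM.
have cw : continuous (fun x : R => x ^+ 2 * \sum_j edge_sq (u t) j x) by exact: contM.
rewrite (itg_chasles cw Yn YY); apply: ler_wpDl.
  apply: itg_ge0 => x _; rewrite mulr_ge0 ?sqr_ge0 // sumr_ge0 // => j _; exact: edge_sq_ge0.
apply: le_itg => //; first by apply: continuous_sum => j; exact: contM.
by move=> x _; rewrite mulr_sumr.
Qed.

Lemma evo_datum t : 0 <= t -> datum (reverse t u 0).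
Proof.
move=> t0; split.
- by move=> j b; apply: contZ; rewrite subr0; exact: evo_cont.
- move=> j j' b; rewrite /reverse subr0; congr (_ * _).
  by apply: (mild_vertex (evo_mild evo t)); rewrite t0 lexx.
- by exists B => m; rewrite reverse_grad subr0; exact: (evo_grad evo).
- exists M => Y Y0; have := evo_mass evo t0 Y0; congr (_ <= _); apply: eq_itg => x _.
  by apply: eq_bigr => j _; rewrite reverse_sq subr0.
- exists ((A + kap * t) ^+ 2) => Y Y0; have := evo_weight evo t0 Y0; congr (_ <= _).
  by apply: eq_itg => x _; congr (_ * _); apply: eq_bigr => j _; rewrite reverse_sq subr0.
Qed.

(* The solution issued from the reversed state is the reversed solution, so its
   energy inequality is the opposite one. *)
Lemma backward_energy t : 0 < t -> exists2 c, 0 <= c & forall m Y, 0 < Y ->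
  grad_energy (u 0) m + pot_energy G Y (u 0) <=
  grad_sup (u t) + pot_energy G Y (u t) + c / Y ^+ 2.
Proof.
move=> t0; have t0' := ltW t0.
have [M' [B' [S' [A' [k' [C' [KG' [v Hv]]]]]]]] := evolution_exists (evo_datum t0').
have [A0 k0 _ KG0] := evo_pos Hv.
exists (2 * KG' * (A' + k' * t) ^+ 2); first exact: (mulr_ge0 (mulr_ge0 (ler0n _ 2) KG0) (sqr_ge0 _)).
move=> m Y Y0.
have un s j b x : 0 <= s < t -> 0 <= x -> v s j b x = reverse t u s j b x.
  apply: (mild_unique cF Flip (evo_mild Hv t) (reverse_mild (evo_mild evo t))).
  by move=> j' b' x' x0'; exact: (evo_init Hv).
(* Uniqueness identifies the two evolutions strictly before time [t]; the end point, the only one of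
   interest, follows by continuity in time. *)
have vt j b x : 0 <= x -> v t j b x = sgb b * u 0 j b x.
  move=> x0; have E : reverse t u t j b x = sgb b * u 0 j b x by rewrite /reverse subrr.
  rewrite -E; apply/eqP; rewrite -subr_eq0 -normr_le0; apply/ler_addgt0Pr => e e0; rewrite add0r.
  have bz : buc (fun s y => v s j b y - reverse t u s j b y).
    by apply: bucB; [exact: (mild_buc (evo_mild Hv 0))|exact: (mild_buc (reverse_mild (evo_mild evo t)))].
  have [_ /(_ e e0) [d d0 Hd]] := bz.
  pose s := t - Num.min (d / 2) t.
  have m0 : 0 < Num.min (d / 2) t by rewrite lt_min t0 divr_gt0.
  have [m1 m2] : Num.min (d / 2) t <= d / 2 /\ Num.min (d / 2) t <= t by rewrite !ge_min !lexx orbT.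
  have st : 0 <= s < t by rewrite /s; apply/andP; split; lra.
  have ts : `|t - s| < d by rewrite /s opprB addrC subrK gtr0_norm //; lra.
  have xx : `|x - x| < d by rewrite subrr normr0.
  have := Hd s t x x ts xx; rewrite (un s j b x st x0).
  by set q := reverse t u s j b x; rewrite (subrr q) subr0.
have HB : forall n, grad_energy (reverse t u 0) n <= grad_sup (u t).
  by move=> n; rewrite reverse_grad subr0; apply: (grad_le_sup (B := B)) => k; exact: (evo_grad evo).
have := evo_energy Hv m HB t0' Y0.
have -> : grad_energy (v t) m = grad_energy (u 0) m.
  rewrite -[RHS](_ : grad_energy (fun j b x => sgb b * u 0 j b x) m = _).
    apply: eq_bigr => j _; rewrite /dyadic_energy; congr (_ * _ + _ * _);
      by apply: eq_bigr => k _; rewrite !vt // natr_mesh_ge0.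
  by apply: eq_bigr => j _; rewrite !dyadic_energyZ !sgb_sqr !mul1r.
have -> : pot_energy G Y (v t) = pot_energy G Y (u 0).
  apply: eq_bigr => j _; apply: eq_itg => x /andP[x0 _].
  by rewrite /edge_sq !vt // !exprMn !sgb_sqr !mul1r.
have -> // : pot_energy G Y (reverse t u 0) = pot_energy G Y (u t).
by apply: eq_bigr => j _; apply: eq_itg => x _; rewrite reverse_sq subr0.
Qed.

Let W t Y : R := 2 * KG * (A + kap * t) ^+ 2 / Y ^+ 2.

(** The constant of the backward inequality comes from another evolution and is not controlled in
    [t]. It is used at a length [Y'] so large that its error disappears; passing from [Y'] back to
    [Y] at the two times costs a tail estimate each, which add up to at most [W t Y]. *)
Lemma energy_conservation t Y : 0 <= t -> 0 < Y ->
  `|(grad_sup (u t) + pot_energy G Y (u t)) - (grad_sup (u 0) + pot_energy G Y (u 0))| <= W t Y.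
Proof.
move=> t0 Y0; have [A0 k0 C0 KG0] := evo_pos evo.
have Y2 : 0 < Y ^+ 2 by rewrite exprn_gt0.
have W0 : 0 <= W t Y by rewrite /W divr_ge0 ?(ltW Y2) // mulr_ge0 ?sqr_ge0 // mulr_ge0.
move: t0; rewrite le_eqVlt => /predU1P[t0|t0].
  by move: W0; rewrite -t0 subrr normr0.
have t0' := ltW t0.
have gB s n : 0 <= s -> grad_energy (u s) n <= B by move=> s0; exact: (evo_grad evo).
have u0E m : grad_energy u0 m = grad_energy (u 0) m.
  apply: eq_bigr => j _; rewrite /dyadic_energy; congr (_ * _ + _ * _);
    by apply: eq_bigr => k _; rewrite !(evo_init evo) // natr_mesh_ge0.
have p0E : pot_energy G Y u0 = pot_energy G Y (u 0).
  by apply: eq_bigr => j _; apply: eq_itg => x /andP[x0 _]; rewrite /edge_sq !(evo_init evo).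
have fw : grad_sup (u t) + pot_energy G Y (u t) <= grad_sup (u 0) + pot_energy G Y (u 0) + W t Y.
  rewrite -lerBrDr; apply: grad_sup_le => m; rewrite lerBrDr -p0E; apply: (evo_energy evo) => // n.
  by rewrite u0E; apply: (grad_le_sup (B := B)) => k; exact: gB.
have [c c0 Hc] := backward_energy t0.
have bw : grad_sup (u 0) + pot_energy G Y (u 0) <= grad_sup (u t) + pot_energy G Y (u t) + W t Y.
  apply/ler_addgt0Pr => e e0.
  pose Y' := Y + (c + 1) / e + 1.
  have ce : 0 < (c + 1) / e by rewrite divr_gt0 //; lra.
  have YY : Y <= Y' by rewrite /Y'; lra.
  have Y'1 : 1 <= Y' by rewrite /Y'; lra.
  have Y'0 : 0 < Y' by lra.
  have cY : c / Y' ^+ 2 <= e.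
    rewrite ler_pdivrMr ?exprn_gt0 //; apply: (@le_trans _ _ (e * Y')).
      by rewrite /Y' !mulrDr mulrCA divff ?gt_eqF // !mulr1; have := mulr_gt0 e0 Y0; lra.
    by rewrite ler_pM2l // expr2 ler_peMl // ltW.
  have T1 := pot_tail t0' Y0 YY; have T2 := pot_tail (lexx 0) Y0 YY.
  have W2 : KG * (A + kap * 0) ^+ 2 / Y ^+ 2 <= KG * (A + kap * t) ^+ 2 / Y ^+ 2.
    rewrite ler_pM2r ?invr_gt0 // ler_wpM2l //.
    have kt := mulr_ge0 k0 t0'.
    by rewrite mulr0 addr0 ler_pXn2r ?nnegrE ?addr_ge0 // lerDl.
  have H : grad_sup (u 0) <= grad_sup (u t) + pot_energy G Y' (u t) + c / Y' ^+ 2 - pot_energy G Y' (u 0).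
    by apply: grad_sup_le => m; rewrite lerBrDr; exact: Hc.
  have WE : W t Y = KG * (A + kap * t) ^+ 2 / Y ^+ 2 + KG * (A + kap * t) ^+ 2 / Y ^+ 2.
    by rewrite /W; ring.
  move: T1 T2; rewrite WE !ler_norml => /andP[? ?] /andP[? ?]; lra.
by rewrite ler_norml; apply/andP; split; lra.
Qed.

Lemma pot_cont Y e : 0 < Y -> 0 < e -> exists2 d, 0 < d & forall t s, `|t - s| < d ->
  `|pot_energy G Y (u t) - pot_energy G Y (u s)| <= e.
Proof.
move=> Y0 e0; have [_ H] := buc_fin pot_buc.
pose k := N.+1%:R * Y; have k0 : 0 < k by rewrite mulr_gt0.
have [d d0 Hd] := H (e / k) (divr_gt0 e0 k0).
exists d => // t s ts; rewrite /pot_energy -sumrB.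
apply: le_trans (ler_norm_sum _ _ _) _.
have -> : e = \sum_(j < N.+1) (e / k * (Y - 0)).
  by rewrite sumr_const card_ord subr0 -mulr_natl /k; field; rewrite !gt_eqF //= ?ltr0n.
apply: ler_sum => j _; rewrite -itgB; [|exact: buc_contx (pot_buc j)|exact: buc_contx (pot_buc j)].
apply: itg_bound => //; [|exact: ltW|].
  by apply: contB; exact: buc_contx (pot_buc j).
by move=> x _; apply: Hd; rewrite // subrr normr0.
Qed.

(** On the time interval [0, t + 1] one length [Y] makes every conservation error at most e / 4. The
    gradient norm then varies by no more than these errors and the variation of the potential energy
    on [[0, Y]], which is continuous in time. *)
Lemma grad_sup_cont t e : 0 <= t -> 0 < e -> exists2 d, 0 < d & forall s, 0 <= s ->
  `|s - t| < d -> `|grad_sup (u s) - grad_sup (u t)| <= e.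
Proof.
move=> t0 e0; have [A0 k0 C0 KG0] := evo_pos evo.
pose Q := 2 * KG * (A + kap * (t + 1)) ^+ 2.
have Q0 : 0 <= Q := mulr_ge0 (mulr_ge0 (ler0n _ 2) KG0) (sqr_ge0 _).
pose Y := 4 * Q / e + 1.
have q0 : 0 <= 4 * Q / e := divr_ge0 (mulr_ge0 (ler0n _ 4) Q0) (ltW e0).
have Y1 : 1 <= Y by rewrite /Y; lra.
have Y0 : 0 < Y by lra.
have WY s : 0 <= s <= t + 1 -> W s Y <= e / 4.
  move=> /andP[s0 s1]; apply: (@le_trans _ _ (Q / Y ^+ 2)).
    rewrite /W /Q ler_pM2r ?invr_gt0 ?exprn_gt0 // ler_wpM2l ?mulr_ge0 //.
    have a1 : 0 <= A + kap * s by rewrite addr_ge0 // mulr_ge0.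
    have a2 : A + kap * s <= A + kap * (t + 1) by rewrite lerD2l ler_wpM2l.
    by rewrite ler_pXn2r ?nnegrE // (le_trans a1).
  rewrite ler_pdivrMr ?exprn_gt0 //; apply: (@le_trans _ _ (e / 4 * Y)).
    have -> : e / 4 * Y = Q + e / 4 by rewrite /Y; field; rewrite gt_eqF.
    by rewrite lerDl; lra.
  rewrite ler_wpM2l ?expr2 ?ler_peMl //; [lra|exact: ltW].
have e4 : 0 < e / 4 by lra.
have [d d0 Hd] := pot_cont Y0 e4.
exists (Num.min d 1); first by rewrite lt_min d0 ltr01.
move=> s s0; rewrite lt_min => /andP[sd s1].
have s1' : 0 <= s <= t + 1 by rewrite s0; move: s1; rewrite ltr_norml; lra.
have t1' : 0 <= t <= t + 1 by rewrite t0; lra.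
have := Hd s t sd; have := energy_conservation t0 Y0; have := energy_conservation s0 Y0.
have := WY s s1'; have := WY t t1'.
rewrite !ler_norml => ? ? /andP[? ?] /andP[? ?] /andP[? ?]; apply/andP; split; lra.
Qed.

(* Parallelogram identity: with the norms converging, pointwise convergence of
   the dyadic energies of u s + u t forces u s - u t to be small in energy. *)
Lemma grad_strong_cont t e : 0 <= t -> 0 < e -> exists2 d, 0 < d & forall s m, 0 <= s ->
  `|s - t| < d -> grad_energy (fun j b x => u s j b x - u t j b x) m <= e.
Proof.
move=> t0 e0; have e8 : 0 < e / 8 by lra.
have gB s n : 0 <= s -> grad_energy (u s) n <= B by move=> s0; exact: (evo_grad evo).
have gS s n : 0 <= s -> grad_energy (u s) n <= grad_sup (u s).
  by move=> s0; apply: (grad_le_sup (B := B)) => k; exact: gB.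
have [k Hk] : exists k, grad_sup (u t) - e / 8 < grad_energy (u t) k.
  have ne : has_sup (range (grad_energy (u t))).
    split; first by exists (grad_energy (u t) 0%N); exists 0%N.
    by exists B => _ [n _ <-]; exact: gB.
  by have [_ [k _ <-] Hk] := sup_adherent e8 ne; exists k.
pose P n s := grad_energy (fun j b x => u s j b x + u t j b x) n.
have par n s : grad_energy (fun j b x => u s j b x - u t j b x) n =
    2 * grad_energy (u s) n + 2 * grad_energy (u t) n - P n s.
  rewrite /P /grad_energy !mulr_sumr -!big_split -sumrB /=; apply: eq_bigr => j _.
  have D b : dyadic_energy (fun x => u s j b x - u t j b x) n =
     2 * dyadic_energy (u s j b) n + 2 * dyadic_energy (u t j b) n - dyadic_energy (fun x => u s j b x + u t j b x) n.
    rewrite /dyadic_energy ![2 * (_ * _)]mulrCA -mulrDr -mulrBr; congr (_ * _).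
    rewrite !mulr_sumr -big_split -sumrB /=; apply: eq_bigr => l _; ring.
  by rewrite !D; ring.
have Pt : P k t = 4 * grad_energy (u t) k.
  rewrite /P /grad_energy mulr_sumr; apply: eq_bigr => j _.
  have D b : dyadic_energy (fun x => u t j b x + u t j b x) k = 4 * dyadic_energy (u t j b) k.
    rewrite [RHS](_ : _ = 2 ^+ 2 * dyadic_energy (u t j b) k); last by ring.
    by rewrite -dyadic_energyZ; congr (dyadic_energy _ k); apply/funext => x; ring.
  by rewrite !D mulrDr.
have cP : continuous (P k).
  have cD b j : continuous (fun s => dyadic_energy (fun x => u s j b x + u t j b x) k).
    apply: contZ; apply: continuous_sum => l; apply: continuous_sqr.
    apply: contB; apply: contD; (try exact: cst_continuous); exact: buc_contt (bu j b).
  by apply: continuous_sum => j; apply: contD.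
have [d1 d10 Hd1] := grad_sup_cont t0 e8.
have [d2 d20 Hd2] := heine t t cP e8.
exists (Num.min d1 d2); first by rewrite lt_min d10.
move=> s m s0; rewrite lt_min => /andP[st1 st2].
apply: le_trans (grad_energy_nondec _ (leq_maxl m k)) _; rewrite par.
have A1 := gS s (maxn m k) s0; have A2 := gS t (maxn m k) t0.
have A3 : P k s <= P (maxn m k) s by exact: grad_energy_nondec (leq_maxr m k).
have A4 := Hd1 s s0 st1.
have tt : t <= t <= t by rewrite lexx.
have A5 := Hd2 t s tt; rewrite distrC st2 in A5; have {}A5 := A5 isT.
move: A4 A5; rewrite Pt !ler_norml => /andP[? ?] /andP[? ?]; lra.
Qed.

End Conservation.

End Datum.

(** * Complex-valued solutions *)

Section ComplexNorms.
Context {R : realType}.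
Notation mu := (@lebesgue_measure R).
Implicit Types (f v : R -> R[i]) (b : bool).

Definition part b (z : R[i]) : R := if b then complex.Re z else complex.Im z.

Definition nsq f (x : R) : R := part true (f x) ^+ 2 + part false (f x) ^+ 2.

Lemma normc_sqr (z : R[i]) : Normc.normc z ^+ 2 = part true z ^+ 2 + part false z ^+ 2.
Proof. by case: z => a b; rewrite /= sqr_sqrtr // addr_ge0 ?sqr_ge0. Qed.

Lemma partB b (z z' : R[i]) : part b (z - z') = part b z - part b z'.
Proof. by case: z => a c; case: z' => a' c'; case: b. Qed.

Lemma eq_part (z z' : R[i]) : (forall b, part b z = part b z') -> z = z'.
Proof. by case: z => a c; case: z' => a' c' H; rewrite (H true : a = a') (H false : c = c'). Qed.

Lemma nsq_ge0 f x : 0 <= nsq f x. Proof. by rewrite addr_ge0 ?sqr_ge0. Qed.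

Lemma L2normE f : L2norm f = sqrte (\int[mu]_(x in halfline) (nsq f x)%:E)%E.
Proof.
rewrite -poweR12_sqrt; last by apply: integral_ge0 => x _; rewrite lee_fin nsq_ge0.
rewrite /L2norm unlock; congr (_ `^ _)%E.
rewrite [RHS]integral_mkcond; apply: eq_integral => x _ /=.
rewrite !patchE; case: ifPn => _; last by rewrite normr0 powR0.
rewrite -[2]/(2%:R) powR_mulrn ?normr_ge0 // real_normK ?num_real //.
by rewrite normc_sqr.
Qed.

Lemma L2norm_sqr f : (L2norm f ^+ 2 = \int[mu]_(x in halfline) (nsq f x)%:E)%E.
Proof.
by rewrite L2normE sqr_sqrte //; apply: integral_ge0 => x _; rewrite lee_fin nsq_ge0.
Qed.

Lemma H1normE f : H1norm f = sqrte (\int[mu]_(x in halfline) (nsq f x)%:E +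
  \int[mu]_(x in halfline) (nsq (wderiv f) x)%:E)%E.
Proof. by rewrite /H1norm !L2norm_sqr poweR12_sqrt // adde_ge0 // integral_ge0 // => x _; rewrite lee_fin nsq_ge0. Qed.

Lemma sqrte_le (x : \bar R) (eta : R) : 0 <= eta -> (0 <= x)%E ->
  (sqrte x <= eta%:E)%E -> (x <= (eta ^+ 2)%:E)%E.
Proof.
move=> e0 x0 H; rewrite -(sqr_sqrte x0) EFin_expe.
by rewrite lee_sqr ?sqrte_ge0 // lee_fin.
Qed.

Lemma le_sqrte (x : \bar R) (eta : R) : 0 <= eta -> (0 <= x)%E ->
  (x <= (eta ^+ 2)%:E)%E -> (sqrte x <= eta%:E)%E.
Proof.
move=> e0 x0 H; rewrite lee_sqrE ?lee_fin // sqr_sqrte //.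
Qed.

Lemma cont_int_le (g : R -> R) (K : R) : continuous g -> (forall x, 0 <= g x) ->
  (forall Y, 0 <= Y -> itg 0 Y g <= K) -> (\int[mu]_(x in halfline) (g x)%:E <= K%:E)%E.
Proof.
move=> cg g0 H; apply: integral_halfline_le.
- by apply/measurable_EFinP; apply: (measurable_funS (E := setT)) => //; exact: continuous_measurable_fun.
- by move=> x _; rewrite lee_fin.
move=> n; have := H n%:R (ler0n _ n); rewrite -lee_fin /itg /Rintegral fineK; last first.
  by apply: integrable_fin_num => //; exact: integrable_cont.
apply: le_trans; apply: ge0_subset_integral => //=.
- apply/measurable_EFinP; apply: (measurable_funS (E := setT)) => //; exact: continuous_measurable_fun.
- by move=> x _; rewrite lee_fin.
- by move=> x /=; rewrite !in_itv /= => /andP[-> /ltW].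
Qed.

Lemma wderiv_parts f v : is_wderiv f v <-> forall b,
  loc_integrable (fun x => part b (v x)) /\ primitive_of (fun x => part b (f x)) (fun x => part b (v x)).
Proof.
split=> [H b|H x x0].
  have H0 x : 0 <= x -> mu.-integrable `[0, x] (EFin \o (fun x => part b (v x))).
    by move=> x0; have [[H1 H2] _] := H x x0; case: b.
  split=> x.
    have [x0|x0] := leP 0 x; first exact: H0.
    have -> : `[0, x]%classic = set0 by apply: set_itv_ge; rewrite bnd_simp -ltNge.
    exact: integrable_set0.
  move=> x0; have [_ ->] := H x x0; rewrite /cintegral.
  by case: (f 0) => a c; case: b {H0}.
split; first by split; [have [+ _] := H true|have [+ _] := H false]; apply.
apply: eq_part => b; have [_ /(_ x x0) ->] := H b; rewrite /cintegral.
by case: (f 0) => a c; case: b.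
Qed.

Lemma wderivP f v : is_wderiv f v -> is_wderiv f (wderiv f).
Proof. by move=> H; exact: (@xgetPex _ (fun=> 0) [set v | is_wderiv f v] (ex_intro _ v H)). Qed.

Lemma nsq_split v : (forall b, loc_integrable (fun x => part b (v x))) ->
  (\int[mu]_(x in halfline) (nsq v x)%:E =
   \int[mu]_(x in halfline) (part true (v x) ^+ 2)%:E +
   \int[mu]_(x in halfline) (part false (v x) ^+ 2)%:E)%E.
Proof.
move=> H; have m b : measurable_fun halfline (fun x => (part b (v x) ^+ 2)%:E).
  apply/measurable_EFinP; apply: measurable_funX; exact: loc_integrable_measurable (H b).
under eq_integral do rewrite EFinD.
rewrite ge0_integralD //; [exact: measurable_halfline| |exact: m| |exact: m].
- by move=> x _; rewrite lee_fin sqr_ge0.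
- by move=> x _; rewrite lee_fin sqr_ge0.
Qed.

Lemma part_le_nsq b f x : part b (f x) ^+ 2 <= nsq f x.
Proof. by rewrite /nsq; case: b; rewrite ?lerDl ?lerDr sqr_ge0. Qed.

Lemma H1norm_le f v (eta K1 K2 : R) : 0 <= eta -> K1 + 2 * K2 <= eta ^+ 2 -> is_wderiv f v ->
  (\int[mu]_(x in halfline) (nsq f x)%:E <= K1%:E)%E ->
  (forall b m, dyadic_energy (fun x => part b (f x)) m <= K2) -> (H1norm f <= eta%:E)%E.
Proof.
move=> e0 KK fv fK dK; have w := wderivP fv; have /wderiv_parts wp := w.
have i0 g : (0 <= \int[mu]_(x in halfline) (nsq g x)%:E)%E.
  by apply: integral_ge0 => x _; rewrite lee_fin nsq_ge0.
rewrite H1normE; apply: le_sqrte => //; first exact: adde_ge0.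
apply: (@le_trans _ _ (K1 + 2 * K2)%:E); last by rewrite lee_fin.
rewrite EFinD; apply: leeD => //; rewrite nsq_split; last by move=> b; have [] := wp b.
have -> : 2 * K2 = K2 + K2 by ring.
have D b : (\int[mu]_(x in halfline) (part b (wderiv f x) ^+ 2)%:E <= K2%:E)%E.
  by have [wi wprim] := wp b; exact: dyadic_energy_wderiv wi wprim (dK b).
by rewrite EFinD; apply: leeD; exact: D.
Qed.

Record H1_bounded (eta : R) (f : R -> R[i]) : Prop := {
  h1b_L2 : (\int[mu]_(x in halfline) (nsq f x)%:E <= (eta ^+ 2)%:E)%E;
  h1b_energy : forall b m, dyadic_energy (fun x => part b (f x)) m <= eta ^+ 2;
  h1b_holder : forall b x y, 0 <= x -> 0 <= y ->
    (part b (f x) - part b (f y)) ^+ 2 <= `|x - y| * eta ^+ 2;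
  h1b_sup : forall b x, 0 <= x -> part b (f x) ^+ 2 <= 4 * eta ^+ 2 }.

Lemma measurable_nsq f : cmeasurable halfline f -> measurable_fun halfline (fun x => (nsq f x)%:E).
Proof.
by move=> [m1 m2]; apply/measurable_EFinP; apply: measurable_funD; apply: measurable_funX.
Qed.

Lemma itg_le_int (g h : R -> R) (K a b : R) : 0 <= a -> continuous g ->
  measurable_fun halfline (fun x => (h x)%:E) -> (forall x, 0 <= h x) ->
  (forall x, 0 <= x -> g x <= h x) -> (forall x, 0 <= g x) ->
  (\int[mu]_(x in halfline) (h x)%:E <= K%:E)%E -> itg a b g <= K.
Proof.
move=> a0 cg mh h0 gh g0 HK.
have I2 := integrable_cont a b cg.
rewrite -lee_fin /itg /Rintegral fineK; last exact: integrable_fin_num.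
have sub : `[a, b] `<=` (halfline : set R).
  by move=> x /=; rewrite /halfline /= !in_itv /= andbT => /andP[/(le_trans a0)].
apply: le_trans HK; apply: (@le_trans _ _ (\int[mu]_(x in `[a, b]) (h x)%:E)%E).
  apply: ge0_le_integral => //=.
  - by move=> x _; rewrite lee_fin.
  - by case/integrableP: I2.
  - by apply: (measurable_funS (E := halfline)) => //; exact: measurable_halfline.
  - by move=> x /sub; rewrite /halfline /= in_itv /= andbT lee_fin => /gh.
apply: ge0_subset_integral => //=; first exact: measurable_halfline.
by move=> x _; rewrite lee_fin.
Qed.

Lemma holder_clip_cont (g : R -> R) (K : R) : 0 <= K ->
  (forall x y, 0 <= x -> 0 <= y -> (g x - g y) ^+ 2 <= `|x - y| * K) ->
  forall e, 0 < e -> exists2 d, 0 < d & forall x y, `|x - y| < d -> `|g (clip x) - g (clip y)| <= e.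
Proof.
move=> K0 H e e0; have K1 : 0 < K + 1 by rewrite ltr_wpDl.
exists (e ^+ 2 / (K + 1)); first by rewrite divr_gt0 ?exprn_gt0.
move=> x y xy; rewrite -(ler_pXn2r (n := 2)) ?nnegrE ?(ltW e0) // real_normK ?num_real //.
apply: le_trans (H _ _ (clip_ge0 x) (clip_ge0 y)) _.
apply: (@le_trans _ _ (`|x - y| * (K + 1))).
  by apply: ler_pM; rewrite // ?clip_lip // lerDl.
by rewrite -ler_pdivlMr // ltW.
Qed.

(** The supremum bound averages over [[x, x + 1]]: the value at [x] differs from the values there by
    at most [eta], which gives twice eta^2 from the mass and twice eta^2 from the gradient. *)
Lemma H1_boundedP f v (eta : R) : 0 <= eta -> is_wderiv f v -> cmeasurable halfline f ->
  (H1norm f <= eta%:E)%E -> H1_bounded eta f.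
Proof.
move=> e0 fv mf; have w := wderivP fv; have /wderiv_parts wp := w.
have i0 g : (0 <= \int[mu]_(x in halfline) (nsq g x)%:E)%E.
  by apply: integral_ge0 => x _; rewrite lee_fin nsq_ge0.
rewrite H1normE => /(sqrte_le e0 (adde_ge0 (i0 _) (i0 _))) H.
have L2f : (\int[mu]_(x in halfline) (nsq f x)%:E <= (eta ^+ 2)%:E)%E.
  by apply: le_trans H; rewrite leeDl.
have L2w b : (\int[mu]_(x in halfline) (part b (wderiv f x) ^+ 2)%:E <= (eta ^+ 2)%:E)%E.
  apply: (@le_trans _ _ (\int[mu]_(x in halfline) (nsq (wderiv f) x)%:E)%E).
    rewrite nsq_split; last by move=> b'; have [] := wp b'.
    by case: b; rewrite ?leeDl ?leeDr // integral_ge0 // => x _; rewrite lee_fin sqr_ge0.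
  by apply: le_trans H; rewrite leeDr.
have W b := wderiv_sqr (proj1 (wp b)) (L2w b).
have hol b x y : 0 <= x -> x <= y -> (part b (f y) - part b (f x)) ^+ 2 <= (y - x) * eta ^+ 2.
  move=> x0 xy; have [wi wprim] := wp b; have [w2 w2B] := W b.
  apply: le_trans (incr_sqr_le wi w2 wprim x0 xy) _; rewrite ler_wpM2l ?subr_ge0 //.
  apply: le_trans (w2B y); rewrite (itg_chasles_int x0 xy (w2 y)) lerDr.
  by apply: itg_ge0 => z _; exact: sqr_ge0.
have hol2 b x y : 0 <= x -> 0 <= y -> (part b (f x) - part b (f y)) ^+ 2 <= `|x - y| * eta ^+ 2.
  move=> x0 y0; have [xy|/ltW yx] := leP x y.
    by rewrite distrC (ger0_norm (x := y - x)) ?subr_ge0 // -sqrrN opprB; exact: hol.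
  by rewrite (ger0_norm (x := x - y)) ?subr_ge0 //; exact: hol.
split=> //.
- move=> b m; have [wi wprim] := wp b; have [w2 w2B] := W b.
  exact: le_trans (dyadic_energy_le m wi w2 wprim) (w2B _).
- move=> b x x0; have x1 : x <= x + 1 by rewrite lerDl.
  have cx : continuous (fun y => part b (f (clip y))).
    apply: modulus_continuous => e e0'.
    exact: (holder_clip_cont (sqr_ge0 eta) (hol2 b) e0').
  have I1 : itg x (x + 1) (fun y => part b (f (clip y)) ^+ 2) <= eta ^+ 2.
    apply: (@itg_le_int _ (nsq f) (eta ^+ 2) x (x + 1) x0 (continuous_sqr cx)) => //.
    + exact: measurable_nsq.
    + by move=> y; exact: nsq_ge0.
    + by move=> y y0; rewrite clipE //; exact: part_le_nsq.
    + by move=> y; exact: sqr_ge0.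
  have I2 : itg x (x + 1) (fun=> part b (f x) ^+ 2) <=
     itg x (x + 1) (fun y => 2 * part b (f (clip y)) ^+ 2 + 2 * eta ^+ 2).
    apply: le_itg; first exact: cst_continuous.
      by apply: contD; [apply: contZ; exact: continuous_sqr|exact: cst_continuous].
    move=> y /andP[xy yx]; have y0 := le_trans x0 xy; rewrite clipE //.
    have := hol b x y x0 xy; set p := part b (f x); set q := part b (f y) => h1.
    have h2 : (y - x) * eta ^+ 2 <= eta ^+ 2 by rewrite ler_piMl ?sqr_ge0 //; lra.
    by have := sqr_ge0 (q - (p - q)); rewrite !sqrrB in h1 h2 *; lra.
  move: I2; rewrite itg_cst // itgD; [|apply: contZ; exact: continuous_sqr|exact: cst_continuous].
  rewrite itgZ; last exact: continuous_sqr.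
  rewrite itg_cst // addrAC subrr add0r !mulr1; lra.
Qed.

Lemma in_L2P f : in_L2 f <-> cmeasurable halfline f /\
  (\int[mu]_(x in halfline) (nsq f x)%:E < +oo)%E.
Proof.
have i0 : (0 <= \int[mu]_(x in halfline) (nsq f x)%:E)%E.
  by apply: integral_ge0 => x _; rewrite lee_fin nsq_ge0.
split=> -[mf H]; split=> //.
  by rewrite -L2norm_sqr expe2; apply: lte_mul_pinfty; rewrite ?L2normE ?sqrte_ge0 // -L2normE // ge0_fin_numE // L2normE sqrte_ge0.
by rewrite L2normE; case: (\int[_]_(_ in _) _)%E i0 H => //= r _ _; exact: ltry.
Qed.

End ComplexNorms.

(** * Growth and regularity of an admissible nonlinearity *)

Section TameNonlinearity.
Context {R : realType}.
Variable F : R -> R.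
Hypothesis aF : admissible F.

(** Constant on the negative axis, hence continuous on the line; the explicit 0 matches the shape of
    [clip_primitive_cont]. *)
Definition antider (s : R) : R := 0 + itg 0 (clip s) F.

Lemma admissible_derive (x : R) : is_derive x 1 F (derive1 F x).
Proof. by have [H _ _ _ _] := aF; rewrite derive1E; apply: DeriveDef => //; exact: (H 0%N x). Qed.

Lemma admissible_cont : continuous F.
Proof.
by move=> x; apply: differentiable_continuous; apply/derivable1_diffP; have [] := admissible_derive x.
Qed.

Lemma admissible_cont1 : continuous (derive1 F).
Proof.
have [H _ _ _ _] := aF; move=> x; apply: differentiable_continuous; apply/derivable1_diffP.
exact: (H 1%N x).
Qed.

Lemma admissible_lip S : exists2 L, 0 <= L & forall s s', 0 <= s <= S -> 0 <= s' <= S ->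
  `|F s - F s'| <= L * `|s - s'|.
Proof.
have [L L0 HL] := cont_bounded 0 S admissible_cont1; exists L; first exact: ltW.
move=> s s'; wlog ss : s s' / s' <= s.
  move=> H hs hs'; have [h|/ltW h] := leP s' s; first exact: H.
  by rewrite distrC [`|s - s'|]distrC; exact: H.
move=> /andP[s0 sS] /andP[s'0 s'S].
have D x : x \in `]s', s[%R -> is_derive x 1 F (derive1 F x) by move=> _; exact: admissible_derive.
have [c] := MVT_segment ss D (continuous_subspaceT admissible_cont).
rewrite in_itv /= => /andP[c1 c2] ->; rewrite normrM ler_wpM2r //.
by apply: HL; rewrite (le_trans s'0) //= (le_trans c2).
Qed.

Lemma antider_cont : continuous antider.
Proof. exact: clip_primitive_cont admissible_cont. Qed.

Lemma antiderE s : 0 <= s -> antider s = itg 0 s F.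
Proof. by move=> s0; rewrite /antider add0r clipE. Qed.

Lemma admissible_tame : tame F antider.
Proof.
have cF := admissible_cont; split.
- by move=> S; have [K K0 HK] := cont_bounded 0 S cF; exists K => //; exact: ltW.
- move=> S; have [L L0 HL] := admissible_lip S; exists L => //.
  have key s s' : 0 <= s -> s <= s' -> s' <= S -> forall z, s <= z <= s' ->
      `|itg s s' F - F z * (s' - s)| <= L * (s' - s) ^+ 2.
    move=> s0 ss s'S z /andP[z1 z2].
    rewrite -itg_cst // -itgB //; last exact: cst_continuous.
    rewrite expr2 mulrA; apply: itg_bound => //; first by apply: contB => //; exact: cst_continuous.
    move=> x /andP[x1 x2]; apply: le_trans (HL _ _ _ _) _.
    + by rewrite (le_trans s0 x1) (le_trans x2).
    + by rewrite (le_trans s0 z1) (le_trans z2).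
    + by rewrite ler_wpM2l // ler_norml; lra.
  move=> s s' /andP[s0 sS] /andP[s'0 s'S]; rewrite !antiderE //.
  have [ss|/ltW ss] := leP s s'.
    rewrite (itg_chasles cF s0 ss).
    have -> : itg 0 s F + itg s s' F - itg 0 s F - F s * (s' - s) = itg s s' F - F s * (s' - s) by ring.
    by apply: key => //; rewrite lexx.
  rewrite (itg_chasles cF s'0 ss).
  have -> : itg 0 s' F - (itg 0 s' F + itg s' s F) - F s * (s' - s) = - (itg s' s F - F s * (s - s')) by ring.
  have -> : (s' - s) ^+ 2 = (s - s') ^+ 2 by ring.
  by rewrite normrN; apply: key => //; rewrite lexx ss.
- have [_ [C1 [q [C10 q2 HC]]] _ _ _] := aF.
  have [K K0 HK] := cont_bounded 0 1 cF.
  (* A nonnegative exponent makes the power increasing, so that on [[1, s]] the lower bound on [F]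
     is uniform and its integral is at least - C1 s^(1+p). On [[0, 1]] continuity gives the bound
     [- K]. *)
  pose p := Num.max q 0; have p0 : 0 <= p by rewrite /p le_max lexx orbT.
  exists (K + C1), p; split; first by rewrite addr_ge0 // ltW.
    by rewrite p0 /p gt_max q2 ltr0n.
  move=> s s0; rewrite antiderE //.
  have P0 : 0 <= s `^ p by exact: powR_ge0.
  have [s1|/ltW s1] := leP s 1.
    have := itg_bound (k := K) cF s0 _; rewrite subr0 ler_norml => /(_ _)/andP[|H _].
      by move=> x /andP[x0 xs]; apply: HK; rewrite x0 (le_trans xs).
    apply: le_trans H; rewrite lerN2 -mulrA; apply: ler_pM.
    + exact: ltW.
    + exact: s0.
    + by rewrite lerDl ltW.
    + by rewrite mulrDr mulr1 lerDl mulr_ge0.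
  rewrite (itg_chasles cF ler01 s1).
  have H1 : - K <= itg 0 1 F.
    have := itg_bound (k := K) cF ler01 HK.
    by rewrite subr0 mulr1 ler_norml => /andP[].
  have H2 : itg 1 s (fun=> - (C1 * s `^ p)) <= itg 1 s F.
    apply: le_itg => //; first exact: cst_continuous.
    move=> x /andP[x1 xs]; apply: le_trans (HC x x1); rewrite mulNr lerN2 ler_pM2l //.
    apply: (@le_trans _ _ (x `^ p)); first by apply: ler_powR => //; rewrite /p le_max lexx.
    by apply: ge0_ler_powR; rewrite ?nnegrE // (le_trans ler01).
  move: H2; rewrite itg_cst // => H2.
  have A1 : K <= K * s by rewrite ler_peMr // ltW.
  have A2 : 0 <= K * (s * s `^ p) by rewrite !mulr_ge0 // ltW.
  have A3 : 0 <= C1 * s `^ p by rewrite mulr_ge0 // ltW.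
  have A4 : 0 <= C1 * s by rewrite mulr_ge0 // ltW.
  lra.
- by rewrite antiderE // itgxx.
Qed.

End TameNonlinearity.

(** * Exchange of the time and space integrals *)

Section Fubini.
Context {R : realType}.

Lemma buc_swap (f : R -> R -> R) : buc f -> buc (fun x t => f t x).
Proof.
move=> [[K HK] H]; split; first by exists K.
by move=> e e0; have [d d0 Hd] := H e e0; exists d => // s t x y ts xy; exact: Hd.
Qed.

(** Both sides vanish at Y = 0 and have the same derivative in [Y]. *)
Lemma itg_swap (f : R -> R -> R) (t Y : R) : 0 <= t -> 0 <= Y -> buc f ->
  itg 0 Y (fun x => itg 0 t (fun s => f s x)) = itg 0 t (fun s => itg 0 Y (f s)).
Proof.
move=> t0 Y0 bf; have [[K HK] uf] := bf.
have cx s : continuous (f s) by exact: buc_contx bf.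
have cs x : continuous (fun s => f s x) by exact: buc_contt bf.
pose q y s := itg 0 (clip y) (f s).
have cq y : continuous (q y) by exact: buc_itg_cont (clip_ge0 y) (buc_swap bf).
have E y : 0 <= y -> itg 0 t (q y) = itg 0 t (fun s => itg 0 y (f s)).
  by move=> y0; apply: eq_itg => s _; rewrite /q clipE.
rewrite -E //.
have -> : itg 0 Y (fun x => itg 0 t (fun s => f s x)) = itg 0 t (q Y) - itg 0 t (q 0); last first.
  rewrite (E 0) //; have -> : itg 0 t (fun s => itg 0 0 (f s)) = 0.
    by rewrite -[RHS](itg0 0 t); apply: eq_itg => s _; rewrite itgxx.
  by rewrite subr0.
apply: (@itg_FTC2 _ 0 Y (fun y => itg 0 t (q y)) _ Y0).
- exact: buc_itg_cont.
- apply: continuous_subspaceT; apply: modulus_continuous => e e0.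
  have K0 : 0 <= K by apply: le_trans (HK 0 0).
  have k0 : 0 < K * t + 1 by rewrite ltr_wpDl // mulr_ge0.
  exists (e / (K * t + 1)); first by rewrite divr_gt0.
  move=> y z yz; rewrite -itgB //; apply: (@le_trans _ _ (K * `|y - z| * (t - 0))).
    by apply: itg_bound => //; [exact: contB|move=> s _; exact: itg_clip_lip].
  rewrite subr0 -mulrA [`|_| * t]mulrC mulrA; apply: (@le_trans _ _ ((K * t + 1) * `|y - z|)).
    by rewrite ler_wpM2r // lerDl.
  by rewrite mulrC -ler_pdivlMr // ltW.
- move=> x /andP[x0 _].
  apply: (@is_derive_itg_param _ t x x q (fun y s => f s y)) => //.
  + move=> y s yx _; have y0 : 0 < y by move: yx; rewrite ltr_norml; lra.
    apply: (@is_derive_near_pos _ (fun y => q y s) (fun y => itg 0 y (f s))) => //.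
      by move=> z z0; rewrite /q clipE // ltW.
    exact: is_derive_itg.
  + move=> e e0; have [d d0 Hd] := uf e e0; exists d => // y s yx _.
    by apply: Hd => //; rewrite subrr normr0.
Qed.

End Fubini.

(** * Complex functions and their real components *)

Section Assembly.
Context {R : realType}.
Notation mu := (@lebesgue_measure R).
Implicit Types (f v w : R -> R[i]) (b : bool).

Definition join (z : bool -> R) : R[i] := (z true +i* z false)%C.

Lemma part_join b z : part b (join z) = z b. Proof. by case: b. Qed.

Lemma cmeasurable_cont f : (forall b, continuous (fun x => part b (f x))) -> cmeasurable halfline f.
Proof.
move=> cf; split; apply: (measurable_funS (E := setT)) => //; apply: continuous_measurable_fun.
- exact: (cf true).
- exact: (cf false).
Qed.

Lemma int_nsq_le f (K : R) : (forall b, continuous (fun x => part b (f x))) ->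
  (forall b Y, 0 <= Y -> itg 0 Y (fun x => part b (f x) ^+ 2) <= K) ->
  (\int[mu]_(x in halfline) (nsq f x)%:E <= (2 * K)%:E)%E.
Proof.
move=> cf H; have c2 b : continuous (fun x => part b (f x) ^+ 2) by exact: continuous_sqr.
apply: cont_int_le; first exact: contD.
  by move=> x; exact: nsq_ge0.
by move=> Y Y0; rewrite itgD // mulrDl !mul1r lerD // H.
Qed.

Lemma in_L2_cont f (K : R) : (forall b, continuous (fun x => part b (f x))) ->
  (forall b Y, 0 <= Y -> itg 0 Y (fun x => part b (f x) ^+ 2) <= K) -> in_L2 f.
Proof.
move=> cf H; apply/in_L2P; split; first exact: cmeasurable_cont.
by apply: le_lt_trans (int_nsq_le cf H) _; exact: ltry.
Qed.

Lemma in_L2_wderiv f v (K : R) : is_wderiv f v ->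
  (forall b m, dyadic_energy (fun x => part b (f x)) m <= K) -> in_L2 v.
Proof.
move=> /wderiv_parts fv HK; apply/in_L2P; split.
  by split; [have [+ _] := fv true|have [+ _] := fv false]; exact: loc_integrable_measurable.
rewrite nsq_split; last by move=> b; have [] := fv b.
have D b : (\int[mu]_(x in halfline) (part b (v x) ^+ 2)%:E <= K%:E)%E.
  by have [vi vp] := fv b; exact: dyadic_energy_wderiv vi vp (HK b).
by apply: le_lt_trans (leeD (D true) (D false)) _; rewrite -EFinD; exact: ltry.
Qed.

Lemma ex_wderiv f (K : R) : (forall b, continuous (fun x => part b (f x))) ->
  (forall b m, dyadic_energy (fun x => part b (f x)) m <= K) -> exists v, is_wderiv f v.
Proof.
move=> cf HK.
have [v Hv] := choice (fun b => ex_weak_derivative (cf b) (HK b)).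
exists (fun x => join (fun b => v b x)); apply/wderiv_parts => b.
have [vi vp] := Hv b; split.
  by move=> x; have := vi x; congr (_.-integrable _ _); apply/funext => y /=; rewrite part_join.
by move=> x x0; rewrite (vp x x0); congr (_ + _); apply: eq_itg => y _; rewrite part_join.
Qed.

Lemma in_H1 f (K : R) : (forall b, continuous (fun x => part b (f x))) ->
  (forall b Y, 0 <= Y -> itg 0 Y (fun x => part b (f x) ^+ 2) <= K) ->
  (forall b m, dyadic_energy (fun x => part b (f x)) m <= K) -> in_H 1 f.
Proof.
move=> cf H1 H2; split; first exact: in_L2_cont H1.
by have [v fv] := ex_wderiv cf H2; exists v => //; exact: in_L2_wderiv fv H2.
Qed.

Lemma normc_le (z : R[i]) : Normc.normc z <= `|part true z| + `|part false z|.
Proof.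
rewrite -(ler_pXn2r (n := 2)) ?nnegrE ?addr_ge0 //; last by case: z => a c; rewrite sqrtr_ge0.
rewrite normc_sqr sqrrD !real_normK ?num_real // -addrA [_ *+ 2 + _]addrC addrA lerDl.
by rewrite mulrn_wge0 // mulr_ge0.
Qed.

Lemma part_mulI b (z : R[i]) : part b ((0 +i* 1)%C * z) = - (sgb b * part (~~ b) z).
Proof. by case: z => a c; case: b => /=; rewrite /sgb /=; ring. Qed.

Lemma part_subD b (z z' : R[i]) : part b (- z + z') = - part b z + part b z'.
Proof. by case: z => a c; case: z' => a' c'; case: b. Qed.

Lemma part_div b (z : R[i]) (h : R) : part b (z / h%:C%C) = part b z / h.
Proof.
have -> : (h%:C%C)^-1 = (h^-1)%:C%C :> R[i] by rewrite -fmorphV.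
by case: z => a c; case: b => /=; rewrite !mulr0 ?subr0 ?addr0 ?add0r.
Qed.

Lemma part_sum b (I : finType) (z : I -> R[i]) : part b (\sum_i z i) = \sum_i part b (z i).
Proof.
case: b; rewrite /part; first by rewrite raddf_sum.
by rewrite raddf_sum.
Qed.

Variable N : nat.

Lemma part_time_integral b (u : R -> graph_fun R N) t j x :
  part b (time_integral u t j x) = itg 0 t (fun s => part b (u s j x)).
Proof. by case: b. Qed.

Lemma part_nonlinear b (F : R -> R) (u : graph_fun R N) j x :
  part b (nonlinear F u j x) = F (nsq (u j) x) * part b (u j x).
Proof.
rewrite /nonlinear normc_sqr -/(nsq (u j) x); case: (u j x) => a c.
by case: b => /=; rewrite mul0r ?subr0 ?addr0.
Qed.

End Assembly.

(** * The limit as a complex-valued solution *)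

Section Solution.
Context {R : realType} {N : nat}.
Notation mu := (@lebesgue_measure R).
Variables (F G : R -> R) (U0 : 'I_N.+1 -> bool -> R -> R) (M B S A kap C KG : R).
Variable U : R -> 'I_N.+1 -> bool -> R -> R.
Hypotheses (tFG : tame F G) (cF : continuous F) (cG : continuous G).
Hypothesis Flip : forall S, exists2 L, 0 <= L & forall s s', 0 <= s <= S -> 0 <= s' <= S ->
  `|F s - F s'| <= L * `|s - s'|.
Hypothesis evo : evolution F G U0 M B S A kap C KG U.

Definition state t : graph_fun R N.+1 := fun j x => join (fun b => U t j b x).

Let bU j b : buc (fun t x => U t j b x). Proof. exact: (mild_buc (evo_mild evo 0)). Qed.

Let cU t j b : continuous (U t j b). Proof. exact: buc_contx (bU j b). Qed.

Lemma stateE t j b : (fun x => part b (state t j x)) = U t j b.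
Proof. by apply/funext => x; rewrite part_join. Qed.

Lemma state_dyadic t j b m : 0 <= t -> dyadic_energy (U t j b) m <= B.
Proof. by move=> t0; apply: le_trans (dyadic_le_grad _ _ _ _) _; exact: (evo_grad evo). Qed.

Lemma state_itg t Y j b : 0 <= t -> 0 <= Y -> itg 0 Y (fun x => U t j b x ^+ 2) <= M.
Proof.
move=> t0 Y0; apply: le_trans (evo_mass evo t0 Y0); apply: le_itg.
- exact: continuous_sqr.
- by apply: continuous_sum => i; apply: cont_edge_sq => b'.
- by move=> x _; exact: sq_le_edge.
Qed.

Lemma state_vertex t : 0 <= t -> vertex_continuous (state t).
Proof.
move=> t0 i j; apply: eq_part => b; rewrite !part_join.
by apply: (mild_vertex (evo_mild evo t)); rewrite t0 lexx.
Qed.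

Lemma state_H1 t : 0 <= t -> graph_H 1 (state t).
Proof.
move=> t0; split; last exact: state_vertex.
move=> j; apply: (@in_H1 _ _ (Num.max M B)) => b; first by rewrite stateE.
  move=> Y Y0; rewrite (@eq_itg _ _ _ _ (fun x => U t j b x ^+ 2)).
    by rewrite le_max state_itg.
  by move=> x _; rewrite part_join.
by move=> m; rewrite stateE le_max state_dyadic ?orbT.
Qed.

(** The gradient part is the strong continuity obtained from conservation of energy, the mass part
    is the Hoelder bound in time. Each component contributes eta^2 / 4 of either kind, and [eta] is
    the share of one edge. *)
Lemma state_H1norm_cont t : 0 <= t ->
  graph_H1norm (fun j x => state s j x - state t j x) @[s --> within halfline (nbhs t)] --> 0%E.
Proof.
move=> t0; have [_ _ C0 _] := evo_pos evo.
suff small e : 0 < e -> exists2 d, 0 < d & forall s, 0 <= s -> `|s - t| < d ->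
    (graph_H1norm (fun j x => (state s j x - state t j x)%R) <= e%:E)%E.
  have nn s : (0 <= graph_H1norm (fun j x => (state s j x - state t j x)%R))%E.
    apply: sume_ge0 => j _; rewrite /H1norm; exact: poweR_ge0.
  have nr e : 0 < e -> \forall s \near within halfline (nbhs t),
      (graph_H1norm (fun j x => (state s j x - state t j x)%R) <= e%:E)%E.
    move=> e0; have [d d0 Hd] := small e e0.
    exists d => //= s; rewrite /= distrC => st; rewrite /halfline /= in_itv /= andbT => s0.
    exact: Hd.
  apply/fine_cvgP; split.
    apply: filterS (nr 1 ltr01) => s H; rewrite ge0_fin_numE //.
    by apply: le_lt_trans H _; exact: ltry.
  apply/cvgrPdist_le => /= e e0; apply: filterS (nr e e0) => s H.
  rewrite sub0r normrN ger0_norm ?fine_ge0 // -lee_fin fineK //.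
  by rewrite ge0_fin_numE // (le_lt_trans H) // ltry.
move=> e0; pose eta := e / N.+1%:R.
have eta0 : 0 < eta by rewrite divr_gt0.
have e2 : 0 < eta ^+ 2 / 4 by rewrite divr_gt0 // exprn_gt0.
have [d1 d10 Hd1] := grad_strong_cont tFG cF cG Flip evo t0 e2.
have C1 : 0 < 4 * (C + 1) by lra.
exists (Num.min d1 (eta ^+ 2 / (4 * (C + 1)))).
  by rewrite lt_min d10 divr_gt0 // exprn_gt0.
move=> s s0; rewrite lt_min => /andP[st1 st2].
have -> : e = \sum_(j < N.+1) eta.
  by rewrite sumr_const card_ord -mulr_natl /eta mulrCA divff ?mulr1.
rewrite /graph_H1norm -sumEFin; apply: lee_sum => j _.
have dE b : (fun x => part b (state s j x - state t j x)) = (fun x => U s j b x - U t j b x).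
  by apply/funext => x; rewrite partB !part_join.
have cd b : continuous (fun x => part b (state s j x - state t j x)) by rewrite dE; exact: contB.
have D b m : dyadic_energy (fun x => part b (state s j x - state t j x)) m <= eta ^+ 2 / 4.
  rewrite dE; apply: le_trans (Hd1 s m s0 st1).
  exact: (dyadic_le_grad (fun j b x => U s j b x - U t j b x)).
have [v fv] := ex_wderiv cd D.
have I2 b Y : 0 <= Y -> itg 0 Y (fun x => part b (state s j x - state t j x) ^+ 2) <= eta ^+ 2 / 4.
  move=> Y0; have key p q : 0 <= q <= p -> `|p - q| < eta ^+ 2 / (4 * (C + 1)) ->
      itg 0 Y (fun x => (U p j b x - U q j b x) ^+ 2) <= eta ^+ 2 / 4.
    move=> /andP[q0 qp] pq; have qq : 0 <= q <= p by rewrite q0 qp.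
    apply: (@le_trans _ _ (C * (p - q))).
      apply: le_trans (evo_holder evo qq Y0); apply: le_itg.
      - by apply: continuous_sqr; exact: contB.
      - by apply: continuous_sum => i; apply: cont_edge_sq => b'; exact: contB.
      - by move=> x _; exact: (sq_le_edge (fun j b x => U p j b x - U q j b x)).
    move: pq; rewrite ger0_norm ?subr_ge0 // ltr_pdivlMr // => pq.
    have := sqr_ge0 eta; have : 0 <= p - q by rewrite subr_ge0.
    by move: pq; rewrite mulrCA mulrDr mulr1; lra.
  rewrite (@eq_itg _ _ _ _ (fun x => (U s j b x - U t j b x) ^+ 2)).
    have [ts|/ltW ts] := leP t s; first by apply: key; rewrite ?t0.
    rewrite (@eq_itg _ _ _ _ (fun x => (U t j b x - U s j b x) ^+ 2)).
      by apply: key; rewrite ?s0 // distrC.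
    by move=> x _; rewrite -sqrrN opprB.
  by move=> x _; rewrite partB !part_join.
apply: (H1norm_le (ltW eta0) _ fv (int_nsq_le cd I2) D).
by lra.
Qed.

Lemma double_primitive (f g : R -> R) (c d : R) : continuous f -> continuous g ->
  (forall x, 0 <= x -> f x = c + d * x + itg 0 x (fun y => (x - y) * g y)) ->
  primitive_of f (fun x => d + itg 0 (clip x) g).
Proof.
move=> cf cg fE x x0.
have -> : itg 0 x (fun x => d + itg 0 (clip x) g) = f x - f 0; last by ring.
apply: itg_FTC2 => //.
- exact: clip_primitive_cont.
- exact: continuous_subspaceT.
- by move=> y /andP[y0 _]; exact: is_derive_double fE y0.
Qed.

(** Cauchy-Schwarz in time followed by the exchange of integrals; it places the time integrals of
    the solution and of the nonlinear term in L^2. *)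
Lemma itg_sqr_time (f : R -> R -> R) t Y K : 0 <= t -> 0 <= Y -> buc f ->
  (forall s, 0 <= s <= t -> itg 0 Y (fun x => f s x ^+ 2) <= K) ->
  itg 0 Y (fun x => itg 0 t (fun s => f s x) ^+ 2) <= t * (t * K).
Proof.
move=> t0 Y0 bf HK; have bf2 := buc_sqr bf.
apply: (@le_trans _ _ (itg 0 Y (fun x => t * itg 0 t (fun s => f s x ^+ 2)))).
  apply: le_itg.
  - by apply: continuous_sqr; exact: buc_itg_cont.
  - by apply: contZ; exact: buc_itg_cont.
  - by move=> x _; have := sqr_itg t0 (buc_contt (x := x) bf); rewrite subr0.
rewrite itgZ; last exact: buc_itg_cont.
rewrite ler_wpM2l // (itg_swap t0 Y0 bf2).
apply: (@le_trans _ _ (itg 0 t (fun=> K))); last by rewrite itg_cst // subr0 mulrC.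
apply: le_itg => //; last exact: cst_continuous.
by apply: (buc_itg_cont Y0); exact: buc_swap.
Qed.

Notation source := (mild_source F U).

Let bn j b : buc (fun s x => F (edge_sq (U s) j x) * U s j b x).
Proof. exact: (rhs_buc cF b (bU j)). Qed.

Lemma source_continuous t j b : 0 <= t -> continuous (source t j b).
Proof.
move=> t0; apply: contD; first exact: (buc_itg_cont t0 (bn j b)).
by apply: contZ; exact: contB.
Qed.

Lemma source_L2 t : 0 <= t -> exists K, forall j b Y, 0 <= Y ->
  itg 0 Y (fun x => source t j b x ^+ 2) <= K.
Proof.
move=> t0; have [KF KF0 HF] := cont_bounded 0 S cF.
exists (2 * (t * (t * (KF ^+ 2 * M))) + 4 * M + 4 * M) => j b Y Y0.
have cn : continuous (fun x => itg 0 t (fun s => F (edge_sq (U s) j x) * U s j b x)).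
  exact: (buc_itg_cont t0 (bn j b)).
have H1 : itg 0 Y (fun x => itg 0 t (fun s => F (edge_sq (U s) j x) * U s j b x) ^+ 2) <=
    t * (t * (KF ^+ 2 * M)).
  apply: (itg_sqr_time t0 Y0 (bn j b)) => s /andP[s0 st].
  apply: (@le_trans _ _ (itg 0 Y (fun x => KF ^+ 2 * U s j b x ^+ 2))).
    apply: le_itg.
    - by apply: continuous_sqr; exact: buc_contx (bn j b).
    - by apply: contZ; exact: continuous_sqr.
    move=> x /andP[x0 _]; rewrite exprMn ler_wpM2r ?sqr_ge0 //.
    rewrite -real_normK ?num_real // ler_pXn2r ?nnegrE ?(ltW KF0) //; apply: HF.
    by rewrite edge_sq_ge0 (evo_sup evo).
  rewrite itgZ; last exact: continuous_sqr.
  by rewrite ler_wpM2l ?sqr_ge0 // state_itg.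
have H2 := state_itg j (~~ b) t0 Y0; have H3 := state_itg j (~~ b) (lexx 0) Y0.
apply: (@le_trans _ _ (itg 0 Y (fun x =>
   2 * itg 0 t (fun s => F (edge_sq (U s) j x) * U s j b x) ^+ 2 +
   4 * U t j (~~ b) x ^+ 2 + 4 * U 0 j (~~ b) x ^+ 2))).
  apply: le_itg.
  - by apply: continuous_sqr; exact: source_continuous.
  - by apply: contD; [apply: contD|]; apply: contZ; exact: continuous_sqr.
  move=> x _; rewrite /mild_source; set p := itg _ _ _; set q := U t _ _ _; set r := U 0 _ _ _.
  have -> : (p + sgb b * (q - r)) ^+ 2 = 2 * p ^+ 2 + 2 * (sgb b ^+ 2 * (q - r) ^+ 2) - (p - sgb b * (q - r)) ^+ 2 by ring.
  rewrite sgb_sqr mul1r; have := sqr_ge0 (p - sgb b * (q - r)); have := sqr_ge0 (q + r).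
  by rewrite sqrrD sqrrB; lra.
have c1 : continuous (fun x => 2 * itg 0 t (fun s => F (edge_sq (U s) j x) * U s j b x) ^+ 2).
  by apply: contZ; exact: continuous_sqr.
have c2 t' : continuous (fun x => 4 * U t' j (~~ b) x ^+ 2) by apply: contZ; exact: continuous_sqr.
rewrite itgD; [|by apply: contD|by []].
rewrite itgD // !itgZ; [|exact: continuous_sqr|exact: continuous_sqr|exact: continuous_sqr].
lra.
Qed.

(** The solved form supplies the witnesses: [g] is the source, its primitive [W] starting from the
    slope [d] is the first derivative, and these slopes are the one-sided derivatives at the vertex
    because the remainder is of second order in x. *)
Lemma state_equation t : 0 <= t -> exists2 g : graph_fun R N.+1,
  is_Laplacian (time_integral state t) g &
  forall j x, 0 <= x -> (0 +i* 1)%C * (state t j x - state 0 j x) =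
    - g j x + time_integral (fun s => nonlinear F (state s)) t j x.
Proof.
move=> t0; have tt : 0 <= t <= t by rewrite t0 lexx.
have [d Hd] := choice (fun b => mild_eq (evo_mild evo t) b tt).
pose f j b x := itg 0 t (fun s => U s j b x).
have cf j b : continuous (f j b) by exact: buc_itg_cont t0 (bU j b).
have cs j b := @source_continuous t j b t0.
have fE j b x : 0 <= x -> f j b x = f j b 0 + d b j * x + itg 0 x (fun y => (x - y) * source t j b y).
  by have [_] := Hd b; apply.
pose w j b x := d b j + itg 0 (clip x) (source t j b).
have cw j b : continuous (w j b) by exact: clip_primitive_cont (cs j b).
have fw j b : primitive_of (f j b) (w j b) by exact: double_primitive (cf j b) (cs j b) (fE j b).
pose W : graph_fun R N.+1 := fun j x => join (fun b => w j b x).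
pose g : graph_fun R N.+1 := fun j x => join (fun b => source t j b x).
have TE j b : (fun x => part b (time_integral state t j x)) = f j b.
  by apply/funext => x; rewrite part_time_integral; apply: eq_itg => s _; rewrite part_join.
have WE j b : (fun x => part b (W j x)) = w j b by apply/funext => x; rewrite part_join.
have gE j b : (fun x => part b (g j x)) = source t j b by apply/funext => x; rewrite part_join.
have TW j : is_wderiv (time_integral state t j) (W j).
  by apply/wderiv_parts => b; rewrite TE WE; split; [exact: cont_loc_integrable|exact: fw].
have Wg j : is_wderiv (W j) (g j).
  apply/wderiv_parts => b; rewrite WE gE; split; first exact: cont_loc_integrable.
  by move=> x x0; rewrite /w !clipE // itgxx addr0.
have fB j b m : dyadic_energy (f j b) m <= t ^+ 2 * B.
  have H s : 0 <= s <= t -> dyadic_energy (U s j b) m <= B by move=> /andP[s0 _]; exact: state_dyadic.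
  by have := dyadic_energy_itg t0 (bU j b) H; rewrite subr0.
have [K HK] := source_L2 t0.
have TV : vertex_continuous (time_integral state t).
  move=> i j; apply: eq_part => b; rewrite !part_time_integral; apply: eq_itg => s /andP[s0 st].
  by rewrite !part_join; apply: (mild_vertex (evo_mild evo t)); rewrite s0.
have sqE (h : R -> R[i]) (k : bool -> R -> R) : (forall b, (fun x => part b (h x)) = k b) ->
    forall b Y, itg 0 Y (fun x => part b (h x) ^+ 2) = itg 0 Y (fun x => k b x ^+ 2).
  by move=> hk b Y; rewrite -hk.
exists g; last first.
  move=> j x x0; apply: eq_part => b.
  have N' b' : part b' (time_integral (fun s => nonlinear F (state s)) t j x) =
      itg 0 t (fun s => F (edge_sq (U s) j x) * U s j b' x).
    rewrite part_time_integral; apply: eq_itg => s _; rewrite part_nonlinear part_join.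
    by rewrite /nsq !part_join.
  by rewrite part_mulI partB part_subD N' !part_join /mild_source; ring.
split; last by move=> j; exists (W j).
- split=> // j; split.
    apply: (@in_L2_cont _ _ (t * (t * M))) => b; first by rewrite TE.
    move=> Y Y0; rewrite (sqE _ _ (TE j)); apply: (itg_sqr_time t0 Y0 (bU j b)) => s /andP[s0 _].
    exact: state_itg.
  exists (W j) => //; split.
    by apply: (in_L2_wderiv (TW j)) => b m; rewrite TE; exact: fB.
  exists (g j) => //; apply: (@in_L2_cont _ _ K) => b; first by rewrite gE.
  by move=> Y Y0; rewrite (sqE _ _ (gE j)); exact: HK.
- split=> //; exists (fun j => join (fun b => d b j)); split; last first.
    by apply: eq_part => b; rewrite part_sum; under eq_bigr do rewrite part_join;
      have [-> _] := Hd b; case: b.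
  move=> j; apply/cvgrPdist_le => e e0.
  have Kb b : exists2 k, 0 < k & forall x, 0 <= x <= 1 -> `|source t j b x| <= k.
    by have [k k0 Hk] := cont_bounded 0 1 (cs j b); exists k.
  have [k1 k10 Hk1] := Kb true; have [k2 k20 Hk2] := Kb false.
  near=> h; rewrite sub0r normrN.
  have h0 : 0 < h by near: h; exact: nbhs_right_gt.
  have h1 : h <= 1 by near: h; apply: nbhs_right_le.
  have he : h <= e / (k1 + k2) by near: h; apply: nbhs_right_le; rewrite divr_gt0 // addr_gt0.
  have P b k : (forall x, 0 <= x <= 1 -> `|source t j b x| <= k) ->
    `|part b ((time_integral state t j h - time_integral state t j 0) / h%:C%C - join (fun b => d b j))| <= k * h.
    move=> Hk; rewrite partB part_div partB part_join.
    have E x : part b (time_integral state t j x) = f j b x by rewrite -(TE j b).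
    rewrite !E (fE j b h (ltW h0)).
    have -> : (f j b 0 + d b j * h + itg 0 h (fun y => (h - y) * source t j b y) - f j b 0) / h - d b j =
       itg 0 h (fun y => (h - y) * source t j b y) / h by field; rewrite gt_eqF.
    rewrite normrM normfV (gtr0_norm h0) ler_pdivrMr //.
    have -> : k * h * h = h * k * (h - 0) by ring.
    apply: itg_bound; [|exact: ltW|].
      apply: contM => //; apply: contB; first exact: cst_continuous.
      by move=> y; exact: cvg_id.
    move=> y /andP[y0 yh]; rewrite normrM; apply: ler_pM => //.
      by rewrite ger0_norm ?subr_ge0 // gerBl.
    by apply: Hk; rewrite y0 (le_trans yh).
  have n0 (z : R[i]) : 0 <= Normc.normc z by case: z => a c; rewrite sqrtr_ge0.
  rewrite ger0_norm //.
  apply: le_trans (normc_le _) _; have := lerD (P true k1 Hk1) (P false k2 Hk2).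
  move=> H; apply: le_trans H _; rewrite -mulrDl mulrC -ler_pdivlMr //.
  exact: addr_gt0.
Unshelve. all: end_near. Qed.

Lemma state_bounds : exists C' c, forall t, 0 <= t ->
  (graph_H1norm (state t) <= C'%:E)%E /\ (graph_L2norm (weighted (state t)) <= (C' * t + c)%:E)%E.
Proof.
have [A0 k0 C0 KG0] := evo_pos evo.
have M0 : 0 <= M.
  by apply: le_trans (evo_mass evo (lexx 0) (lexx 0)); rewrite itgxx.
have B0 : 0 <= B.
  by apply: le_trans (evo_grad evo 0%N (lexx 0)); apply: sumr_ge0 => j _; rewrite addr_ge0 ?dyadic_energy_ge0.
pose eta := Num.sqrt (2 * M + 2 * B).
have etaE : eta ^+ 2 = 2 * M + 2 * B by rewrite sqr_sqrtr // addr_ge0 // mulr_ge0.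
have eta0 : 0 <= eta by exact: sqrtr_ge0.
(* One constant has to serve both bounds: [eta] for the norm of each edge and [2 * kap] for the
   linear growth of its weighted norm. *)
pose C' := N.+1%:R * (eta + 2 * kap); exists C', (N.+1%:R * (2 * A)) => t t0; split.
  apply: (@le_trans _ _ (\sum_(j < N.+1) eta%:E)%E); last first.
    rewrite sumEFin lee_fin sumr_const card_ord -mulr_natl /C' ler_wpM2l // lerDl.
    by rewrite mulr_ge0.
  apply: lee_sum => j _.
  have cd b : continuous (fun x => part b (state t j x)) by rewrite stateE.
  have D b m : dyadic_energy (fun x => part b (state t j x)) m <= B by rewrite stateE; exact: state_dyadic.
  have I2 b Y : 0 <= Y -> itg 0 Y (fun x => part b (state t j x) ^+ 2) <= M.
    move=> Y0; rewrite (@eq_itg _ _ _ _ (fun x => U t j b x ^+ 2)); first exact: state_itg.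
    by move=> x _; rewrite part_join.
  have [v fv] := ex_wderiv cd D.
  by apply: (H1norm_le eta0 _ fv (int_nsq_le cd I2) D); rewrite etaE.
have At0 : 0 <= A + kap * t by rewrite addr_ge0 // mulr_ge0.
apply: (@le_trans _ _ (\sum_(j < N.+1) (2 * (A + kap * t))%:E)%E); last first.
  rewrite sumEFin lee_fin sumr_const card_ord -mulr_natl /C'.
  have : 0 <= N.+1%:R * eta * t by rewrite !mulr_ge0.
  lra.
apply: lee_sum => j _.
have pw b x : part b (weighted (state t) j x) = `|x| * U t j b x.
  by rewrite /weighted /state /join; case: b => /=; ring.
have cx : continuous (fun x : R => `|x|) by apply: continuous_norm => x; exact: cvg_id.
have cw b : continuous (fun x => part b (weighted (state t) j x)).
  have -> : (fun x => part b (weighted (state t) j x)) = (fun x => `|x| * U t j b x).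
    by apply/funext => x; rewrite pw.
  exact: contM.
have I2 b Y : 0 <= Y -> itg 0 Y (fun x => part b (weighted (state t) j x) ^+ 2) <= (A + kap * t) ^+ 2.
  move=> Y0; apply: le_trans (evo_weight evo t0 Y0); apply: le_itg.
  - exact: continuous_sqr.
  - apply: contM; first by apply: continuous_sqr => x; exact: cvg_id.
    by apply: continuous_sum => i; apply: cont_edge_sq => b'.
  - move=> x _; rewrite pw exprMn real_normK ?num_real // ler_wpM2l ?sqr_ge0 //.
    exact: sq_le_edge.
rewrite L2normE; apply: le_sqrte; first by rewrite mulr_ge0.
  by apply: integral_ge0 => x _; rewrite lee_fin nsq_ge0.
apply: le_trans (int_nsq_le cw I2) _; rewrite lee_fin exprMn ler_wpM2r ?sqr_ge0 //.
by rewrite expr2 -natrM ler_nat.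
Qed.

End Solution.

(** Uniform continuity on a compact time interval for an abstract closeness relation [E], which need
    not come from a metric. Two nearby times are compared through the centre of a covering ball,
    whence [e + e]. *)
Lemma lebesgue_number {R : realType} (E : R -> R -> R -> Prop) (T : R) :
  (forall e s t, E e s t -> E e t s) ->
  (forall e s t r, E e s t -> E e t r -> E (e + e) s r) ->
  (forall t e, 0 <= t <= T -> 0 < e -> exists2 d, 0 < d &
     forall s, 0 <= s <= T -> `|s - t| < d -> E e s t) ->
  forall e, 0 < e -> exists2 d, 0 < d &
     forall s t, 0 <= s <= T -> 0 <= t <= T -> `|s - t| < d -> E (e + e) s t.
Proof.
move=> sym tri loc e e0.
have /compact_near_coveringP/near_covering_withinP := @segment_compact R 0 T.
move=> /(_ R (0^'+) (fun d s => forall t, 0 <= t <= T -> `|s - t| < d -> E (e + e) s t)) H.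
have : \forall d \near 0^'+, `[0, T] `<=` (fun s => forall t, 0 <= t <= T -> `|s - t| < d -> E (e + e) s t).
  apply: H => x; rewrite /= in_itv /= => xT.
  have [d d0 Hd] := loc x e xT e0.
  exists (ball x (d / 2), [set t | 0 < t < d / 2]) => /=.
    split; first by apply: nbhsx_ballx; rewrite divr_gt0.
    exists (d / 2) => /=; first by rewrite divr_gt0.
    by move=> t /=; rewrite sub0r normrN => td t0; rewrite t0 -(gtr0_norm t0).
  move=> [z t] /= [xz /andP[t0 td]]; rewrite in_itv /= => zT y yT zy.
  move: xz; rewrite /ball /= distrC => xz.
  apply: (tri _ _ x); first by apply: Hd => //; lra.
  apply: sym; apply: Hd => //.
  have -> : y - x = (z - x) - (z - y) by ring.
  by apply: le_lt_trans (ler_normB _ _) _; lra.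
move=> [d /= d0 Hd]; exists (d / 2); first by rewrite divr_gt0.
move=> s t sT tT st; apply: (Hd (d / 2)) => //=.
- by rewrite sub0r normrN gtr0_norm ?divr_gt0 // ltr_pdivrMr // ltr_pMr // ltr1n.
- by rewrite divr_gt0.
Qed.

Lemma int_nsq_fin {R : realType} (f : R -> R[i]) : in_L2 f -> exists2 K, 0 <= K &
  (\int[@lebesgue_measure R]_(x in halfline) (nsq f x)%:E <= K%:E)%E.
Proof.
move=> /in_L2P[_ fin].
have i0 : (0 <= \int[@lebesgue_measure R]_(x in halfline) (nsq f x)%:E)%E.
  by apply: integral_ge0 => x _; rewrite lee_fin nsq_ge0.
exists (fine (\int[@lebesgue_measure R]_(x in halfline) (nsq f x)%:E)%E); first exact: fine_ge0.
by rewrite fineK // ge0_fin_numE.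
Qed.

Lemma in_H1_bounded {R : realType} (f : R -> R[i]) : in_H 1 f ->
  exists2 eta, 0 <= eta & H1_bounded eta f.
Proof.
move=> [fL2 [w fw wL2]]; have [K1 K10 HK1] := int_nsq_fin fL2; have [K2 K20 HK2] := int_nsq_fin wL2.
have /wderiv_parts wp := fw.
have D b m : dyadic_energy (fun x => part b (f x)) m <= K2.
  have [wi wprim] := wp b.
  have H : (\int[@lebesgue_measure R]_(x in halfline) (part b (w x) ^+ 2)%:E <= K2%:E)%E.
    apply: le_trans HK2; rewrite nsq_split; last by move=> b'; have [] := wp b'.
    by case: (b); rewrite ?leeDl ?leeDr // integral_ge0 // => x _; rewrite lee_fin sqr_ge0.
  have [w2 w2B] := wderiv_sqr wi H.
  exact: le_trans (dyadic_energy_le m wi w2 wprim) (w2B _).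
exists (Num.sqrt (K1 + 2 * K2)); first exact: sqrtr_ge0.
apply: (H1_boundedP (sqrtr_ge0 _) fw) => //; first by case: fL2.
apply: (H1norm_le (sqrtr_ge0 _) _ fw HK1 D).
by rewrite sqr_sqrtr // addr_ge0 // mulr_ge0.
Qed.

(** * Every solution satisfies the real integrated equation *)

Section Competitor.
Context {R : realType} {N : nat}.
Notation mu := (@lebesgue_measure R).
Variables (F : R -> R) (u0 : graph_fun R N.+1) (v : R -> graph_fun R N.+1).
Hypothesis cF : continuous F.
Hypothesis sv : is_solution F u0 v.

Lemma is_wderivB (f g f' g' : R -> R[i]) : is_wderiv f f' -> is_wderiv g g' ->
  is_wderiv (fun x => f x - g x) (fun x => f' x - g' x).
Proof.
move=> /wderiv_parts Hf /wderiv_parts Hg; apply/wderiv_parts => b.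
have [fi fp] := Hf b; have [gi gp] := Hg b.
have E x : part b (f' x - g' x) = part b (f' x) - part b (g' x) by exact: partB.
split.
  move=> x; have -> : EFin \o (fun x => part b (f' x - g' x)) =
    ((EFin \o (fun x => part b (f' x))) \- (EFin \o (fun x => part b (g' x))))%E.
    by apply/funext => y; rewrite /= E EFinB.
  by apply: integrableB.
move=> x x0; rewrite !partB (fp x x0) (gp x x0).
have -> : itg 0 x (fun x => part b (f' x - g' x)) =
    itg 0 x (fun x => part b (f' x)) - itg 0 x (fun x => part b (g' x)).
  by rewrite /itg -RintegralB //; apply: eq_Rintegral => y _; rewrite E.
ring.
Qed.

Lemma part_le_normc b (z : R[i]) : `|part b z| <= Normc.normc z.
Proof.
have n0 : 0 <= Normc.normc z by case: z => a c; rewrite sqrtr_ge0.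
rewrite -(ler_pXn2r (n := 2)) ?nnegrE // normc_sqr real_normK ?num_real //.
by case: b; rewrite ?lerDl ?lerDr sqr_ge0.
Qed.

Let comp t j b x : R := part b (v t j x).

(** What an H^1 distance of at most [e] implies, in terms of point values only. The factor 2 is the
    square root of the constant in [h1b_sup]. *)
Definition near_states (e s t : R) : Prop := forall j b,
  (forall m, dyadic_energy (fun x => comp s j b x - comp t j b x) m <= e ^+ 2) /\
  (forall x, 0 <= x -> `|comp s j b x - comp t j b x| <= 2 * e).

Lemma comp_wderiv t j : 0 <= t -> in_L2 (v t j) /\ exists w, is_wderiv (v t j) w.
Proof.
move=> t0; have [/(_ t t0) [H _] _ _ _] := sv.
by have [H1 [w H2 _]] := H j; split=> //; exists w.
Qed.

Lemma near_states_local t e : 0 <= t -> 0 < e -> exists2 d, 0 < d &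
  forall s, 0 <= s -> `|s - t| < d -> near_states e s t.
Proof.
move=> t0 e0; have [_ /(_ t t0) H _ _] := sv.
have nr : \forall s \near within halfline (nbhs t),
    (graph_H1norm (fun j x => (v s j x - v t j x)%R) <= e%:E)%E.
  have /fine_cvgP[H1 /cvgrPdist_le/(_ e e0) H2] := H.
  apply: filterS2 H1 H2 => s fs /=; rewrite sub0r normrN => H3.
  by rewrite -(fineK fs) lee_fin (le_trans _ H3) // ler_norm.
have [d /= d0 Hd] := nr; exists d => // s s0 st j b.
have {Hd}Hs : (graph_H1norm (fun j x => (v s j x - v t j x)%R) <= e%:E)%E.
  have Hb : ball_ Num.norm t d s by rewrite /ball_ /= distrC.
  have hs : halfline s by rewrite /halfline /= in_itv /= s0.
  exact: (Hd s Hb hs).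
have Hj : (H1norm (fun x => (v s j x - v t j x)%R) <= e%:E)%E.
  apply: le_trans Hs; rewrite /graph_H1norm (bigD1 j) //= leeDl // sume_ge0 // => i _.
  exact: poweR_ge0.
have [[[m1 m2] _] [w1 W1]] := comp_wderiv j s0; have [[[m3 m4] _] [w2 W2]] := comp_wderiv j t0.
have mB : cmeasurable halfline (fun x => v s j x - v t j x).
  split.
    have -> : (fun x => complex.Re (v s j x - v t j x)) =
       (fun x => complex.Re (v s j x) - complex.Re (v t j x)).
      by apply/funext => x; exact: (partB true).
    exact: measurable_funB.
  have -> : (fun x => complex.Im (v s j x - v t j x)) =
     (fun x => complex.Im (v s j x) - complex.Im (v t j x)).
    by apply/funext => x; exact: (partB false).
  exact: measurable_funB.
have Hb := H1_boundedP (ltW e0) (is_wderivB W1 W2) mB Hj.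
have E : (fun x => part b (v s j x - v t j x)) = (fun x => comp s j b x - comp t j b x).
  by apply/funext => x; rewrite partB.
split=> [m|x x0]; first by rewrite -E; exact: h1b_energy Hb b m.
rewrite -(ler_pXn2r (n := 2)) ?nnegrE ?mulr_ge0 ?(ltW e0) // real_normK ?num_real //.
have := h1b_sup Hb b x0; rewrite partB => H4; apply: le_trans H4 _.
by rewrite exprMn; have -> : 2 ^+ 2 = 4 :> R by ring.
Qed.

Lemma dyadic_energy_add (f g : R -> R) m :
  dyadic_energy (fun x => f x + g x) m <= 2 * (dyadic_energy f m + dyadic_energy g m).
Proof.
rewrite /dyadic_energy -mulrDr mulrCA ler_pM2l ?exprn_gt0 // -big_split /= mulr_sumr.
apply: ler_sum => k _; set p := f _; set q := g _; set p' := f _; set q' := g _.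
have -> : p + q - (p' + q') = (p - p') + (q - q') by ring.
by have := sqr_ge0 ((p - p') - (q - q')); rewrite sqrrB sqrrD; lra.
Qed.

Lemma near_states_unif T e : 0 < e -> exists2 d, 0 < d & forall s t, 0 <= s <= T -> 0 <= t <= T ->
  `|s - t| < d -> near_states (e + e) s t.
Proof.
apply: lebesgue_number.
- move=> {}e s t H j b; have [H1 H2] := H j b; split=> [m|x x0]; last by rewrite distrC; exact: H2.
  have -> : (fun x => comp t j b x - comp s j b x) = (fun x => -1 * (comp s j b x - comp t j b x)).
    by apply/funext => x; ring.
  by rewrite dyadic_energyZ sqrrN expr1n mul1r.
- move=> {}e s t r H H' j b; have [H1 H2] := H j b; have [H3 H4] := H' j b; split=> [m|x x0].
    have -> : (fun x => comp s j b x - comp r j b x) =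
       (fun x => (comp s j b x - comp t j b x) + (comp t j b x - comp r j b x)).
      by apply/funext => x; ring.
    apply: le_trans (dyadic_energy_add _ _ m) _; have := H1 m; have := H3 m.
    have -> : (e + e) ^+ 2 = 2 * (e ^+ 2 + e ^+ 2) by ring.
    by move=> A1 A2; rewrite ler_pM2l // lerD.
  have -> : comp s j b x - comp r j b x = (comp s j b x - comp t j b x) + (comp t j b x - comp r j b x) by ring.
  apply: le_trans (ler_normD _ _) _; have := H2 x x0; have := H4 x x0; lra.
- move=> t e' /andP[t0 _] e'0; have [d d0 Hd] := near_states_local t0 e'0.
  by exists d => // s /andP[s0 _]; exact: Hd.
Qed.

(** A solution is only assumed continuous in H^1. Uniform continuity on [[0, T]] yields a step
    [d / 2], and bounds are carried forward from time 0 through finitely many such steps. *)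
Lemma comp_bounded T : exists2 B, 0 <= B & forall t j b, 0 <= t <= T ->
  (forall m, dyadic_energy (comp t j b) m <= B) /\ (forall x, 0 <= x -> `|comp t j b x| <= B).
Proof.
have base : exists2 B, 0 <= B & forall j b,
    (forall m, dyadic_energy (comp 0 j b) m <= B) /\ (forall x, 0 <= x -> `|comp 0 j b x| <= B).
  have H j : exists B, 0 <= B /\ forall b,
      (forall m, dyadic_energy (comp 0 j b) m <= B) /\ (forall x, 0 <= x -> `|comp 0 j b x| <= B).
    have [/(_ 0 (lexx 0)) [/(_ j) Hj _] _ _ _] := sv.
    have [eta eta0 Hb] := in_H1_bounded Hj.
    exists (eta ^+ 2 + 2 * eta); split; first by rewrite addr_ge0 ?sqr_ge0 // mulr_ge0.
    move=> b; split=> [m|x x0].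
      by apply: le_trans (h1b_energy Hb b m) _; rewrite lerDl mulr_ge0.
    apply: (@le_trans _ _ (2 * eta)); last by rewrite lerDr sqr_ge0.
    rewrite -(ler_pXn2r (n := 2)) ?nnegrE ?mulr_ge0 // real_normK ?num_real //.
    apply: le_trans (h1b_sup Hb b x0) _.
    by rewrite exprMn; have -> : 2 ^+ 2 = 4 :> R by ring.
  have [K HK] := choice H; have K0 j : 0 <= K j by have [] := HK j.
  have le j : K j <= \sum_i K i by rewrite (bigD1 j) //= lerDl sumr_ge0.
  exists (\sum_i K i); first exact: sumr_ge0.
  move=> j b; have [_ /(_ b) [H1 H2]] := HK j; split=> [m|x x0].
    exact: le_trans (H1 m) (le j).
  exact: le_trans (H2 x x0) (le j).
have [d d0 Hd] := near_states_unif T (@ltr01 R).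
have step n : exists2 B, 0 <= B & forall t j b, 0 <= t <= T -> t <= n%:R * (d / 2) ->
    (forall m, dyadic_energy (comp t j b) m <= B) /\ (forall x, 0 <= x -> `|comp t j b x| <= B).
  elim: n => [|n [B B0 IH]].
    have [B B0 HB] := base; exists B => // t j b /andP[t0 tT]; rewrite mul0r => t0'.
    by have -> : t = 0; [apply/le_anti; rewrite t0'|exact: HB].
  (* States one step apart are near with parameter 1 + 1: energies grow to at most 2 (4 + B) and
     values to at most 4 + B. *)
  exists (2 * B + 8); first by rewrite addr_ge0 // mulr_ge0.
  move=> t j b /andP[t0 tT] tn.
  have d20 : 0 < d / 2 by rewrite divr_gt0.
  pose s := clip (t - d / 2).
  have s0 : 0 <= s by exact: clip_ge0.
  have st : s <= t by rewrite /s /clip ge_max t0; lra.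
  have ts : t - s <= d / 2.
    have : t - d / 2 <= s by rewrite /s /clip le_max lexx.
    lra.
  have sn : s <= n%:R * (d / 2).
    rewrite /s /clip ge_max mulr_ge0 ?(ltW d20) // andbT lerBlDr.
    by apply: le_trans tn _; rewrite -natr1 mulrDl mul1r.
  have sT : 0 <= s <= T by rewrite s0 (le_trans st).
  have tT' : 0 <= t <= T by rewrite t0.
  have cl : `|t - s| < d by rewrite ger0_norm ?subr_ge0 //; lra.
  have [N1 N2] := Hd t s tT' sT cl j b; have [P1 P2] := IH s j b sT sn.
  have E : comp t j b = (fun x => (comp t j b x - comp s j b x) + comp s j b x).
    by apply/funext => x; rewrite subrK.
  split=> [m|x x0].
    rewrite E; apply: le_trans (dyadic_energy_add _ _ m) _.
    have := N1 m; have := P1 m; have -> : (1 + 1) ^+ 2 = 4 :> R by ring.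
    lra.
  have -> : comp t j b x = (comp t j b x - comp s j b x) + comp s j b x by rewrite subrK.
  by apply: le_trans (ler_normD _ _) _; have := N2 x x0; have := P2 x x0; lra.
have d2 : 0 < d / 2 by rewrite divr_gt0.
have [B B0 HB] := step (Num.truncn (T / (d / 2))).+1; exists B => // t j b /andP[t0 tT].
apply: HB; first by rewrite t0.
apply: le_trans tT _; rewrite -ler_pdivrMr //; exact/ltW/truncnS_gt.
Qed.

Lemma comp_holder (t : R) j b B : 0 <= t -> (forall m, dyadic_energy (comp t j b) m <= B) ->
  forall x y, 0 <= x -> 0 <= y -> (comp t j b x - comp t j b y) ^+ 2 <= `|x - y| * B.
Proof.
move=> t0 HB; have [_ [w /wderiv_parts W]] := comp_wderiv j t0; have [wi wp] := W b.
have [w2 w2B] := wderiv_sqr wi (dyadic_energy_wderiv wi wp HB).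
have hol x y : 0 <= x -> x <= y -> (comp t j b y - comp t j b x) ^+ 2 <= (y - x) * B.
  move=> x0 xy; apply: le_trans (incr_sqr_le wi w2 wp x0 xy) _; rewrite ler_wpM2l ?subr_ge0 //.
  apply: le_trans (w2B y); rewrite (itg_chasles_int x0 xy (w2 y)) lerDr.
  by apply: itg_ge0 => z _; exact: sqr_ge0.
move=> x y x0 y0; have [xy|/ltW yx] := leP x y.
  by rewrite distrC (ger0_norm (x := y - x)) ?subr_ge0 // -sqrrN opprB; exact: hol.
by rewrite (ger0_norm (x := x - y)) ?subr_ge0 //; exact: hol.
Qed.

Variable T : R.
Hypothesis T0 : 0 < T.

(** Time is clamped to [[0, T]] and space to the half-line, so that bounds on compact time intervals
    suffice for uniform continuity on the plane. *)
Definition extend t j b x : R := part b (v (Num.min (clip t) T) j (clip x)).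

Let tc t := Num.min (clip t) T.

Let tc_in t : 0 <= tc t <= T.
Proof. by rewrite /tc le_min clip_ge0 (ltW T0) /= ge_min lexx orbT. Qed.

Let tcE t : 0 <= t <= T -> tc t = t.
Proof. by case/andP=> t0 tT; rewrite /tc clipE // min_l. Qed.

Lemma extendE t j b x : 0 <= t <= T -> 0 <= x -> extend t j b x = part b (v t j x).
Proof. by move=> tT x0; rewrite /extend -/(tc t) tcE // clipE. Qed.

Lemma tc_lip t s : `|tc t - tc s| <= `|t - s|.
Proof.
have minE p : Num.min p T = T - clip (T - p).
  rewrite /clip; have [pT|Tp] := leP p T; first by rewrite max_l ?subr_ge0 //; ring.
  by rewrite max_r ?subr0 // subr_le0 ltW.
rewrite /tc !minE; have -> : T - clip (T - clip t) - (T - clip (T - clip s)) =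
  clip (T - clip s) - clip (T - clip t) by ring.
apply: le_trans (clip_lip _ _) _; have -> : T - clip s - (T - clip t) = clip t - clip s by ring.
exact: clip_lip.
Qed.

Lemma extend_buc j b : buc (fun t x => extend t j b x).
Proof.
have [B B0 HB] := comp_bounded T; split.
  by exists B => t x; have [_ H] := HB (tc t) j b (tc_in t); apply: H; exact: clip_ge0.
move=> e e0; have e8 : 0 < e / 8 by rewrite divr_gt0.
have [d1 d10 H1] := near_states_unif T e8.
have e2 : 0 < e / 2 by rewrite divr_gt0.
have B1 : 0 < B + 1 by lra.
exists (Num.min d1 ((e / 2) ^+ 2 / (B + 1))); first by rewrite lt_min d10 divr_gt0 // exprn_gt0.
move=> s t x y; rewrite !lt_min => /andP[ts _] /andP[_ xy].
have [_ N2] := H1 (tc t) (tc s) (tc_in t) (tc_in s) (le_lt_trans (tc_lip t s) ts) j b.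
have [D _] := HB (tc s) j b (tc_in s); have [s0 _] := andP (tc_in s).
have hol := comp_holder s0 D (clip_ge0 x) (clip_ge0 y).
have A1 := N2 _ (clip_ge0 x).
have A2 : `|comp (tc s) j b (clip x) - comp (tc s) j b (clip y)| <= e / 2.
  rewrite -(ler_pXn2r (n := 2)) ?nnegrE ?(ltW e2) // real_normK ?num_real //.
  apply: le_trans hol _; apply: (@le_trans _ _ (`|x - y| * (B + 1))).
    by apply: ler_pM => //; [exact: clip_lip|rewrite lerDl].
  by rewrite -ler_pdivlMr // ltW.
rewrite /extend -/(tc t) -/(tc s) -!/(comp _ _ _ _).
have -> : comp (tc t) j b (clip x) - comp (tc s) j b (clip y) =
  (comp (tc t) j b (clip x) - comp (tc s) j b (clip x)) +
  (comp (tc s) j b (clip x) - comp (tc s) j b (clip y)) by ring.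
apply: le_trans (ler_normD _ _) _; lra.
Qed.

Lemma extend_grad : exists B, forall t m, 0 <= t <= T -> grad_energy (extend t) m <= B.
Proof.
have [B B0 HB] := comp_bounded T; exists (\sum_(j < N.+1) (B + B)) => t m tT.
apply: ler_sum => j _.
have D b : dyadic_energy (extend t j b) m <= B.
  have [H _] := HB t j b tT; apply: le_trans (H m); rewrite /dyadic_energy.
  by rewrite le_eqVlt; apply/orP; left; apply/eqP; congr (_ * _); apply: eq_bigr => k _;
    rewrite !extendE // natr_mesh_ge0.
exact: lerD.
Qed.

Lemma itg_primitive (g : R -> R) (c x : R) : continuous g -> 0 <= x ->
  itg 0 x (fun y => c + itg 0 (clip y) g) = c * x + itg 0 x (fun y => (x - y) * g y).
Proof.
move=> cg x0; have cyg : continuous (fun y : R => y * g y) by apply: contM => // y; exact: cvg_id.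
pose f x := c * x + (x * (0 + itg 0 (clip x) g) - (0 + itg 0 (clip x) (fun y => y * g y))).
have cf : continuous f.
  apply: contD; first by apply: contZ => y; exact: cvg_id.
  apply: contB; last exact: clip_primitive_cont.
  by apply: contM; [move=> y; exact: cvg_id|exact: clip_primitive_cont].
have fE y : 0 <= y -> f y = 0 + c * y + itg 0 y (fun z => (y - z) * g z).
  move=> y0; rewrite /f !add0r clipE //; congr (_ + _).
  by rewrite -itgZ // -itgB //; [apply: eq_itg => z _; ring|exact: contZ].
have H := double_primitive cf cg fE x0.
have f0 : f 0 = 0 by rewrite fE // mulr0 !add0r itgxx.
by rewrite f0 add0r in H; rewrite -H fE // add0r.
Qed.

(** Integrating the two weak derivatives gives the solved form with the coefficient [w j 0]. The
    Kirchhoff condition, however, speaks of one-sided derivatives, so the two kinds of slopes must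
    be identified. *)
Lemma extend_eq t b : 0 <= t <= T -> exists d : 'I_N.+1 -> R, \sum_j d j = 0 /\
  forall j x, 0 <= x -> itg 0 t (fun s => extend s j b x) =
    itg 0 t (fun s => extend s j b 0) + d j * x +
    itg 0 x (fun y => (x - y) * mild_source F extend t j b y).
Proof.
move=> tT; have [t0 tT'] := andP tT.
have [_ _ v0 /(_ t t0) [g [_ [_ [dk [Hdk dk0]]] Hw] geq]] := sv.
have sT s : 0 <= s <= t -> 0 <= s <= T by move=> /andP[-> st]; rewrite (le_trans st).
have IE j x : 0 <= x -> itg 0 t (fun s => extend s j b x) = part b (time_integral v t j x).
  move=> x0; rewrite part_time_integral; apply: eq_itg => s /sT st; exact: extendE.
have be j b' := extend_buc j b'.
have bn j : buc (fun s x => F (edge_sq (extend s) j x) * extend s j b x) by exact: (rhs_buc cF b (be j)).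
have cs j : continuous (mild_source F extend t j b).
  apply: contD; first exact: (buc_itg_cont t0 (bn j)).
  by apply: contZ; apply: contB; apply: buc_contx (be _ _).
have gE j x : 0 <= x -> part b (g j x) = mild_source F extend t j b x.
  move=> x0; have := congr1 (part b) (geq j x x0).
  rewrite part_mulI partB part_subD => H.
  have -> : part b (g j x) = part b (time_integral (fun s => nonlinear F (v s)) t j x) +
    sgb b * (part (~~ b) (v t j x) - part (~~ b) (u0 j x)).
    by rewrite -[sgb b * _]opprK H; ring.
  rewrite part_time_integral /mild_source; congr (_ + sgb b * (_ - _)).
  - apply: eq_itg => s /sT st; rewrite part_nonlinear extendE //.
    by rewrite /edge_sq !extendE.
  - by rewrite extendE.
  - by rewrite extendE ?lexx ?(ltW T0) // v0.
have Hw1 j : exists w, is_wderiv (time_integral v t j) w /\ is_wderiv w (g j).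
  by have [w W1 W2] := Hw j; exists w.
have [w Hw'] := choice Hw1.
have wE j x : 0 <= x -> part b (w j x) = part b (w j 0) + itg 0 (clip x) (mild_source F extend t j b).
  move=> x0; have [_ /wderiv_parts/(_ b) [_ /(_ x x0) ->]] := Hw' j.
  by rewrite clipE //; congr (_ + _); apply: eq_itg => y /andP[y0 _]; exact: gE.
have fE j x : 0 <= x -> part b (time_integral v t j x) = part b (time_integral v t j 0) +
    part b (w j 0) * x + itg 0 x (fun y => (x - y) * mild_source F extend t j b y).
  move=> x0; have [/wderiv_parts/(_ b) [_ /(_ x x0) ->] _] := Hw' j.
  rewrite -addrA -(itg_primitive _ (cs j) x0); congr (_ + _).
  by apply: eq_itg => y /andP[y0 _]; exact: wE.
exists (fun j => part b (w j 0)); split; last first.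
  by move=> j x x0; rewrite !IE // fE.
(* The solved form makes the difference quotient at [h] equal to [w j 0] up to an error of at most
   [k * h]. *)
have dE j : part b (w j 0) = part b (dk j).
  have [k k0 Hk] := cont_bounded 0 1 (cs j).
  apply/eqP; rewrite -subr_eq0 -normr_le0; apply/ler_addgt0Pr => e e0; rewrite add0r.
  have e2 : 0 < e / 2 by rewrite divr_gt0.
  have /cvgrPdist_le/(_ _ e2) Hj := Hdk j.
  have [h [h0 h1 he Hh]] : exists h : R, [/\ 0 < h, h <= 1, h <= e / 2 / k &
     `|0 - Normc.normc ((time_integral v t j h - time_integral v t j 0) / h%:C%C - dk j)| <= e / 2].
    have : \forall h \near 0^'+, [/\ 0 < h, h <= 1, h <= e / 2 / k &
     `|0 - Normc.normc ((time_integral v t j h - time_integral v t j 0) / h%:C%C - dk j)| <= e / 2].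
      near=> h; split.
      - near: h; exact: nbhs_right_gt.
      - by near: h; apply: nbhs_right_le.
      - by near: h; apply: nbhs_right_le; rewrite divr_gt0.
      - near: h; exact: Hj.
    by move=> /filter_ex[h Hh]; exists h.
  have := part_le_normc b ((time_integral v t j h - time_integral v t j 0) / h%:C%C - dk j).
  rewrite sub0r normrN in Hh; move=> /(le_trans)/(_ (le_trans (ler_norm _) Hh)).
  rewrite partB part_div partB (fE j h (ltW h0)).
  set I := itg 0 h _; set W := part b (w j 0); set D := part b (dk j); set f0 := part b _.
  have -> : (f0 + W * h + I - f0) / h - D = (W - D) + I / h by field; rewrite gt_eqF.
  move=> H; have -> : W - D = (W - D + I / h) - I / h by ring.
  apply: le_trans (ler_normB _ _) _.
  have : `|I / h| <= e / 2.
    rewrite normrM normfV (gtr0_norm h0) ler_pdivrMr //.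
    apply: (@le_trans _ _ (h * k * (h - 0))).
      apply: itg_bound; [|exact: ltW|].
        apply: contM => //; apply: contB; first exact: cst_continuous.
        by move=> y; exact: cvg_id.
      move=> y /andP[y0 yh]; rewrite normrM; apply: ler_pM => //.
        by rewrite ger0_norm ?subr_ge0 // gerBl.
      by apply: Hk; rewrite y0 (le_trans yh).
    by rewrite subr0 ler_pM2r // -ler_pdivlMr.
  lra.
by rewrite (eq_bigr _ (fun j _ => dE j)) -part_sum dk0; case: b {IE bn cs gE wE fE dE}.
Unshelve. all: end_near. Qed.

Lemma extend_mild : mild F T extend.
Proof.
split; [exact: extend_buc|exact: extend_grad| |exact: extend_eq].
move=> t j j' b tT; rewrite !extendE //; have [t0 _] := andP tT.
by have [/(_ t t0) [_ H] _ _ _] := sv; rewrite (H j j').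
Qed.

End Competitor.

(** Values at negative x are arbitrary; composition with [clip] gives a continuous representative on
    the line with the same norms on the half-line. *)
Lemma datum_of_H1 {R : realType} {N : nat} (u0 : graph_fun R N.+1) :
  graph_H 1 u0 -> graph_L2 (weighted u0) ->
  datum (fun j b x => part b (u0 j (clip x))).
Proof.
move=> [uH uV] uW.
have [eta He] := choice (fun j => let: ex_intro2 eta e0 Hb := in_H1_bounded (uH j) in
  ex_intro (fun eta => 0 <= eta /\ H1_bounded eta (u0 j)) eta (conj e0 Hb)).
have [K HK] := choice (fun j => let: ex_intro2 K k0 Hb := int_nsq_fin (uW j) in
  ex_intro (fun K => (\int[@lebesgue_measure R]_(x in halfline) (nsq (weighted u0 j) x)%:E <= K%:E)%E) K Hb).
have cu j b : continuous (fun x => part b (u0 j (clip x))).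
  have [_ Hb] := He j; apply: modulus_continuous => e e0.
  exact: (holder_clip_cont (sqr_ge0 _) (h1b_holder Hb b) e0).
have cq j : continuous (edge_sq (fun j b x => part b (u0 j (clip x))) j).
  exact: cont_edge_sq (cu j).
have sqE j x : 0 <= x -> edge_sq (fun j b x => part b (u0 j (clip x))) j x = nsq (u0 j) x.
  by move=> x0; rewrite /edge_sq clipE.
have wE j x : 0 <= x -> nsq (weighted u0 j) x = x ^+ 2 * nsq (u0 j) x.
  move=> x0; rewrite /nsq /weighted ger0_norm //; case: (u0 j x) => a c.
  by rewrite /part /=; ring.
split=> //.
- by move=> j j' b; rewrite clipE // (uV j j').
- exists (\sum_j (eta j ^+ 2 + eta j ^+ 2)) => m; apply: ler_sum => j _.
  have [_ Hb] := He j.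
  have D b : dyadic_energy (fun x => part b (u0 j (clip x))) m <= eta j ^+ 2.
    apply: le_trans (h1b_energy Hb b m); rewrite /dyadic_energy le_eqVlt; apply/orP; left.
    by apply/eqP; congr (_ * _); apply: eq_bigr => k _; rewrite !clipE // natr_mesh_ge0.
  exact: lerD.
- exists (\sum_j eta j ^+ 2) => Y Y0; rewrite itg_sum //; apply: ler_sum => j _.
  have [_ Hb] := He j; have [[mf _] _] := uH j.
  apply: (@itg_le_int _ _ (nsq (u0 j)) _ 0 Y (lexx 0) (cq j)).
  + exact: measurable_nsq.
  + by move=> x; exact: nsq_ge0.
  + by move=> x x0; rewrite sqE.
  + by move=> x; exact: edge_sq_ge0.
  + exact: h1b_L2 Hb.
- have cx2 : continuous (fun x : R => x ^+ 2) by apply: continuous_sqr => x; exact: cvg_id.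
  have cw j : continuous (fun x : R => x ^+ 2 * edge_sq (fun j b x => part b (u0 j (clip x))) j x).
    exact: contM.
  exists (\sum_j K j) => Y Y0.
  rewrite (@eq_itg _ _ _ _ (fun x => \sum_j x ^+ 2 * edge_sq (fun j b x => part b (u0 j (clip x))) j x)).
    rewrite itg_sum //; apply: ler_sum => j _; have [mw _] := uW j.
    apply: (@itg_le_int _ _ (nsq (weighted u0 j)) _ 0 Y (lexx 0) (cw j)).
    + exact: measurable_nsq.
    + by move=> x; exact: nsq_ge0.
    + by move=> x x0; rewrite sqE // wE.
    + by move=> x; rewrite mulr_ge0 ?sqr_ge0 ?edge_sq_ge0.
    + exact: HK.
  by move=> x _; rewrite mulr_sumr.
Qed.

(** The star without edges is separate because everywhere else edge [ord0] exists and carries the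
    value at the vertex. *)
Lemma trivial_graph (R : realType) (F : R -> R) (u0 : graph_fun R 0) :
  is_solution F u0 (fun=> u0).
Proof.
have E (f : graph_fun R 0) : graph_H 1 f by split; case.
split=> //.
- move=> t _; have -> : (fun s : R => graph_H1norm (fun j x => (u0 j x - u0 j x)%R)) = (fun=> 0%E).
    by apply/funext => s; rewrite /graph_H1norm big_ord0.
  exact: cvg_cst.
- move=> t _; exists u0; last by case.
  split; [by split; case| |by case].
  by split; [case|exists (fun=> 0); split; [case|rewrite big_ord0]].
Qed.

Theorem proposition1p1 (R : realType) (N : nat) (F : R -> R)
    (u0 : graph_fun R N) :
  admissible F ->
  graph_H 1 u0 -> kirchhoff u0 -> graph_L2 (weighted u0) ->
  exists u : R -> graph_fun R N,
    [/\ is_solution F u0 u,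
        (exists C c : R, forall t, 0 <= t ->
           (graph_H1norm (u t) <= C%:E)%E /\
           (graph_L2norm (weighted (u t)) <= (C * t + c)%:E)%E) &
        forall v : R -> graph_fun R N, is_solution F u0 v ->
          forall t j x, 0 <= t -> 0 <= x -> v t j x = u t j x].
Proof.
move=> aF; case: N u0 => [|N] u0 uH _ uW.
  exists (fun=> u0); split; first exact: trivial_graph.
    exists 0, 0 => t t0; rewrite /graph_H1norm /graph_L2norm !big_ord0 mul0r addr0.
    by split.
  by move=> v _ t; case.
have cF := admissible_cont aF; have cG := antider_cont aF.
have tFG := admissible_tame aF; have Flip := admissible_lip aF.
have [M [B [S [A [kap [C [KG [U evo]]]]]]]] :=
  evolution_exists tFG cF cG (datum_of_H1 uH uW).
have U0 j x : 0 <= x -> state U 0 j x = u0 j x.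
  by move=> x0; apply: eq_part => b; rewrite part_join (evo_init evo) // clipE.
exists (state U); split.
- split=> //.
  + by move=> t; exact: (state_H1 evo).
  + by move=> t; exact: (state_H1norm_cont tFG cF cG Flip evo).
  + move=> t t0; have [g gL gE] := state_equation cF evo t0.
    by exists g => // j x x0; rewrite -U0 //; exact: gE.
- exact: (state_bounds evo).
(* Uniqueness holds strictly before the horizon, so the competitor is extended from [[0, t + 1]]. *)
- move=> v sv t j x t0 x0; have T0 : 0 < t + 1 by rewrite ltr_wpDl.
  apply: eq_part => b; rewrite part_join.
  have tT : 0 <= t <= t + 1 by rewrite t0 lerDl ler01.
  have E : extend v (t + 1) t j b x = part b (v t j x) by exact: extendE.
  rewrite -E.
  apply: (mild_unique cF Flip (extend_mild cF sv T0) (evo_mild evo (t + 1))) => //.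
    move=> j' b' x' x'0; have I0 : 0 <= (0 : R) <= t + 1 by rewrite lexx ltW.
    have E0 : extend v (t + 1) 0 j' b' x' = part b' (v 0 j' x') by exact: extendE.
    by rewrite E0; have [_ _ v0 _] := sv; rewrite v0 // (evo_init evo) // clipE.
  by rewrite t0 ltrDl ltr01.
Qed.
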